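(* Let $s\geq 1$ be an integer. Let $V:\mathbb{R}\to\mathbb{R}$ be a real valued potential with $V\in L^\infty(\mathbb{R})$ and $\lim_{|x|\to\infty}V(x)=0$, such that for every $j=1,\dots,s$ there is a constant $C_j>0$ with $$|\partial_x^j V(x)|\leq C_j (1+|x|)^{-1}\quad\text{for all } x\in\mathbb{R},$$ such that $-\partial_x^2-V\geq 0$ in the operator sense on $L^2(\mathbb{R})$, and such that the following asymptotic completeness property holds: for every $g\in L^2(\mathbb{R})$ there exist $g_\pm\in L^2(\mathbb{R})$ with $$\|e^{it(\partial_x^2+V)}g-e^{it\partial_x^2}g_\pm\|_{L^2(\mathbb{R})}\to 0\quad\text{as } t\to\pm\infty .$$ Then for every $f\in\Sigma_s(\mathbb{R})$, $$\lim_{t\to\pm\infty}\int_{\mathbb{R}}\Big(\frac{x}{t}\Big)^{2s}\big|e^{it(\partial_x^2+V)}f(x)\big|^2\,dx=2^{2s}\,\big\|(\sqrt{-\partial_x^2-V})^s f\big\|_{L^2(\mathbb{R})}^2 .$$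
   Context: For an integer $s\ge 1$, $\Sigma_s(\mathbb{R})$ is the space of (complex valued) functions with finite norm $\|f\|_{\Sigma_s(\mathbb{R})}^2=\|f\|_{H^s(\mathbb{R})}^2+\int_{\mathbb{R}}x^{2s}|f(x)|^2\,dx$, where $H^s(\mathbb{R})$ is the classical Sobolev space. $e^{it(\partial_x^2+V)}$ is the unitary group on $L^2(\mathbb{R})$ generated by the self-adjoint operator $\partial_x^2+V$ (domain $H^2(\mathbb{R})$); $e^{it\partial_x^2}$ is the same with $V=0$. Powers of $\sqrt{-\partial_x^2-V}$ are defined by the functional calculus of the nonnegative self-adjoint operator $-\partial_x^2-V$. *)

(* Defs.v *)
From mathcomp Require Import all_boot all_order all_algebra.
From mathcomp Require Import complex.
From mathcomp Require Import all_classical all_reals all_analysis.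

Set Implicit Arguments.
Unset Strict Implicit.
Unset Printing Implicit Defensive.

Import Order.TTheory GRing.Theory Num.Theory.
Import numFieldNormedType.Exports.

Local Open Scope classical_set_scope.
Local Open Scope ring_scope.

Section L2.
Context {R : realType}.
Local Notation C := R[i].
Local Notation mu := (@lebesgue_measure R).
Implicit Types f g h : R -> C.

(** Elements of L^2(R) are represented by Borel functions [R -> R[i]]; all the
    notions below are invariant under almost everywhere equality. *)

Definition cmeasurable f :=
  measurable_fun setT (fun x => complex.Re (f x)) /\
  measurable_fun setT (fun x => complex.Im (f x)).

Definition l2norm f : \bar R :=
  Lnorm mu 2%:E (fun x => (ComplexField.Normc.normc (f x))%:E).

Definition L2 f := cmeasurable f /\ (l2norm f < +oo)%E.

Definition cintegral f : C :=
  Complex (\int[mu]_x complex.Re (f x))%R (\int[mu]_x complex.Im (f x))%R.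

Definition inner f g : C := cintegral (fun x => f x * conjc (g x)).

(** Real-valued test functions are enough to test complex-valued [f]. *)
Definition test_function (phi : R -> R) :=
  (forall (n : nat) (x : R), derivable (derive1n n phi) x 1) /\
  (exists M : R, forall x : R, M < `|x| -> phi x = 0).

Definition weak_derivative (k : nat) f g :=
  forall phi, test_function phi ->
    cintegral (fun x => f x * (derive1n k phi x)%:C%C) =
    (-1) ^+ k * cintegral (fun x => g x * (phi x)%:C%C).

Definition Hsobolev (s : nat) f :=
  L2 f /\
  forall k : nat, (k <= s)%N -> exists2 g, L2 g & weak_derivative k f g.

Definition Sigma_space (s : nat) f :=
  Hsobolev s f /\
  (\int[mu]_x (x ^+ (2 * s) * ComplexField.Normc.normc (f x) ^+ 2)%:E
     < +oo)%E.

(** A (possibly unbounded) operator on L^2(R) is given by its graph: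
    [A f g] means that [f] is in the domain of [A] and [A f = g]. *)
Definition operator := (R -> C) -> (R -> C) -> Prop.

Definition oppop (A : operator) : operator :=
  fun f g => A f (fun x => - g x).

Definition laplacian_plus (V : R -> R) : operator := fun f g =>
  [/\ Hsobolev 2 f, L2 g &
      exists f2, [/\ L2 f2, weak_derivative 2 f f2 &
        g = (fun x => f2 x + (V x)%:C%C * f x) %[ae mu]]].

Definition nonneg_operator (A : operator) :=
  forall f g, A f g -> 0 <= inner g f.

Definition linear_on_L2 (T : (R -> C) -> R -> C) :=
  (forall f, L2 f -> L2 (T f)) /\
  (forall (a : C) f g, L2 f -> L2 g ->
     T (fun x => a * f x + g x) = (fun x => a * T f x + T g x) %[ae mu]).

(** [U t = e^{itA}]: [U] is a strongly continuous one-parameter group of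
    unitary operators, and the derivative of [U t f] at [t = 0] exists in L^2
    exactly when [f] is in the domain of [A], with value [i A f].
    Surjectivity of [U t] follows from the group law. *)
Record unitary_group (A : operator) (U : R -> (R -> C) -> R -> C) : Prop := {
  ug_linear : forall t, linear_on_L2 (U t) ;
  ug_isometry : forall t f, L2 f -> l2norm (U t f) = l2norm f ;
  ug_zero : forall f, L2 f -> U 0 f = f %[ae mu] ;
  ug_add : forall t u f, L2 f -> U (t + u) f = U t (U u f) %[ae mu] ;
  ug_continuous : forall f, L2 f ->
    l2norm (fun x => U t f x - f x) @[t --> (0 : R)] --> 0%E ;
  ug_generator : forall f g, L2 f -> L2 g ->
    (A f g <->
     l2norm (fun x => (U t f x - f x) / (Complex 0 t) - g x)
       @[t --> (0 : R)^'] --> 0%E)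
}.

Definition scalar_measure (E : set R -> (R -> C) -> R -> C) f (B : set R) :
    \bar R :=
  (complex.Re (inner (E B f) f))%:E.

Record projection_valued_measure (E : set R -> (R -> C) -> R -> C) : Prop := {
  pvm_linear : forall B, measurable B -> linear_on_L2 (E B) ;
  pvm_symmetric : forall B f g, measurable B -> L2 f -> L2 g ->
    inner (E B f) g = inner f (E B g) ;
  pvm_setT : forall f, L2 f -> E setT f = f %[ae mu] ;
  pvm_setI : forall B B' f, measurable B -> measurable B' -> L2 f ->
    E (B `&` B') f = E B (E B' f) %[ae mu] ;
  pvm_sigma_additive : forall f, L2 f ->
    semi_sigma_additive (scalar_measure E f)
}.

Definition spectral_domain (E : set R -> (R -> C) -> R -> C) (phi : R -> R) f :=
  L2 f /\ (\int[scalar_measure E f]_l (phi l ^+ 2)%:E < +oo)%E.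

(** The integral of [phi] against the complex measure [B |-> <E(B) f, h>],
    defined by polarization; [phi] is integrable against all four measures
    when [f] and [h] are in [spectral_domain E phi]. *)
Definition spectral_form (E : set R -> (R -> C) -> R -> C) (phi : R -> R) f h
    : C :=
  4^-1 * \sum_(k < 4) (Complex 0 1) ^+ k *
    (fine (\int[scalar_measure E
                  (fun x => f x + (Complex 0 1) ^+ k * h x)%R]_l
             (phi l)%:E)%E)%:C%C.

Definition spectral_integral (E : set R -> (R -> C) -> R -> C) (phi : R -> R)
    : operator := fun f g =>
  [/\ spectral_domain E phi f, L2 g &
      forall h, spectral_domain E phi h -> inner g h = spectral_form E phi f h].

(** [E] is the spectral measure of [A], so that [phi(A)] is
    [spectral_integral E phi]. *)
Definition spectral_measure (A : operator) (E : set R -> (R -> C) -> R -> C) :=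
  projection_valued_measure E /\
  (forall f g, A f g <-> spectral_integral E (fun l => l) f g).

End L2.

(* Main.v *)
(** The classes of L^2(R) form a real Hilbert space with a strong derivative [D],
    multiplication operators [M m] and an isometry [J], multiplication by i. Write
    H = - D^2 - V, U t = e^{-itH}, U0 t = e^{itD^2}, p = - J D, and let g be the
    scattering state of f, so that U t f ~ U0 t g.

    For f in a dense class of smooth decaying vectors, weighted energy estimates bound
    (x / 2t)^j U t f uniformly in t. The commutation x U0 t k = U0 t (x k) + 2t U0 t (p k)
    gives by induction on j that <(x / 2t)^j U t f, U0 t k> tends to <p^j g, k>; moreover
    ||(x / 2t)^j U t f||^2 = <(x / 2t)^(j+1) U t f, (x / 2t)^(j-1) U t f>, which turns weak
    into strong convergence and yields ||(x / 2t)^s U t f|| --> ||p^s g||. By intertwining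
    ||p^s g||^2 is <H^a f, H^b f> with a + b = s and |a - b| <= 1, that is, the integral of
    l^s against the spectral measure of f. A uniform bound of ||(x / 2t)^s U t f|| by the
    norm of f in Sigma_s extends the result to all of Sigma_s. *)

Require Import Defs.
From HB Require Import structures.
From mathcomp Require Import all_boot all_order all_algebra.
From mathcomp Require Import complex ring lra zify.
From mathcomp Require Import all_classical all_reals all_analysis.
From mathcomp Require Import measurable_realfun.

Set Implicit Arguments.
Unset Strict Implicit.
Unset Printing Implicit Defensive.

Import Order.TTheory GRing.Theory Num.Theory.
Import numFieldNormedType.Exports.

Local Open Scope classical_set_scope.
Local Open Scope ring_scope.

(** * Real Hilbert spaces *)

(** The datum and the potential share the order [s], and this shapes the proof. Strong convergence
    at order [s] is drawn from the weak limit at order [s + 1], while smoothness is propagated by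
    the flow, and carried over to g, through domains of powers of H, which are Sobolev spaces of
    even order. The dense class therefore has as regularity the least even number that is at least s
    + 1; it is at most s + 2, which is what a potential with [s] bounded derivatives allows.

    A weighted norm of U t f cannot be differentiated before it is known to be finite. The energy
    estimates use bounded weights x / (1 + e^2 x^2) with constants independent of e, and Fatou
    removes e. The norm of w^n D U t f is interpolated between those of w^(n+1) U t f and D^(n+1) U
    t f at the scale 1 / (1 + |t|): the part that is absorbed then costs exactly the growth (1 +
    |t|)^(n+1).

    That f lies in the domain of H^(s/2) is itself deduced from the uniform velocity bound. The
    functional calculus is built from finite combinations of spectral projections; positivity of H
    removes the negative half-line, after which integrals of powers of the square root can be
    compared with powers of H. *)

Definition hilbert_cauchy (R : realType) (T : lmodType R) (ip : T -> T -> R)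
    (u : nat -> T) :=
  forall e : R, 0 < e -> exists N, forall m n, (N <= m)%N -> (N <= n)%N ->
    ip (u m - u n) (u m - u n) < e.

Definition hilbert_cvg (R : realType) (T : lmodType R) (ip : T -> T -> R)
    (u : nat -> T) (l : T) :=
  forall e : R, 0 < e -> exists N, forall n, (N <= n)%N ->
    ip (u n - l) (u n - l) < e.

HB.mixin Record Lmodule_isHilbert (R : realType) T & GRing.Lmodule R T := {
  ip : T -> T -> R ;
  ipC : forall f g, ip f g = ip g f ;
  ipDl : forall f g h, ip (f + g) h = ip f h + ip g h ;
  ipZl : forall a f g, ip (a *: f) g = a * ip f g ;
  ipff_ge0 : forall f, 0 <= ip f f ;
  ipff_eq0 : forall f, ip f f = 0 -> f = 0 ;
  ip_complete : forall u, hilbert_cauchy ip u -> exists l, hilbert_cvg ip u l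
}.

#[short(type="hilbertType")]
HB.structure Definition Hilbert (R : realType) :=
  {T of GRing.Lmodule R T & Lmodule_isHilbert R T}.

Section HilbertTheory.
Context {R : realType} {T : hilbertType R}.
Implicit Types (f g h : T) (a b e : R).

Definition nrm f : R := Num.sqrt (ip f f).

Lemma ipDr f g h : ip f (g + h) = ip f g + ip f h.
Proof. by rewrite ipC ipDl !(ipC _ f). Qed.

Lemma ipZr a f g : ip f (a *: g) = a * ip f g.
Proof. by rewrite ipC ipZl ipC. Qed.

Lemma ipNl f g : ip (- f) g = - ip f g.
Proof. by rewrite -scaleN1r ipZl mulN1r. Qed.

Lemma ipNr f g : ip f (- g) = - ip f g.
Proof. by rewrite ipC ipNl ipC. Qed.

Lemma ipBl f g h : ip (f - g) h = ip f h - ip g h.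
Proof. by rewrite ipDl ipNl. Qed.

Lemma ipBr f g h : ip f (g - h) = ip f g - ip f h.
Proof. by rewrite ipDr ipNr. Qed.

Lemma ip0l f : ip 0 f = 0.
Proof. by rewrite -(scale0r (0 : T)) ipZl mul0r. Qed.

Lemma ip0r f : ip f 0 = 0.
Proof. by rewrite ipC ip0l. Qed.

Lemma ipff f : ip f f = nrm f ^+ 2.
Proof. by rewrite sqr_sqrtr// ipff_ge0. Qed.

Lemma nrm_ge0 f : 0 <= nrm f.
Proof. exact: sqrtr_ge0. Qed.
Hint Resolve nrm_ge0 : core.

Lemma nrm0 : nrm 0 = 0 :> R.
Proof. by rewrite /nrm ip0l sqrtr0. Qed.

Lemma nrm0_eq0 f : nrm f = 0 -> f = 0.
Proof. by move=> f0; apply: ipff_eq0; rewrite ipff f0 expr0n. Qed.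

Lemma nrmZ a f : nrm (a *: f) = `|a| * nrm f.
Proof.
rewrite /nrm ipZl ipZr mulrA -expr2 sqrtrM ?sqr_ge0//.
by rewrite sqrtr_sqr.
Qed.

Lemma nrmN f : nrm (- f) = nrm f.
Proof. by rewrite -scaleN1r nrmZ normrN1 mul1r. Qed.

Lemma nrmBC f g : nrm (f - g) = nrm (g - f).
Proof. by rewrite -nrmN opprB. Qed.

Lemma nrm_le2 f b : 0 <= b -> (nrm f <= b) = (ip f f <= b ^+ 2).
Proof. by move=> b0; rewrite ipff ler_sqr// ?nnegrE. Qed.

Lemma cauchy_schwarz f g : `|ip f g| <= nrm f * nrm g.
Proof.
rewrite -(@ler_sqr R) ?nnegrE ?mulr_ge0//.
rewrite exprMn -!ipff real_normK ?num_real//.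
have [g0|g0] := eqVneq (ip g g) 0.
  by rewrite (ipff_eq0 _ g0) !ip0r expr0n/= mulr0.
have gp : 0 < ip g g by rewrite lt_neqAle eq_sym g0 ipff_ge0.
have := ipff_ge0 (ip g g *: f - ip f g *: g).
rewrite ipBl !ipBr !ipZl !ipZr (ipC g f).
rewrite [X in 0 <= X -> _](_ : _ =
   ip g g * (ip f f * ip g g - ip f g ^+ 2)); last by ring.
by rewrite pmulr_rge0// subr_ge0.
Qed.

Lemma ip_le f g : ip f g <= nrm f * nrm g.
Proof. by rewrite (le_trans (ler_norm _))// cauchy_schwarz. Qed.

Lemma nrmD_le f g : nrm (f + g) <= nrm f + nrm g.
Proof.
rewrite nrm_le2 ?addr_ge0// ipDl !ipDr !ipff (ipC g f).
by have := ip_le f g; nra.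
Qed.

Lemma nrmB_le f g : nrm (f - g) <= nrm f + nrm g.
Proof. by rewrite -(nrmN g) nrmD_le. Qed.

Lemma nrm_dist f g : `|nrm f - nrm g| <= nrm (f - g).
Proof.
rewrite ler_norml; apply/andP; split.
  by rewrite lerNl opprB lerBlDr -(nrmN (f - g)) opprB (le_trans _ (nrmD_le _ _))// subrK.
by rewrite lerBlDr (le_trans _ (nrmD_le _ _))// subrK.
Qed.

Lemma nrm_triangle h f g : nrm (f - g) <= nrm (f - h) + nrm (h - g).
Proof. by rewrite (le_trans _ (nrmD_le _ _))// addrA subrK. Qed.

Lemma nrm_small_eq f g : (forall e, 0 < e -> nrm (f - g) <= e) -> f = g.
Proof.
move=> fg; apply/eqP; rewrite -subr_eq0; apply/eqP/nrm0_eq0/le_anti.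
by rewrite nrm_ge0 andbT; apply/ler_addgt0Pl => e /fg; rewrite addr0.
Qed.

Lemma cvg_dist_squeeze {I : Type} (F : set_system I) {FF : ProperFilter F}
    (u b : I -> R) (l : R) :
  (\forall i \near F, `|u i - l| <= b i) -> b @ F --> (0 : R) -> u @ F --> l.
Proof.
move=> ub /cvgrPdist_lt b0; apply/cvgrPdist_lt => e e0; near=> i.
rewrite distrC (@le_lt_trans _ _ (b i))//; first by near: i.
rewrite (le_lt_trans (ler_norm _))// -normrN -sub0r.
by near: i; exact: b0.
Unshelve. all: by end_near. Qed.

Definition hcvg {I : Type} (F : set_system I) (u : I -> T) (l : T) :=
  nrm (u i - l) @[i --> F] --> (0 : R).

Section hcvg.
Context {I : Type} {F : set_system I} {FF : ProperFilter F}.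
Implicit Types (u v : I -> T) (l m : T).

Lemma hcvg_squeeze u l (b : I -> R) :
  (\forall i \near F, nrm (u i - l) <= b i) -> b @ F --> (0 : R) -> hcvg F u l.
Proof.
move=> ub b0; apply: (squeeze_cvgr _ (cvg_cst 0) b0).
by apply: filterS ub => i ->; rewrite nrm_ge0.
Qed.

Lemma hcvgP u l :
  hcvg F u l <-> forall e, 0 < e -> \forall i \near F, nrm (u i - l) < e.
Proof.
split => [/cvgrPdist_lt h e e0|h].
  by near do rewrite -[X in X < _]ger0_norm// -normrN -sub0r; exact: h.
apply/cvgrPdist_lt => e e0; near=> i.
by rewrite sub0r normrN ger0_norm//; near: i; exact: h.
Unshelve. all: by end_near. Qed.

Lemma hcvg_cst l : hcvg F (fun=> l) l.
Proof. by rewrite /hcvg subrr nrm0; exact: cvg_cst. Qed.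

Lemma hcvgD u v l m : hcvg F u l -> hcvg F v m -> hcvg F (fun i => u i + v i) (l + m).
Proof.
move=> ul vm; apply: (@hcvg_squeeze _ _ (fun i => nrm (u i - l) + nrm (v i - m))).
  by near=> i; rewrite opprD addrACA nrmD_le.
by rewrite -[X in _ --> X]addr0; exact: cvgD.
Unshelve. all: by end_near. Qed.

Lemma hcvgZ (a : I -> R) (c : R) u l : a @ F --> c -> hcvg F u l ->
  hcvg F (fun i => a i *: u i) (c *: l).
Proof.
move=> ac ul; apply: (@hcvg_squeeze _ _
    (fun i => `|a i| * nrm (u i - l) + `|a i - c| * nrm l)).
  near=> i; rewrite -!nrmZ.
  rewrite [X in nrm X](_ : _ = a i *: (u i - l) + (a i - c) *: l) ?nrmD_le//.
  by rewrite scalerBr scalerBl addrA subrK.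
rewrite (_ : 0 = `|c| * 0 + 0 * nrm l); last by rewrite mulr0 mul0r addr0.
apply: cvgD; apply: cvgM => //; first exact: cvg_norm.
  by rewrite -(@normr0 _ R) -(subrr c); apply: cvg_norm; apply: cvgB => //; exact: cvg_cst.
exact: cvg_cst.
Unshelve. all: by end_near. Qed.

Lemma hcvgZr (c : R) u l : hcvg F u l -> hcvg F (fun i => c *: u i) (c *: l).
Proof. by apply: hcvgZ; exact: cvg_cst. Qed.

Lemma hcvgN u l : hcvg F u l -> hcvg F (fun i => - u i) (- l).
Proof. by move=> /(hcvgZr (-1)); rewrite scaleN1r; under eq_fun do rewrite scaleN1r. Qed.

Lemma hcvgB u v l m : hcvg F u l -> hcvg F v m -> hcvg F (fun i => u i - v i) (l - m).
Proof. by move=> ul /hcvgN; exact: hcvgD. Qed.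

Lemma hcvg_unique u l m : hcvg F u l -> hcvg F u m -> l = m.
Proof.
move=> ul um; have := hcvgB ul um.
under [X in hcvg _ X]eq_fun do rewrite subrr.
rewrite /hcvg; under eq_fun do rewrite sub0r nrmN.
move=> /cvg_lim => /(_ (@norm_hausdorff _ _)).
rewrite lim_cst; last exact: norm_hausdorff.
by move=> /nrm0_eq0/eqP; rewrite subr_eq0 => /eqP.
Qed.

Lemma hcvg_ip u v l m : hcvg F u l -> hcvg F v m ->
  ip (u i) (v i) @[i --> F] --> ip l m.
Proof.
move=> ul vm; apply: (@cvg_dist_squeeze _ _ _ _
  (fun i => nrm (u i - l) * nrm (v i - m) + nrm l * nrm (v i - m) + nrm (u i - l) * nrm m)).
- near=> i.
  have -> : ip (u i) (v i) - ip l m = ip (u i - l) (v i - m) + ip l (v i - m) + ip (u i - l) m.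
    by rewrite !ipBl !ipBr; ring.
  rewrite (le_trans (ler_normD _ _))// lerD ?cauchy_schwarz//.
  by rewrite (le_trans (ler_normD _ _))// lerD ?cauchy_schwarz//.
- rewrite (_ : 0 = 0 * 0 + nrm l * 0 + 0 * nrm m); last by rewrite !(mulr0, mul0r, addr0).
  by apply: cvgD; [apply: cvgD|]; apply: cvgM => //; exact: cvg_cst.
Unshelve. all: by end_near. Qed.

Lemma hcvg_ipr u l h : hcvg F u l -> ip (u i) h @[i --> F] --> ip l h.
Proof. by move=> ul; apply: hcvg_ip => //; exact: hcvg_cst. Qed.

Lemma hcvg_nrm u l : hcvg F u l -> nrm (u i) @[i --> F] --> nrm l.
Proof.
move=> ul; apply: (@cvg_dist_squeeze _ _ _ _ (fun i => nrm (u i - l))) => //.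
by near=> i; rewrite nrm_dist.
Unshelve. all: by end_near. Qed.

Lemma hcvg_nrm_le u l b : (\forall i \near F, nrm (u i) <= b) -> hcvg F u l ->
  nrm l <= b.
Proof.
move=> ub /hcvg_nrm ul; rewrite -(cvg_lim (@norm_hausdorff _ _) ul).
by apply: limr_le => //; apply/cvg_ex; exists (nrm l).
Qed.

End hcvg.

Lemma hcvg_le_sub u l : hilbert_cvg ip u l <-> hcvg \oo u l.
Proof.
split => [h|/hcvgP h e e0].
  apply/hcvgP => e e0; have [N hN] := h (e ^+ 2) (exprn_gt0 _ e0).
  exists N => // n /= Nn; have := hN n Nn.
  by rewrite ipff ltr_pXn2r// ?nnegrE ?nrm_ge0// ltW.
have se : 0 < Num.sqrt e by rewrite sqrtr_gt0.
have [N _ hN] := h _ se; exists N => n Nn.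
rewrite ipff -[ltRHS]sqr_sqrtr ?(ltW e0)//.
by rewrite ltr_pXn2r// ?nnegrE ?nrm_ge0 ?(ltW se)//; exact: hN.
Qed.

Lemma hcomplete (u : nat -> T) :
  (forall e, 0 < e -> exists N, forall m n, (N <= m)%N -> (N <= n)%N ->
     nrm (u m - u n) <= e) ->
  exists l, hcvg \oo u l.
Proof.
move=> h; have [|l ul] := @ip_complete R T u; last by exists l; apply/hcvg_le_sub.
move=> e e0; have se : 0 < Num.sqrt e by rewrite sqrtr_gt0.
have [N hN] := h (Num.sqrt e / 2) ltac:(by rewrite divr_gt0); exists N => m n Nm Nn.
rewrite ipff -[ltRHS]sqr_sqrtr ?(ltW e0)//.
rewrite ltr_pXn2r// ?nnegrE ?nrm_ge0 ?(ltW se)//.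
by rewrite (le_lt_trans (hN _ _ Nm Nn))//; lra.
Qed.

(* The distance of [f] to [S] is attained in the closure (parallelogram law), and
   the difference with the minimizer is orthogonal to [S]. *)
Lemma dense_of_orthogonal (S : set T) :
  S 0 -> (forall a f g, S f -> S g -> S (a *: f + g)) ->
  (forall f, (forall g, S g -> ip f g = 0) -> f = 0) ->
  forall f e, 0 < e -> exists2 g, S g & nrm (f - g) < e.
Proof.
move=> S0 Slin Sorth f.
pose D := [set ip (f - g) (f - g) | g in S].
have D0 : D !=set0 by exists (ip (f - 0) (f - 0)), 0.
have Dlb : lbound D 0 by move=> _ [g _ <-]; exact: ipff_ge0.
have Di : has_inf D by split => //; exists 0.
pose d := inf D.
have dle g : S g -> d <= ip (f - g) (f - g).
  by move=> Sg; apply: ge_inf; [exists 0|exists g].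
have ex n : {g | S g /\ ip (f - g) (f - g) < d + n.+1%:R^-1}.
  apply: cid; have n0 : 0 < (n.+1%:R)^-1 :> R by rewrite invr_gt0.
  by have [_ [g Sg <-] gd] := inf_adherent n0 Di; exists g.
pose u n := sval (ex n).
have Su n : S (u n) by have [] := svalP (ex n).
have ud n : ip (f - u n) (f - u n) < d + n.+1%:R^-1 by have [] := svalP (ex n).
have uu m n : ip (u m - u n) (u m - u n) <= 2 * (m.+1%:R^-1 + n.+1%:R^-1).
  have Smid : S (2^-1 *: (u m + u n)).
    have -> : 2^-1 *: (u m + u n) = 2^-1 *: u m + (2^-1 *: u n + 0).
      by rewrite addr0 scalerDr.
    by apply/Slin => //; exact/Slin.
  have := dle _ Smid; have := ud m; have := ud n.
  have e1 : ip (u m - u n) (u m - u n) = 2 * ip (f - u m) (f - u m) + 2 * ip (f - u n) (f - u n)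
      - 4 * ip (f - 2^-1 *: (u m + u n)) (f - 2^-1 *: (u m + u n)).
    rewrite !ipBl !ipBr !ipZl !ipZr !ipDl !ipDr (ipC (u n) f) (ipC (u m) f) (ipC (u n) (u m)).
    by field.
  by rewrite e1; move: (m.+1%:R^-1) (n.+1%:R^-1) => a b; lra.
have [l ul] : exists l, hcvg \oo u l.
  (* From this index on each of the two reciprocals in [uu] is at most e^2/4, which makes the
     right-hand side of [uu] at most e^2. *)
  apply: hcomplete => e e0; exists (Num.truncn (4 / e ^+ 2)) => m n Nm Nn.
  rewrite nrm_le2 ?(ltW e0)// (le_trans (uu m n))//.
  have e20 : 0 < e ^+ 2 by rewrite exprn_gt0.
  have inv k : (Num.truncn (4 / e ^+ 2) <= k)%N -> k.+1%:R^-1 <= e ^+ 2 / 4.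
    move=> Nk; rewrite -[leRHS]invf_div lef_pV2 ?posrE ?divr_gt0//.
    by rewrite (le_trans (ltW (truncnS_gt _)))// ler_nat ltnS.
  have := inv _ Nm; have := inv _ Nn.
  by move: (m.+1%:R^-1) (n.+1%:R^-1) => a b; lra.
have ld : ip (f - l) (f - l) <= d.
  have c1 : ip (f - u n) (f - u n) @[n --> \oo] --> ip (f - l) (f - l).
    by apply: hcvg_ip; apply: hcvgB => //; exact: hcvg_cst.
  have c2 : d + n.+1%:R^-1 @[n --> \oo] --> d + 0.
    by apply: cvgD; [exact: cvg_cst|exact: cvg_harmonic].
  rewrite -[leRHS]addr0; apply: (ler_cvg_to c1 c2).
  by near=> n; rewrite ltW.
have lo g : S g -> ip (f - l) g = 0.
  (* Moving the minimizer [l] along [g] cannot bring it closer to [f]; the increment of the squared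
     distance is a quadratic polynomial in [c]. *)
  move=> Sg; have hq (c : R) : 0 <= - 2 * c * ip (f - l) g + c ^+ 2 * ip g g.
    have c1 : ip (f - (c *: g + u n)) (f - (c *: g + u n)) @[n --> \oo] --> 
         ip (f - (c *: g + l)) (f - (c *: g + l)).
      by apply: hcvg_ip; (apply: hcvgB; [exact: hcvg_cst|apply: hcvgD => //; exact: hcvg_cst]).
    have : d <= ip (f - (c *: g + l)) (f - (c *: g + l)).
      apply: (ler_cvg_to (cvg_cst d) c1).
      by near=> n; apply: dle; exact: Slin.
    have -> : ip (f - (c *: g + l)) (f - (c *: g + l)) = ip (f - l) (f - l) 
        - 2 * c * ip (f - l) g + c ^+ 2 * ip g g.
      by rewrite !ipBl !ipBr !ipDl !ipDr !ipZl !ipZr (ipC g f) (ipC g l) (ipC l f); ring.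
    by lra.
  have [g0|g0] := eqVneq (ip g g) 0; first by rewrite (ipff_eq0 _ g0) ip0r.
  have gp : 0 < ip g g by rewrite lt_neqAle eq_sym g0 ipff_ge0.
  (* The minimum of the quadratic, where its value is minus the square of [ip (f - l) g] divided by
     [ip g g]. *)
  have := hq (ip (f - l) g / ip g g).
  have -> : - 2 * (ip (f - l) g / ip g g) * ip (f - l) g + (ip (f - l) g / ip g g) ^+ 2 * ip g g
     = - (ip (f - l) g ^+ 2 / ip g g) by field.
  rewrite oppr_ge0 pmulr_lle0 ?invr_gt0// => h.
  by apply/eqP; rewrite -sqrf_eq0 eq_le h sqr_ge0.
have /eqP := Sorth _ lo; rewrite subr_eq0 => /eqP -> e e0.
have /hcvgP /(_ e e0) [N _ hN] := ul.
by exists (u N) => //; rewrite nrmBC; apply: hN => /=.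
Unshelve. all: by end_near. Qed.

End HilbertTheory.
#[global] Hint Extern 0 (is_true (0 <= nrm _)) => solve [apply: nrm_ge0] : core.
Arguments hcvg {R T I} F u l.

(** * Classes of square integrable functions *)

#[global] Instance ae_lebesgue_filter (R : realType) :
  Filter (nbhs (almost_everywhere (@lebesgue_measure R))).
Proof. exact: ae_filter_ringOfSetsType. Qed.

Section SquareIntegrable.
Context {R : realType}.
Local Notation mu := (@lebesgue_measure R).
Implicit Types f g : R -> R.

Definition sqi f :=
  measurable_fun setT f /\ mu.-integrable setT (EFin \o (fun x => f x ^+ 2)).

Lemma sqi_bound f (b : R -> R) : measurable_fun setT f ->
  mu.-integrable setT (EFin \o b) ->
  (forall x, f x ^+ 2 <= b x) -> sqi f.
Proof.
move=> mf ib fb; split => //; apply: (le_integrable _ _ _ ib) => //=.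
  by apply/measurable_EFinP; exact: measurable_funX.
move=> x _; rewrite lee_fin ger0_norm ?sqr_ge0//.
by rewrite (le_trans (fb x))// ler_norm.
Qed.

Lemma sqiP f : sqi f <->
  measurable_fun setT f /\ (\int[mu]_x (f x ^+ 2)%:E < +oo)%E.
Proof.
split => [[mf /integrableP[_ h]]|[mf h]]; split => //.
  by move: h; under eq_integral do rewrite /= ger0_norm ?sqr_ge0//.
apply/integrableP; split.
  by apply/measurable_EFinP; exact: measurable_funX.
by under eq_integral do rewrite /= ger0_norm ?sqr_ge0//.
Qed.

Lemma sqiM_integrable f g : sqi f -> sqi g ->
  mu.-integrable setT (EFin \o (fun x => f x * g x)).
Proof.
move=> [mf f2] [mg g2].
have h := integrableD measurableT f2 g2.
apply: (le_integrable _ _ _ h) => //=.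
  by apply/measurable_EFinP; exact: measurable_funM.
move=> x _; rewrite lee_fin.
rewrite [leRHS]ger0_norm ?addr_ge0 ?sqr_ge0// ler_norml.
by apply/andP; split; have := sqr_ge0 (f x + g x); have := sqr_ge0 (f x - g x); nra.
Qed.

Lemma sqiD f g : sqi f -> sqi g -> sqi (fun x => f x + g x).
Proof.
move=> hf hg; have [mf f2] := hf; have [mg g2] := hg.
apply: (@sqi_bound _ (fun x => 2 * (f x ^+ 2 + g x ^+ 2))).
- exact: measurable_funD.
- have h := integrableZl measurableT 2 (integrableD measurableT f2 g2).
  by apply: eq_integrable h => // x _.
- by move=> x; have := sqr_ge0 (f x - g x); nra.
Qed.

Lemma sqi_bounded_mul (c : R) (m : R -> R) f : measurable_fun setT m ->
  (forall x, `|m x| <= c) -> sqi f -> sqi (fun x => m x * f x).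
Proof.
move=> mm mc [mf f2].
apply: (@sqi_bound _ (fun x => c ^+ 2 * f x ^+ 2)).
- exact: measurable_funM.
- have h := integrableZl measurableT (c ^+ 2) f2.
  by apply: eq_integrable h => // x _.
- move=> x; rewrite exprMn ler_wpM2r ?sqr_ge0//.
  by rewrite -real_normK ?num_real// lerXn2r ?nnegrE// (le_trans _ (mc x)).
Qed.

Lemma sqiZ (a : R) f : sqi f -> sqi (fun x => a * f x).
Proof. by apply: (@sqi_bounded_mul `|a|) => // ; exact: measurable_cst. Qed.

Lemma sqi0 : sqi (fun=> 0).
Proof.
split; first exact: measurable_cst.
by under [X in integrable _ _ X]eq_fun do rewrite /= expr0n/=; exact: integrable0.
Qed.

Lemma ae_sqi f g : measurable_fun setT g -> f = g %[ae mu] -> sqi f -> sqi g.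
Proof.
move=> mg fg /sqiP[mf hf]; apply/sqiP; split => //.
rewrite (_ : (\int[mu]_x _)%E = (\int[mu]_x (f x ^+ 2)%:E)%E) //.
apply: ae_eq_integral => //; try by apply/measurable_EFinP; exact: measurable_funX.
by apply: filterS fg => x h /h ->.
Qed.

Definition sip f g : R := \int[mu]_x (f x * g x).

Lemma ae_sip f f' g g' : sqi f -> sqi f' -> sqi g -> sqi g' ->
  f = f' %[ae mu] -> g = g' %[ae mu] -> sip f g = sip f' g'.
Proof.
move=> [mf _] [mf' _] [mg _] [mg' _] ff gg; congr fine.
apply: ae_eq_integral => //; try by apply/measurable_EFinP; exact: measurable_funM.
by apply: filterS2 ff gg => x h k; move=> /[dup] /h -> /k ->.
Qed.

Lemma sip_ae0 f : sqi f -> sip f f = 0 -> f = (fun=> 0) %[ae mu].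
Proof.
move=> hf; have [mf f2] := hf => f0.
have := sqiM_integrable hf hf => hi.
have : (\int[mu]_x (f x * f x)%:E = 0)%E.
  by rewrite -(fineK (integrable_fin_num measurableT hi))// [fine _]f0.
have e1 : (\int[mu]_x (f x * f x)%:E = \int[mu]_x `|(f x * f x)%:E|)%E.
  by apply: eq_integral => x _; rewrite gee0_abs// lee_fin -expr2 sqr_ge0.
have mff : measurable_fun (setT : set R) (fun x => (f x * f x)%:E : \bar R).
  by apply/measurable_EFinP; exact: measurable_funM.
rewrite e1 => h0; have := (ae_eq_integral_abs mu measurableT mff).1 h0.
by apply: filterS => x /= h /h [] /eqP; rewrite mulf_eq0 orbb => /eqP.
Qed.

(** The set given to [xget] depends only on the class of [f], so functions equal almost everywhere
    receive literally the same representative. For measurable [f] the set contains [f], and the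
    default value is not reached. *)
Definition rep f : R -> R :=
  xget (fun=> 0) [set g | measurable_fun setT g /\ f = g %[ae mu]].

Lemma rep_spec f : measurable_fun setT f ->
  measurable_fun setT (rep f) /\ f = rep f %[ae mu].
Proof.
move=> mf; rewrite /rep; case: xgetP => [g _ []//|/(_ f)]; apply: contra_notP => _.
by split => //; exact: aeW.
Qed.

Lemma rep_ae f g : f = g %[ae mu] -> rep f = rep g.
Proof.
move=> fg; rewrite /rep; congr xget; apply/seteqP; split => h [mh e]; split => //.
  by apply: ae_eq_trans e; exact: ae_eq_sym.
exact: ae_eq_trans e.
Qed.

Lemma sqi_rep f : sqi f -> sqi (rep f).
Proof. by move=> hf; have [m e] := rep_spec hf.1; exact: ae_sqi e hf. Qed.

Lemma repK f : measurable_fun setT f -> rep (rep f) = rep f.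
Proof. by move=> mf; apply/rep_ae/ae_eq_sym; have [] := rep_spec mf. Qed.

End SquareIntegrable.

(* A canonical representative is chosen in every class of functions equal almost
   everywhere, so that Leibniz equality of [ltwo R] is almost everywhere equality. *)
Record ltwo (R : realType) := Ltwo {
  fn :> R -> R ; ltwo_subproof : `[< sqi fn /\ rep fn = fn >] }.

HB.instance Definition _ (R : realType) := gen_eqMixin (ltwo R).
HB.instance Definition _ (R : realType) := gen_choiceMixin (ltwo R).

Section Ltwo.
Context {R : realType}.
Local Notation mu := (@lebesgue_measure R).
Local Notation Q := (ltwo R).
Implicit Types (p q r : Q) (f g : R -> R).

Lemma fn_inj p q : fn p = fn q -> p = q.
Proof.
by case: p q => [p hp] [q hq] /= e; subst q; congr Ltwo; exact: bool_irrelevance.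
Qed.

Lemma sqi_fn p : sqi p. Proof. by case: p => p /= /asboolP[]. Qed.
Hint Resolve sqi_fn : core.

Lemma rep_fn p : rep p = p. Proof. by case: p => p /= /asboolP[]. Qed.

Lemma measurable_fn p : measurable_fun setT p. Proof. by case: (sqi_fn p). Qed.

Lemma ltwo_ext p q : p = q %[ae mu] -> p = q.
Proof. by move=> /rep_ae e; apply: fn_inj; rewrite -(rep_fn p) -(rep_fn q). Qed.

Lemma cl_subproof f : `[< sqi (if `[< sqi f >] then rep f else rep (fun=> 0)) /\
  rep (if `[< sqi f >] then rep f else rep (fun=> 0)) =
  (if `[< sqi f >] then rep f else rep (fun=> 0)) >].
Proof.
apply/asboolP; case: ifPn => [/asboolP hf|_]; split.
- exact: sqi_rep.
- by apply: repK; case: hf.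
- exact/sqi_rep/sqi0.
- by apply: repK; case: (@sqi0 R).
Qed.

Definition cl f : Q := Ltwo (cl_subproof f).
Arguments cl : simpl never.

Lemma clE f : sqi f -> cl f = f %[ae mu].
Proof.
move=> hf; rewrite /fn /cl ifT; last exact/asboolP.
by apply: ae_eq_sym; have [] := rep_spec hf.1.
Qed.

Lemma cl_ae f q : sqi f -> f = q %[ae mu] -> cl f = q.
Proof. by move=> hf fq; apply/ltwo_ext/(ae_eq_trans (clE hf)). Qed.

Lemma fnK q : cl q = q. Proof. by apply: cl_ae => //; exact: aeW. Qed.

Lemma eq_cl f g : sqi f -> sqi g -> f = g %[ae mu] -> cl f = cl g.
Proof.
move=> hf hg fg; apply: cl_ae => //; apply: ae_eq_trans fg _.
exact/ae_eq_sym/clE.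
Qed.

Definition ltwo_add p q : Q := cl (fun x => p x + q x).
Definition ltwo_scale (a : R) p : Q := cl (fun x => a * p x).

Lemma ltwo_addE p q : ltwo_add p q = (fun x => p x + q x) %[ae mu].
Proof. exact/clE/sqiD. Qed.

Lemma ltwo_scaleE a p : ltwo_scale a p = (fun x => a * p x) %[ae mu].
Proof. exact/clE/sqiZ. Qed.

Lemma ltwo_addA : associative ltwo_add.
Proof.
move=> p q r; apply: ltwo_ext.
have a := ltwo_addE p (ltwo_add q r); have b := ltwo_addE q r.
have c := ltwo_addE (ltwo_add p q) r; have d := ltwo_addE p q.
near=> x => _; rewrite (near a x)// (near b x)// (near c x)// (near d x)//.
by rewrite addrA.
Unshelve. all: by end_near. Qed.

Lemma ltwo_addC : commutative ltwo_add.
Proof. by move=> p q; congr cl; apply/funext => x; rewrite addrC. Qed.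

Lemma ltwo_add0 : left_id (cl (fun=> 0)) ltwo_add.
Proof.
move=> p; apply: ltwo_ext; have a := ltwo_addE (cl (fun=> 0)) p.
have b := clE (@sqi0 R).
by near=> x => _; rewrite (near a x)// (near b x)// add0r.
Unshelve. all: by end_near. Qed.

Lemma ltwo_addN : left_inverse (cl (fun=> 0)) (ltwo_scale (-1)) ltwo_add.
Proof.
move=> p; apply: ltwo_ext; have a := ltwo_addE (ltwo_scale (-1) p) p.
have b := clE (@sqi0 R); have c := ltwo_scaleE (-1) p.
by near=> x => _; rewrite (near a x)// (near b x)// (near c x)// mulN1r addNr.
Unshelve. all: by end_near. Qed.

HB.instance Definition _ := GRing.isZmodule.Build Q
  ltwo_addA ltwo_addC ltwo_add0 ltwo_addN.

Lemma ltwo_scaleA (a b : R) p : ltwo_scale a (ltwo_scale b p) = ltwo_scale (a * b) p.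
Proof.
apply: ltwo_ext; have h1 := ltwo_scaleE a (ltwo_scale b p).
have h2 := ltwo_scaleE b p; have h3 := ltwo_scaleE (a * b) p.
by near=> x => _; rewrite (near h1 x)// (near h2 x)// (near h3 x)// mulrA.
Unshelve. all: by end_near. Qed.

Lemma ltwo_scale1 : left_id 1 ltwo_scale.
Proof.
move=> p; apply: ltwo_ext; have h := ltwo_scaleE 1 p.
by near=> x => _; rewrite (near h x)// mul1r.
Unshelve. all: by end_near. Qed.

Lemma ltwo_scaleDr : right_distributive ltwo_scale +%R.
Proof.
move=> a p q; apply: ltwo_ext.
have h1 := ltwo_scaleE a (ltwo_add p q); have h2 := ltwo_addE p q.
have h3 := ltwo_addE (ltwo_scale a p) (ltwo_scale a q).
have h4 := ltwo_scaleE a p; have h5 := ltwo_scaleE a q.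
near=> x => _; rewrite (near h1 x)// (near h2 x)// (near h3 x)// (near h4 x)// (near h5 x)//.
by rewrite mulrDr.
Unshelve. all: by end_near. Qed.

Lemma ltwo_scaleDl p : {morph ltwo_scale^~ p : a b / a + b}.
Proof.
move=> a b; apply: ltwo_ext.
have h1 := ltwo_scaleE (a + b) p.
have h3 := ltwo_addE (ltwo_scale a p) (ltwo_scale b p).
have h4 := ltwo_scaleE a p; have h5 := ltwo_scaleE b p.
near=> x => _; rewrite (near h1 x)// (near h3 x)// (near h4 x)// (near h5 x)//.
by rewrite mulrDl.
Unshelve. all: by end_near. Qed.

HB.instance Definition _ := GRing.Zmodule_isLmodule.Build R Q
  ltwo_scaleA ltwo_scale1 ltwo_scaleDr ltwo_scaleDl.

Lemma fnD p q : fn (p + q) = (fun x => p x + q x) %[ae mu].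
Proof. exact: ltwo_addE. Qed.

Lemma fnZ a p : fn (a *: p) = (fun x => a * p x) %[ae mu].
Proof. exact: ltwo_scaleE. Qed.

Lemma fn0 : fn (0 : Q) = (fun=> 0) %[ae mu].
Proof. exact/clE/sqi0. Qed.

Lemma fnB p q : fn (p - q) = (fun x => p x - q x) %[ae mu].
Proof.
have h1 := fnD p (- q); have h2 := fnZ (-1) q.
by near=> x => _; rewrite (near h1 x)// -scaleN1r (near h2 x)// mulN1r.
Unshelve. all: by end_near. Qed.

Lemma clD f g : sqi f -> sqi g -> cl (fun x => f x + g x) = cl f + cl g.
Proof.
move=> hf hg; apply: cl_ae; first exact: sqiD.
have h1 := fnD (cl f) (cl g); have h2 := clE hf; have h3 := clE hg.
by near=> x => _; rewrite (near h1 x)// (near h2 x)// (near h3 x).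
Unshelve. all: by end_near. Qed.

Lemma clZ a f : sqi f -> cl (fun x => a * f x) = a *: cl f.
Proof.
move=> hf; apply: cl_ae; first exact: sqiZ.
have h1 := fnZ a (cl f); have h2 := clE hf.
by near=> x => _; rewrite (near h1 x)// (near h2 x).
Unshelve. all: by end_near. Qed.

Definition ltwo_ip p q : R := sip p q.

Lemma ltwo_ipC p q : ltwo_ip p q = ltwo_ip q p.
Proof. by congr fine; apply: eq_integral => x _; rewrite mulrC. Qed.

Lemma ltwo_ipDl p q r : ltwo_ip (p + q) r = ltwo_ip p r + ltwo_ip q r.
Proof.
rewrite /ltwo_ip (@ae_sip _ _ (fun x => p x + q x) _ r)//.
- rewrite /sip -RintegralD//; try exact: sqiM_integrable.
  by congr fine; apply: eq_integral => x _; rewrite mulrDl.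
- exact: sqiD.
- exact: fnD.
- exact: aeW.
Qed.

Lemma ltwo_ipZl a p q : ltwo_ip (a *: p) q = a * ltwo_ip p q.
Proof.
rewrite /ltwo_ip (@ae_sip _ _ (fun x => a * p x) _ q)//.
- rewrite /sip -RintegralZl//; try exact: sqiM_integrable.
  by congr fine; apply: eq_integral => x _; rewrite mulrA.
- exact: sqiZ.
- exact: fnZ.
- exact: aeW.
Qed.

Lemma ltwo_ipff_ge0 p : 0 <= ltwo_ip p p.
Proof. by apply: Rintegral_ge0 => x _; rewrite -expr2 sqr_ge0. Qed.

Lemma ltwo_ipff_eq0 p : ltwo_ip p p = 0 -> p = 0.
Proof.
by move=> /(sip_ae0 (sqi_fn p)) h; apply: ltwo_ext; apply: ae_eq_trans h (ae_eq_sym fn0).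
Qed.

(** Lower semicontinuity of the norm under pointwise limits. It bounds the limit without assuming it
    square integrable, which is how limits are shown to belong to L^2 or to the domain of a
    multiplication operator. *)
Lemma sq_fatou (w : nat -> R -> R) (l : R -> R) (c : \bar R) :
  (forall n, measurable_fun setT (w n)) -> measurable_fun setT l ->
  (\forall x \ae mu, w ^~ x @ \oo --> l x) ->
  (\forall n \near \oo, (\int[mu]_x (w n x ^+ 2)%:E <= c)%E) ->
  (\int[mu]_x (l x ^+ 2)%:E <= c)%E.
Proof.
move=> mw ml wl wc.
have msq f : measurable_fun setT f ->
    measurable_fun (setT : set R) (fun x => (f x ^+ 2)%:E : \bar R).
  by move=> mf; apply/measurable_EFinP; exact: measurable_funX.
have -> : (\int[mu]_x (l x ^+ 2)%:E = \int[mu]_x limn_einf (fun n => (w n x ^+ 2)%:E))%E.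
  apply: ae_eq_integral => //.
  - exact: msq.
  - rewrite (_ : (fun x => _) = -%E \o (fun x => limn_esup (fun n => - (w n x ^+ 2)%:E)))%E; last first.
      apply/funext => x /=; rewrite -limn_einfN; congr limn_einf.
      by apply/funext => n /=; rewrite /= opprK.
    apply: measurableT_comp => //; apply: measurable_fun_limn_esup => n.
    by apply: measurableT_comp => //; exact: msq.
  - apply: filterS wl => x wlx _.
    have /cvg_limn_einf_sup[-> //] : (w n x ^+ 2)%:E @[n --> \oo] --> (l x ^+ 2)%:E.
    by apply: cvg_EFin; [exact: nearW|exact: (cvgM wlx wlx)].
apply: (@le_trans _ _ (limn_einf (fun n => \int[mu]_x (w n x ^+ 2)%:E))%E).
  apply: fatou => //; first by move=> n; exact: msq.
  by move=> n x _; rewrite lee_fin sqr_ge0.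
rewrite limn_einf_lim; apply: lime_le; first exact: is_cvg_einfs.
apply: filterS wc => n; apply: le_trans.
by apply: ereal_inf_lbound; exists n => /=.
Qed.

Lemma integral_sq p : (\int[mu]_x (p x ^+ 2)%:E = (ltwo_ip p p)%:E)%E.
Proof.
have h := sqiM_integrable (sqi_fn p) (sqi_fn p).
rewrite -[LHS]fineK//.
  by have := integrable_fin_num measurableT h; congr (_ \is a fin_num).
Qed.

Lemma integral_sq_ae f p : measurable_fun setT f -> f = p %[ae mu] ->
  (\int[mu]_x (f x ^+ 2)%:E = (ltwo_ip p p)%:E)%E.
Proof.
move=> mf fp; rewrite -integral_sq; apply: ae_eq_integral => //.
- by apply/measurable_EFinP; exact: measurable_funX.
- by apply/measurable_EFinP; apply: measurable_funX; exact: measurable_fn.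
- by apply: filterS fp => x h /h ->.
Qed.

Lemma ltwo_ipBC p q : ltwo_ip (p - q) (p - q) = ltwo_ip (q - p) (q - p).
Proof.
by rewrite -(opprB q p) -scaleN1r ltwo_ipZl ltwo_ipC ltwo_ipZl mulrA mulrNN !mul1r.
Qed.

(** Riesz-Fischer for a rapidly convergent sequence. The increments rescaled by 2^n have squared
    norms at most 4^n 8^-n = 2^-n, so the sum [G] of their squares is integrable and finite almost
    everywhere. There every rescaled increment is at most 1 + G, and the true increments are
    dominated by a geometric series. *)
Lemma ltwo_complete_fast (u : nat -> Q) :
  (forall n, ltwo_ip (u n.+1 - u n) (u n.+1 - u n) <= 8^-1 ^+ n) ->
  exists l : R -> R, measurable_fun setT l /\ \forall x \ae mu, (fun n => u n x) @ \oo --> l x.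
Proof.
move=> hu; pose e n : Q := 2 ^+ n *: (u n.+1 - u n).
have eE n : e n = (fun x => 2 ^+ n * (u n.+1 x - u n x)) %[ae mu].
  have h1 := fnZ (2 ^+ n) (u n.+1 - u n); have h2 := fnB (u n.+1) (u n).
  by near=> x => _; rewrite (near h1 x)// (near h2 x).
pose G x := (\sum_(n <oo) (e n x ^+ 2)%:E)%E.
have mt n : measurable_fun (setT : set R) (fun x => (e n x ^+ 2)%:E : \bar R).
  by apply/measurable_EFinP; apply: measurable_funX => //; exact: measurable_fn.
have t0 n x : (0 <= (e n x ^+ 2)%:E)%E by rewrite lee_fin sqr_ge0.
have mG : measurable_fun setT G by apply: ge0_emeasurable_sum.
have G0 x : (0 <= G x)%E by apply: nneseries_ge0 => n _ _; exact: t0.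
have iG : (\int[mu]_x G x < +oo)%E.
  rewrite integral_nneseries//.
  apply: (@le_lt_trans _ _ (\sum_(n <oo) (2 / (2 ^ n.+1)%:R)%:E)%E); last first.
    by rewrite (le_lt_trans (epsilon_trick0 _ _))// ltry.
  apply: lee_nneseries => n _; first by move=> _; apply: integral_ge0 => x _; exact: t0.
  rewrite integral_sq lee_fin ltwo_ipZl ltwo_ipC ltwo_ipZl mulrA.
  rewrite (le_trans (ler_wpM2l _ (hu n)))// ?mulr_ge0 ?exprn_ge0//.
  rewrite natrX exprS invfM mulrA divff// mul1r.
  by rewrite -!exprMn -exprVn; apply: lerXn2r; rewrite ?nnegrE; lra.
have ifin : \forall x \ae mu, G x \is a fin_num.
  have : mu.-integrable setT G.
    apply/integrableP; split => //; rewrite (_ : (\int[mu]_x _)%E = (\int[mu]_x G x)%E)//.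
    by apply: eq_integral => x _; rewrite gee0_abs.
  by move=> /(integrable_ae measurableT); apply: filterS => x; apply.
pose A := [set x | G x \is a fin_num].
have mA : measurable A by rewrite -[A]setTI; exact: emeasurable_fin_num.
(* A telescoping sum that equals [u n x] wherever the almost everywhere description of all [e n] is
   valid, hence almost everywhere. *)
pose W n x : R := u 0%N x + \sum_(0 <= i < n) 2^-1 ^+ i * e i x.
have mW n : measurable_fun setT (W n).
  apply: measurable_funD; first exact: measurable_fn.
  apply: measurable_sum => i; apply: measurable_funM => //; exact: measurable_fn.
have ub i x : A x -> `|e i x| <= 1 + fine (G x).
  move=> Ax; have : (e i x) ^+ 2 <= fine (G x).
    rewrite -lee_fin fineK//.
    rewrite (le_trans _ (nneseries_lim_ge i.+1 _))//.
    by rewrite sumEFin lee_fin big_nat_recr//= lerDr sumr_ge0// => j _; rewrite sqr_ge0.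
  have : 0 <= fine (G x) by rewrite fine_ge0.
  by case: (ger0P (e i x)); nra.
have cW x : A x -> cvgn (W ^~ x).
  move=> Ax; have -> : W^~ x = (fun n => u 0%N x + series (fun i => 2^-1 ^+ i * e i x) n) by [].
  apply: is_cvgD; first exact: is_cvg_cst.
  apply: normed_cvg; apply: (@series_le_cvg _ _ (geometric (1 + fine (G x)) 2^-1)).
  - by move=> n; exact: normr_ge0.
  - by move=> n /=; rewrite mulr_ge0 ?exprn_ge0 ?addr_ge0 ?fine_ge0.
  - move=> n /=; rewrite normrM ger0_norm ?exprn_ge0// mulrC.
    by rewrite ler_wpM2r ?exprn_ge0// ub.
  - by apply: is_cvg_geometric_series; rewrite ger0_norm ?invf_lt1 ?ltr1n// invr_ge0.
(* The cut-off by [A] turns the limit into one that exists at every point, so that it is measurable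
   as an everywhere limit. *)
pose l x : R := \1_A x * limn (W ^~ x).
exists l; split.
  apply: (@measurable_fun_cvg _ _ _ _ (fun n x => \1_A x * W n x)).
    by move=> n; apply: measurable_funM => //; exact: measurable_indic.
  move=> x _; rewrite /l indicE; case: (boolP (x \in A)) => [/set_mem Ax|_].
    by rewrite mul1r; under eq_fun do rewrite mul1r; exact: cW.
  by rewrite mul0r; under eq_fun do rewrite mul0r; exact: cvg_cst.
have eall : \forall x \ae mu, forall n, e n x = 2 ^+ n * (u n.+1 x - u n x).
  by apply/ae_foralln => n; apply: filterS (eE n) => x; apply.
near=> x; have Ax : A x by near: x.
have ex : forall n, e n x = 2 ^+ n * (u n.+1 x - u n x) by near: x.
rewrite /l indicE mem_set// mul1r.
have -> : (fun n => u n x) = W ^~ x.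
  apply/funext; elim=> [|n IH]; first by rewrite /W big_nil addr0.
  rewrite /W big_nat_recr// addrA -[X in X + _]/(W n x) -IH.
  by rewrite [in RHS]ex mulrA -exprMn mulVf// expr1n mul1r addrC subrK.
exact: cW.
Unshelve. all: by end_near. Qed.

Lemma ltwo_complete (u : nat -> Q) : hilbert_cauchy ltwo_ip u ->
  exists l, hilbert_cvg ltwo_ip u l.
Proof.
move=> cu.
have h8 n : (0 : R) < 8^-1 ^+ n by rewrite exprn_gt0.
pose N n := projT1 (cid (cu _ (h8 n))).
have NP n i j : (N n <= i)%N -> (N n <= j)%N ->
    ltwo_ip (u i - u j) (u i - u j) < 8^-1 ^+ n by exact: (projT2 (cid (cu _ (h8 n)))).
(* Summing makes the extraction dominate [N], nondecreasing and at least [n]: consecutive terms of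
   the subsequence are 8^-n close, and Fatou can later be run along it. *)
pose k n := (\sum_(i < n.+1) (N i).+1)%N.
have kN n : (N n <= k n)%N by rewrite /k big_ord_recr/= addnS ltnW// ltnS leq_addl.
have kS n : (k n <= k n.+1)%N by rewrite /k [leqRHS]big_ord_recr leq_addr.
have kge n : (n <= k n)%N.
  elim: n => // n IH; rewrite /k big_ord_recr/= addnS ltnS (leq_trans IH)//.
  by rewrite leq_addr.
have [|l [ml ul]] := @ltwo_complete_fast (u \o k).
  by move=> n; apply/ltW/NP; rewrite // (leq_trans (kN n)).
(* With [n] fixed, Fatou along the subsequence transfers the Cauchy estimate to the pointwise
   limit. *)
have bound c : 0 < c -> exists M, forall n, (M <= n)%N ->
    (\int[mu]_x ((l x - u n x) ^+ 2)%:E <= c%:E)%E.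
  move=> c0; have [M HM] := cu c c0; exists M => n Mn.
  apply: (@sq_fatou (fun j x => u (k j) x - u n x)).
  - by move=> j; apply: measurable_funB; exact: measurable_fn.
  - by apply: measurable_funB => //; exact: measurable_fn.
  - by apply: filterS ul => x h; apply: cvgB => //; exact: cvg_cst.
  - exists M => // j /= Mj.
    rewrite (@integral_sq_ae _ (u (k j) - u n)).
    + by rewrite lee_fin ltW// HM// (leq_trans Mj).
    + by apply: measurable_funB; exact: measurable_fn.
    + exact: ae_eq_sym (fnB _ _).
have sl : sqi l.
  have [M /(_ _ (leqnn _)) h] := bound 1 ltr01.
  have -> : l = (fun x => (l x - u M x) + u M x) by apply/funext => x; rewrite subrK.
  apply: sqiD => //; apply/sqiP; split; last by rewrite (le_lt_trans h)// ltry.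
  by apply: measurable_funB => //; exact: measurable_fn.
exists (cl l) => e e0; have [M HM] := bound (e / 2) ltac:(by rewrite divr_gt0).
exists M => n Mn; suff : ltwo_ip (u n - cl l) (u n - cl l) <= e / 2 by lra.
rewrite -lee_fin ltwo_ipBC (le_trans _ (HM n Mn))// (@integral_sq_ae _ (cl l - u n))//.
- by apply: measurable_funB => //; exact: measurable_fn.
- have h1 := fnB (cl l) (u n); have h2 := clE sl.
  by near=> x => _; rewrite (near h1 x)// (near h2 x).
Unshelve. all: by end_near. Qed.

HB.instance Definition _ := Lmodule_isHilbert.Build R Q
  ltwo_ipC ltwo_ipDl ltwo_ipZl ltwo_ipff_ge0 ltwo_ipff_eq0 ltwo_complete.

Lemma ipE p q : ip p q = sip p q. Proof. by []. Qed.

Lemma ip_cl f g : sqi f -> sqi g -> ip (cl f) (cl g) = sip f g.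
Proof. by move=> hf hg; apply: ae_sip => //; exact: clE. Qed.

Lemma ip_clr p g : sqi g -> ip p (cl g) = sip p g.
Proof. by move=> hg; rewrite -[in LHS](fnK p) ip_cl. Qed.

Lemma nrm_le_cl f (b : R) : measurable_fun setT f -> 0 <= b ->
  (\int[mu]_x (f x ^+ 2)%:E <= (b ^+ 2)%:E)%E -> sqi f /\ nrm (cl f) <= b.
Proof.
move=> mf b0 hb; have hf : sqi f by apply/sqiP; split => //; rewrite (le_lt_trans hb)// ltry.
split => //; rewrite nrm_le2// -lee_fin ipE -[X in (X <= _)%E]integral_sq.
by rewrite [X in (X <= _)%E]integral_sq -(integral_sq_ae mf (ae_eq_sym (clE hf))).
Qed.

Lemma integral_sq_nrm f : sqi f -> (\int[mu]_x (f x ^+ 2)%:E = (nrm (cl f) ^+ 2)%:E)%E.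
Proof.
by move=> hf; rewrite -ipff (integral_sq_ae hf.1 (ae_eq_sym (clE hf))).
Qed.

End Ltwo.
#[export] Hint Resolve sqi_fn : core.
Arguments cl : simpl never.

(** * Test functions *)

Section RealCalculus.
Context {R : realType}.
Implicit Types (f g : R -> R) (x y a b c h : R).

Lemma derivable_is_derive1 f x : derivable f x 1 -> is_derive x 1 f ((derive1 f) x).
Proof. by move=> df; apply: DeriveDef => //; rewrite derive1E. Qed.

Lemma is_derive1E f x l : is_derive x 1 f l -> (derive1 f) x = l.
Proof. by move=> d; rewrite derive1E; exact: derive_val. Qed.

Lemma is_derive_conv f g x l m : is_derive x 1 f l -> f =1 g -> l = m ->
  is_derive x 1 g m.
Proof. by move=> d /funext <- <-. Qed.

Lemma dnbhs_norm_cvg0 : `|h| @[h --> (0 : R)^'] --> (0 : R).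
Proof.
by rewrite -[X in _ --> X](@normr0 _ R); apply: cvg_norm; exact: cvg_within.
Qed.

Lemma derivable_continuous f : (forall x, derivable f x 1) -> continuous f.
Proof. by move=> df x; apply: differentiable_continuous; exact/derivable1_diffP. Qed.

Lemma derivable_measurable f : (forall x, derivable f x 1) -> measurable_fun setT f.
Proof. by move=> df; apply: continuous_measurable_fun; exact: derivable_continuous. Qed.

(** The intermediate point is located by a distance, so that one statement serves both orders of [a]
    and [b], hence increments and times of either sign. *)
Lemma mean_value f a b : (forall x, derivable f x 1) ->
  exists2 c, `|c - a| <= `|b - a| & f b - f a = (derive1 f) c * (b - a).
Proof.
move=> df; have cf A : {within A, continuous f}.
  by apply: continuous_subspaceT; exact: derivable_continuous.
have [ab|ba] := leP a b.
  have [c cab e] := MVT_segment ab (fun x _ => derivable_is_derive1 (df x)) (cf _).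
  exists c => //; move: cab; rewrite in_itv/= => /andP[ac cb].
  by rewrite !ger0_norm ?subr_ge0// lerD2r.
have [c cab e] := MVT_segment (ltW ba) (fun x _ => derivable_is_derive1 (df x)) (cf _).
exists c; last by rewrite -opprB e -mulrN opprB.
move: cab; rewrite in_itv/= => /andP[bc ca].
by rewrite !ler0_norm ?subr_le0// ?(ltW ba)// !opprB lerD2l lerN2.
Qed.

Lemma lipschitz_of_derive f c : (forall x, derivable f x 1) ->
  (forall x, `|(derive1 f) x| <= c) -> forall x h, `|f (x + h) - f x| <= c * `|h|.
Proof.
move=> df fc x h; have [d _ ->] := mean_value x (x + h) df.
by rewrite addrC addKr normrM ler_wpM2r.
Qed.

Lemma derive_lim f x : derivable f x 1 ->
  (f (x + h) - f x) / h @[h --> 0^'] --> (derive1 f) x.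
Proof.
move=> /derivable_is_derive1 d.
have := @ex_derive _ _ _ _ _ _ _ d; rewrite /derivable => /cvg_lim e.
have := @ex_derive _ _ _ _ _ _ _ d; rewrite /derivable.
have -> : (fun h : R => h^-1 *: (f (h *: (1 : R) + x) - f x)) = (fun h => (f (x + h) - f x) / h).
  by apply/funext => h; rewrite /GRing.scale/= mulr1 mulrC (addrC x).
move=> /cvg_ex[l hl]; suff -> : (derive1 f) x = l by [].
rewrite derive1E /derive.
have -> : (fun h : R => h^-1 *: (f (h *: (1 : R) + x) - f x)) = (fun h => (f (x + h) - f x) / h).
  by apply/funext => h; rewrite /GRing.scale/= mulr1 mulrC (addrC x).
exact: cvg_lim.
Qed.

Lemma lim_derive f x l : (f (x + h) - f x) / h @[h --> 0^'] --> l ->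
  is_derive x 1 f l.
Proof.
move=> hl.
have e : (fun h : R => h^-1 *: (f (h *: (1 : R) + x) - f x)) = (fun h => (f (x + h) - f x) / h).
  by apply/funext => h; rewrite /GRing.scale/= mulr1 mulrC (addrC x).
apply: DeriveDef; first by rewrite /derivable e; apply/cvg_ex; exists l.
by rewrite /derive e; exact: cvg_lim.
Qed.

Lemma derive1_measurable f : (forall x, derivable f x 1) -> measurable_fun setT (derive1 f).
Proof.
move=> df; have mf := derivable_measurable df.
apply: (@measurable_fun_cvg _ _ _ _ (fun n x => (f (x + n.+1%:R^-1) - f x) / n.+1%:R^-1)).
  move=> n; apply: measurable_funM => //; apply: measurable_funB => //.
  by apply: measurableT_comp => //; exact: measurable_funD.
move=> x _; have /cvgr_dnbhsP := derive_lim (df x); apply; split; last exact: cvg_harmonic.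
by move=> n; rewrite invr_eq0 pnatr_eq0.
Qed.

(** The recursion passes to [derive1 f], the form in which products and affine changes of variable
    are handled by induction; [smoothP] converts it to the iterated derivatives of test
    functions. *)
Fixpoint Cn n f : Prop :=
  if n is m.+1 then (forall x, derivable f x 1) /\ Cn m (derive1 f) else True.

Definition smooth f := forall n x, derivable (derive1n n f) x 1.

Lemma derive1Sn n f : derive1n n.+1 f = derive1n n (derive1 f).
Proof. by rewrite /derive1n iterSr. Qed.

Lemma smoothP f : smooth f <-> forall n, Cn n f.
Proof.
split=> [sf n|cf n].
  elim: n f sf => //= n IH f sf; split; first exact: (sf 0%N).
  by apply: IH => m x; rewrite -derive1Sn; exact: sf.
elim: n f cf => [|n IH] f cf x; first by have [] := cf 1%N.
rewrite derive1Sn; apply: IH => m.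
by have [] := cf m.+1.
Qed.

Lemma smooth_derivable f x : smooth f -> derivable f x 1.
Proof. by move=> /(_ 0%N). Qed.

Lemma smooth_derive f : smooth f -> smooth (derive1 f).
Proof. by move=> sf n x; rewrite -derive1Sn; exact: sf. Qed.

Lemma CnW n f : Cn n.+1 f -> Cn n f.
Proof. by elim: n f => //= n IH f [df [df' cf]]; split => //; apply: IH. Qed.

Lemma eq_Cn n f g : f =1 g -> Cn n f -> Cn n g.
Proof. by move=> /funext ->. Qed.

Lemma CnD n f g : Cn n f -> Cn n g -> Cn n (fun x => f x + g x).
Proof.
elim: n f g => //= n IH f g [df cf] [dg cg]; split.
  by move=> x; apply: derivableD.
apply: eq_Cn (IH _ _ cf cg) => x; apply/esym/is_derive1E.
by apply: is_deriveD; exact: derivable_is_derive1.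
Qed.

Lemma is_derive1M f g x : derivable f x 1 -> derivable g x 1 ->
  is_derive x 1 (fun x => f x * g x) ((derive1 f) x * g x + f x * (derive1 g) x).
Proof.
move=> df dg.
apply: (is_derive_conv (is_deriveM (derivable_is_derive1 df) (derivable_is_derive1 dg))) => //.
by rewrite /GRing.scale/= addrC [g x * _]mulrC.
Qed.

Lemma CnM n f g : Cn n f -> Cn n g -> Cn n (fun x => f x * g x).
Proof.
elim: n f g => // n IH f g [df cf] [dg cg]; split.
  by move=> x; have [] := is_derive1M (df x) (dg x).
apply: (@eq_Cn _ (fun x => (derive1 f) x * g x + f x * (derive1 g) x)).
  by move=> x; apply/esym/is_derive1E/is_derive1M.
apply: CnD; first by apply: IH => //; apply: (@CnW n); split.
by apply: IH => //; apply: (@CnW n); split.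
Qed.

Lemma Cn_cst n c : Cn n (fun=> c).
Proof.
elim: n c => //= n IH c; split; first by move=> x; exact: derivable_cst.
by apply: eq_Cn (IH 0) => x; rewrite derive1_cst.
Qed.

Lemma is_derive_affine f x a b : derivable f (a * x + b) 1 ->
  is_derive x 1 (fun x => f (a * x + b)) (a * (derive1 f) (a * x + b)).
Proof.
move=> /derivable_is_derive1 df.
have da : is_derive x 1 (fun x => a * x + b) a.
  apply: (is_derive_conv (is_deriveD (is_deriveZ a (is_derive_id x (1 : R))) (is_derive_cst b x (1 : R)))) => //.
  by rewrite /GRing.scale/= mulr1 addr0.
apply: (is_derive_conv (@is_derive1_comp _ f (fun x => a * x + b) x _ _ df da)) => //.
by rewrite mulrC.
Qed.

Lemma Cn_affine n f a b : Cn n f -> Cn n (fun x => f (a * x + b)).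
Proof.
elim: n f => // n IH f [df cf]; split.
  by move=> x; have [] := is_derive_affine (df (a * x + b)).
apply: (@eq_Cn _ (fun x => a * (derive1 f) (a * x + b))).
  by move=> x; apply/esym/is_derive1E/is_derive_affine.
by apply: CnM; [exact: Cn_cst|exact: IH].
Qed.

Lemma smoothM f g : smooth f -> smooth g -> smooth (fun x => f x * g x).
Proof. by move=> /smoothP sf /smoothP sg; apply/smoothP => n; exact: CnM. Qed.

Lemma smoothD f g : smooth f -> smooth g -> smooth (fun x => f x + g x).
Proof. by move=> /smoothP sf /smoothP sg; apply/smoothP => n; exact: CnD. Qed.

Lemma smooth_cst c : smooth (fun=> c).
Proof. by apply/smoothP => n; exact: Cn_cst. Qed.

Lemma smooth_affine f a b : smooth f -> smooth (fun x => f (a * x + b)).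
Proof. by move=> /smoothP sf; apply/smoothP => n; exact: Cn_affine. Qed.

(* The functions [P(1/x) exp(-1/x)] on the half-line, extended by [0], are stable
   under differentiation. *)
Definition flat (P : {poly R}) x := if 0 < x then P.[x^-1] * expR (- x^-1) else 0.

Lemma expR_decay n : exists2 C, 0 <= C & forall y : R, 0 < y -> y ^+ n * expR (- y) <= C.
Proof.
exists n.+1`!%:R; first by [].
case: n => [|n] y y0.
  rewrite expr0 mul1r.
  by rewrite -expR0 ler_expR oppr_le0 ltW.
rewrite expRN ler_pdivrMr ?expR_gt0//.
have h := expR_ge1Dxn n (ltW y0).
have f0 : (0 : R) < n.+1`!%:R by rewrite ltr0n fact_gt0.
rewrite (@le_trans _ _ (n.+1`!%:R * expR y))//.
  by rewrite mulrC -ler_pdivrMr// (le_trans _ h)// lerDr.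
by rewrite ler_wpM2r ?expR_ge0// ler_nat factS leq_pmull.
Qed.

(** The exponent [n] is universally quantified in the induction because the step from [P] to P X + c
    trades one degree of the polynomial for one power of [y]. *)
Lemma poly_decay (P : {poly R}) n :
  exists2 C, 0 <= C & forall y, 0 < y -> `|P.[y]| * y ^+ n * expR (- y) <= C.
Proof.
elim/poly_ind: P n => [|P c IH] n.
  by exists 0 => // y y0; rewrite horner0 normr0 !mul0r.
have [C1 C10 h1] := IH n.+1; have [C2 C20 h2] := expR_decay n.
exists (C1 + `|c| * C2) => [|y y0]; first by rewrite addr_ge0// mulr_ge0.
rewrite hornerMXaddC; apply: (@le_trans _ _ ((`|P.[y]| * y + `|c|) * y ^+ n * expR (- y))).
  apply: ler_wpM2r; first exact: expR_ge0.
  apply: ler_wpM2r; first by rewrite exprn_ge0// ltW.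
  by rewrite (le_trans (ler_normD _ _))// normrM (gtr0_norm y0).
have := h1 _ y0; have := h2 _ y0 => /(ler_wpM2l (normr_ge0 c)).
rewrite exprS => a b; apply: le_trans (lerD b a).
by rewrite le_eqVlt; apply/orP; left; apply/eqP; ring.
Qed.

(** Decay at infinity in the variable 1/x, taken with two extra powers. Quadratic smallness at 0 is
    what makes the difference quotient of [flat P] at 0 tend to 0. *)
Lemma flat_small (P : {poly R}) : exists2 C, 0 <= C & forall x, `|flat P x| <= C * x ^+ 2.
Proof.
have [C C0 hC] := poly_decay P 2; exists C => // x; rewrite /flat; case: ifPn => [x0|_].
  have xi : 0 < x^-1 by rewrite invr_gt0.
  have := hC _ xi; rewrite normrM [`|expR _|]ger0_norm ?expR_ge0// => h.
  rewrite -ler_pdivrMr ?exprn_gt0// (le_trans _ h)// -exprVn.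
  by rewrite le_eqVlt; apply/orP; left; apply/eqP; ring.
by rewrite normr0 mulr_ge0// sqr_ge0.
Qed.

Lemma is_derive_flat (P : {poly R}) x :
  is_derive x 1 (flat P) (flat ('X^2 * (P - P^`())%R) x).
Proof.
have [x0|x0|->] := ltgtP x 0.
- have -> : flat ('X^2 * (P - P^`())) x = 0 by rewrite /flat ltNge (ltW x0).
  apply: (@near_eq_is_derive _ _ _ (cst 0) _ _ _ _ _ (is_derive_cst _ _ _)).
  by near=> y; rewrite /flat ifN// -leNgt ltW//; near: y; exact: lt_nbhsl.
- rewrite [flat _ x]/flat x0.
  apply: (@near_eq_is_derive _ _ _ (fun x => P.[x^-1] * expR (- x^-1))).
    by near=> y; rewrite /flat ifT//; near: y; exact: lt_nbhsr.
  have xn0 : x != 0 by rewrite gt_eqF.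
  have dV : is_derive x 1 (fun x : R => x^-1) (- x ^- 2).
    by apply: (is_derive_conv (is_deriveV xn0 (is_derive_id x (1 : R)))) => //; rewrite /GRing.scale/= mulr1.
  have dP : is_derive x 1 (fun x => P.[x^-1]) (P^`().[x^-1] * (- x ^- 2)).
    exact: (is_derive_conv (@is_derive1_comp _ _ _ x _ _ (is_derive_poly P x^-1) dV)).
  have dE : is_derive x 1 (fun x => expR (- x^-1)) (expR (- x^-1) * x ^- 2).
    have dN : is_derive x 1 (fun x : R => - x^-1) (x ^- 2).
      by apply: (is_derive_conv (is_deriveN dV)) => //; rewrite opprK.
    exact: (is_derive_conv (@is_derive1_comp _ _ _ x _ _ (is_derive_expR _) dN)).
  apply: (is_derive_conv (is_deriveM dP dE)) => //.
  by rewrite /GRing.scale/= !hornerE/= -!exprVn; move: (P.[_]) (P^`().[_]) (expR _) => a b c; ring.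
- have -> : flat ('X^2 * (P - P^`())) 0 = 0 by rewrite /flat ltxx.
  apply: lim_derive; have [C C0 hC] := flat_small P.
  apply: (@cvg_dist_squeeze _ _ _ _ _ (fun h => C * `|h|)).
    near=> h; have h0 : h != 0 by near: h; exact: nbhs_dnbhs_neq.
    rewrite add0r {2}/flat ltxx !subr0 normrM normfV ler_pdivrMr ?normr_gt0//.
    by rewrite -mulrA -expr2 real_normK ?num_real.
  rewrite -[X in _ --> X](mulr0 C); apply: cvgM; first exact: cvg_cst.
  exact: dnbhs_norm_cvg0.
Unshelve. all: by end_near. Qed.

Lemma smooth_flat (P : {poly R}) : smooth (flat P).
Proof.
apply/smoothP => n; elim: n P => // n IH P; split.
  by move=> x; have [] := is_derive_flat P x.
apply: eq_Cn (IH ('X^2 * (P - P^`())%R)) => x.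
exact/esym/is_derive1E/is_derive_flat.
Qed.

Definition test_fun f := smooth f /\ exists M, forall x, M < `|x| -> f x = 0.

Lemma test_funD f g : test_fun f -> test_fun g -> test_fun (fun x => f x + g x).
Proof.
move=> [sf [M hM]] [sg [N hN]]; split; first exact: smoothD.
by exists (Num.max M N) => x; rewrite gt_max => /andP[Mx Nx]; rewrite hM// hN// addr0.
Qed.

Lemma test_fun_smoothM f g : smooth f -> test_fun g -> test_fun (fun x => f x * g x).
Proof.
move=> sf [sg [N hN]]; split; first exact: smoothM.
by exists N => x Nx; rewrite hN// mulr0.
Qed.

Lemma test_fun_derive f : test_fun f -> test_fun (derive1 f).
Proof.
move=> [sf [M hM]]; split; first exact: smooth_derive.
exists M => x Mx; apply: is_derive1E.
apply: (@near_eq_is_derive _ _ _ (cst 0) _ _ _ _ _ (is_derive_cst _ _ _)).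
have e0 : 0 < `|x| - M by rewrite subr_gt0.
apply: filterS (nbhsx_ballx x _ e0) => y; rewrite /ball/= => yx.
by rewrite hM//; have := ler_normD y (x - y); rewrite addrC subrK; lra.
Qed.

Lemma test_fun_derive1n n f : test_fun f -> test_fun (derive1n n f).
Proof. by move=> tf; elim: n => // n; rewrite derive1nS; exact: test_fun_derive. Qed.

Lemma test_fun_shift f h : test_fun f -> test_fun (fun x => f (x + h)).
Proof.
move=> [sf [M hM]]; split.
  have -> : (fun x => f (x + h)) = (fun x => f (1 * x + h)) by apply/funext => x; rewrite mul1r.
  exact: smooth_affine.
exists (M + `|h|) => x Mx; apply: hM.
have := ler_normB (x + h) h; rewrite addrK; lra.
Qed.

Lemma compact_support_bounded f : continuous f ->
  (exists M, forall x, M < `|x| -> f x = 0) -> exists2 c, 0 <= c & forall x, `|f x| <= c.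
Proof.
move=> cf [M hM]; pose N := `|M|.
have NN : - N <= N by rewrite /N; have := normr_ge0 M; lra.
have cn : {within `[- N, N], continuous (fun x => `|f x|)}.
  by apply: continuous_subspaceT => x; apply: cvg_norm; exact: cf.
have [c _ hc] := EVT_max NN cn.
exists `|f c| => // x; have [xN|xN] := leP `|x| N.
  by apply: hc; rewrite in_itv/= -ler_norml.
by rewrite hM ?normr0// (le_lt_trans _ xN)// ler_norm.
Qed.

Lemma test_fun_bounded f : test_fun f -> exists2 c, 0 <= c & forall x, `|f x| <= c.
Proof.
move=> [sf fM]; apply: compact_support_bounded => //.
by apply: derivable_continuous => x; exact: smooth_derivable.
Qed.

(** The product of exp(-1/(n(x - a))) and exp(-1/(n(b - x))) inside ]a, b[. The dilation by [n]
    pushes both factors to 1 on the interval, so these smooth functions approach its indicator from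
    below. *)
Definition bump a b n x := flat 1 (n%:R * (x - a)) * flat 1 (n%:R * (b - x)).

Lemma bump_ge0 a b n x : 0 <= bump a b n x <= 1.
Proof.
have h y : 0 <= flat 1 y <= 1.
  rewrite /flat; case: ifPn => [y0|_]; last by rewrite lexx ler01.
  by rewrite hornerC mul1r expR_ge0/= -expR0 ler_expR oppr_le0 invr_ge0 ltW.
have /andP[a0 a1] := h (n%:R * (x - a)); have /andP[b0 b1] := h (n%:R * (b - x)).
by rewrite /bump mulr_ge0//= mulr_ile1.
Qed.

Lemma test_fun_bump a b n : test_fun (bump a b n).
Proof.
split.
  apply: smoothM.
    have -> : (fun x => flat 1 (n%:R * (x - a))) = (fun x => flat 1 (n%:R * x + (- (n%:R * a)))).
      by apply/funext => x; rewrite mulrBr.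
    exact/smooth_affine/smooth_flat.
  have -> : (fun x => flat 1 (n%:R * (b - x))) = (fun x => flat 1 ((- n%:R) * x + (n%:R * b))).
    by apply/funext => x; rewrite mulrBr addrC mulNr.
  exact/smooth_affine/smooth_flat.
exists (`|a| + `|b|) => x xab; rewrite /bump /flat.
have [x0|x0] := leP 0 x.
  rewrite [X in _ * X]ifN ?mulr0// -leNgt mulr_ge0_le0// subr_le0.
  by move: xab; rewrite (ger0_norm x0); have := ler_norm b; have := normr_ge0 a; lra.
rewrite ifN ?mul0r// -leNgt mulr_ge0_le0// subr_le0.
move: xab; rewrite (ltr0_norm x0); have := normr_ge0 b.
by have := ler_norm (- a); rewrite normrN; lra.
Qed.

Lemma bump_cvg a b x : bump a b n x @[n --> \oo] --> (\1_(`]a, b[%classic) x : R).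
Proof.
have fl y : 0 < y -> (fun n : nat => flat 1 (n%:R * y)) @ \oo --> (1 : R).
  move=> y0; apply: (@cvg_dist_squeeze _ _ _ _ _ (fun n : nat => y^-1 * n%:R^-1)); last first.
    rewrite -[X in _ --> X](mulr0 y^-1); apply: cvgM; first exact: cvg_cst.
    by apply/gtr0_cvgV0; [near=> n; rewrite ltr0n; near: n; exists 1%N|exact: cvgr_idn].
  near=> n; have n0 : (0 : R) < n%:R by rewrite ltr0n; near: n; exists 1%N.
  rewrite /flat mulr_gt0// hornerC mul1r -invfM (mulrC y) distrC ger0_norm.
    by have := expR_ge1Dx (- (n%:R * y)^-1); lra.
  have : expR (- (n%:R * y)^-1) <= expR 0.
    by rewrite ler_expR oppr_le0 invr_ge0 ltW// mulr_gt0.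
  by rewrite expR0 subr_ge0.
rewrite indicE; case: (boolP (_ \in _)) => [/set_mem/=|/negP h].
  rewrite in_itv/= => /andP[ax xb]; rewrite /bump -[X in _ --> X](mulr1 1).
  by apply: cvgM; apply: fl; rewrite subr_gt0.
have -> : (fun n => bump a b n x) = (fun=> 0 : R); last exact: cvg_cst.
apply/funext => n; rewrite /bump /flat.
have [ax|ax] := ltP a x; last by rewrite ifN ?mul0r// -leNgt mulr_ge0_le0// subr_le0.
rewrite [X in _ * X]ifN ?mulr0// -leNgt mulr_ge0_le0// subr_le0 leNgt.
by apply/negP => xb; apply: h; apply: mem_set; rewrite /= in_itv/= ax.
Unshelve. all: by end_near. Qed.

End RealCalculus.

(** * Multiplication operators *)

Section Multiplication.
Context {R : realType}.
Local Notation mu := (@lebesgue_measure R).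
Local Notation Q := (ltwo R).
Implicit Types (p q : Q) (f g m : R -> R) (c b : R).

Definition bounded_by c m := measurable_fun setT m /\ forall x, `|m x| <= c.

Definition dm m p := sqi (fun x => m x * p x).
Definition mul m p : Q := cl (fun x => m x * p x).

Lemma mulE m p : dm m p -> mul m p = (fun x => m x * p x) %[ae mu].
Proof. exact: clE. Qed.

Lemma bounded_dm c m p : bounded_by c m -> dm m p.
Proof. by move=> [mm mc]; exact: (sqi_bounded_mul mm mc). Qed.

Lemma measurable_mulfn m p : measurable_fun setT m ->
  measurable_fun setT (fun x => m x * p x).
Proof. by move=> mm; apply: measurable_funM => //; exact: measurable_fn. Qed.

Lemma nrm_le_ae p q c : 0 <= c -> (\forall x \ae mu, `|p x| <= c * `|q x|) ->
  nrm p <= c * nrm q.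
Proof.
move=> c0 h; rewrite nrm_le2 ?mulr_ge0// exprMn -ipff -lee_fin -!integral_sq.
rewrite EFinM -integral_sq -ge0_integralZl//; last 3 first.
- by apply/measurable_EFinP; apply: measurable_funX; exact: measurable_fn.
- by move=> x _; rewrite lee_fin sqr_ge0.
- by rewrite lee_fin sqr_ge0.
apply: ae_ge0_le_integral => //.
- by move=> x _; rewrite lee_fin sqr_ge0.
- by apply/measurable_EFinP; apply: measurable_funX; exact: measurable_fn.
- by move=> x _; rewrite -EFinM lee_fin mulr_ge0 ?sqr_ge0.
- apply/measurable_EFinP; apply: measurable_funM => //.
  by apply: measurable_funX; exact: measurable_fn.
- apply: filterS h => x h _; rewrite -EFinM lee_fin -exprMn.
  rewrite -real_normK ?num_real// -[leRHS]real_normK ?num_real//.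
  by rewrite lerXn2r ?nnegrE// normrM (ger0_norm c0).
Qed.

Lemma eq_mul m m' p : m =1 m' -> mul m p = mul m' p.
Proof. by move=> /funext ->. Qed.

Section measurable_multiplier.
Variables (m : R -> R) (mm : measurable_fun setT m).

Lemma dmD p q : dm m p -> dm m q -> dm m (p + q).
Proof.
move=> hp hq; have := sqiD hp hq; apply: ae_sqi; first exact: measurable_mulfn.
by apply: filterS (fnD p q) => x /(_ I) -> _; rewrite mulrDr.
Qed.

Lemma dmZ a p : dm m p -> dm m (a *: p).
Proof.
move=> hp; have := sqiZ a hp; apply: ae_sqi; first exact: measurable_mulfn.
by apply: filterS (fnZ a p) => x /(_ I) -> _; rewrite mulrCA.
Qed.

Lemma dmN p : dm m p -> dm m (- p).
Proof. by move=> hp; rewrite -scaleN1r; exact: dmZ. Qed.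

Lemma dmB p q : dm m p -> dm m q -> dm m (p - q).
Proof. by move=> hp hq; apply: dmD => //; exact: dmN. Qed.

Lemma mulD p q : dm m p -> dm m q -> mul m (p + q) = mul m p + mul m q.
Proof.
move=> hp hq; rewrite -clD//; apply: eq_cl; [exact: dmD|exact: sqiD|].
by apply: filterS (fnD p q) => x /(_ I) -> _; rewrite mulrDr.
Qed.

Lemma mulZ a p : dm m p -> mul m (a *: p) = a *: mul m p.
Proof.
move=> hp; rewrite -clZ//; apply: eq_cl; [exact: dmZ|exact: sqiZ|].
by apply: filterS (fnZ a p) => x /(_ I) -> _; rewrite mulrCA.
Qed.

Lemma mulB p q : dm m p -> dm m q -> mul m (p - q) = mul m p - mul m q.
Proof.
by move=> hp hq; rewrite mulD//; [rewrite -scaleN1r mulZ// scaleN1r|exact: dmN].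
Qed.

Lemma ip_mul p q : dm m p -> dm m q -> ip (mul m p) q = ip p (mul m q).
Proof.
move=> hp hq; rewrite ip_clr// ipC ip_clr// /sip; congr fine.
by apply: eq_integral => x _; congr EFin; ring.
Qed.

End measurable_multiplier.

Lemma mul_mul m m' p : measurable_fun setT m -> dm m' p ->
  dm m (mul m' p) -> dm (fun x => m x * m' x) p.
Proof.
move=> mm h h'; have := h'; apply: ae_sqi.
  apply: (@eq_measurable_fun _ _ _ _ _ (fun x => m x * (m' x * p x))).
    by move=> x _; rewrite mulrA.
  by apply: measurable_funM => //; case: h.
by apply: filterS (mulE h) => x /(_ I) -> _; rewrite mulrA.
Qed.

Lemma mulM m m' p : measurable_fun setT m -> dm m' p ->
  dm (fun x => m x * m' x) p -> dm m (mul m' p) /\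
  mul m (mul m' p) = mul (fun x => m x * m' x) p.
Proof.
move=> mm h h'; have h2 : dm m (mul m' p).
  have := h'; apply: ae_sqi; first exact: measurable_mulfn.
  by apply: filterS (mulE h) => x /(_ I) -> _; rewrite mulrA.
split => //; apply: eq_cl => //.
by apply: filterS (mulE h) => x /(_ I) -> _; rewrite mulrA.
Qed.

Lemma dm_le c m m' p : 0 <= c -> measurable_fun setT m ->
  (forall x, `|m x| <= c * `|m' x|) -> dm m' p ->
  dm m p /\ nrm (mul m p) <= c * nrm (mul m' p).
Proof.
move=> c0 mm mm' h.
have h1 : dm m p.
  have [h1 h2] := sqiZ c h.
  apply: (@sqi_bound _ _ _ _ h2); first exact: measurable_mulfn.
  move=> x; rewrite -real_normK ?num_real// -[leRHS]real_normK ?num_real//.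
  rewrite lerXn2r ?nnegrE// !normrM (ger0_norm c0) mulrA.
  by rewrite ler_wpM2r.
split => //; apply: nrm_le_ae => //.
have e1 := mulE h; have e2 := mulE h1.
near=> x; rewrite (near e1 x)// (near e2 x)// !normrM mulrA ler_wpM2r//.
Unshelve. all: by end_near. Qed.

Lemma bounded_mul_nrm c m p : bounded_by c m -> nrm (mul m p) <= c * nrm p.
Proof.
move=> [mm mc]; have c0 : 0 <= c by rewrite (le_trans _ (mc 0)).
apply: nrm_le_ae => //; have e := mulE (bounded_dm p (conj mm mc)).
by near=> x; rewrite (near e x)// normrM ler_wpM2r.
Unshelve. all: by end_near. Qed.

Lemma mul1 p : mul (fun=> 1) p = p.
Proof. by rewrite /mul; under eq_fun do rewrite mul1r; exact: fnK. Qed.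

Lemma dm1 p : dm (fun=> 1) p.
Proof. by rewrite /dm; under eq_fun do rewrite mul1r; exact: sqi_fn. Qed.

Lemma mul_addm m m' p : dm m p -> dm m' p ->
  dm (fun x => m x + m' x) p /\ mul (fun x => m x + m' x) p = mul m p + mul m' p.
Proof.
move=> h h'; have e : (fun x => (m x + m' x) * p x) = (fun x => m x * p x + m' x * p x).
  by apply/funext => x; rewrite mulrDl.
by split; rewrite /dm /mul e; [exact: sqiD|rewrite clD].
Qed.

Lemma mul_scalem a m p : dm m p ->
  dm (fun x => a * m x) p /\ mul (fun x => a * m x) p = a *: mul m p.
Proof.
move=> h; have e : (fun x => a * m x * p x) = (fun x => a * (m x * p x)).
  by apply/funext => x; rewrite mulrA.
by split; rewrite /dm /mul e; [exact: sqiZ|rewrite clZ].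
Qed.

Lemma mul_fatou (mn : nat -> R -> R) m p b : 0 <= b ->
  (forall n, measurable_fun setT (mn n)) -> (forall x, mn ^~ x @ \oo --> m x) ->
  (forall n, dm (mn n) p) -> (forall n, nrm (mul (mn n) p) <= b) ->
  dm m p /\ nrm (mul m p) <= b.
Proof.
move=> b0 mmn mnm dn nb.
have mm : measurable_fun setT m.
  by apply: (measurable_fun_cvg mmn) => x _; exact: mnm.
apply: nrm_le_cl => //; first exact: measurable_mulfn.
apply: (@sq_fatou _ (fun n x => mn n x * p x)).
- by move=> n; exact: measurable_mulfn.
- exact: measurable_mulfn.
- by apply: aeW => x; apply: cvgM; [exact: mnm|exact: cvg_cst].
- apply: nearW => n; rewrite (integral_sq_nrm (dn n)) lee_fin lerXn2r ?nnegrE//.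
  exact: nb.
Qed.

Lemma mul_dct (mn : nat -> R -> R) m p c :
  (forall n, bounded_by c (mn n)) -> (forall x, mn ^~ x @ \oo --> m x) ->
  hcvg \oo (fun n => mul (mn n) p) (mul m p).
Proof.
move=> bm mnm.
have c0 : 0 <= c by have [_ /(_ 0)] := bm 0%N; apply: le_trans.
have bmm : bounded_by c m.
  split; first by apply: (@measurable_fun_cvg _ _ _ _ mn) => [n|x _]; [have [] := bm n|exact: mnm].
  move=> x; have h : `|mn n x| @[n --> \oo] --> `|m x| by apply: cvg_norm.
  rewrite -(cvg_lim _ h)//.
  apply: limr_le; first by apply/cvg_ex; exists `|m x|.
  by apply: nearW => n; have [_] := bm n.
have e n : nrm (mul (mn n) p - mul m p) ^+ 2 =
    \int[mu]_x (((mn n x - m x) * p x) ^+ 2).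
  have hd : dm (fun x => mn n x + (-1) * m x) p.
    apply: (mul_addm (bounded_dm p (bm n)) _).1.
    exact: (mul_scalem (-1) (bounded_dm p bmm)).1.
  have -> : mul (mn n) p - mul m p = mul (fun x => mn n x + (-1) * m x) p.
    rewrite (mul_addm (bounded_dm p (bm n)) (mul_scalem (-1) (bounded_dm p bmm)).1).2.
    by rewrite (mul_scalem (-1) (bounded_dm p bmm)).2 scaleN1r.
  apply: EFin_inj; rewrite -(integral_sq_nrm hd) /Rintegral fineK.
    by apply: eq_integral => x _; rewrite mulN1r.
  have [_ /(integrable_fin_num measurableT)] := hd; congr (_ \is a fin_num).
  by apply: eq_integral => x _ /=; rewrite mulN1r.
have [_ ip2] := sqi_fn p.
have := @dominated_convergence _ _ R mu setT measurableT
  (fun n x => (((mn n x - m x) * p x) ^+ 2)%:E) (fun=> 0%E)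
  (fun x => ((2 * c) ^+ 2 * p x ^+ 2)%:E).
case.
- move=> n; apply/measurable_EFinP; apply: measurable_funX; apply: measurable_mulfn.
  by apply: measurable_funB; [have [] := bm n|have [] := bmm].
- exact: measurable_cst.
- apply: aeW => x _; apply: cvg_EFin; first exact: nearW.
  rewrite -[X in _ --> X](_ : ((m x - m x) * p x) ^+ 2 = 0); last by rewrite subrr mul0r expr0n.
  have h1 : (mn n x - m x) * p x @[n --> \oo] --> (m x - m x) * p x.
    by apply: cvgM; [apply: cvgB; [exact: mnm|exact: cvg_cst]|exact: cvg_cst].
  exact: (cvgM h1 h1).
- by apply: eq_integrable (integrableZl measurableT ((2 * c) ^+ 2) ip2).
- apply: aeW => x n _; rewrite gee0_abs ?lee_fin ?sqr_ge0// exprMn ler_wpM2r ?sqr_ge0//.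
  rewrite -real_normK ?num_real// lerXn2r ?nnegrE ?mulr_ge0//.
  rewrite (le_trans (ler_normB _ _))// mulr_natl mulr2n lerD//.
    by have [_] := bm n.
  by have [_] := bmm.
move=> _ _; rewrite integral0 => h.
have h2 : nrm (mul (mn n) p - mul m p) ^+ 2 @[n --> \oo] --> (0 : R).
  under eq_fun do rewrite e.
  by apply: fine_cvg; exact: h.
rewrite /hcvg -[X in _ --> X]sqrtr0.
have -> : (fun n => nrm (mul (mn n) p - mul m p)) =
   (fun n => Num.sqrt (nrm (mul (mn n) p - mul m p) ^+ 2)).
  by apply/funext => n; rewrite sqrtr_sqr ger0_norm.
by apply: continuous_cvg => //; exact: sqrt_continuous.
Qed.

(** The multiplier is truncated where it exceeds [k]. For fixed [k] the truncation is a bounded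
    operator, so the bound passes to the limit of the vectors; Fatou then removes the truncation. *)
Lemma dm_closed m (pn : nat -> Q) p b : measurable_fun setT m -> 0 <= b ->
  hcvg \oo pn p -> (forall n, dm m (pn n)) -> (forall n, nrm (mul m (pn n)) <= b) ->
  dm m p /\ nrm (mul m p) <= b.
Proof.
move=> mm b0 pnp dn nb.
pose mk (k : nat) x := m x * \1_[set y | `|m y| <= k%:R] x.
have mA k : measurable [set y | `|m y| <= k%:R].
  rewrite -[X in measurable X]setTI.
  have -> : [set y | `|m y| <= k%:R] = (fun y => `|m y|) @^-1` `]-oo, k%:R]%classic.
    by apply/seteqP; split => y /=; rewrite in_itv.
  by apply: (measurableT_comp (@normr_measurable R setT) mm) => //; exact: measurable_itv.
have mmk k : measurable_fun setT (mk k).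
  by apply: measurable_funM => //; exact: measurable_indic.
have bk k : bounded_by k%:R (mk k).
  split => // x; rewrite /mk indicE; case: (boolP (x \in _)) => [/set_mem /=|_].
    by rewrite mulr1.
  by rewrite mulr0 normr0.
have lk k x : `|mk k x| <= 1 * `|m x|.
  by rewrite /mk mul1r indicE; case: (x \in _); rewrite ?mulr1 ?mulr0 ?normr0.
apply: (@mul_fatou mk) => //.
- move=> x; apply: (@cvg_dist_squeeze _ _ _ _ _ (fun=> 0)); last exact: cvg_cst.
  exists (Num.truncn `|m x|).+1 => // k /= hk; rewrite /mk indicE mem_set /=.
    by rewrite mulr1 subrr normr0.
  by rewrite (le_trans (ltW (truncnS_gt _)))// ler_nat.
- by move=> k; exact: bounded_dm.
move=> k; apply: (@hcvg_nrm_le _ _ _ \oo _ (fun n => mul (mk k) (pn n))).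
  apply: nearW => n; apply: le_trans (nb n).
  by have [_] := dm_le ler01 (mmk k) (lk k) (dn n); rewrite mul1r.
apply: (@hcvg_squeeze _ _ _ _ _ _ _ (fun n => k%:R * nrm (pn n - p))).
  apply: nearW => n; rewrite -mulB//; try exact: bounded_dm.
  exact: bounded_mul_nrm.
by rewrite -[X in _ --> X](mulr0 k%:R); apply: cvgM => //; exact: cvg_cst.
Qed.

End Multiplication.

(** * Translations *)

Section Translation.
Context {R : realType}.
Local Notation mu := (@lebesgue_measure R).
Local Notation Q := (ltwo R).
Implicit Types (p q : Q) (f g m : R -> R) (a b c h : R).

Lemma measurable_shift h : measurable_fun setT (fun x : R => x + h).
Proof. exact: measurable_funD. Qed.

Lemma lebesgue_measure_shift h (A : set R) : measurable A ->
  pushforward mu ((fun x => x + h) : _ -> measurableTypeR R) A = mu A.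
Proof.
move=> mA; apply/esym/lebesgue_measure_unique => //=; first exact: measurable_shift.
move=> _ _ [[a b]] _ <-; rewrite /pushforward.
have -> : (fun x : measurableTypeR R => x + h) @^-1` `]a, b]%classic = `]a - h, b - h]%classic.
  by apply/seteqP; split => x /=; rewrite !in_itv/= ltrBlDr lerBrDr.
by rewrite !lebesgue_measure_itv/= !lte_fin ltrD2r; case: ifP => // _; rewrite -!EFinB opprB addrA subrK.
Qed.

Lemma ge0_integral_shift h (f : R -> \bar R) : measurable_fun setT f ->
  (forall x, 0 <= f x)%E -> (\int[mu]_x f (x + h)%R = \int[mu]_x f x)%E.
Proof.
move=> mf f0.
have ms : measurable_fun (setT : set (measurableTypeR R)) ((fun x => x + h) : _ -> measurableTypeR R).
  exact: measurable_shift.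
have := @ge0_integral_pushforward _ _ _ _ R _ ms mu setT f measurableT mf (fun _ _ => f0 _).
rewrite preimage_setT => <-; apply: eq_measure_integral => A mA _.
exact: lebesgue_measure_shift.
Qed.

Lemma ae_shift h (P : R -> Prop) : (\forall x \ae mu, P x) -> \forall x \ae mu, P (x + h).
Proof.
move=> [N [mN N0 PN]]; exists ((fun x => x + h) @^-1` N); split.
- by rewrite -[X in measurable X]setTI; exact: measurable_shift.
- by rewrite -[LHS]/(pushforward mu ((fun x => x + h) : _ -> measurableTypeR R) N) lebesgue_measure_shift.
- by move=> x /= nP; apply: PN.
Qed.

Lemma sqi_shift h f : sqi f -> sqi (fun x => f (x + h)).
Proof.
move=> /sqiP[mf hf]; apply/sqiP; split.
  by apply: measurableT_comp => //; exact: measurable_shift.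
rewrite (@ge0_integral_shift h (fun x => (f x ^+ 2)%:E))//.
  by apply/measurable_EFinP; exact: measurable_funX.
by move=> x; rewrite lee_fin sqr_ge0.
Qed.

Definition tau h p : Q := cl (fun x => p (x + h)).

Lemma tauE h p : tau h p = (fun x => p (x + h)) %[ae mu].
Proof. exact/clE/sqi_shift. Qed.

Lemma tau_cl h f : sqi f -> tau h (cl f) = cl (fun x => f (x + h)).
Proof.
move=> hf; apply: eq_cl; try exact: sqi_shift.
exact: (ae_shift h (clE hf)).
Qed.

Lemma tauD h p q : tau h (p + q) = tau h p + tau h q.
Proof.
rewrite -clD; try exact: sqi_shift.
apply: eq_cl; [exact: sqi_shift|by apply: sqiD; exact: sqi_shift|].
exact: (ae_shift h (fnD p q)).
Qed.

Lemma tauZ h a p : tau h (a *: p) = a *: tau h p.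
Proof.
rewrite -clZ; last exact: sqi_shift.
apply: eq_cl; [exact: sqi_shift|by apply: sqiZ; exact: sqi_shift|].
exact: (ae_shift h (fnZ a p)).
Qed.

Lemma tauN h p : tau h (- p) = - tau h p.
Proof. by rewrite -scaleN1r tauZ scaleN1r. Qed.

Lemma tauB h p q : tau h (p - q) = tau h p - tau h q.
Proof. by rewrite tauD tauN. Qed.

Lemma tau0 p : tau 0 p = p.
Proof. by rewrite /tau; under eq_fun do rewrite addr0; exact: fnK. Qed.

Lemma tau_add a b p : tau (a + b) p = tau a (tau b p).
Proof.
rewrite [tau b p]/tau tau_cl; last exact: sqi_shift.
by congr cl; apply/funext => x; rewrite addrA.
Qed.

Lemma tau_nrm h p : nrm (tau h p) = nrm p.
Proof.
have hs := sqi_shift h (sqi_fn p).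
apply/eqP; rewrite -(@eqrXn2 _ 2)//; apply/eqP/EFin_inj.
rewrite -(integral_sq_nrm hs) -[in RHS](fnK p) -(integral_sq_nrm (sqi_fn p)).
rewrite (@ge0_integral_shift h (fun x => (p x ^+ 2)%:E))//.
  by apply/measurable_EFinP; apply: measurable_funX; exact: measurable_fn.
by move=> x; rewrite lee_fin sqr_ge0.
Qed.

Lemma tau_ip h p q : ip (tau h p) (tau h q) = ip p q.
Proof.
have pol (u v : Q) : ip u v = (nrm (u + v) ^+ 2 - nrm u ^+ 2 - nrm v ^+ 2) / 2.
  by rewrite -!ipff ipDl !ipDr (ipC v u); field.
by rewrite pol [RHS]pol -tauD !tau_nrm.
Qed.

Lemma tau_adj h p q : ip (tau h p) q = ip p (tau (- h) q).
Proof. by rewrite -(tau_ip (- h)) -tau_add addNr tau0. Qed.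

Lemma tau_mul h m p : measurable_fun setT m -> dm m p -> dm (fun x => m (x + h)) (tau h p) /\
  tau h (mul m p) = mul (fun x => m (x + h)) (tau h p).
Proof.
move=> mm hm; have h1 := sqi_shift h hm.
have e : (fun x => m (x + h) * p (x + h)) = (fun x => m (x + h) * tau h p x) %[ae mu].
  by apply: filterS (tauE h p) => x /(_ I) -> _.
have hd : dm (fun x => m (x + h)) (tau h p).
  have := h1; apply: ae_sqi => //; apply: measurable_mulfn.
  by apply: measurableT_comp => //; exact: measurable_shift.
split => //; rewrite [mul m p]/mul tau_cl//.
exact: eq_cl.
Qed.

Lemma sqi_indic (A : set R) : measurable A -> (mu A < +oo)%E -> sqi (\1_A : R -> R).
Proof.
move=> mA fA; apply/sqiP; split; first exact: measurable_indic.
rewrite (_ : (\int[mu]_x _)%E = (\int[mu]_x (\1_A x)%:E)%E).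
  by rewrite integral_indic// setIT.
by apply: eq_integral => x _; rewrite indicE; case: (_ \in _); rewrite ?expr1n ?expr0n.
Qed.

Lemma sqi_indic_itv (i : interval R) : (mu [set` i] < +oo)%E -> sqi (\1_[set` i] : R -> R).
Proof. by move=> h; apply: sqi_indic => //; exact: measurable_itv. Qed.

Lemma sqi_test f : test_fun f -> sqi f.
Proof.
move=> tf; have [sf [M hM]] := tf; have [c c0 fc] := test_fun_bounded tf.
have mf : measurable_fun setT f by apply: derivable_measurable => x; exact: smooth_derivable.
have sI : sqi (\1_(`[- `|M|, `|M|]%classic : set R) : R -> R).
  by apply: sqi_indic_itv; rewrite lebesgue_measure_itv/=; case: ifP => _; rewrite ?ltry// -EFinD ltry.
apply: (sqi_bound mf (sqiZ c sI).2).
move=> x; rewrite exprMn indicE; case: (boolP (_ \in _)) => [_|/negP h].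
  by rewrite expr1n mulr1 -real_normK ?num_real// lerXn2r ?nnegrE.
rewrite hM ?expr0n/= ?mulr0// ltNge; apply/negP => xM; apply: h.
by apply: mem_set; rewrite /= in_itv/= -ler_norml (le_trans xM)// ler_norm.
Qed.

Lemma sqi_integrable_on (A : set R) f : measurable A -> (mu A < +oo)%E -> sqi f ->
  mu.-integrable A (EFin \o f).
Proof.
move=> mA fA [mf f2].
have i1 : mu.-integrable A (cst 1%E).
  apply/integrableP; split; first exact: measurable_cst.
  rewrite (_ : (fun x => `|_|%E) = cst 1%E); last by apply/funext => x /=; rewrite normr1.
  by rewrite integral_cst// mul1e.
have := @integrableD _ _ _ mu _ mA _ _ i1 (@integrableS _ _ _ mu _ _ _ measurableT mA (@subsetT _ _) f2).
apply: le_integrable => //; first by apply/measurable_EFinP; exact: measurable_funTS.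
move=> x _ /=; rewrite lee_fin [leRHS]ger0_norm ?addr_ge0 ?sqr_ge0//.
by have := sqr_ge0 (1 - `|f x|); rewrite -[f x ^+ 2]real_normK ?num_real//; have := normr_ge0 (f x); nra.
Qed.

(** By [dense_of_orthogonal] it suffices that a class orthogonal to all test functions vanishes.
    Bumps show that its integral over every bounded interval is zero, and Lebesgue differentiation
    recovers its values. *)
Lemma test_dense p e : 0 < e -> exists2 f, test_fun f & nrm (p - cl f) < e.
Proof.
move: p e; suff h : forall p e, 0 < e -> exists2 q, [set cl f | f in test_fun] q & nrm (p - q) < e.
  by move=> p e /(h p)[_ [f tf <-] ?]; exists f.
apply: dense_of_orthogonal.
- exists (fun=> 0); last by [].
  by split; [exact: smooth_cst|exists 0].
- move=> a _ _ [f tf <-] [g tg <-]; exists (fun x => a * f x + g x).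
    apply: test_funD => //; apply: test_fun_smoothM => //; exact: smooth_cst.
  by rewrite clD; [rewrite clZ//|apply: sqiZ|]; exact: sqi_test.
move=> p orth.
have int0 a b : \int[mu]_(x in `[a, b]) p x = 0.
  have sI : sqi (\1_(`]a, b[%classic) : R -> R).
    by apply: sqi_indic_itv; rewrite lebesgue_measure_itv/=; case: ifP => _; rewrite ?ltry// -EFinD ltry.
  have bb n : bounded_by 1 (bump a b n).
    split; last by move=> x; have /andP[b0 b1] := bump_ge0 a b n x; rewrite ger0_norm.
    by have [sb _] := test_fun_bump a b n; apply: derivable_measurable => x; exact: smooth_derivable.
  (* The bump is viewed as a bounded multiplier applied to the indicator, so that [mul_dct] upgrades
     the pointwise convergence to convergence in L^2. *)
  have bI n : mul (bump a b n) (cl \1_(`]a, b[%classic)) = cl (bump a b n).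
    apply: eq_cl; [exact: (bounded_dm _ (bb n))|exact/sqi_test/test_fun_bump|].
    have := clE sI; apply: filterS => x /(_ I) -> _.
    rewrite indicE; case: (boolP (_ \in _)) => [_|/negP h]; first by rewrite mulr1.
    rewrite mulr0 /bump /flat; case: ifPn => n1; rewrite ?mul0r//; case: ifPn => n2; rewrite ?mulr0//.
    case: h; apply: mem_set; rewrite /= in_itv/=.
    have n0 : (0 : R) < n%:R.
      by rewrite ltr0n lt0n; apply: contraTneq n1 => ->; rewrite mul0r ltxx.
    by move: n1 n2; rewrite !pmulr_rgt0// !subr_gt0 => -> ->.
  have h := mul_dct (cl \1_(`]a, b[%classic)) bb (fun x => @bump_cvg R a b x).
  have II : mul (\1_(`]a, b[%classic)) (cl \1_(`]a, b[%classic)) = cl (\1_(`]a, b[%classic) : R -> R).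
    apply: eq_cl => //; first by apply: (bounded_dm _ (_ : bounded_by 1 _)); split; [exact: measurable_indic|move=> x; rewrite indicE; case: (_ \in _); rewrite ?normr1 ?normr0].
    have := clE sI; apply: filterS => x /(_ I) -> _.
    by rewrite indicE; case: (_ \in _); rewrite ?mulr1 ?mulr0.
  rewrite II in h.
  have : ip (cl (\1_(`]a, b[%classic) : R -> R)) p = 0.
    have c : ip (mul (bump a b n) (cl (\1_(`]a, b[%classic)))) p @[n --> \oo] -->
        ip (cl (\1_(`]a, b[%classic) : R -> R)) p by exact: hcvg_ipr.
    rewrite -(cvg_lim _ c)//; apply/cvg_lim => //.
    rewrite (_ : (fun n => _) = (fun=> 0)); first exact: cvg_cst.
    by apply/funext => n; rewrite bI ipC orth//; exists (bump a b n) => //; exact: test_fun_bump.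
  rewrite ipC ip_clr// /sip => h0.
  have fin : (mu (`[a, b]%classic : set R) < +oo)%E.
    by rewrite lebesgue_measure_itv/=; case: ifP => _; rewrite ?ltry// -EFinD ltry.
  have ip1 := sqi_integrable_on (measurable_itv _) fin (sqi_fn p).
  have ip2 : mu.-integrable `]a, b] (EFin \o p).
    by apply: integrableS ip1 => //; exact: subset_itv_oc_cc.
  have ip3 : mu.-integrable `]a, b[ (EFin \o p).
    by apply: integrableS ip1 => //; exact: subset_itv_oo_cc.
  rewrite -Rintegral_itv_obnd_cbnd// -Rintegral_itv_bndo_bndc// Rintegral_mkcond -[RHS]h0.
  congr fine; apply: eq_integral => x _; congr EFin; rewrite patchE indicE.
  by case: (_ \in _); rewrite ?mulr1 ?mulr0.
apply: ltwo_ext; apply: ae_eq_trans (ae_eq_sym (@fn0 R)).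
have loc : locally_integrable setT p.
  split; [exact: measurable_fn|exact: openT|move=> K _ cK].
  have mK := compact_measurable cK.
  by have /integrableP[] := sqi_integrable_on mK (compact_finite_measure cK) (sqi_fn p).
(* At a Lebesgue point the primitive of [p] has derivative [p x]; the primitive is identically zero
   by [int0]. *)
have := lebesgue_differentiation loc; apply: filterS => x lx _.
have xx : x < x + 1 by rewrite ltrDl.
have fin : (mu [set` `[(x - 1)%R, (x + 1)%R]] < +oo)%E.
  by rewrite lebesgue_measure_itv/=; case: ifP => _; rewrite ?ltry// -EFinD ltry.
have := @FTC1_lebesgue_pt R p (BLeft (x - 1)) x (x + 1) xx
  (sqi_integrable_on (measurable_itv _) fin (sqi_fn p)).
have -> : (fun y => \int[mu]_(t in [set` Interval (BLeft (x - 1)) (BRight y)]) p t) = cst 0.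
  by apply/funext => y; exact: int0.
move=> /= h; have [||_ <-] := h => //; last by rewrite derive1_cst.
by rewrite lte_fin ltrBlDr ltrDl.
Qed.

End Translation.

(** * Strong and weak derivatives *)

Opaque cl ltwo_add ltwo_scale ltwo_ip tau mul.

Section HilbertLimits.
Context {R : realType} {T T' : hilbertType R}.

Lemma hcvg_eq {I : Type} (F : set_system I) (u v : I -> T) l :
  (forall i, u i = v i) -> hcvg F u l -> hcvg F v l.
Proof. by move=> /funext ->. Qed.

Lemma hcvg_lipschitz {I : Type} (F : set_system I) {FF : ProperFilter F} (V : T -> T') c
    (u : I -> T) l : (forall x y, nrm (V x - V y) <= c * nrm (x - y)) ->
  hcvg F u l -> hcvg F (V \o u) (V l).
Proof.
move=> hV ul; apply: (@hcvg_squeeze _ _ _ _ _ _ _ (fun i => c * nrm (u i - l))).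
  by apply: nearW => i; exact: hV.
by rewrite -[X in _ --> X](mulr0 c); apply: cvgM => //; exact: cvg_cst.
Qed.

Lemma hcvg_lin (u : R -> T) l (d C : R) : 0 < d ->
  (forall h, h != 0 -> `|h| < d -> nrm (u h - l) <= C * `|h|) -> hcvg (0 : R)^' u l.
Proof.
move=> d0 hC; apply: (@hcvg_squeeze _ _ _ _ _ _ _ (fun h : R => C * `|h|)).
  near=> h; apply: hC; first by near: h; exact: nbhs_dnbhs_neq.
  near: h; have := @dnbhs_norm_cvg0 R => /cvgrPdist_lt/(_ d d0).
  by apply: filterS => h; rewrite sub0r normrN normr_id.
by rewrite -[X in _ --> X](mulr0 C); apply: cvgM; [exact: cvg_cst|exact: dnbhs_norm_cvg0].
Unshelve. all: by end_near. Qed.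

End HilbertLimits.

Section StrongDerivative.
Context {R : realType}.
Local Notation mu := (@lebesgue_measure R).
Local Notation Q := (ltwo R).
Implicit Types (p q : Q) (f g m : R -> R) (a b c h : R).

Lemma bounded_mulD c m p q : bounded_by c m -> mul m (p + q) = mul m p + mul m q.
Proof. by move=> bm; apply: mulD; [case: bm|exact: bounded_dm bm|exact: bounded_dm bm]. Qed.

Lemma bounded_mulZ c m a p : bounded_by c m -> mul m (a *: p) = a *: mul m p.
Proof. by move=> bm; apply: mulZ; [case: bm|exact: bounded_dm bm]. Qed.

Lemma bounded_mulB c m p q : bounded_by c m -> mul m (p - q) = mul m p - mul m q.
Proof. by move=> bm; apply: mulB; [case: bm|exact: bounded_dm bm|exact: bounded_dm bm]. Qed.

Lemma bounded_mulM c c' m m' p : bounded_by c m -> bounded_by c' m' ->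
  mul m (mul m' p) = mul (fun x => m x * m' x) p.
Proof.
move=> bm bm'; have [mm mc] := bm; have [mm' mc'] := bm'.
apply: (mulM mm (bounded_dm p bm') _).2; apply: (@bounded_dm _ (c * c')); split.
  exact: measurable_funM.
by move=> x; rewrite normrM ler_pM.
Qed.

(** The generator of the translation group. Differentiation is taken in norm, which makes
    closedness, skew symmetry and the Leibniz rule direct; [weak_SD_SD] identifies it with the
    distributional derivative. *)
Definition SD p q := hcvg (0 : R)^' (fun h => h^-1 *: (tau h p - p)) q.

Lemma SD_unique p q q' : SD p q -> SD p q' -> q = q'.
Proof. exact: hcvg_unique. Qed.

Lemma SD_lin a p q p' q' : SD p q -> SD p' q' -> SD (a *: p + p') (a *: q + q').
Proof.
move=> h1 h2; rewrite /SD (_ : (fun h => _) = (fun h => a *: (h^-1 *: (tau h p - p)) +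
    h^-1 *: (tau h p' - p'))); first exact: hcvgD (hcvgZr _ h1) h2.
apply/funext => h; rewrite tauD tauZ [a *: (h^-1 *: _)]scalerA mulrC -scalerA.
by rewrite -scalerDr; congr (_ *: _); rewrite scalerBr opprD addrACA.
Qed.

Lemma SD0 : SD 0 0.
Proof.
rewrite /SD (_ : (fun h => _) = (fun=> 0)); first exact: hcvg_cst.
by apply/funext => h; rewrite -(scale0r 0) tauZ !scale0r subrr scaler0.
Qed.

Lemma SD_Z a p q : SD p q -> SD (a *: p) (a *: q).
Proof. by move=> h; rewrite -[a *: p]addr0 -[a *: q]addr0; apply: SD_lin h SD0. Qed.

Lemma SD_D p q p' q' : SD p q -> SD p' q' -> SD (p + p') (q + q').
Proof. by move=> h1 h2; rewrite -[p]scale1r -[q]scale1r; exact: SD_lin. Qed.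

Lemma SD_B p q p' q' : SD p q -> SD p' q' -> SD (p - p') (q - q').
Proof. by move=> h1 h2; rewrite addrC -scaleN1r [q - _]addrC -(scaleN1r q'); exact: SD_lin. Qed.

Lemma SD_tau h p q : SD p q -> SD (tau h p) (tau h q).
Proof.
move=> hpq; apply: (hcvg_eq _ (hcvg_lipschitz (c := 1) _ hpq)).
  by move=> k; rewrite /comp tauZ tauB -!tau_add (addrC h).
by move=> x y; rewrite -tauB tau_nrm mul1r.
Qed.

Lemma cl_shift_test h f : test_fun f -> tau h (cl f) = cl (fun x => f (x + h)).
Proof. by move=> tf; rewrite tau_cl//; exact: sqi_test. Qed.

Lemma SD_test f : test_fun f -> SD (cl f) (cl (derive1 f)).
Proof.
move=> tf; have [sf [M hM]] := tf.
have tf1 := test_fun_derive tf; have tf2 := test_fun_derive tf1.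
have [C C0 hC] := test_fun_bounded tf2.
(* For increments of size at most 1, both [f x] and [f (x + h)] vanish outside [-N, N], so the
   pointwise error is dominated by a multiple of one fixed indicator. *)
pose N := `|M| + 1; have N0 : 0 <= N by rewrite addr_ge0.
pose I := cl (\1_[set` `[- N, N]%R] : R -> R).
have sI : sqi (\1_[set` `[- N, N]%R] : R -> R).
  by apply: sqi_indic_itv; rewrite lebesgue_measure_itv/=; case: ifP => _; rewrite ?ltry// -EFinD ltry.
apply: (@hcvg_lin _ _ _ _ 1 (C * nrm I)) => // h h0 /ltW h1.
have st h' : sqi (fun x => f (x + h')) by apply/sqi_test/test_fun_shift.
have sd := sqi_test tf1; have s0 := sqi_test tf.
have -> : h^-1 *: (tau h (cl f) - cl f) - cl (derive1 f) =
    cl (fun x => h^-1 * (f (x + h) + (-1) * f x) + (-1) * derive1 f x).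
  rewrite clD; [|by apply/sqiZ/sqiD => //; exact: sqiZ|exact: sqiZ].
  rewrite clZ; last by apply: sqiD => //; exact: sqiZ.
  rewrite (clZ (-1) sd) (clD (st h) (sqiZ (-1) s0)) (clZ (-1) s0).
  by rewrite !scaleN1r cl_shift_test.
rewrite mulrAC; apply: nrm_le_ae; first by rewrite mulr_ge0.
have e1 : cl (fun x => h^-1 * (f (x + h) + (-1) * f x) + (-1) * derive1 f x) =
    (fun x => h^-1 * (f (x + h) + (-1) * f x) + (-1) * derive1 f x) %[ae mu].
  by apply: clE; apply: sqiD; [apply/sqiZ/sqiD => //|]; exact: sqiZ.
have e2 := clE sI.
apply: filterS2 e1 e2 => x /(_ Logic.I) -> /(_ Logic.I) ->.
have d0 y : derivable f y 1 by exact: smooth_derivable.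
have d1 y : derivable (derive1 f) y 1 by apply: smooth_derivable; exact: smooth_derive.
rewrite indicE; case: (boolP (_ \in _)) => [_|/negP xI].
  have [y yx ->] : exists2 y, `|y - x| <= `|h| &
      h^-1 * (f (x + h) + -1 * f x) + -1 * derive1 f x = derive1 f y - derive1 f x.
    have [y yx e] := mean_value x (x + h) d0; exists y.
      by rewrite (le_trans yx)// addrC addKr.
    by rewrite !mulN1r e [x + h - x]addrC addKr mulrC mulfK.
  have := lipschitz_of_derive d1 hC x (y - x); rewrite [x + _]addrC subrK => h2.
  by rewrite (le_trans h2)// normr1 mulr1 ler_wpM2l.
have xN : N < `|x|.
  by rewrite ltNge; apply/negP => xN; apply: xI; apply: mem_set; rewrite /= in_itv/= -ler_norml.
have Mx : M < `|x| by rewrite (le_lt_trans _ xN)// (le_trans (ler_norm M))// lerDl.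
have Mxh : M < `|x + h|.
  rewrite (le_lt_trans (ler_norm M))//; have := ler_normB (x + h) h; rewrite addrK.
  by rewrite /N in xN; lra.
have -> : derive1 f x = 0.
  have [sf1 _] := tf1.
  apply: is_derive1E; apply: (@near_eq_is_derive _ _ _ (cst 0) _ _ _ _ _ (is_derive_cst _ _ _)).
  have e0 : 0 < `|x| - M by rewrite subr_gt0.
  apply: filterS (nbhsx_ballx x _ e0) => y; rewrite /ball/= => yx.
  by rewrite hM//; have := ler_normD y (x - y); rewrite addrC subrK; lra.
by rewrite !hM// !(mulr0, addr0) normr0 !mulr_ge0.
Qed.

Lemma tau_continuous p e : 0 < e -> exists2 d, 0 < d & forall h, `|h| < d -> nrm (tau h p - p) <= e.
Proof.
move=> e0; have e4 : 0 < e / 4 by rewrite divr_gt0.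
have [f tf pf] := test_dense p e4.
have /hcvgP/(_ _ ltr01) := SD_test tf => -[d d0 hd].
have K0 : 0 < 1 + nrm (cl (derive1 f)) by rewrite ltr_wpDr.
(* Within [d] of 0 the difference quotient of [cl f] has norm at most 1 + [nrm (cl (derive1 f))].
   The second bound makes the displacement of [cl f] at most e/2, and replacing [p] by [cl f] costs
   e/4 twice. *)
exists (Num.min d (e / 2 / (1 + nrm (cl (derive1 f))))) => [|h].
  by rewrite lt_min d0/= !divr_gt0.
rewrite lt_min => /andP[hd1]; rewrite ltr_pdivlMr// => hK.
have h2 : nrm (tau h (cl f) - cl f) <= e / 2.
  have [->|h0] := eqVneq h 0; first by rewrite tau0 subrr nrm0 divr_ge0// ltW.
  have {hd}hd : nrm (h^-1 *: (tau h (cl f) - cl f) - cl (derive1 f)) < 1.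
    by apply: hd => //; rewrite /ball/= sub0r normrN.
  have := le_trans (nrmD_le (h^-1 *: (tau h (cl f) - cl f) - cl (derive1 f)) (cl (derive1 f))) (lerD (ltW hd) (lexx _)).
  rewrite subrK nrmZ normfV ler_pdivrMl ?normr_gt0// => /le_trans; apply.
  exact: ltW.
have -> : tau h p - p = tau h (p - cl f) + (tau h (cl f) - cl f) - (p - cl f).
  have z (V : zmodType) (x y u v : V) : x - y = (x - u) + (u - v) - (y - v).
    by rewrite addrA subrK opprB addrA subrK.
  by rewrite tauB; exact: z.
rewrite (le_trans (nrmB_le _ _))// (le_trans (lerD (nrmD_le _ _) (lexx _)))// tau_nrm.
move: pf h2; move: (nrm (p - _)) (nrm (tau h _ - _)) => x y; lra.
Qed.

(** Integration by parts: the adjoint of [tau h] is [tau (- h)], so the difference quotient moved to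
    the other factor has step [- h] and the opposite sign. *)
Lemma SD_skew p p' q q' : SD p p' -> SD q q' -> ip p' q = - ip p q'.
Proof.
move=> hp hq.
have h1 : ip (h^-1 *: (tau h p - p)) q @[h --> (0 : R)^'] --> ip p' q by exact: (hcvg_ipr hp).
have hq2 : hcvg (0 : R)^' (fun h => (- h)^-1 *: (tau (- h) q - q)) q'.
  have hN : (- h) @[h --> (0 : R)^'] --> (0 : R)^'.
    move=> A [e e0 hA]; exists e => // h; rewrite /ball/= sub0r normrN => he h0.
    by apply: hA; rewrite /= ?oppr_eq0// sub0r opprK.
  exact: (cvg_comp _ _ hN hq).
have h2 : ip (h^-1 *: (tau h p - p)) q @[h --> (0 : R)^'] --> - ip p q'.
  rewrite (_ : (fun h => _) = (fun h => - ip p ((- h)^-1 *: (tau (- h) q - q)))).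
    have h3 : ip ((- h)^-1 *: (tau (- h) q - q)) p @[h --> (0 : R)^'] --> ip q' p by exact: (hcvg_ipr hq2).
    by apply: cvgN; rewrite ipC; under eq_fun do rewrite ipC.
  by apply/funext => h; rewrite ipZl ipBl tau_adj -ipBr ipZr invrN mulNr opprK.
exact: (cvg_unique _ h1 h2).
Qed.

Lemma nrm_le_test p b : 0 <= b -> (forall f, test_fun f -> ip p (cl f) <= b * nrm (cl f)) -> nrm p <= b.
Proof.
move=> b0 hb; suff h e : 0 < e -> nrm p ^+ 2 <= b * nrm p + (`|b| + nrm p) * e.
  have h2 : nrm p ^+ 2 <= b * nrm p.
    apply/ler_addgt0Pr => e e0; have K : 0 < 1 + (`|b| + nrm p) by rewrite ltr_wpDr// addr_ge0.
    rewrite (le_trans (h _ (divr_gt0 e0 K)))// lerD2l mulrA ler_pdivrMr// mulrC ler_pM2l//.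
    by rewrite lerDr.
  have [->//|p0] := eqVneq (nrm p) 0.
  by move: h2; rewrite expr2 ler_pM2r// lt_neqAle eq_sym p0/=.
move=> e0; have [f tf pf] := test_dense p e0.
have := hb _ tf; have := ip_le p (p - cl f); rewrite ipBr ipff.
have := nrm_dist p (cl f); have := nrm_ge0 p; have := nrm_ge0 (p - cl f).
move: pf; have := ler_norm b; have := ler_norm (- b); rewrite normrN.
rewrite ler_norml => a1 a2 a3 a4 a5 /andP[a6 a7] a8 a9.
have a10 : nrm p * nrm (p - cl f) <= nrm p * e by rewrite ler_wpM2l// ltW.
have a11 : b * (nrm (cl f) - nrm p) <= `|b| * e.
  rewrite (le_trans (ler_norm _))// normrM ler_wpM2l//.
  by rewrite distrC (le_trans (nrm_dist _ _))// ltW.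
move: a8 a9 a10 a11; move: (nrm (p - _)) (nrm (cl f)) (nrm p) (ip p (cl f)) => *; nra.
Qed.

Definition weak_SD p q :=
  forall f, test_fun f -> ip p (cl (derive1 f)) = - ip q (cl f).

Lemma SD_weak p q : SD p q -> weak_SD p q.
Proof. by move=> pq f /SD_test hf; rewrite (SD_skew pq hf) opprK. Qed.

(* For a test function [f], [h |-> <tau_h p, f>] has derivative [<tau_h q, f>];
   the mean value theorem turns the weak derivative into a strong one. *)
Lemma weak_SD_SD p q : weak_SD p q -> SD p q.
Proof.
move=> w.
have dphi f : test_fun f -> forall h, is_derive h 1 (fun h => ip (tau h p) (cl f)) (ip (tau h q) (cl f)).
  move=> tf h; apply: lim_derive.
  have tf' := test_fun_shift (- h) tf.
  have hd := SD_test tf'.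
  have hN : (- k) @[k --> (0 : R)^'] --> (0 : R)^'.
    move=> A [e e0 hA]; exists e => // k; rewrite /ball/= sub0r normrN => he h0.
    by apply: hA; rewrite /= ?oppr_eq0// sub0r opprK.
  have hq2 := cvg_comp _ _ hN hd.
  have h3 : ip ((- k)^-1 *: (tau (- k) (cl (fun x => f (x - h))) - cl (fun x => f (x - h)))) p
    @[k --> (0 : R)^'] --> ip (cl (derive1 (fun x => f (x - h)))) p by exact: (hcvg_ipr hq2).
  have -> : ip (tau h q) (cl f) = - ip (cl (derive1 (fun x => f (x - h)))) p.
    by rewrite ipC [in RHS]ipC w// opprK ipC tau_adj cl_shift_test.
  rewrite (_ : (fun k => _) = (fun k => - ip ((- k)^-1 *: (tau (- k) (cl (fun x => f (x - h))) - cl (fun x => f (x - h)))) p)).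
    exact: cvgN.
  apply/funext => k; rewrite ipZl ipBl -!cl_shift_test// invrN mulNr opprK mulrC; congr (_ * _).
  by rewrite !(ipC _ p) !tau_adj -tau_add -opprD (addrC k).
apply/hcvgP => e e0; have [d d0 hd] := tau_continuous q (divr_gt0 e0 (ltr0n _ 2)).
exists d => // h; rewrite /ball/= sub0r normrN => hh h0.
suff : nrm (tau h p - p - h *: q) <= `|h| * (e / 2).
  move=> hs.
  have -> : h^-1 *: (tau h p - p) - q = h^-1 *: (tau h p - p - h *: q).
    by rewrite [RHS]scalerBr scalerA mulVf// scale1r.
  rewrite nrmZ normfV ltr_pdivrMl ?normr_gt0// (le_lt_trans hs)// ltr_pM2l ?normr_gt0//.
  by rewrite ltr_pdivrMr// ltr_pMr// ltr1n.
apply: nrm_le_test => [|f tf]; first by rewrite mulr_ge0// divr_ge0// ltW.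
have df k : derivable (fun h => ip (tau h p) (cl f)) k 1 by have [] := dphi f tf k.
have [c ch e1] := mean_value 0 h df.
rewrite (is_derive1E (dphi f tf c)) subr0 tau0 in e1.
rewrite !ipBl ipZl e1 mulrC -mulrBr -ipBl.
rewrite (le_trans (ler_norm _))// normrM -mulrA ler_wpM2l//.
rewrite (le_trans (cauchy_schwarz _ _))// ler_wpM2r//.
by apply: hd; rewrite !subr0 in ch; exact: (le_lt_trans ch).
Qed.

Lemma SD_closed (pn qn : nat -> Q) p q : (forall n, SD (pn n) (qn n)) ->
  hcvg \oo pn p -> hcvg \oo qn q -> SD p q.
Proof.
move=> hs hp hq; apply: weak_SD_SD => f tf.
have h1 : ip (pn n) (cl (derive1 f)) @[n --> \oo] --> ip p (cl (derive1 f)) by exact: (hcvg_ipr hp).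
have h2 : - ip (qn n) (cl f) @[n --> \oo] --> - ip q (cl f) by apply: cvgN; exact: (hcvg_ipr hq).
have e : (fun n => ip (pn n) (cl (derive1 f))) = (fun n => - ip (qn n) (cl f)).
  by apply/funext => n; exact: SD_weak.
by rewrite -e in h2; exact: (cvg_unique _ h1 h2).
Qed.

(** The difference quotient of the product splits into that of [m], applied to [p], and the shifted
    [m] applied to that of [p]. The first is bounded by [c'] for every step, so dominated
    convergence applies to it; the second uses that the shifted [m] stays [c' * |h|] close to
    [m]. *)
Lemma SD_mul m c c' p p' : (forall x, derivable m x 1) -> bounded_by c m ->
  (forall x, `|derive1 m x| <= c') -> SD p p' ->
  SD (mul m p) (mul (derive1 m) p + mul m p').
Proof.
move=> dm_ bm bm' hp; have [mm mc] := bm.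
have c0 : 0 <= c by rewrite (le_trans _ (mc 0)).
have c0' : 0 <= c' by rewrite (le_trans _ (bm' 0)).
have lip := lipschitz_of_derive dm_ bm'.
have bs h : bounded_by c (fun x => m (x + h)).
  by split => //; apply: measurableT_comp => //; exact: measurable_shift.
have bd : bounded_by c' (derive1 m) by split => //; exact: derive1_measurable.
pose r h x := (m (x + h) - m x) / h.
have br h : h != 0 -> bounded_by c' (r h).
  move=> h0; split; last by move=> x; rewrite normrM normfV ler_pdivrMr ?normr_gt0.
  by apply: measurable_funM => //; apply: measurable_funB => //; have [] := bs h.
have dec h : h != 0 -> h^-1 *: (tau h (mul m p) - mul m p) =
    mul (r h) p + mul (fun x => m (x + h)) (h^-1 *: (tau h p - p)).
  move=> h0; have hmp := bounded_dm p bm; have [_ ->] := tau_mul h mm hmp.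
  have ms : measurable_fun (setT : set R) (fun x : R => m (x + h)) by have [] := bs h.
  rewrite (bounded_mulZ _ _ (bs h)) (bounded_mulB _ _ (bs h)).
  have -> : mul (r h) p = h^-1 *: (mul (fun x => m (x + h)) p - mul m p).
    have [h1 h2] := mul_scalem (-1) hmp.
    have [h3 h4] := mul_addm (bounded_dm p (bs h)) h1.
    have [_ h6] := mul_scalem h^-1 h3.
    rewrite -scaleN1r -h2 -h4 -h6; apply: eq_mul => x.
    by rewrite mulN1r mulrC.
  have z (V : zmodType) (x y u v : V) : x - y = (u - y) + (x - u).
    by rewrite [RHS]addrC addrA subrK.
  by rewrite -scalerDr -z.
have : hcvg (0 : R)^' (fun h => mul (r h) p + mul (fun x => m (x + h)) (h^-1 *: (tau h p - p)))
    (mul (derive1 m) p + mul m p').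
  apply: hcvgD.
    (* The limit is taken along arbitrary sequences of nonzero increments, because dominated
       convergence is stated for sequences. *)
    apply/cvgr_dnbhsP => u [u0 uc]; apply: (@mul_dct R _ _ _ c') => [n|x]; first exact: br.
    by have /cvgr_dnbhsP := derive_lim (dm_ x); apply.
  apply: (@hcvg_squeeze _ _ _ _ _ _ _ (fun h => c * nrm (h^-1 *: (tau h p - p) - p') + c' * `|h| * nrm p')).
    near=> h; have h0 : h != 0 by near: h; exact: nbhs_dnbhs_neq.
    have ms : measurable_fun (setT : set R) (fun x : R => m (x + h)) by have [] := bs h.
    have hb q : dm (fun x => m (x + h)) q by exact: (bounded_dm _ (bs h)).
    have hmp := bounded_dm p' bm.
    have [h1 h2] := mul_scalem (-1) hmp.
    have [h3 h4] := mul_addm (hb p') h1.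
    rewrite (_ : _ - _ = mul (fun x => m (x + h)) (h^-1 *: (tau h p - p) - p') +
       mul (fun x => m (x + h) + -1 * m x) p').
      rewrite (le_trans (nrmD_le _ _))// lerD//; first exact: bounded_mul_nrm.
      apply: bounded_mul_nrm; split; first by apply: measurable_funD => //; exact: measurable_funM.
      by move=> x; rewrite mulN1r.
    by rewrite (bounded_mulB _ _ (bs h)) h4 h2 scaleN1r addrA subrK.
  rewrite [X in _ --> X](_ : _ = c * 0 + c' * 0 * nrm p'); last by rewrite !mulr0 mul0r addr0.
  apply: cvgD; first by apply: cvgM => //; exact: cvg_cst.
  by apply: cvgM; [apply: cvgM|]; [exact: cvg_cst|exact: dnbhs_norm_cvg0|exact: cvg_cst].
apply: cvg_trans; apply: near_eq_cvg; near=> h; rewrite dec//.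
by near: h; exact: nbhs_dnbhs_neq.
Unshelve. all: by end_near. Qed.

End StrongDerivative.

(** * Mollification and density *)

Opaque cl ltwo_add ltwo_scale ltwo_ip tau mul nrm.

Section SobolevBounds.
Context {R : realType} {T : hilbertType R}.
Variable D : T -> T -> Prop.
Implicit Types (x y : T) (K L a : R).

(* [Hb k x K]: [x] has derivatives up to order [k], all of norm at most [K]. *)
Fixpoint Hb k x K : Prop :=
  nrm x <= K /\ if k is k'.+1 then exists2 x', D x x' & Hb k' x' K else True.

Lemma Hb_nrm k x K : Hb k x K -> nrm x <= K.
Proof. by case: k => [|k] []. Qed.

Lemma Hb_ge0 k x K : Hb k x K -> 0 <= K.
Proof. by move=> /Hb_nrm; apply: le_trans. Qed.

Lemma HbW k x K L : K <= L -> Hb k x K -> Hb k x L.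
Proof.
move=> KL; elim: k x => [|k IH] x [h1 h2]; split; rewrite ?(le_trans h1)//.
by have [x' xx' h] := h2; exists x' => //; exact: IH.
Qed.

Lemma HbS k x K : Hb k.+1 x K -> Hb k x K.
Proof.
elim: k x => [|k IH] x [h1 [x' xx' h2]]; first by split.
by split => //; exists x' => //; exact: IH.
Qed.

Lemma Hb_le j k x K : (j <= k)%N -> Hb k x K -> Hb j x K.
Proof.
move=> /subnK <-; elim: (k - j)%N => // n IH; rewrite addSn => /HbS; exact: IH.
Qed.

Lemma HbI k x x' K : nrm x <= K -> D x x' -> Hb k x' K -> Hb k.+1 x K.
Proof. by move=> h xx' h'; split => //; exists x'. Qed.

Lemma Hb_map (P : T -> T) c k x K : 0 <= c -> (forall x x', D x x' -> D (P x) (P x')) ->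
  (forall x, nrm (P x) <= c * nrm x) -> Hb k x K -> Hb k (P x) (c * K).
Proof.
move=> c0 hD hn; elim: k x => [|k IH] x [h1 h2]; split => //;
  try by rewrite (le_trans (hn x))// ler_wpM2l.
by have [x' xx' h] := h2; exists (P x'); [exact: hD|exact: IH].
Qed.

Hypothesis Dlin : forall a x x' y y', D x x' -> D y y' -> D (a *: x + y) (a *: x' + y').
Hypothesis D0 : D 0 0.

Lemma Hb_lin k a x y K L : Hb k x K -> Hb k y L -> Hb k (a *: x + y) (`|a| * K + L).
Proof.
elim: k x y => [|k IH] x y [h1 h2] [h3 h4]; split => //;
  try by rewrite (le_trans (nrmD_le _ _))// lerD// nrmZ ler_wpM2l.
have [x' xx' h] := h2; have [y' yy' h'] := h4.
by exists (a *: x' + y'); [exact: Dlin|exact: IH].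
Qed.

Lemma Hb0 k : Hb k 0 0.
Proof. by elim: k => [|k IH]; split; rewrite ?nrm0//; exists 0. Qed.

Lemma HbZ k a x K : Hb k x K -> Hb k (a *: x) (`|a| * K).
Proof. by move=> h; have := Hb_lin a h (Hb0 k); rewrite !addr0. Qed.

Lemma HbD k x y K L : Hb k x K -> Hb k y L -> Hb k (x + y) (K + L).
Proof. by move=> hx hy; have := Hb_lin 1 hx hy; rewrite scale1r normr1 mul1r. Qed.

Lemma HbB k x y K L : Hb k x K -> Hb k y L -> Hb k (x - y) (K + L).
Proof.
move=> hx hy; have := Hb_lin (-1) hy hx.
by rewrite scaleN1r normrN1 mul1r addrC [L + K]addrC.
Qed.

End SobolevBounds.

(** * Mollification by averaging translates *)

Section Mollifier.
Context {R : realType}.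
Local Notation Q := (ltwo R).
Implicit Types (p q : Q) (d h e : R).

(** The mean of the 2^n translates of [p] by multiples k d / 2^n with k < 2^n, that is, a Riemann
    sum for the average of [tau h p] over 0 <= h <= d. Doubling the grid needs a single
    translation. *)
Fixpoint dyadic_mean d n p : Q :=
  if n is m.+1 then 2^-1 *: (dyadic_mean d m p + tau (d / 2 ^+ m.+1) (dyadic_mean d m p)) else p.

Lemma dyadic_meanB d n p q :
  dyadic_mean d n (p - q) = dyadic_mean d n p - dyadic_mean d n q.
Proof.
elim: n => //= n ->; rewrite tauB -scalerBr; congr (_ *: _).
by rewrite opprD addrACA.
Qed.

Lemma dyadic_mean_tau d n h p : dyadic_mean d n (tau h p) = tau h (dyadic_mean d n p).
Proof.
by elim: n => //= n ->; rewrite tauZ tauD -!tau_add (addrC h).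
Qed.

Lemma dyadic_mean_nrm d n p : nrm (dyadic_mean d n p) <= nrm p.
Proof.
elim: n => //= n IH; rewrite nrmZ ger0_norm ?invr_ge0// ler_pdivrMl//.
by rewrite (le_trans (nrmD_le _ _))// tau_nrm mulr_natl mulr2n lerD.
Qed.

(** Shifting by one grid step exchanges only the two end points of the grid. This is the discrete
    form of the fact that the averaged class has derivative (tau d p - p) / d. *)
Lemma dyadic_mean_telescope d n p :
  tau (d / 2 ^+ n) (dyadic_mean d n p) - dyadic_mean d n p = 2^-1 ^+ n *: (tau d p - p).
Proof.
elim: n => [|n IH]; first by rewrite !expr0 divr1 scale1r.
rewrite /= tauZ tauD -tau_add.
have -> : d / 2 ^+ n.+1 + d / 2 ^+ n.+1 = d / 2 ^+ n by rewrite exprS; field.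
rewrite -scalerBr [2^-1 ^+ n.+1]exprS -scalerA -IH; congr (_ *: _).
have z (V : zmodType) (x y u : V) : (x + y) - (u + x) = y - u.
  by rewrite (addrC x) opprD addrACA subrr addr0.
exact: z.
Qed.

Lemma dyadic_mean_convex d n p (P : Q -> Prop) : 0 <= d ->
  (forall q q', P q -> P q' -> P (2^-1 *: (q + q'))) ->
  (forall h, 0 <= h -> h <= d -> P (tau h p)) -> P (dyadic_mean d n p).
Proof.
move=> d0 Pc Ph; suff h n' a : 0 <= a -> a <= d / 2 ^+ n' -> P (tau a (dyadic_mean d n' p)).
  (* The induction allows an extra shift [a] of at most one grid step: the largest translate in the
     mean is d - d / 2^n, so all shifts remain in [0, d]. *)
  by rewrite -[dyadic_mean _ _ _]tau0; apply: h => //; rewrite divr_ge0// exprn_ge0.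
elim: n' a => [|n' IH] a a0; first by rewrite expr0 divr1; exact: Ph.
move=> ad; rewrite /= tauZ tauD -tau_add.
have dn0 : 0 <= d / 2 ^+ n'.+1 by rewrite divr_ge0// exprn_ge0.
have e1 : d / 2 ^+ n' = d / 2 ^+ n'.+1 + d / 2 ^+ n'.+1 by rewrite exprS; field.
by apply: Pc; apply: IH; rewrite ?addr_ge0// e1; lra.
Qed.

Lemma SD_lipschitz p p' h : SD p p' -> nrm (tau h p - p) <= `|h| * nrm p'.
Proof.
move=> hp; apply: nrm_le_test => [|f tf]; first by rewrite mulr_ge0.
pose phi h := ip (tau h p) (cl f).
have dphi (k : R) : is_derive k 1 phi (ip (tau k p') (cl f)).
  apply: lim_derive; have hk := SD_tau k hp.
  have h3 : ip (h^-1 *: (tau h (tau k p) - tau k p)) (cl f) @[h --> (0 : R)^'] --> ip (tau k p') (cl f).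
    exact: (hcvg_ipr hk).
  rewrite (_ : (fun h => _) = (fun h => ip (h^-1 *: (tau h (tau k p) - tau k p)) (cl f)))//.
  by apply/funext => j; rewrite /phi ipZl ipBl -tau_add (addrC j) mulrC.
have dd (k : R) : derivable phi k 1 by have [] := dphi k.
have [c ch e1] := mean_value 0 h dd.
rewrite (is_derive1E (dphi c)) subr0 /phi tau0 in e1.
rewrite ipBl e1 (le_trans (ler_norm _))// normrM mulrC -mulrA ler_wpM2l//.
by rewrite (le_trans (cauchy_schwarz _ _))// tau_nrm.
Qed.

(** For a test function, halving the grid changes the mean by at most C / 2^(n+1) because
    translation is Lipschitz on it; density and the contraction property of the means give the
    Cauchy criterion for every class. *)
Lemma dyadic_mean_cvg d p : exists q, hcvg \oo (fun n => dyadic_mean d n p) q.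
Proof.
apply: hcomplete => e e0; have e4 : 0 < e / 4 by rewrite divr_gt0.
have [f tf pf] := test_dense p e4.
pose C := `|d| * nrm (cl (derive1 f)).
have step n : nrm (dyadic_mean d n.+1 (cl f) - dyadic_mean d n (cl f)) <= C / 2 ^+ n.+1.
  rewrite /=; set u := dyadic_mean d n (cl f); set t := tau _ _.
  have -> : 2^-1 *: (u + t) - u = 2^-1 *: (t - u).
    have z (V : lmodType R) (x y : V) : 2^-1 *: (x + y) - x = 2^-1 *: (y - x).
      rewrite scalerDr scalerBr addrAC -[X in _ - X + _]scale1r -scalerBl addrC -scaleNr.
      by congr (_ + _ *: _); field.
    exact: z.
  rewrite /t /u -dyadic_mean_tau -dyadic_meanB nrmZ ger0_norm ?invr_ge0//.
  rewrite (le_trans (ler_wpM2l _ (dyadic_mean_nrm _ _ _)))//.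
  rewrite (le_trans (ler_wpM2l _ (SD_lipschitz _ (SD_test tf))))//.
  rewrite normrM normfV (ger0_norm (exprn_ge0 _ _))// /C.
  rewrite [leRHS]mulrAC ler_piMl ?mulr_ge0 ?invr_ge0 ?exprn_ge0//.
  by rewrite invf_le1// ler1n.
have C0 : 0 <= C by rewrite mulr_ge0.
have far n k : nrm (dyadic_mean d (n + k) (cl f) - dyadic_mean d n (cl f)) <= C / 2 ^+ n - C / 2 ^+ (n + k).
  elim: k => [|k IH]; first by rewrite addn0 !subrr nrm0.
  rewrite addnS (le_trans (nrm_triangle (dyadic_mean d (n + k) (cl f)) _ _))//.
  have e1 : C / 2 ^+ (n + k) = C / 2 ^+ (n + k).+1 + C / 2 ^+ (n + k).+1.
    by rewrite [in RHS]exprS; field.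
  have := step (n + k)%N; rewrite e1 in IH.
  move: IH; move: (nrm _) (nrm _) (C / 2 ^+ _) (C / _) => a b c' c''; lra.
have [N hN] : exists N, C / 2 ^+ N <= e / 4.
  exists (Num.truncn (C / (e / 4))); rewrite ler_pdivrMr ?exprn_gt0//.
  rewrite mulrC -ler_pdivrMr// (le_trans (ltW (truncnS_gt _)))//.
  by rewrite -natrX ler_nat ltn_expl.
exists N => m n Nm Nn.
have hf k : (N <= k)%N -> nrm (dyadic_mean d k (cl f) - dyadic_mean d N (cl f)) <= e / 4.
  move=> /subnKC <-; rewrite (le_trans (far _ _))// (le_trans _ hN)// lerBlDr lerDl.
  by rewrite divr_ge0// exprn_ge0.
have hp k : nrm (dyadic_mean d k p - dyadic_mean d k (cl f)) <= e / 4.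
  by rewrite -dyadic_meanB (le_trans (dyadic_mean_nrm _ _ _))// ltW.
have := hf _ Nm; have := hf _ Nn; have := hp m; have := hp n.
have := nrm_triangle (dyadic_mean d N (cl f)) (dyadic_mean d m (cl f)) (dyadic_mean d n (cl f)).
have := nrm_triangle (dyadic_mean d m (cl f)) (dyadic_mean d m p) (dyadic_mean d n p).
have := nrm_triangle (dyadic_mean d n (cl f)) (dyadic_mean d m (cl f)) (dyadic_mean d n p).
rewrite [nrm (dyadic_mean d N _ - dyadic_mean d n _)]nrmBC.
rewrite [nrm (dyadic_mean d n (cl f) - dyadic_mean d n p)]nrmBC.
move: (nrm (_ - _)) (nrm (_ - _)) (nrm (_ - _)) (nrm (_ - _)) (nrm (_ - _)) (nrm (_ - _)) (nrm (_ - _)) => *.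
lra.
Qed.

Definition mollify d p : Q := projT1 (cid (dyadic_mean_cvg d p)).

Lemma mollify_cvg d p : hcvg \oo (fun n => dyadic_mean d n p) (mollify d p).
Proof. exact: projT2 (cid (dyadic_mean_cvg d p)). Qed.

Lemma mollify_nrm d p : nrm (mollify d p) <= nrm p.
Proof.
by apply: (hcvg_nrm_le _ (mollify_cvg d p)); apply: nearW => n; exact: dyadic_mean_nrm.
Qed.

Lemma SD_mollify d p p' : SD p p' -> SD (mollify d p) (mollify d p').
Proof.
move=> hp; apply: (SD_closed _ (mollify_cvg d p) (mollify_cvg d p')).
elim=> [|n IH]; first exact: hp.
exact: (SD_Z _ (SD_D IH (SD_tau _ IH))).
Qed.

(** Tested against the difference quotient of a test function with step -d / 2^n, the n-th mean
    telescopes to a value independent of [n]; letting n grow gives the weak derivative. *)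
Lemma mollify_SD d p : 0 < d -> SD (mollify d p) (d^-1 *: (tau d p - p)).
Proof.
move=> d0; have dn0 : d != 0 by rewrite gt_eqF.
apply: weak_SD_SD => f tf.
pose eta n := - (d / 2 ^+ n).
have eta0 n : eta n != 0 by rewrite oppr_eq0 mulf_neq0 ?gt_eqF// invr_gt0 exprn_gt0.
have etac : eta n @[n --> \oo] --> (0 : R).
  rewrite -oppr0; apply: cvgN; rewrite -(mulr0 d); apply: cvgM; first exact: cvg_cst.
  rewrite (_ : (fun n => _) = (fun n => 2^-1 ^+ n)); last by apply/funext => n; rewrite exprVn.
  by apply: cvg_expr; rewrite ger0_norm ?invf_lt1 ?ltr1n// invr_ge0.
have hf : hcvg \oo (fun n => (eta n)^-1 *: (tau (eta n) (cl f) - cl f)) (cl (derive1 f)).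
  by have /cvgr_dnbhsP := SD_test tf; apply.
have h1 := hcvg_ip (mollify_cvg d p) hf.
have e1 : (fun n => ip (dyadic_mean d n p) ((eta n)^-1 *: (tau (eta n) (cl f) - cl f))) =
   (fun=> - ip (d^-1 *: (tau d p - p)) (cl f)).
  apply/funext => n; rewrite ipZr ipBr /eta -tau_adj -ipBl dyadic_mean_telescope !ipZl.
  move: (ip _ _) => X; rewrite exprVn.
  have : (2 : R) ^+ n != 0 by rewrite gt_eqF// exprn_gt0.
  by move: (2 ^+ n) => t t0; field; rewrite t0 dn0.
by rewrite e1 in h1; exact: (cvg_unique _ (h1 _) (cvg_cst _)).
Qed.

(** A property that is stable under midpoints and limits passes from the translates to their
    average. It is applied to the support and to the distance from [p]. *)
Lemma mollify_closed d p (P : Q -> Prop) : 0 <= d ->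
  (forall q q', P q -> P q' -> P (2^-1 *: (q + q'))) ->
  (forall (u : nat -> Q) l, (forall n, P (u n)) -> hcvg \oo u l -> P l) ->
  (forall h, 0 <= h -> h <= d -> P (tau h p)) -> P (mollify d p).
Proof.
move=> d0 Pc Pl Ph; apply: (Pl _ _ _ (mollify_cvg d p)) => n.
exact: dyadic_mean_convex.
Qed.

Lemma mollify_dist d e p : 0 <= d -> (forall h, 0 <= h -> h <= d -> nrm (tau h p - p) <= e) ->
  nrm (mollify d p - p) <= e.
Proof.
move=> d0 he.
have z (V : lmodType R) (q q' r : V) : 2^-1 *: (q + q') - r = 2^-1 *: ((q - r) + (q' - r)).
  rewrite addrACA -opprD scalerBr; congr (_ - _); rewrite -[r]scale1r -scalerDl scalerA.
  by congr (_ *: _); field.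
have c1 (q q' : Q) : nrm (q - p) <= e -> nrm (q' - p) <= e -> nrm (2^-1 *: (q + q') - p) <= e.
  move=> hq hq'; rewrite z nrmZ ger0_norm ?invr_ge0// ler_pdivrMl//.
  by rewrite (le_trans (nrmD_le _ _))// mulr_natl mulr2n lerD.
have c2 (u : nat -> Q) l : (forall n, nrm (u n - p) <= e) -> hcvg \oo u l -> nrm (l - p) <= e.
  move=> hu ul; apply: (@hcvg_nrm_le _ _ _ \oo _ (fun n => u n - p)); first exact: nearW hu.
  exact: (hcvgB ul (hcvg_cst _)).
exact: (@mollify_closed d p (fun q => nrm (q - p) <= e) d0 c1 c2 he).
Qed.

End Mollifier.

Opaque mollify SD.
Section Density.
Context {R : realType}.
Local Notation mu := (@lebesgue_measure R).
Local Notation Q := (ltwo R).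
Implicit Types (p q : Q) (d h e K L B : R) (f m : R -> R).

Lemma Hb_mollify d k p K : Hb SD k p K -> Hb SD k (mollify d p) K.
Proof.
move=> h; rewrite -[K]mul1r; apply: (@Hb_map _ _ _ (mollify d) 1 _ _ _ ler01 _ _ h).
  by move=> x x'; exact: SD_mollify.
by move=> x; rewrite mul1r; exact: mollify_nrm.
Qed.

Lemma Hb_tau h k p K : Hb SD k p K -> Hb SD k (tau h p) K.
Proof.
move=> hp; rewrite -[K]mul1r; apply: (@Hb_map _ _ _ (tau h) 1 _ _ _ ler01 _ _ hp).
  by move=> x x'; exact: SD_tau.
by move=> x; rewrite mul1r tau_nrm.
Qed.

Lemma Hb_mollifyS d k p K : 0 < d -> Hb SD k p K ->
  Hb SD k.+1 (mollify d p) (K + `|d^-1| * (K + K)).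
Proof.
move=> d0 h; have K0 := Hb_ge0 h; have hh : K <= K + `|d^-1| * (K + K).
  by rewrite lerDl mulr_ge0// addr_ge0.
apply: (HbI _ (mollify_SD p d0)); first exact: le_trans (Hb_nrm (Hb_mollify d h)) hh.
have h2 := HbZ (@SD_lin R) (@SD0 R) d^-1 (HbB (@SD_lin R) (Hb_tau d h) h).
by apply: (HbW _ h2); rewrite lerDr.
Qed.

Lemma Hb_mollify_dist e k p K : 0 < e -> Hb SD k p K ->
  exists2 d0, 0 < d0 & forall d, 0 < d -> d <= d0 -> Hb SD k (mollify d p - p) e.
Proof.
move=> e0; elim: k p => [|k IH] p [h1 h2].
  have [d0 d00 hd] := tau_continuous p e0; exists (d0 / 2) => [|d d1 d2]; first by rewrite divr_gt0.
  split; last by [].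
  apply: mollify_dist (ltW d1) _ => h h0 hd2; apply: hd.
  rewrite ger0_norm// (le_lt_trans hd2)// (le_lt_trans d2)// ltr_pdivrMr//.
  by rewrite ltr_pMr// ltr1n.
have [p' pp' h] := h2; have [d1 d10 hd1] := IH _ h.
have [d0 d00 hd] := tau_continuous p e0.
exists (Num.min d1 (d0 / 2)) => [|d d3]; first by rewrite lt_min d10 divr_gt0.
rewrite le_min => /andP[d4 d5]; split.
  apply: mollify_dist (ltW d3) _ => j j0 hd2; apply: hd.
  rewrite ger0_norm// (le_lt_trans hd2)// (le_lt_trans d5)// ltr_pdivrMr//.
  by rewrite ltr_pMr// ltr1n.
by exists (mollify d p' - p'); [exact: (SD_B (SD_mollify _ pp') pp')|exact: hd1].
Qed.

Definition window B (x : R) : R := (`|x| <= B)%R%:R.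

(** Support as a fixed-point equation for a contraction: the condition makes sense on classes and is
    visibly linear and closed under limits. *)
Definition supported B p := mul (window B) p = p.

Lemma bounded_window B : bounded_by 1 (window B).
Proof.
split; last by move=> x; rewrite /window normr_nat lern1; case: (_ <= _).
rewrite (_ : window B = \1_(`[(- B), B]%classic)); first exact: measurable_indic.
by apply/funext => x; rewrite indicE /window mem_setE in_itv/= ler_norml.
Qed.

Lemma supported_weight B n p : 0 <= B -> supported B p ->
  dm (fun x => x ^+ n) p /\ nrm (mul (fun x => x ^+ n) p) <= B ^+ n * nrm p.
Proof.
move=> B0 sp; have mX : measurable_fun (setT : set R) (fun x : R => x ^+ n) by exact: measurable_funX.
have bb : bounded_by (B ^+ n) (fun x => x ^+ n * window B x).
  split; first by apply: measurable_funM => //; case: (bounded_window B).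
  move=> x; rewrite /window; case: (lerP `|x| B) => xB.
    by rewrite mulr1 normrX lerXn2r// nnegrE.
  by rewrite mulr0 normr0 exprn_ge0.
have [h1 h2] := mulM mX (bounded_dm p (bounded_window B)) (bounded_dm p bb).
by rewrite sp in h1 h2; split=> //; rewrite h2; exact: bounded_mul_nrm.
Qed.

Lemma supportedW B B' p : B <= B' -> supported B p -> supported B' p.
Proof.
move=> BB' sp; rewrite /supported -sp (bounded_mulM p (bounded_window _) (bounded_window _)).
apply: eq_mul => x; rewrite /window; case: (lerP `|x| B) => xB; last by rewrite mulr0.
by rewrite (le_trans xB BB') mulr1.
Qed.

Lemma supported_tau B h p : `|h| <= 1 -> supported B p -> supported (B + 1) (tau h p).
Proof.
move=> h1 sp.
have bs : bounded_by 1 (fun x => window B (x + h)).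
  have [h2 h3] := bounded_window B; split => //.
  by apply: measurableT_comp => //; exact: measurable_shift.
have [mw _] := bounded_window B.
have [_ e] := tau_mul h mw (bounded_dm p (bounded_window B)).
rewrite /supported -{1}sp e (bounded_mulM _ (bounded_window _) bs) -{2}sp e.
apply: eq_mul => x; rewrite /window; case: (lerP `|x + h| B) => xB; last by rewrite mulr0.
rewrite (_ : _ <= _ = true) ?mulr1//.
have -> : x = (x + h) - h by rewrite addrK.
by rewrite (le_trans (ler_normB _ _))// lerD.
Qed.

Lemma supportedD B a p q : supported B p -> supported B q -> supported B (a *: (p + q)).
Proof.
move=> sp sq; rewrite /supported (bounded_mulZ _ _ (bounded_window B)).
by rewrite (bounded_mulD _ _ (bounded_window B)) sp sq.
Qed.

Lemma supported_closed B (u : nat -> Q) l : (forall n, supported B (u n)) -> hcvg \oo u l ->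
  supported B l.
Proof.
move=> su ul; apply: (@hcvg_unique _ _ _ \oo _ u _ _ _ ul).
apply: (@hcvg_eq _ _ _ \oo (mul (window B) \o u)) => [n|]; first exact: su.
apply: (@hcvg_lipschitz _ _ _ _ _ _ _ 1) ul => x y.
rewrite -(bounded_mulB _ _ (bounded_window B)).
exact: bounded_mul_nrm (bounded_window B).
Qed.

Lemma supported_mollify B d p : 0 <= d -> d <= 1 -> supported B p ->
  supported (B + 1) (mollify d p).
Proof.
move=> d0 d1 sp; apply: (@mollify_closed _ d p (supported (B + 1)) d0).
- by move=> q q'; exact: supportedD.
- exact: supported_closed.
- by move=> h h0 hd; apply: supported_tau => //; rewrite ger0_norm// (le_trans hd).
Qed.

(** Each of the [j] mollifications gains one derivative and enlarges the support by at most 1. The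
    bound [L] on the gained derivatives is only qualitative, whereas the error in the original order
    stays below [e]. *)
Lemma smoothing e k j B p K : 0 < e -> supported B p -> Hb SD k p K ->
  exists q, [/\ supported (B + j%:R) q, (exists L, Hb SD (k + j) q L) & Hb SD k (p - q) e].
Proof.
elim: j e => [|j IH] e e0 sp hp.
  exists p; rewrite addr0 addn0; split => //; first by exists K.
  by rewrite subrr; apply: (HbW (ltW e0)); exact: (Hb0 (@SD0 R)).
have e2 : 0 < e / 2 by rewrite divr_gt0.
have [q [sq [L hq] pq]] := IH _ e2 sp hp.
have [d0 d00 hd] := Hb_mollify_dist e2 hq.
(* The bound 1 on the averaging length limits the growth of the support, and [d0] controls the
   error. *)
have d10 : 0 < Num.min 1 d0 by rewrite lt_min ltr01.
have d1 : Num.min 1 d0 <= 1 by rewrite ge_min lexx.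
have dd : Num.min 1 d0 <= d0 by rewrite ge_min lexx orbT.
exists (mollify (Num.min 1 d0) q); split.
- by rewrite -natr1 addrA; exact: supported_mollify (ltW d10) d1 sq.
- by rewrite addnS; eexists; exact: Hb_mollifyS d10 hq.
- have h := Hb_le (leq_addr j k) (hd _ d10 dd).
  have := HbB (@SD_lin R) pq h; rewrite -splitr.
  have z (V : zmodType) (x y u : V) : (x - y) - (u - y) = x - u by rewrite opprB addrA subrK.
  by rewrite z.
Qed.

Definition dil f (n : nat) : R -> R := fun x => f (x / n.+1%:R).

Lemma dil_is_derive f n (x : R) : test_fun f ->
  is_derive x 1 (dil f n) (n.+1%:R^-1 * dil (derive1 f) n x).
Proof.
move=> [sf _]; have -> : dil f n = (fun x => f (n.+1%:R^-1 * x + 0)).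
  by apply/funext => y; rewrite /dil addr0 mulrC.
apply: (is_derive_conv (is_derive_affine (sf 0 (n.+1%:R^-1 * x + 0)))) => //.
by rewrite /dil addr0 (mulrC x).
Qed.

Lemma test_fun_bounded_dil f : test_fun f -> exists2 c, 0 <= c & forall n, bounded_by c (dil f n).
Proof.
move=> tf; have [c c0 hc] := test_fun_bounded tf; exists c => //.
move=> n; split; last by move=> x; exact: hc.
by apply: derivable_measurable => x; have [] := dil_is_derive n x tf.
Qed.

Lemma SD_dil f n p p' : test_fun f -> SD p p' ->
  SD (mul (dil f n) p) (n.+1%:R^-1 *: mul (dil (derive1 f) n) p + mul (dil f n) p').
Proof.
move=> tf hp; have [c c0 bc] := test_fun_bounded_dil tf.
have [c' c0' bc'] := test_fun_bounded_dil (test_fun_derive tf).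
have dd x : derivable (dil f n) x 1 by have [] := dil_is_derive n x tf.
have e x : derive1 (dil f n) x = n.+1%:R^-1 * dil (derive1 f) n x.
  by rewrite (is_derive1E (dil_is_derive n x tf)).
have bd x : `|derive1 (dil f n) x| <= c'.
  rewrite e normrM (le_trans _ ((bc' n).2 x))// ler_piMl// ger0_norm ?invr_ge0//.
  by rewrite invf_le1// ler1n.
have := SD_mul dd (bc n) bd hp; rewrite (eq_mul _ e).
by have [_ ->] := mul_scalem n.+1%:R^-1 (bounded_dm p (bc' n)).
Qed.

Lemma Hb_dil f k p K : test_fun f -> Hb SD k p K -> exists C, forall n, Hb SD k (mul (dil f n) p) C.
Proof.
elim: k f p => [|k IH] f p tf [h1 h2]; have [c c0 bc] := test_fun_bounded_dil tf.
  exists (c * K) => n; split => //.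
  by rewrite (le_trans (bounded_mul_nrm _ (bc n)))// ler_wpM2l.
have [p' pp' h] := h2; have hp : Hb SD k p K by apply: HbS; split.
have [C1 hC1] := IH _ _ (test_fun_derive tf) hp.
have [C2 hC2] := IH _ _ tf h.
have C10 := Hb_ge0 (hC1 0); have C20 := Hb_ge0 (hC2 0).
have cK : 0 <= c * K by rewrite mulr_ge0// (Hb_ge0 hp).
exists (c * K + (C1 + C2)) => n; split.
  by rewrite (le_trans (bounded_mul_nrm _ (bc n)))// ler_wpDr ?addr_ge0// ler_wpM2l.
exists (n.+1%:R^-1 *: mul (dil (derive1 f) n) p + mul (dil f n) p'); first exact: SD_dil.
have /HbW := Hb_lin (@SD_lin R) n.+1%:R^-1 (hC1 n) (hC2 n); apply.
rewrite ler_wpDl// lerD2r ler_piMl// ger0_norm ?invr_ge0//.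
by rewrite invf_le1// ler1n.
Qed.

Lemma Hb_dil_cvg f k p K e : 0 < e -> test_fun f -> Hb SD k p K ->
  \forall n \near \oo, Hb SD k (mul (dil f n) p - f 0 *: p) e.
Proof.
move=> e0 tf; have [c c0 bc] := test_fun_bounded_dil tf; move: e0.
have sz q a : 0 < a -> \forall n \near \oo, nrm (mul (dil f n) q - f 0 *: q) <= a.
  move=> a0; have h : hcvg \oo (fun n => mul (dil f n) q) (mul (fun=> f 0) q).
    apply: (@mul_dct R _ _ _ c) => // x.
    apply: continuous_cvg.
      by apply: derivable_continuous; case: tf => sf _; exact: (sf 0).
    by rewrite -(mulr0 x); apply: cvgM; [exact: cvg_cst|exact: cvg_harmonic].
  have e1 : mul (fun=> f 0) q = f 0 *: q.
    have [_ h1] := mul_scalem (f 0) (dm1 q); rewrite mul1 in h1; rewrite -h1.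
    by apply: eq_mul => x; rewrite mulr1.
  by rewrite e1 in h; have /hcvgP/(_ a a0) := h; apply: filterS => n /ltW.
elim: k p e => [|k IH] p e e0 [h1 h2]; first by near=> n; split => //; near: n; exact: sz.
have [p' pp' h] := h2; have hp : Hb SD k p K by apply: HbS; split.
have [C hC] := Hb_dil (test_fun_derive tf) hp.
have C0 := Hb_ge0 (hC 0); have e2 : 0 < e / 2 by rewrite divr_gt0.
near=> n.
have h3 : nrm (mul (dil f n) p - f 0 *: p) <= e by near: n; exact: sz.
have h4 : Hb SD k (mul (dil f n) p' - f 0 *: p') (e / 2) by near: n; exact: IH.
apply: (HbI h3 (SD_B (SD_dil n tf pp') (SD_Z (f 0) pp'))).
have z (V : zmodType) (x y u : V) : x + y - u = x + (y - u) by rewrite addrA.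
rewrite z; have /HbW := Hb_lin (@SD_lin R) n.+1%:R^-1 (hC n) h4; apply.
rewrite [leRHS]splitr lerD2r ger0_norm ?invr_ge0// mulrC ler_pdivrMr//.
rewrite mulrC -ler_pdivrMr//; near: n.
exists (Num.truncn (C / (e / 2))) => // n /= Nn.
by rewrite (le_trans (ltW (truncnS_gt _)))// ler_nat ltnS.
Unshelve. all: by end_near. Qed.

Lemma test_fun_one : exists2 f : R -> R, test_fun f & f 0 = 1.
Proof.
pose b := bump (-1) 1 1 (0 : R).
have b0 : b != 0.
  rewrite /b /bump /flat sub0r opprK subr0 mulr1 ltr01 hornerC mul1r.
  by rewrite mulf_neq0// gt_eqF// expR_gt0.
exists (fun x => b^-1 * bump (-1) 1 1 x); last by rewrite mulVf.
by apply: test_fun_smoothM; [exact: smooth_cst|exact: test_fun_bump].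
Qed.

Lemma supported_dil f n p : test_fun f -> exists B, supported B (mul (dil f n) p) /\ 0 <= B.
Proof.
move=> tf; have [c c0 bc] := test_fun_bounded_dil tf; have [_ [M hM]] := tf.
exists (n.+1%:R * `|M|); split; last by rewrite mulr_ge0.
rewrite /supported (bounded_mulM p (bounded_window _) (bc n)); apply: eq_mul => x.
rewrite /window; case: (lerP `|x|) => xB; first by rewrite mul1r.
rewrite mul0r /dil hM// normrM [`|n.+1%:R^-1|]ger0_norm ?invr_ge0// ltr_pdivlMr//.
by rewrite (le_lt_trans _ xB)// mulrC ler_wpM2l// ler_norm.
Qed.

(** Cutting off by a dilated test function equal to 1 at 0 converges in the Sobolev norm and in the
    weighted one. The result has compact support, where the weight is bounded, and can then be
    smoothed up to order [r] without losing the weight. *)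
Lemma weighted_density (s r : nat) p K e : (s <= r)%N -> 0 < e ->
  Hb SD s p K -> dm (fun x => x ^+ s) p ->
  exists q L, [/\ Hb SD r q L, dm (fun x => x ^+ r) q, Hb SD s (p - q) e &
    nrm (mul (fun x => x ^+ s) (p - q)) <= e].
Proof.
move=> sr e0 hp wp; have [f tf f1] := test_fun_one.
have mX n : measurable_fun (setT : set R) (fun x : R => x ^+ n) by exact: measurable_funX.
have e2 : 0 < e / 2 by rewrite divr_gt0.
have [c c0 bc] := test_fun_bounded_dil tf.
(* The weight commutes with the cut-off, so weighted convergence is convergence at order 0 for the
   class of x^s p. One index serves both. *)
have [n [hn1 hn2]] : exists n, Hb SD s (mul (dil f n) p - f 0 *: p) (e / 2) /\
    nrm (mul (dil f n) (mul (fun x => x ^+ s) p) - f 0 *: mul (fun x => x ^+ s) p) <= e / 2.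
  have h1 := Hb_dil_cvg e2 tf hp.
  have h2 := Hb_dil_cvg e2 tf (conj (lexx (nrm (mul (fun x => x ^+ s) p))) I : Hb SD 0 _ _).
  have [N1 _ h3] := h1; have [N2 _ h4] := h2; exists (maxn N1 N2); split.
    by apply: h3; rewrite /= leq_maxl.
  by have [] := h4 (maxn N1 N2) (leq_maxr _ _).
rewrite f1 !scale1r in hn1 hn2.
set q0 := mul (dil f n) p in hn1.
have [B [sB B0]] := supported_dil n p tf.
have [C hC] := Hb_dil tf hp; have hq0 := hC n.
pose B1 := B + (r - s)%:R; have B10 : 0 <= B1 by rewrite addr_ge0.
(* On the support the weight costs a factor B1^s; this error makes both the plain and the weighted
   smoothing errors at most e/2. *)
pose e3 := e / 2 / (1 + B1 ^+ s).
have B2 : 0 < 1 + B1 ^+ s by rewrite ltr_wpDr// exprn_ge0.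
have e30 : 0 < e3 by rewrite divr_gt0.
have [q [sq [L hq] q0q]] := smoothing (r - s) e30 sB hq0.
rewrite subnKC// in hq; exists q, L.
have [wq _] := supported_weight r B10 sq.
have [wqs _] := supported_weight s B10 sq.
have [wq0 _] := supported_weight s B0 sB.
have z (V : zmodType) (x y u : V) : - (y - x) + (y - u) = x - u by rewrite opprB addrA subrK.
have z' (V : zmodType) (x y u : V) : (x - y) + (y - u) = x - u by rewrite addrA subrK.
have e32 : e3 <= e / 2.
  by rewrite ler_pdivrMr// ler_peMr ?(ltW e2)// lerDl exprn_ge0.
have sqq : supported B1 (q0 - q).
  have s1 : supported B1 q0 by apply: supportedW sB; rewrite lerDl.
  by rewrite /supported (bounded_mulB _ _ (bounded_window _)) s1 sq.
split => //.
  have h1 := Hb_lin (@SD_lin R) (-1) hn1 q0q.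
  rewrite scaleN1r z normrN1 mul1r in h1; apply: (HbW _ h1).
  by rewrite [leRHS]splitr lerD2l.
have -> : mul (fun x => x ^+ s) (p - q) = mul (fun x => x ^+ s) (p - q0) + mul (fun x => x ^+ s) (q0 - q).
  by rewrite -(mulD (mX s)) ?z'//; [exact: dmB|exact: dmB].
apply: le_trans (nrmD_le _ _) _; rewrite [leRHS]splitr; apply: lerD.
  rewrite (mulB (mX s) wp wq0).
  have mm : mul (fun x => x ^+ s) q0 = mul (dil f n) (mul (fun x => x ^+ s) p).
    have [md _] := bc n.
    have wd : dm (fun x => x ^+ s * dil f n x) p.
      rewrite (_ : (fun x => _) = (fun x => dil f n x * x ^+ s)); last by apply/funext => x; rewrite mulrC.
      exact: (mul_mul md wp (bounded_dm _ (bc n))).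
    have [_ ->] := mulM (mX s) (bounded_dm p (bc n)) wd.
    have wd' : dm (fun x => dil f n x * x ^+ s) p.
      exact: (mul_mul md wp (bounded_dm _ (bc n))).
    have [_ ->] := mulM md wp wd'.
    by apply: eq_mul => x; rewrite mulrC.
  by rewrite mm nrmBC.
have [_ /le_trans] := supported_weight s B10 sqq; apply.
have h5 := Hb_nrm q0q; rewrite (le_trans (ler_wpM2l (exprn_ge0 _ B10) h5))//.
rewrite /e3 mulrA ler_pdivrMr// mulrC ler_wpM2l ?(ltW e2)// lerDr ler01//.
Qed.

End Density.

(** * Abstract setting *)

Opaque cl ltwo_add ltwo_scale ltwo_ip tau mul nrm SD mollify.

Section PairHilbert.
Context {R : realType} (T1 T2 : hilbertType R).
Implicit Types (x y z : (T1 * T2)%type) (a : R).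

Definition pair_ip x y : R := ip x.1 y.1 + ip x.2 y.2.

Lemma pair_ipC x y : pair_ip x y = pair_ip y x.
Proof. by rewrite /pair_ip ipC (ipC x.2). Qed.

Lemma pair_ipDl x y z : pair_ip (x + y) z = pair_ip x z + pair_ip y z.
Proof. by rewrite /pair_ip !ipDl addrACA. Qed.

Lemma pair_ipZl a x y : pair_ip (a *: x) y = a * pair_ip x y.
Proof. by rewrite /pair_ip !ipZl mulrDr. Qed.

Lemma pair_ipff_ge0 x : 0 <= pair_ip x x.
Proof. by rewrite addr_ge0// ipff_ge0. Qed.

Lemma pair_ipff_eq0 x : pair_ip x x = 0 -> x = 0.
Proof.
case: x => x1 x2 /eqP; rewrite /pair_ip paddr_eq0 ?ipff_ge0//= => /andP[/eqP h1 /eqP h2].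
by rewrite (ipff_eq0 _ h1) (ipff_eq0 _ h2).
Qed.

Lemma pair_complete (u : nat -> (T1 * T2)%type) : hilbert_cauchy pair_ip u ->
  exists l, hilbert_cvg pair_ip u l.
Proof.
move=> cu; have [|l1 h1] := @ip_complete R T1 (fun n => (u n).1).
  move=> e e0; have [N hN] := cu e e0; exists N => m n Nm Nn.
  by rewrite (le_lt_trans _ (hN m n Nm Nn))// lerDl ipff_ge0.
have [|l2 h2] := @ip_complete R T2 (fun n => (u n).2).
  move=> e e0; have [N hN] := cu e e0; exists N => m n Nm Nn.
  by rewrite (le_lt_trans _ (hN m n Nm Nn))// lerDr ipff_ge0.
exists (l1, l2) => e e0; have e2 : 0 < e / 2 by rewrite divr_gt0.
have [N1 hN1] := h1 _ e2; have [N2 hN2] := h2 _ e2.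
exists (maxn N1 N2) => n; rewrite geq_max => /andP[n1 n2].
by rewrite [ltRHS]splitr /pair_ip/= ltrD// ?hN1// hN2.
Qed.

HB.instance Definition _ := Lmodule_isHilbert.Build R (T1 * T2)%type
  pair_ipC pair_ipDl pair_ipZl pair_ipff_ge0 pair_ipff_eq0 pair_complete.

Lemma ip_pair x y : ip x y = ip x.1 y.1 + ip x.2 y.2. Proof. by []. Qed.

Lemma nrm_pair x : nrm x ^+ 2 = nrm x.1 ^+ 2 + nrm x.2 ^+ 2.
Proof. by rewrite -!ipff. Qed.

Lemma nrm_fst x : nrm x.1 <= nrm x.
Proof. by rewrite -(@ler_pXn2r _ 2)// ?nnegrE// nrm_pair lerDl exprn_ge0. Qed.

Lemma nrm_snd x : nrm x.2 <= nrm x.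
Proof. by rewrite -(@ler_pXn2r _ 2)// ?nnegrE// nrm_pair lerDr exprn_ge0. Qed.

Lemma nrm_pair_le x : nrm x <= nrm x.1 + nrm x.2.
Proof.
rewrite -(@ler_pXn2r _ 2)// ?nnegrE ?addr_ge0// nrm_pair sqrrD addrAC lerDl.
by rewrite mulrn_wge0// mulr_ge0.
Qed.

Lemma nrm_pair_le2 x a b : nrm x.1 <= a -> nrm x.2 <= b -> nrm x <= a + b.
Proof. by move=> h1 h2; exact: le_trans (nrm_pair_le _) (lerD h1 h2). Qed.

Lemma nrm_pair_scale c x y : 0 <= c -> nrm x.1 <= c * nrm y.1 -> nrm x.2 <= c * nrm y.2 ->
  nrm x <= c * nrm y.
Proof.
move=> c0 h1 h2; rewrite -(@ler_pXn2r _ 2)// ?nnegrE ?mulr_ge0// exprMn !nrm_pair mulrDr.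
by rewrite -!exprMn lerD// ler_pXn2r// ?nnegrE ?mulr_ge0.
Qed.

Lemma hcvg_pair {I : Type} (F : set_system I) {FF : ProperFilter F} u l :
  hcvg F u l <-> hcvg F (fun i => (u i).1) l.1 /\ hcvg F (fun i => (u i).2) l.2.
Proof.
split => [h|[h1 h2]].
  by split; apply: hcvg_squeeze h; apply: nearW => i; [exact: (nrm_fst (u i - l))|exact: (nrm_snd (u i - l))].
apply: (@hcvg_squeeze _ _ _ _ _ _ _ (fun i => nrm ((u i).1 - l.1) + nrm ((u i).2 - l.2))).
  by apply: nearW => i; exact: (nrm_pair_le (u i - l)).
by rewrite -[X in _ --> X]addr0; exact: cvgD.
Qed.

End PairHilbert.

Definition powx {R : realType} (n : nat) (x : R) : R := x ^+ n.

(* The properties of L^2(R) used by the dynamical argument: [D x x'] says that [x'] is the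
   derivative of [x], [dM m] is the domain of the multiplication operator [M m]. They pass
   from real-valued to complex-valued functions, that is, to pairs. *)
Record weighted (R : realType) := Weighted {
  carrier :> hilbertType R ;
  D : carrier -> carrier -> Prop ;
  M : (R -> R) -> carrier -> carrier ;
  dM : (R -> R) -> carrier -> Prop ;
  wcst : R ;
  wcst_ge0 : 0 <= wcst ;
  D_lin : forall (a : R) x x' y y', D x x' -> D y y' -> D (a *: x + y) (a *: x' + y') ;
  D_0 : D 0 0 ;
  D_unique : forall x y y', D x y -> D x y' -> y = y' ;
  D_skew : forall x x' y y', D x x' -> D y y' -> ip x' y = - ip x y' ;
  D_closed : forall (u v : nat -> carrier) x y, (forall n, D (u n) (v n)) ->
    hcvg \oo u x -> hcvg \oo v y -> D x y ;
  D_M : forall (m : R -> R) (c c' : R) x y, (forall r : R, derivable m r 1) -> bounded_by c m ->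
    (forall r : R, `|derive1 m r| <= c') -> D x y -> D (M m x) (M (derive1 m) x + M m y) ;
  dM_lin : forall (m : R -> R) (a : R) x y, measurable_fun setT m -> dM m x -> dM m y -> dM m (a *: x + y) ;
  M_lin : forall (m : R -> R) (a : R) x y, measurable_fun setT m -> dM m x -> dM m y ->
    M m (a *: x + y) = a *: M m x + M m y ;
  M_sym : forall (m : R -> R) x y, measurable_fun setT m -> dM m x -> dM m y ->
    ip (M m x) y = ip x (M m y) ;
  dM_bounded : forall (c : R) (m : R -> R) x, bounded_by c m -> dM m x ;
  M_bounded : forall (c : R) (m : R -> R) x, bounded_by c m -> nrm (M m x) <= c * nrm x ;
  dM_comp : forall (m m' : R -> R) x, measurable_fun setT m -> dM m' x ->
    dM (fun r => m r * m' r) x -> dM m (M m' x) ;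
  M_comp : forall (m m' : R -> R) x, measurable_fun setT m -> dM m' x ->
    dM (fun r => m r * m' r) x -> M m (M m' x) = M (fun r => m r * m' r) x ;
  dM_mul : forall (m m' : R -> R) x, measurable_fun setT m -> dM m' x -> dM m (M m' x) ->
    dM (fun r => m r * m' r) x ;
  dM_le : forall (c : R) (m m' : R -> R) x, 0 <= c -> measurable_fun setT m ->
    (forall r : R, `|m r| <= c * `|m' r|) -> dM m' x -> dM m x ;
  M_le : forall (c : R) (m m' : R -> R) x, 0 <= c -> measurable_fun setT m ->
    (forall r : R, `|m r| <= c * `|m' r|) -> dM m' x -> nrm (M m x) <= c * nrm (M m' x) ;
  dM_add : forall (m m' : R -> R) x, dM m x -> dM m' x -> dM (fun r => m r + m' r) x ;
  M_add : forall (m m' : R -> R) x, dM m x -> dM m' x -> M (fun r => m r + m' r) x = M m x + M m' x ;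
  dM_scale : forall (a : R) (m : R -> R) x, dM m x -> dM (fun r => a * m r) x ;
  M_scale : forall (a : R) (m : R -> R) x, dM m x -> M (fun r => a * m r) x = a *: M m x ;
  M_1 : forall x, M (fun=> 1) x = x ;
  M_fatou : forall (mn : nat -> R -> R) (m : R -> R) x (b : R), 0 <= b ->
    (forall n, measurable_fun setT (mn n)) -> (forall r : R, mn ^~ r @ \oo --> m r) ->
    (forall n, dM (mn n) x) -> (forall n, nrm (M (mn n) x) <= b) ->
    dM m x /\ nrm (M m x) <= wcst * b ;
  M_dct : forall (mn : nat -> R -> R) (m : R -> R) x (c : R), (forall n, bounded_by c (mn n)) ->
    (forall r : R, mn ^~ r @ \oo --> m r) -> hcvg \oo (fun n => M (mn n) x) (M m x) ;
  M_closed : forall (m : R -> R) (u : nat -> carrier) x (b : R), measurable_fun setT m -> 0 <= b ->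
    hcvg \oo u x -> (forall n, dM m (u n)) -> (forall n, nrm (M m (u n)) <= b) ->
    dM m x /\ nrm (M m x) <= wcst * b ;
  sigma_dense : forall (s r : nat) x (K e : R), (s <= r)%N -> 0 < e ->
    Hb D s x K -> dM (powx s) x ->
    exists y L, [/\ Hb D r y L, dM (powx r) y, Hb D s (x - y) e &
      nrm (M (powx s) (x - y)) <= e]
}.

(** The complex structure is a separate layer because it appears only once pairs are formed. Keeping
    real scalars makes every energy identity a statement about [ip], in which skewness of [J] plays
    the part of taking imaginary parts. *)
Record calculus (R : realType) := Calculus {
  base :> weighted R ;
  J : base -> base ;
  J_lin : forall a x y, J (a *: x + y) = a *: J x + J y ;
  J_ip : forall x y, ip (J x) (J y) = ip x y ;
  JJ : forall x, J (J x) = - x ;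
  D_J : forall x y : base, D x y -> D (J x) (J y) ;
  dM_J : forall (m : R -> R) (x : base), measurable_fun setT m -> dM m x -> dM m (J x) ;
  M_J : forall (m : R -> R) (x : base), measurable_fun setT m -> dM m x -> M m (J x) = J (M m x)
}.

Definition ltwo_weighted (R : realType) : weighted R.
Proof.
apply: (@Weighted R (ltwo R) SD mul (@dm R) 1).
- exact: ler01.
- by move=> a x x' y y' h1 h2; exact: SD_lin.
- exact: SD0.
- exact: SD_unique.
- exact: SD_skew.
- exact: SD_closed.
- exact: SD_mul.
- by move=> m a x y mm h1 h2; exact: dmD mm _ _ (dmZ mm a h1) h2.
- by move=> m a x y mm h1 h2; rewrite -(mulZ mm a h1); exact: mulD mm _ _ (dmZ mm a h1) h2.
- by move=> m x y mm h1 h2; exact: (ip_mul h1 h2).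
- by move=> c m x; exact: bounded_dm.
- by move=> c m x; exact: bounded_mul_nrm.
- by move=> m m' x mm h1 h2; exact: (mulM mm h1 h2).1.
- by move=> m m' x mm h1 h2; exact: (mulM mm h1 h2).2.
- by move=> m m' x mm h1 h2; exact: (mul_mul mm h1 h2).
- by move=> c m m' x c0 mm mle h; exact: (dm_le c0 mm mle h).1.
- by move=> c m m' x c0 mm mle h; exact: (dm_le c0 mm mle h).2.
- by move=> m m' x h1 h2; exact: (mul_addm h1 h2).1.
- by move=> m m' x h1 h2; exact: (mul_addm h1 h2).2.
- by move=> a m x h; exact: (mul_scalem a h).1.
- by move=> a m x h; exact: (mul_scalem a h).2.
- exact: mul1.
- move=> mn m x b b0 mm cm h1 h2; have [a1 a2] := mul_fatou b0 mm cm h1 h2.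
  by split; [exact: a1|rewrite mul1r; exact: a2].
- by move=> mn m x c bm cm; exact: (mul_dct x bm cm).
- move=> m u x b mm b0 ux h1 h2; have [a1 a2] := dm_closed mm b0 ux h1 h2.
  by split; [exact: a1|rewrite mul1r; exact: a2].
- move=> s r x K e; exact: weighted_density.
Defined.

Section WeightedTheory.
Context {R : realType} {W : weighted R}.
Implicit Types (x y : W) (m : R -> R) (a c : R).

Lemma M_zero x : M (fun=> 0) x = 0.
Proof.
have b0 : bounded_by 0 (fun=> 0 : R) by split => // y; rewrite normr0.
by apply: nrm0_eq0; apply/eqP; rewrite eq_le nrm_ge0 (le_trans (M_bounded x b0))// mul0r.
Qed.

(** The zero vector is its own image under the zero multiplier, and the product of [m] with that
    multiplier is bounded, so [dM_comp] applies. *)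
Lemma dM0 m : measurable_fun setT m -> dM m (0 : W).
Proof.
move=> mm; have b0 : bounded_by 0 (fun=> 0 : R) by split => // y; rewrite normr0.
rewrite -(M_zero 0); apply: dM_comp => //; first exact: dM_bounded b0.
by rewrite (_ : (fun r => _) = fun=> 0); [exact: dM_bounded b0|apply/funext => r; rewrite mulr0].
Qed.

Lemma M0 m : measurable_fun setT m -> M m (0 : W) = 0.
Proof.
move=> mm; have := M_lin 1 mm (dM0 mm) (dM0 mm).
by rewrite !scale1r addr0 => /esym/eqP; rewrite -subr_eq0 addrK => /eqP.
Qed.

Section multiplier.
Variables (m : R -> R) (mm : measurable_fun setT m).

Lemma dMZ a x : dM m x -> dM m (a *: x).
Proof. by move=> h; rewrite -[_ *: _]addr0; apply: dM_lin => //; exact: dM0. Qed.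

Lemma MZ a x : dM m x -> M m (a *: x) = a *: M m x.
Proof. by move=> h; rewrite -[_ *: x]addr0 M_lin// ?M0 ?addr0//; exact: dM0. Qed.

Lemma dMD x y : dM m x -> dM m y -> dM m (x + y).
Proof. by move=> h h'; rewrite -[x]scale1r; exact: dM_lin. Qed.

Lemma MD x y : dM m x -> dM m y -> M m (x + y) = M m x + M m y.
Proof. by move=> h h'; rewrite -{1}[x]scale1r M_lin// scale1r. Qed.

Lemma dMN x : dM m x -> dM m (- x).
Proof. by rewrite -scaleN1r; exact: dMZ. Qed.

Lemma MN x : dM m x -> M m (- x) = - M m x.
Proof. by move=> h; rewrite -scaleN1r MZ// scaleN1r. Qed.

Lemma dMB x y : dM m x -> dM m y -> dM m (x - y).
Proof. by move=> h h'; apply: dMD => //; exact: dMN. Qed.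

Lemma MB x y : dM m x -> dM m y -> M m (x - y) = M m x - M m y.
Proof. by move=> h h'; rewrite MD ?MN//; exact: dMN. Qed.

End multiplier.

Lemma D_Z a x x' : D x x' -> D (a *: x) (a *: x').
Proof. by move=> h; rewrite -[a *: x]addr0 -[a *: x']addr0; apply: D_lin => //; exact: D_0. Qed.

Lemma D_N x x' : D x x' -> D (- x) (- x').
Proof. by rewrite -scaleN1r -(scaleN1r x'); exact: D_Z. Qed.

Lemma D_D x x' y y' : D x x' -> D y y' -> D (x + y) (x' + y').
Proof. by move=> h h'; rewrite -[x]scale1r -[x']scale1r; exact: D_lin. Qed.

Lemma D_B x x' y y' : D x x' -> D y y' -> D (x - y) (x' - y').
Proof. by move=> h h'; apply: D_D => //; exact: D_N. Qed.

End WeightedTheory.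

Section Pairs.
Context {R : realType} (W : weighted R).
Local Notation T := (W * W)%type.
Implicit Types (x y : T) (m : R -> R).

Definition pair_J x : T := (- x.2, x.1).
Definition pair_D x y : Prop := D x.1 y.1 /\ D x.2 y.2.
Definition pair_M m x : T := (M m x.1, M m x.2).
Definition pair_dM m x : Prop := dM m x.1 /\ dM m x.2.

Lemma pair_sigma_dense (s r : nat) x K e : (s <= r)%N -> 0 < e ->
  Hb pair_D s x K -> pair_dM (powx s) x ->
  exists (y : T) L, [/\ Hb pair_D r y L, pair_dM (powx r) y, Hb pair_D s (x - y) e &
      nrm (pair_M (powx s) (x - y)) <= e].
Proof.
have proj1 k z L : Hb pair_D k z L -> Hb (@D _ W) k z.1 L.
  elim: k z => [|k IH] z [h1 h2]; first by split; last by []; exact: le_trans (nrm_fst _) h1.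
  have [z' [zz' _] h] := h2; apply: (HbI _ zz'); first exact: le_trans (nrm_fst _) h1.
  exact: IH.
have proj2 k z L : Hb pair_D k z L -> Hb (@D _ W) k z.2 L.
  elim: k z => [|k IH] z [h1 h2]; first by split; last by []; exact: le_trans (nrm_snd _) h1.
  have [z' [_ zz'] h] := h2; apply: (HbI _ zz'); first exact: le_trans (nrm_snd _) h1.
  exact: IH.
have comb k z L L' : Hb (@D _ W) k z.1 L -> Hb (@D _ W) k z.2 L' -> Hb pair_D k z (L + L').
  elim: k z => [|k IH] z [h1 h2] [h3 h4].
    by split; last by []; exact: nrm_pair_le2 h1 h3.
  have [z1 zz1 h] := h2; have [z2 zz2 h'] := h4.
  have zz : pair_D z (z1, z2) := conj zz1 zz2.
  apply: (HbI _ zz); first exact: nrm_pair_le2 h1 h3.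
  exact: IH.
move=> sr e0 hx [w1 w2]; have e2 : 0 < e / 2 by rewrite divr_gt0.
have [q1 [L1 [a1 b1 c1 d1]]] := sigma_dense sr e2 (proj1 _ _ _ hx) w1.
have [q2 [L2 [a2 b2 c2 d2]]] := sigma_dense sr e2 (proj2 _ _ _ hx) w2.
exists (q1, q2), (L1 + L2); split.
- exact: comb.
- by split.
- by rewrite [e]splitr; exact: comb.
- rewrite [leRHS]splitr; exact: (nrm_pair_le2 (x := pair_M (powx s) (x - (q1, q2))) d1 d2).
Qed.

(** The Fatou constant doubles: both components satisfy the bound separately, and the norm of a pair
    is estimated by the sum of the two norms. *)
Definition pair_weighted : weighted R.
Proof.
apply: (@Weighted R (W * W)%type pair_D pair_M pair_dM (wcst W + wcst W)).
- by rewrite addr_ge0// wcst_ge0.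
- by move=> a [x1 x2] [x1' x2'] [y1 y2] [y1' y2'] [h1 h2] [h3 h4]; split; exact: D_lin.
- by split; exact: D_0.
- move=> [x1 x2] [y1 y2] [z1 z2] [h1 h2] [h3 h4].
  by congr (_, _); [exact: D_unique h1 h3|exact: D_unique h2 h4].
- move=> [x1 x2] [x1' x2'] [y1 y2] [y1' y2'] [h1 h2] [h3 h4].
  by rewrite /= !ip_pair/= (D_skew h1 h3) (D_skew h2 h4) opprD.
- move=> u v x y h /hcvg_pair[u1 u2] /hcvg_pair[v1 v2].
  split; first by apply: (D_closed _ u1 v1) => n; exact: (h n).1.
  by apply: (D_closed _ u2 v2) => n; exact: (h n).2.
- move=> m c c' [x1 x2] [y1 y2] dmm bm bm' [h1 h2].
  by split; [exact: (D_M dmm bm bm' h1)|exact: (D_M dmm bm bm' h2)].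
- by move=> m a [x1 x2] [y1 y2] mm [h1 h2] [h3 h4]; split; exact: dM_lin.
- by move=> m a [x1 x2] [y1 y2] mm [h1 h2] [h3 h4]; congr (_, _); exact: M_lin.
- move=> m [x1 x2] [y1 y2] mm [h1 h2] [h3 h4].
  by rewrite /= !ip_pair/= (M_sym mm h1 h3) (M_sym mm h2 h4).
- by move=> c m [x1 x2] bm; split; exact: dM_bounded bm.
- move=> c m [x1 x2] bm; have c0 : 0 <= c by rewrite (le_trans _ (bm.2 0)).
  by apply: nrm_pair_scale c0 _ _; exact: M_bounded.
- by move=> m m' [x1 x2] mm [h1 h2] [h3 h4]; split; exact: dM_comp.
- by move=> m m' [x1 x2] mm [h1 h2] [h3 h4]; congr (_, _); exact: M_comp.
- by move=> m m' [x1 x2] mm [h1 h2] [h3 h4]; split; exact: dM_mul.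
- by move=> c m m' [x1 x2] c0 mm mle [h1 h2]; split; exact: dM_le mle _.
- move=> c m m' [x1 x2] c0 mm mle [h1 h2].
  by apply: (nrm_pair_scale c0); [exact: (M_le c0 mm mle h1)|exact: (M_le c0 mm mle h2)].
- by move=> m m' [x1 x2] [h1 h2] [h3 h4]; split; exact: dM_add.
- by move=> m m' [x1 x2] [h1 h2] [h3 h4]; congr (_, _); exact: M_add.
- by move=> a m [x1 x2] [h1 h2]; split; exact: dM_scale.
- by move=> a m [x1 x2] [h1 h2]; congr (_, _); exact: M_scale.
- by move=> [x1 x2]; congr (_, _); exact: M_1.
- move=> mn m x b b0 mm cm h1 h2.
  have [a1 a2] := @M_fatou R W mn m x.1 b b0 mm cm (fun n => (h1 n).1)
    (fun n => le_trans (nrm_fst (pair_M (mn n) x)) (h2 n)).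
  have [a3 a4] := @M_fatou R W mn m x.2 b b0 mm cm (fun n => (h1 n).2)
    (fun n => le_trans (nrm_snd (pair_M (mn n) x)) (h2 n)).
  by split; [split|rewrite mulrDl; exact: nrm_pair_le2].
- move=> mn m x c bm cm; apply/hcvg_pair.
  by split; [exact: (@M_dct R W mn m x.1 c bm cm)|exact: (@M_dct R W mn m x.2 c bm cm)].
- move=> m u x b mm b0 /hcvg_pair[ux1 ux2] h1 h2.
  have [a1 a2] := M_closed mm b0 ux1 (fun n => (h1 n).1)
    (fun n => le_trans (nrm_fst (pair_M m (u n))) (h2 n)).
  have [a3 a4] := M_closed mm b0 ux2 (fun n => (h1 n).2)
    (fun n => le_trans (nrm_snd (pair_M m (u n))) (h2 n)).
  by split; [split|rewrite mulrDl; exact: nrm_pair_le2].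
- exact: pair_sigma_dense.
Defined.

Definition pair_calculus : calculus R.
Proof.
apply: (@Calculus R pair_weighted pair_J).
- by move=> a [x1 x2] [y1 y2]; congr (_, _); rewrite /= opprD -scalerN.
- by move=> [x1 x2] [y1 y2]; rewrite /= !ip_pair/= ipNl ipNr opprK addrC.
- by move=> [x1 x2].
- by move=> [x1 x2] [y1 y2] [h1 h2]; split => //=; exact: D_N.
- by move=> m [x1 x2] mm [h1 h2]; split => //=; exact: dMN.
- by move=> m [x1 x2] mm [h1 h2]; congr (_, _); rewrite /= MN.
Defined.

End Pairs.

Definition ltwo_pairs (R : realType) : calculus R := pair_calculus (ltwo_weighted R).

(** * Unitary groups and regularity *)

Transparent nrm.

Section CalculusTheory.
Context {R : realType} {S : calculus R}.
Implicit Types (x y z : S) (m : R -> R) (a c K L : R).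

Lemma JD x y : J (x + y) = J x + J y.
Proof. by have := J_lin 1 x y; rewrite !scale1r. Qed.

Lemma J0 : J (0 : S) = 0.
Proof. by have := J_lin (-1) (0 : S) 0; rewrite !scaleN1r oppr0 addr0 addNr. Qed.

Lemma JZ a x : J (a *: x) = a *: J x.
Proof. by rewrite -[a *: x]addr0 J_lin J0 addr0. Qed.

Lemma JN x : J (- x) = - J x.
Proof. by rewrite -scaleN1r JZ scaleN1r. Qed.

Lemma JB x y : J (x - y) = J x - J y.
Proof. by rewrite JD JN. Qed.

Lemma J_nrm x : nrm (J x) = nrm x.
Proof. by rewrite /nrm J_ip. Qed.

Lemma J_skew x y : ip (J x) y = - ip x (J y).
Proof. by rewrite -J_ip JJ ipNl. Qed.

Lemma J_inj x y : J x = J y -> x = y.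
Proof. by move=> h; rewrite -[x]opprK -[y]opprK -!JJ h. Qed.

Lemma hcvg_J {I : Type} (F : set_system I) {FF : ProperFilter F} (u : I -> S) l :
  hcvg F u l -> hcvg F (fun i => J (u i)) (J l).
Proof.
move=> h; apply: hcvg_squeeze h; apply: nearW => i.
by rewrite -JB J_nrm.
Qed.

(** A symmetric operator commuting with the skew [J] has purely real quadratic form. This removes
    the potential from the derivative of weighted norms. *)
Lemma M_J_ip0 m x : measurable_fun setT m -> dM m x -> ip (M m x) (J x) = 0.
Proof.
move=> mm h; have := J_skew (M m x) x.
by rewrite -M_J// M_sym//; [rewrite [ip (J x) _]ipC => h'; lra|exact: dM_J].
Qed.

Lemma J_eq0 x y : ip (J x) y + ip x (J y) = 0.
Proof. by rewrite J_skew addNr. Qed.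

Fixpoint Wk k c m : Prop := bounded_by c m /\
  if k is k'.+1 then (forall r : R, derivable m r 1) /\ Wk k' c (derive1 m) else True.

Lemma Wk_bounded k c m : Wk k c m -> bounded_by c m.
Proof. by case: k => [|k] []. Qed.

Lemma WkS k c m : Wk k.+1 c m -> Wk k c m.
Proof.
elim: k m => [|k IH] m [h1 [h2 h3]]; first by split.
by split => //; split => //; exact: IH.
Qed.

Lemma Wk_le j k c m : (j <= k)%N -> Wk k c m -> Wk j c m.
Proof. by move=> /subnK <-; elim: (k - j)%N => // n IH; rewrite addSn => /WkS. Qed.

Lemma bounded_by_ge0 c m : bounded_by c m -> 0 <= c.
Proof. by move=> [_ h]; rewrite (le_trans _ (h 0)). Qed.

Lemma Wk_ge0 k c m : Wk k c m -> 0 <= c.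
Proof. by move=> /Wk_bounded/bounded_by_ge0. Qed.

(** Leibniz: every derivative of a product splits into two terms of the same kind, whence the power
    of 2. *)
Lemma Hb_mul k c m x K : Wk k c m -> Hb (@D _ S) k x K ->
  Hb (@D _ S) k (M m x) (2 ^+ k * c * K).
Proof.
elim: k m x => [|k IH] m x wm hx.
  have bm := Wk_bounded wm; rewrite expr0 mul1r; split => //.
  by rewrite (le_trans (M_bounded x bm))// ler_wpM2l ?(Wk_ge0 wm)// (Hb_nrm hx).
have c0 := Wk_ge0 wm; have K0 := Hb_ge0 hx; have bm := Wk_bounded wm.
have [_ [md wm']] := wm; have [hn [x' xx' hx']] := hx.
have bm' := Wk_bounded wm'.
have cK : c * K <= 2 ^+ k.+1 * c * K.
  by rewrite -mulrA ler_peMl ?mulr_ge0// exprn_ege1// ler1n.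
apply: (HbI _ (D_M md bm (bm'.2) xx')).
  by rewrite (le_trans (M_bounded x bm))// (le_trans _ cK)// ler_wpM2l.
have h1 := IH _ _ wm' (HbS hx).
have h2 := IH _ _ (WkS wm) hx'.
have := HbD (@D_lin _ S) h1 h2; rewrite exprS.
by rewrite (_ : _ + _ = 2 * 2 ^+ k * c * K)//; ring.
Qed.

End CalculusTheory.

Section StrongDerivatives.
Context {R : realType} {T : hilbertType R}.
Implicit Types (u v : R -> T) (x y l : T) (t : R).

Definition sder u t l := hcvg (0 : R)^' (fun h => h^-1 *: (u (t + h) - u t)) l.

Lemma sder_cvg u t l : sder u t l -> hcvg (0 : R)^' (fun h => u (t + h)) (u t).
Proof.
move=> h; have h1 : hcvg (0 : R)^' (fun h => h *: (h^-1 *: (u (t + h) - u t))) (0 *: l).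
  apply: hcvgZ => //; exact: nbhs_dnbhs.
have h2 : hcvg (0 : R)^' (fun h => h *: (h^-1 *: (u (t + h) - u t)) + u t) (u t).
  by have := hcvgD h1 (hcvg_cst (u t)); rewrite scale0r add0r; apply.
apply: cvg_trans h2; apply: near_eq_cvg; near=> e.
have e0 : e != 0 by near: e; exact: nbhs_dnbhs_neq.
by rewrite scalerA divff// scale1r subrK.
Unshelve. all: by end_near. Qed.

Lemma sder_ip u v t l m : sder u t l -> sder v t m ->
  is_derive t 1 (fun t => ip (u t) (v t)) (ip l (v t) + ip (u t) m).
Proof.
move=> hu hv; apply: lim_derive.
have hv' := sder_cvg hv.
have h1 : ip (h^-1 *: (u (t + h) - u t)) (v (t + h)) @[h --> (0 : R)^'] --> ip l (v t).
  exact: (hcvg_ip hu hv').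
have h2 : ip (u t) (h^-1 *: (v (t + h) - v t)) @[h --> (0 : R)^'] --> ip (u t) m.
  exact: (hcvg_ip (hcvg_cst (u t)) hv).
have h3 := cvgD h1 h2.
rewrite (_ : (fun h => _) = (fun h => ip (h^-1 *: (u (t + h) - u t)) (v (t + h)) +
  ip (u t) (h^-1 *: (v (t + h) - v t)))); first exact: h3.
apply/funext => h; rewrite ipZl ipZr ipBl ipBr -mulrDr mulrC; congr (_ * _).
by rewrite addrA subrK.
Qed.

Lemma sder_lip (P : T -> T) c u t l : (forall x y, P (x - y) = P x - P y) ->
  (forall a x, P (a *: x) = a *: P x) -> (forall x, nrm (P x) <= c * nrm x) ->
  sder u t l -> sder (P \o u) t (P l).
Proof.
move=> PB PZ Pn hu; apply: hcvg_eq (@hcvg_lipschitz _ _ _ _ _ _ P c _ _ _ hu).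
  by move=> h; rewrite /comp PZ PB.
by move=> x y; rewrite -PB.
Qed.

End StrongDerivatives.

Record evolution (R : realType) (S : calculus R) := Evolution {
  flow :> R -> S -> S ;
  flow_lin : forall t a x y, flow t (a *: x + y) = a *: flow t x + flow t y ;
  flow_J : forall t x, flow t (J x) = J (flow t x) ;
  flow_nrm : forall t x, nrm (flow t x) = nrm x ;
  flow_0 : forall x, flow 0 x = x ;
  flow_add : forall t u x, flow (t + u) x = flow t (flow u x)
}.

Section EvolutionTheory.
Context {R : realType} {S : calculus R} (U : evolution S).
Implicit Types (x y f g : S) (t a c K L : R).

(* If [U t] is [e^{itA}] then [gen f g] means [A f = g]; [genn n f g] means [A^n f = g]. *)
Definition gen f g := hcvg (0 : R)^' (fun t => t^-1 *: (U t f - f)) (J g).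

Lemma flowD t x y : U t (x + y) = U t x + U t y.
Proof. by have := flow_lin U t 1 x y; rewrite !scale1r. Qed.

Lemma flow0 t : U t 0 = 0.
Proof. by apply: nrm0_eq0; rewrite flow_nrm nrm0. Qed.

Lemma flowZ t a x : U t (a *: x) = a *: U t x.
Proof. by rewrite -[a *: x]addr0 flow_lin flow0 addr0. Qed.

Lemma flowN t x : U t (- x) = - U t x.
Proof. by rewrite -scaleN1r flowZ scaleN1r. Qed.

Lemma flowB t x y : U t (x - y) = U t x - U t y.
Proof. by rewrite flowD flowN. Qed.

Lemma flow_ip t x y : ip (U t x) (U t y) = ip x y.
Proof.
have h (u v : S) : ip u v = (nrm (u + v) ^+ 2 - nrm u ^+ 2 - nrm v ^+ 2) / 2 :> R.
  by rewrite -!ipff ipDl !ipDr (ipC v u); field.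
by rewrite h (h x) -flowD !flow_nrm.
Qed.

Lemma flowK t x : U (- t) (U t x) = x.
Proof. by rewrite -flow_add addNr flow_0. Qed.

Lemma flowVK t x : U t (U (- t) x) = x.
Proof. by rewrite -flow_add addrN flow_0. Qed.

Lemma flow_adj t x y : ip (U t x) y = ip x (U (- t) y).
Proof. by rewrite -(flow_ip (- t)) flowK. Qed.

Lemma gen_unique f g g' : gen f g -> gen f g' -> g = g'.
Proof. by move=> h h'; apply: J_inj; exact: hcvg_unique h h'. Qed.

Lemma gen_flow t f g : gen f g -> gen (U t f) (U t g).
Proof.
move=> h; rewrite /gen -flow_J; apply: hcvg_squeeze h; apply: nearW => e.
by rewrite -flow_add [e + t]addrC flow_add -flowB -flowZ -flowB flow_nrm.
Qed.

Lemma gen_J f g : gen f g -> gen (J f) (J g).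
Proof.
by move=> h; apply: hcvg_eq (hcvg_J h) => t; rewrite JZ JB flow_J.
Qed.

Lemma flow_sder t f g : gen f g -> sder (fun t => U t f) t (J (U t g)).
Proof.
move=> h; have := gen_flow t h; apply: hcvg_eq => e.
by rewrite -flow_add [e + t]addrC.
Qed.

(** The unitary flow keeps the pairing of [U t f] with [U t (J f')] constant; its derivative at time
    0 is the difference of the two sides. *)
Lemma gen_sym f g f' g' : gen f g -> gen f' g' -> ip g f' = ip f g'.
Proof.
move=> h /gen_J h'; have := sder_ip (flow_sder 0 h) (flow_sder 0 h').
have -> : (fun t => ip (U t f) (U t (J f'))) = fun=> ip f (J f').
  by apply/funext => t; rewrite flow_ip.
move=> /is_derive1E; rewrite derive1_cst => /esym.
by rewrite !flow_0 J_ip JJ ipNr => /eqP; rewrite subr_eq0 => /eqP.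
Qed.

Lemma flow_hcvg {I : Type} (F : set_system I) {FF : ProperFilter F} (u : I -> S) l t :
  hcvg F u l -> hcvg F (fun i => U t (u i)) (U t l).
Proof. by move=> h; apply: hcvg_squeeze h; apply: nearW => i; rewrite -flowB flow_nrm. Qed.

Fixpoint genn n f g : Prop := if n is m.+1 then exists2 f', gen f f' & genn m f' g else f = g.

Lemma genn_unique n f g g' : genn n f g -> genn n f g' -> g = g'.
Proof.
elim: n f => [|n IH] f /=; first by move=> <-.
by move=> [f' h h'] [f'' i i']; apply: (IH f') => //; rewrite (gen_unique h i).
Qed.

Lemma genn_add m n f g h : genn m f g -> genn n g h -> genn (m + n) f h.
Proof.
elim: m f => [|m IH] f /=; first by move=> ->.
by move=> [f' h1 h2] h3; exists f' => //; exact: IH.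
Qed.

End EvolutionTheory.

Section SchroedingerRegularity.
Context {R : realType} {S : calculus R} (U : evolution S) (V : R -> R) (s : nat) (c : R).
Hypothesis wV : Wk s c V.
Hypothesis genE : forall f g : S, gen U f g <-> exists f1 f2, [/\ D f f1, D f1 f2 & g = f2 + M V f].
Local Notation H := (Hb (@D _ S)).
Implicit Types (f g : S) (K L C : R).

Lemma gen_of_Hb k f K : (k <= s)%N -> H k.+2 f K ->
  exists2 g, gen U f g & H k g ((1 + 2 ^+ k * c) * K).
Proof.
move=> ks hf; have [_ [f1 h1 [_ [f2 h2 hf2]]]] := hf.
exists (f2 + M V f); first by apply/genE; exists f1, f2.
have := HbD (@D_lin _ S) hf2 (Hb_mul (Wk_le ks wV) (HbS (HbS hf))).
by rewrite mulrDl mul1r.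
Qed.

(** Elliptic regularity from the equation f'' = g - V f. At the lowest order f' is controlled by
    integrating by parts, its squared norm being minus the pairing of f with f''; afterwards the
    regularity of V f comes from the previous order. *)
Lemma Hb_of_gen k : (k <= s)%N -> exists2 C, 0 <= C & forall f g K, gen U f g ->
  H k g K -> nrm f <= K -> H k.+2 f (C * K).
Proof.
have c0 := Wk_ge0 wV; have bV := Wk_bounded wV.
elim: k => [|k IH] ks.
  exists (1 + c); first by rewrite addr_ge0.
  move=> f g K /genE[f1 [f2 [d1 d2 e]]] hg hf; have hg' := Hb_nrm hg.
  have K0 : 0 <= K by rewrite (le_trans _ hf).
  have h2 : nrm f2 <= (1 + c) * K.
    have -> : f2 = g - M V f by rewrite e addrK.
    rewrite (le_trans (nrmB_le _ _))// mulrDl mul1r lerD//.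
    by rewrite (le_trans (M_bounded f bV))// ler_wpM2l.
  have hK : K <= (1 + c) * K by rewrite ler_peMl// lerDl.
  have h1 : nrm f1 <= (1 + c) * K.
    rewrite nrm_le2 ?(le_trans K0)// (D_skew d1 d2) (le_trans (ler_norm _))// normrN.
    by rewrite (le_trans (cauchy_schwarz _ _))// expr2 ler_pM// (le_trans hf).
  by apply: HbI d1 _; [exact: le_trans hf hK|apply: HbI d2 _ => //; split].
have [C C0 hC] := IH (ltnW ks).
exists (C + 1 + 2 ^+ k.+1 * c * C); first by rewrite !addr_ge0 ?mulr_ge0 ?exprn_ge0.
move=> f g K ge hg hf; have hfk := hC f g K ge (HbS hg) hf.
have K0 := Hb_ge0 hg.
have hV := Hb_mul (Wk_le ks wV) (HbS hfk).
have /genE[f1 [f2 [d1 d2 e]]] := ge.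
have h2 : H k.+1 f2 ((1 + 2 ^+ k.+1 * c * C) * K).
  have -> : f2 = g - M V f by rewrite e addrK.
  by have := HbB (@D_lin _ S) hg hV; rewrite [(1 + _) * K]mulrDl mul1r mulrA.
have le1 : C * K <= (C + 1 + 2 ^+ k.+1 * c * C) * K.
  by rewrite ler_wpM2r// -addrA lerDl addr_ge0// ?mulr_ge0 ?exprn_ge0.
have [n0 [f1' d1' [n1 _]]] := hfk; rewrite (D_unique d1' d1) in n1.
apply: HbI d1 _; first exact: le_trans n0 le1.
apply: HbI d2 _; first exact: le_trans n1 le1.
by apply: HbW h2; rewrite ler_wpM2r// -addrA lerDr.
Qed.

(** Order 0 is unitarity and order 1 is conservation of energy. Two more orders are gained by
    applying the induction to the generator at [f], which commutes with the flow, and then elliptic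
    regularity. The qualitative bound [L] at the next even order puts [f] in the domain of the
    powers involved; it does not enter the estimate. *)
Lemma Hb_flow k : (k <= s.+1)%N -> exists2 C, 0 <= C & forall f K, H k f K ->
  (exists L, H (uphalf k).*2 f L) -> forall t, H k (U t f) (C * K).
Proof.
have c0 := Wk_ge0 wV; have bV := Wk_bounded wV.
elim/ltn_ind: k => -[|[|k]] IH ks.
- by exists 1 => // f K [h _] _ t; split; rewrite // flow_nrm mul1r.
- exists (1 + c + c); first by rewrite !addr_ge0.
  move=> f K hf [L hL] t; have K0 := Hb_ge0 hf.
  have [g ge _] := @gen_of_Hb 0 f L (leq0n _) hL.
  have /genE[v1 [v2 [d1 d2 e]]] := gen_flow t ge.
  have /genE[f1 [f2 [e1 e2 e']]] := ge.
  have [n0 [f1' e1' [n1 _]]] := hf; rewrite (D_unique e1' e1) in n1.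
  have cf (x : S) : nrm x <= K -> `|ip (M V x) x| <= c * K ^+ 2.
    move=> xK; rewrite (le_trans (cauchy_schwarz _ _))// expr2 mulrA ler_pM//.
    by rewrite (le_trans (M_bounded x bV))// ler_wpM2l.
  have h1 : ip v1 v1 <= (1 + c + c) * K ^+ 2.
    have q1 := D_skew d1 d2; have q2 := D_skew e1 e2.
    (* Conservation of energy. Integration by parts turns it into an identity between the squared
       norms of the first derivatives at times t and 0, up to two potential terms. *)
    have q3 : ip (U t g) (U t f) = ip g f by exact: flow_ip.
    rewrite e ipDl in q3; rewrite e' ipDl in q3.
    have q4 := cf (U t f); rewrite flow_nrm in q4; have {}q4 := q4 n0.
    have q5 := cf f n0.
    have q6 : ip f1 f1 <= K ^+ 2 by rewrite -nrm_le2.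
    rewrite q1 [ip _ v2]ipC; rewrite [ip f f2]ipC in q2.
    have := ler_norm (- ip (M V f) f); have := ler_norm (ip (M V (U t f)) (U t f)).
    rewrite normrN; rewrite q2 in q6.
    move: q3 q4 q5 q6; move: (ip v2 _) (ip f2 f) (ip (M V _) _) (ip (M V f) f) (K ^+ 2) => *.
    lra.
  apply: HbI d1 _.
    by rewrite flow_nrm (le_trans n0)// ler_peMl// -addrA lerDl addr_ge0.
  split => //; rewrite nrm_le2 ?mulr_ge0 ?addr_ge0// (le_trans h1)// exprMn ler_wpM2r ?exprn_ge0//.
  by rewrite expr2 ler_peMl ?addr_ge0// -addrA lerDl addr_ge0.
- have [C C0 hC] := IH k (leqnSn _) (ltnW (ltnW ks)).
  have ks' : (k <= s)%N := ltnW ks.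
  have [B B0 hB] := Hb_of_gen ks'.
  have a0 : 0 <= 1 + 2 ^+ k * c by rewrite addr_ge0// mulr_ge0 ?exprn_ge0.
  have b0 : 0 <= 1 + C * (1 + 2 ^+ k * c) by rewrite addr_ge0// mulr_ge0.
  exists (B * (1 + C * (1 + 2 ^+ k * c))); first by rewrite mulr_ge0.
  move=> f K hf [L hL] t; have K0 := Hb_ge0 hf.
  have [g ge hg] := gen_of_Hb ks' hf.
  (* Since k + 2 <= s + 1, the even order above [k] is at most [s], within reach of the derivatives
     of [V]. *)
  have hg2 : exists L', H (uphalf k).*2 g L'.
    have uk : ((uphalf k).*2 <= s)%N by move: ks; rewrite uphalf_half; have := odd_double_half k; case: (odd k); lia.
    by have [g' ge' hg'] := gen_of_Hb uk hL; rewrite (gen_unique ge ge'); eexists; exact: hg'.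
  have hv := hC _ _ hg hg2 t; rewrite -mulrA.
  apply: hB (gen_flow t ge) _ _.
    by apply: HbW hv; rewrite mulrA mulrDl mul1r lerDr.
  by rewrite flow_nrm (le_trans (Hb_nrm hf))// ler_peMl// lerDl mulr_ge0.
Qed.

End SchroedingerRegularity.

(** * Growth of weighted norms *)

Section RealLemmas.
Context {R : realType}.
Implicit Types (w : nat -> R) (E B t : R).

Lemma convex_max n (u : nat -> R) : (forall b, (b.+1 < n)%N -> 2 * u b.+1 <= u b + u b.+2) ->
  forall b, (b <= n)%N -> u b <= Num.max (u 0%N) (u n).
Proof.
elim: n => [|n IH] h b; first by rewrite leqn0 => /eqP ->; rewrite maxxx.
have {}IH b' : (b' <= n)%N -> u b' <= Num.max (u 0%N) (u n).
  by apply: IH => b'' hb; exact: h (ltnW hb).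
have hn : u n <= Num.max (u 0%N) (u n.+1).
  case: n IH h => [|n] IH h; first by rewrite le_max lexx.
  have h1 := h n (ltnSn _); have := IH n (leqnSn _).
  by rewrite !le_max => /orP[h2|h2]; case: (lerP (u n.+1) (u 0%N)) => //= h3; lra.
rewrite leq_eqVlt => /orP[/eqP ->|/IH h1]; first by rewrite le_max lexx orbT.
by rewrite (le_trans h1)// ge_max hn le_max lexx.
Qed.

(** The arithmetic-geometric inequality turns the hypothesis into midpoint convexity of [w] up to an
    error [E]. Adding E b^2, whose second difference is 2E, makes the sequence convex, hence bounded
    by its end values. *)
Lemma interpolation_max n w E : 0 <= E -> (forall b, 0 <= w b) ->
  (forall b, (b.+1 < n)%N -> w b.+1 ^+ 2 <= w b * w b.+2 + E ^+ 2) ->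
  forall b, (b <= n)%N -> w b <= w 0%N + w n + E * n%:R ^+ 2.
Proof.
move=> E0 w0 h b bn.
have avg b' : (b'.+1 < n)%N -> w b'.+1 <= (w b' + w b'.+2) / 2 + E.
  move=> /h; have := w0 b'; have := w0 b'.+2; have := w0 b'.+1.
  move: (w b') (w b'.+1) (w b'.+2) => x y z y0 z0 x0 hh.
  rewrite leNgt; apply/negP => hlt.
  have q : ((x + z) / 2 + E) ^+ 2 < y ^+ 2 by rewrite ltr_pXn2r// nnegrE; lra.
  have : 0 <= (x - z) ^+ 2 by exact: sqr_ge0.
  have : 0 <= (x + z) * E by rewrite mulr_ge0 ?addr_ge0.
  nra.
pose u b := w b + E * b%:R ^+ 2.
have cu b' : (b'.+1 < n)%N -> 2 * u b'.+1 <= u b' + u b'.+2.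
  move=> /avg; rewrite /u -[b'.+2%:R]natr1 -[b'.+1%:R]natr1.
  move: (w b') (w b'.+1) (w b'.+2) (b'%:R) => x y z k; nra.
have := convex_max cu bn; rewrite /u expr0n/= mulr0 addr0 => h1.
have h2 : w b <= w b + E * b%:R ^+ 2 by rewrite lerDl mulr_ge0// exprn_ge0.
rewrite (le_trans h2)// (le_trans h1)// ge_max -addrA lerDl addr_ge0//=.
  by rewrite lerDr.
by rewrite mulr_ge0// exprn_ge0.
Qed.

(** With the integrating factor (1 + u)^-n, the quantity y(u) / (1 + u)^n - B u has nonpositive
    derivative for u >= 0. *)
Lemma growth_pos (y y' : R -> R) (n : nat) B t : 0 <= t -> 0 <= B -> 0 <= y 0 ->
  (forall u : R, is_derive u 1 y (y' u)) ->
  (forall u : R, 0 <= u -> y' u <= n%:R * (y u / (1 + u)) + B * (1 + u) ^+ n) ->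
  y t <= (1 + t) ^+ n.+1 * (y 0 + B).
Proof.
move=> t0 B0 y0 dy hy.
have tau0 (u : R) : 0 <= u -> 0 < 1 + u by move=> u0; rewrite ltr_wpDr.
have main : y t / (1 + t) ^+ n <= y 0 + B * t.
  pose F (u : R) := y u * ((1 + u) ^+ n)^-1 - B * u.
  pose F' (u : R) := y' u * ((1 + u) ^+ n)^-1 - y u * (n%:R / (1 + u) ^+ n.+1) - B.
  have dF (u : R) : 0 <= u -> is_derive u 1 F (F' u).
    move=> u0; have tu := tau0 _ u0.
    have d1 : is_derive u 1 (fun u : R => 1 + u) 1.
      apply: (is_derive_conv (is_deriveD (is_derive_cst (1 : R) u (1 : R)) (is_derive_id u (1 : R)))) => //.
      by rewrite add0r.
    have d2 : is_derive u 1 (fun u : R => (1 + u) ^+ n) (n%:R * (1 + u) ^+ n.-1).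
      apply: (is_derive_conv (is_deriveX n d1)) => [v|]; first by rewrite exprfctE.
      by rewrite /GRing.scale/= mulr1.
    have nz : (1 + u) ^+ n != 0 by rewrite gt_eqF ?exprn_gt0.
    have d3 := @is_deriveV _ (fun u : R => (1 + u) ^+ n) u _ _ nz d2.
    apply: (is_derive_conv (is_deriveB (is_deriveM (dy u) d3) (is_deriveZ B (is_derive_id u (1 : R))))) => [v|].
      by rewrite /F !fctE.
    rewrite /F' /GRing.scale/= mulr1; congr (_ - _); rewrite addrC mulrC; congr (_ + _).
    rewrite -mulrN; congr (_ * _).
    case: n nz {hy F F' d2 d3} => [|n] nz; first by rewrite !mul0r mulr0 oppr0.
    have u1 : 1 + u != 0 by rewrite gt_eqF.
    by rewrite /= !exprS; field; rewrite u1 expf_neq0.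
  have cF : {within `[0, t], continuous F}.
    apply: derivable_within_continuous => x; rewrite in_itv/= => /andP[x0 _].
    by have [] := dF x x0.
  have dF1 x : x \in `]0, t[%R -> is_derive x 1 F (F' x).
    by rewrite in_itv/= => /andP[x0 _]; apply: dF; exact: ltW.
  have [c] := MVT_segment t0 dF1 cF; rewrite in_itv/= => /andP[c0 ct] e.
  have : F t - F 0 <= 0.
    rewrite e subr0 mulr_le0_ge0// /F' subr_le0.
    have tc := tau0 _ c0; have p := exprn_gt0 n tc.
    rewrite lerBlDr ler_pdivrMr// (le_trans (hy c c0))//.
    rewrite [leRHS](_ : _ = n%:R * (y c / (1 + c)) + B * (1 + c) ^+ n)//.
    by rewrite exprS; field; rewrite !gt_eqF.
  rewrite /F mulr0 subr0 addr0 expr1n invr1 mulr1; lra.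
have pt := exprn_gt0 n (tau0 _ t0).
move: main; rewrite ler_pdivrMr// => /le_trans; apply; rewrite exprSr -mulrA mulrC.
rewrite ler_wpM2l ?(ltW pt)//.
have := mulr_ge0 y0 t0; nra.
Qed.

Lemma growth (y y' : R -> R) (n : nat) B t : 0 <= B -> 0 <= y 0 ->
  (forall u : R, is_derive u 1 y (y' u)) ->
  (forall u : R, `|y' u| <= n%:R * (y u / (1 + `|u|)) + B * (1 + `|u|) ^+ n) ->
  y t <= (1 + `|t|) ^+ n.+1 * (y 0 + B).
Proof.
move=> B0 y0 dy hy; case: (lerP 0 t) => t0.
  rewrite ger0_norm//; apply: (growth_pos t0 B0 y0 dy) => u u0.
  by rewrite (le_trans (ler_norm _))// (le_trans (hy u))// ger0_norm.
pose z u := y (- u).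
have -> : y t = z (- t) by rewrite /z opprK.
have -> : y 0 = z 0 by rewrite /z oppr0.
rewrite ltr0_norm//; apply: (@growth_pos z (fun u => - y' (- u)) n B (- t)) => //; first by rewrite oppr_ge0 ltW.
- by rewrite /z oppr0.
- move=> u.
  have dn : is_derive u 1 (fun u : R => - u) (-1).
    exact: is_deriveN.
  apply: (is_derive_conv (@is_derive1_comp _ y (fun u : R => - u) u _ _ (dy (- u)) dn)) => //.
  by rewrite mulrN1.
- move=> u u0; rewrite (le_trans (ler_norm _))// normrN (le_trans (hy _))//.
  by rewrite normrN ger0_norm.
Qed.

End RealLemmas.

(** * Bounded approximations of the position *)

Section RegularizedWeight.
Context {R : realType}.
Implicit Types (e x : R).

(** A bounded substitute for x that is dominated by x and has slope at most 1 whatever [e] is; the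
    slope differs from 1 by at most 3 e |x|. These uniform facts let [e] tend to 0 in the
    estimates. *)
Definition xi e x := x / (1 + e ^+ 2 * x ^+ 2).
Definition xi' e x := (1 - e ^+ 2 * x ^+ 2) / (1 + e ^+ 2 * x ^+ 2) ^+ 2.

Lemma xi_den e x : 0 < 1 + e ^+ 2 * x ^+ 2.
Proof. by rewrite -exprMn ltr_wpDr// sqr_ge0. Qed.

Lemma xi_is_derive e x : is_derive x 1 (xi e) (xi' e x).
Proof.
have d0 := xi_den e x.
have i1 := is_derive_id x (1 : R).
have d1 := is_deriveD (is_derive_cst (1 : R) x (1 : R)) (is_deriveZ (e ^+ 2) (is_deriveM i1 i1)).
have nz : (cst 1 + e ^+ 2 \*: (id * id)) x != 0 :> R by rewrite !fctE /GRing.scale/= -expr2 gt_eqF.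
apply: (is_derive_conv (is_deriveM i1 (is_deriveV nz d1))) => [v|].
  by rewrite !fctE /GRing.scale/= -expr2.
rewrite !fctE /GRing.scale/= -expr2 /xi' -[_ *: _]/(e ^+ 2 * x ^+ 2).
have := gt_eqF d0; move: (e ^+ 2) => a /negbT nz'; field.
exact: nz'.
Qed.

Lemma xi_le e x : `|xi e x| <= `|x|.
Proof.
rewrite /xi normrM normfV (gtr0_norm (xi_den e x)) ler_pdivrMr ?xi_den//.
by rewrite ler_peMr// lerDl -exprMn sqr_ge0.
Qed.

Lemma xi_bounded e x : 0 < e -> `|xi e x| <= e^-1.
Proof.
move=> e0; rewrite /xi normrM normfV (gtr0_norm (xi_den e x)) ler_pdivrMr ?xi_den//.
rewrite ler_pdivlMl// -exprMn -(real_normK (num_real (e * x))) normrM (gtr0_norm e0).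
by move: (e * `|x|) => z; have := sqr_ge0 (2 * z - 1); nra.
Qed.

Lemma xi'_le1 e x : `|xi' e x| <= 1.
Proof.
rewrite /xi' normrM normfV normrX (gtr0_norm (xi_den e x)) ler_pdivrMr ?exprn_gt0 ?xi_den// mul1r.
rewrite -exprMn; move: ((e * x) ^+ 2) (sqr_ge0 (e * x)) => z z0.
by rewrite ler_norml; apply/andP; split; nra.
Qed.

Lemma xi'_sub1 e x : 0 <= e -> `|xi' e x - 1| <= 3 * e * `|x|.
Proof.
move=> e0.
have -> : xi' e x - 1 = - ((3 + (e * x) ^+ 2) * (e * x) ^+ 2 / (1 + (e * x) ^+ 2) ^+ 2).
  have := gt_eqF (xi_den e x); rewrite /xi' -exprMn => /negbT h; field; exact: h.
have -> : 3 * e * `|x| = 3 * `|e * x| by rewrite normrM ger0_norm// mulrA.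
rewrite normrN; have := normr_ge0 (e * x); rewrite -[(e * x) ^+ 2](real_normK (num_real _)).
move: `|e * x| => z z0.
rewrite ger0_norm; last by rewrite divr_ge0 ?mulr_ge0 ?addr_ge0 ?sqr_ge0.
rewrite ler_pdivrMr ?exprn_gt0 ?ltr_wpDr ?sqr_ge0// -subr_ge0.
(* A sum-of-squares form of 3 z^4 - z^3 + 6 z^2 - 3 z + 3, which is 3 (1 + z^2)^2 - (3 + z^2) z. *)
rewrite (_ : _ - _ = z * (3 * (z ^+ 2 - z / 6) ^+ 2 + 3 * (z - 2^-1) ^+ 2 + (35 / 12 * z ^+ 2 + 9 / 4))); last by field.
rewrite mulr_ge0//; have := sqr_ge0 (z ^+ 2 - z / 6); have := sqr_ge0 (z - 2^-1).
by have := sqr_ge0 z; lra.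
Qed.

Lemma xi_cvg x : xi n.+1%:R^-1 x @[n --> \oo] --> x.
Proof.
rewrite -[X in _ --> X](divr1 x); apply: cvgM; first exact: cvg_cst.
apply: cvgV; first exact: oner_neq0.
rewrite -[X in _ --> X]addr0; apply: cvgD; first exact: cvg_cst.
rewrite -(mul0r (x ^+ 2)); apply: cvgM; last exact: cvg_cst.
rewrite (_ : (fun n => _) = (fun n : nat => n.+1%:R^-1 * n.+1%:R^-1 : R)); last exact/funext.
by rewrite -(mulr0 0); apply: cvgM; exact: cvg_harmonic.
Qed.

Lemma xi_cvgX k x : xi n.+1%:R^-1 x ^+ k @[n --> \oo] --> x ^+ k.
Proof.
elim: k => [|k IH].
  rewrite expr0 (_ : (fun n => _) = fun=> 1); first exact: cvg_cst.
  by apply/funext => n; rewrite expr0.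
rewrite exprS (_ : (fun n => _) = (fun n => xi n.+1%:R^-1 x * xi n.+1%:R^-1 x ^+ k)).
  by apply: cvgM; [exact: xi_cvg|exact: IH].
by apply/funext => n; rewrite exprS.
Qed.

End RegularizedWeight.

(** * Commutators and interpolation with powers of a bounded weight *)

Section BoundedWeights.
Context {R : realType} {S : calculus R} (w w' : R -> R) (B : R).
Hypothesis wd : forall x : R, is_derive x 1 w (w' x).
Hypothesis wB : forall x : R, `|w x| <= B.
Hypothesis w1 : forall x : R, `|w' x| <= 1.
Local Notation H := (Hb (@D _ S)).
Implicit Types (u v : S) (K L : R).

Definition pw n (x : R) : R := w x ^+ n.
(** Up to the factor n + 1, the commutator of the derivative with the (n+1)-st power of the
    weight. *)
Definition qw n (x : R) : R := w x ^+ n * w' x.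

Lemma measurable_w : measurable_fun (setT : set R) w.
Proof. by apply: derivable_measurable => x; have [] := wd x. Qed.

Lemma measurable_w' : measurable_fun (setT : set R) w'.
Proof.
rewrite (_ : w' = derive1 w); last by apply/funext => x; rewrite (is_derive1E (wd x)).
by apply: derive1_measurable => x; have [] := wd x.
Qed.

Lemma B_ge0 : 0 <= B.
Proof. by rewrite (le_trans _ (wB 0)). Qed.

Lemma pw_bounded n : bounded_by (B ^+ n) (pw n).
Proof.
split; first by apply: measurable_funX; exact: measurable_w.
by move=> x; rewrite /pw normrX lerXn2r ?nnegrE ?B_ge0.
Qed.

Lemma qw_bounded n : bounded_by (B ^+ n) (qw n).
Proof.
split; first by apply: measurable_funM; [apply: measurable_funX; exact: measurable_w|exact: measurable_w'].
move=> x; rewrite /qw normrM -[leRHS]mulr1 ler_pM// normrX lerXn2r ?nnegrE ?B_ge0//.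
Qed.

Local Notation P n := (@M R S (pw n)).
Local Notation Q n := (@M R S (qw n)).

Lemma Q_le n v : nrm (Q n v) <= nrm (P n v).
Proof.
have := @M_le R S 1 (qw n) (pw n) v ler01 (qw_bounded n).1 _ (dM_bounded v (pw_bounded n)).
rewrite !mul1r; apply=> x; rewrite mul1r /qw normrM ler_piMr//.
Qed.

Lemma P0 v : P 0 v = v.
Proof. by rewrite (_ : pw 0 = fun=> 1) ?M_1//; apply/funext => x; rewrite /pw expr0. Qed.

Lemma ip_PD m n u v : ip (P (m + n) u) v = ip (P m u) (P n v).
Proof.
have b := pw_bounded; rewrite -M_sym; first last.
- exact: dM_bounded (b n).
- exact: dM_bounded (b n).
- exact: (b n).1.
rewrite M_comp; first last.
- by apply: (dM_bounded (c := B ^+ n * B ^+ m)); split;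
    [apply: measurable_funM; [exact: (b n).1|exact: (b m).1]|move=> x; rewrite normrM ler_pM// ?(b n).2// (b m).2].
- exact: dM_bounded (b m).
- exact: (b n).1.
by congr (ip (M _ _) _); apply/funext => x; rewrite /pw exprD mulrC.
Qed.

Lemma ip_QD m n u v : ip (Q (m + n) u) v = ip (Q m u) (P n v).
Proof.
have b := pw_bounded; have b' := qw_bounded; rewrite -M_sym; first last.
- exact: dM_bounded (b n).
- exact: dM_bounded (b n).
- exact: (b n).1.
rewrite M_comp; first last.
- by apply: (dM_bounded (c := B ^+ n * B ^+ m)); split;
    [apply: measurable_funM; [exact: (b n).1|exact: (b' m).1]|move=> x; rewrite normrM ler_pM// ?(b n).2// (b' m).2].
- exact: dM_bounded (b' m).
- exact: (b n).1.
by congr (ip (M _ _) _); apply/funext => x; rewrite /pw /qw exprD -mulrA mulrCA.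
Qed.

Lemma D_P n v v' : D v v' -> D (P n.+1 v) (n.+1%:R *: Q n v + P n.+1 v').
Proof.
move=> h; have dp (x : R) : is_derive x 1 (pw n.+1) (n.+1%:R * qw n x).
  apply: (is_derive_conv (is_deriveX n.+1 (wd x))) => [y|]; first by rewrite exprfctE.
  by rewrite /GRing.scale/= /qw mulrA.
have e : derive1 (pw n.+1) = (fun x => n.+1%:R * qw n x).
  by apply/funext => x; exact: is_derive1E.
have hd (x : R) : derivable (pw n.+1) x 1 by have [] := dp x.
have hb (x : R) : `|derive1 (pw n.+1) x| <= n.+1%:R * B ^+ n.
  by rewrite e normrM ger0_norm// ler_wpM2l// (qw_bounded n).2.
have := D_M hd (pw_bounded n.+1) hb h.
by rewrite e M_scale//; exact: dM_bounded (qw_bounded n).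
Qed.

(** Integrating by parts in the squared norm of w^(a+1) v1 moves the derivative to give the product
    of the neighbours plus 2a + 2 commutator terms. The powers of [l] follow those of [w]; the
    commutator term has one power of [l] to spare, harmless as l <= 1. *)
Lemma interp_step a (l : R) L (v0 v1 v2 : S) : 0 <= l -> l <= 1 -> D v0 v1 -> D v1 v2 ->
  l ^+ a * nrm (P a v1) <= L -> l ^+ a.+1 * nrm (P a.+1 v0) <= L ->
  (l ^+ a.+1 * nrm (P a.+1 v1)) ^+ 2 <=
  (l ^+ a.+2 * nrm (P a.+2 v0)) * (l ^+ a * nrm (P a v2)) + (a + a.+1).+1%:R * L ^+ 2.
Proof.
move=> l0 l1 d0 d1 h1 h2; set k := (a + a.+1).+1.
have e : nrm (P a.+1 v1) ^+ 2 = - ip (P a v2) (P a.+2 v0) - k%:R * ip (Q a v1) (P a.+1 v0).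
  have d := D_skew d0 (D_P (a + a.+1) d1).
  rewrite -ipff -ip_PD addSn -[a.+1 in X in X.+1]/(a.+1) ipC d ipDr ipZr.
  rewrite opprD [RHS]addrC; congr (- (_ * _) - _); first by rewrite ipC ip_QD.
  by rewrite ipC -ip_PD !addnS.
rewrite exprMn e mulrBr.
have -> : (l ^+ a.+1) ^+ 2 = l ^+ a.+2 * l ^+ a by rewrite -!exprD -exprM; congr (_ ^+ _); lia.
have q1 : - ip (P a v2) (P a.+2 v0) <= nrm (P a.+2 v0) * nrm (P a v2).
  by rewrite (le_trans (ler_norm _))// normrN mulrC cauchy_schwarz.
have q2 : - ip (Q a v1) (P a.+1 v0) <= nrm (P a v1) * nrm (P a.+1 v0).
  by rewrite (le_trans (ler_norm _))// normrN (le_trans (cauchy_schwarz _ _))// ler_wpM2r// Q_le.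
have la : 0 <= l ^+ a.+2 * l ^+ a := mulr_ge0 (exprn_ge0 _ l0) (exprn_ge0 _ l0).
apply: lerD; first by rewrite [leRHS]mulrACA; apply: ler_wpM2l q1.
rewrite -mulrN -mulrN mulrCA ler_wpM2l//.
apply: le_trans (ler_wpM2l la q2) _.
have -> : l ^+ a.+2 * l ^+ a * (nrm (P a v1) * nrm (P a.+1 v0)) =
   l * ((l ^+ a * nrm (P a v1)) * (l ^+ a.+1 * nrm (P a.+1 v0))) by rewrite !exprS; ring.
have p0 : 0 <= l ^+ a * nrm (P a v1) by rewrite mulr_ge0 ?exprn_ge0.
have p1 : 0 <= l ^+ a.+1 * nrm (P a.+1 v0) by rewrite mulr_ge0 ?exprn_ge0.
apply: le_trans (ler_piMl (mulr_ge0 p0 p1) l1) _.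
by rewrite expr2; apply: ler_pM.
Qed.

(** Pointwise z^n <= z^(n+1) + 1 for z = |l w|. *)
Lemma weight_drop n (l : R) v : 0 <= l -> l ^+ n * nrm (P n v) <= l ^+ n.+1 * nrm (P n.+1 v) + nrm v.
Proof.
move=> l0; have b k := dM_bounded v (pw_bounded k).
have e k : l ^+ k * nrm (P k v) = nrm (M (fun x => l ^+ k * pw k x) v).
  by rewrite M_scale// nrmZ ger0_norm ?exprn_ge0.
pose m (x : R) := `|l ^+ n.+1 * pw n.+1 x|.
have mm k : measurable_fun (setT : set R) (fun x => l ^+ k * pw k x).
  by apply: measurable_funM => //; exact: (pw_bounded k).1.
have mm' : measurable_fun (setT : set R) m by exact: measurableT_comp.
have dm' : dM m v.
  apply: (@dM_le _ _ 1 m _ _ ler01 mm' _ (dM_scale (l ^+ n.+1) (b n.+1))) => x.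
  by rewrite /m normr_id mul1r.
have h1 : nrm (M m v) <= l ^+ n.+1 * nrm (P n.+1 v).
  rewrite e -[leRHS]mul1r; apply: (M_le ler01 mm' _ (dM_scale (l ^+ n.+1) (b n.+1))) => x.
  by rewrite /m normr_id mul1r.
have d1 : dM (fun=> 1) v by apply: (@dM_bounded _ _ 1); split => // x; rewrite normr1.
have h2 : nrm (M (fun x => m x + 1) v) <= l ^+ n.+1 * nrm (P n.+1 v) + nrm v.
  by rewrite M_add// (le_trans (nrmD_le _ _))// M_1 lerD2r.
rewrite e (le_trans _ h2)// -[leRHS]mul1r; apply: (M_le ler01 (mm n) _ (dM_add dm' d1)) => x.
rewrite mul1r [`|m x + 1|]ger0_norm ?addr_ge0 ?normr_ge0// /m /pw -!exprMn !normrX.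
move: `|l * w x| (normr_ge0 (l * w x)) => z z0; case: (lerP z 1) => z1.
  by rewrite (le_trans (exprn_ile1 n z0 z1))// lerDr; exact: exprn_ge0.
by rewrite (le_trans (ler_weXn2l (ltW z1) (leqnSn n)))// lerDl.
Qed.

End BoundedWeights.

Section Interpolation.
Context {R : realType} {S : calculus R}.
Implicit Types (w : R -> R) (B K l : R).

(** Mixed norms, with [a] weights and [b] derivatives on the diagonal a + b = s, are controlled by
    the pure weight and the pure derivatives. Commutators fall on the previous diagonal, already
    bounded by induction. The constant depends on [s] only, neither on the bound [B] of the weight
    nor on the scale [l]. *)
Lemma interpolation s : exists2 C : R, 0 <= C & forall w w' B (v : nat -> S) K l,
  (forall x : R, is_derive x 1 w (w' x)) -> (forall x : R, `|w x| <= B) ->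
  (forall x : R, `|w' x| <= 1) -> 0 <= l -> l <= 1 ->
  (forall b, (b < s)%N -> D (v b) (v b.+1)) -> (forall b, (b <= s)%N -> nrm (v b) <= K) ->
  forall a b, (a + b = s)%N ->
    l ^+ a * nrm (M (pw w a) (v b)) <= C * (l ^+ s * nrm (M (pw w s) (v 0%N)) + K).
Proof.
elim: s => [|s [C C0 IH]].
  exists 1 => // w w' B v K l _ _ _ _ _ _ hK a b /eqP; rewrite addn_eq0 => /andP[/eqP -> /eqP ->].
  by rewrite mul1r lerDl (le_trans _ (hK 0%N _)).
pose k : R := (s + s.+1).+1%:R; have k1 : 1 <= k by rewrite ler1n.
exists (1 + (k * (2 * C)) * s.+1%:R ^+ 2).
  by rewrite addr_ge0// !mulr_ge0 ?exprn_ge0.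
move=> w w' B v K l wd wB w1 l0 l1 hD hK.
have K0 : 0 <= K by rewrite (le_trans _ (hK 0%N _)).
set X := l ^+ s.+1 * _.
have X0 : 0 <= X by rewrite mulr_ge0 ?exprn_ge0.
have h a b : (a + b = s)%N -> l ^+ a * nrm (M (pw w a) (v b)) <= 2 * C * (X + K).
  move=> ab; have hD' b' : (b' < s)%N -> D (v b') (v b'.+1) by move=> h; apply: hD; exact: ltnW.
  have hK' b' : (b' <= s)%N -> nrm (v b') <= K by move=> h; apply: hK; exact: leqW.
  rewrite (le_trans (IH w w' B v K l wd wB w1 l0 l1 hD' hK' a b ab))//.
  rewrite [2 * C]mulrC -mulrA ler_wpM2l//.
  have := weight_drop wd wB s (v 0%N) l0; have := hK 0%N isT.
  by rewrite -/X; move: (l ^+ s * _) => z; lra.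
pose N b := l ^+ (s.+1 - b) * nrm (M (pw w (s.+1 - b)) (v b)).
have N0 b : 0 <= N b by rewrite mulr_ge0 ?exprn_ge0.
(* Since k >= 1, the square of [E] dominates [k] times the square of the lower-diagonal bound, and
   [k] dominates every commutator coefficient. *)
pose E := k * (2 * C * (X + K)).
have E0 : 0 <= E by rewrite !mulr_ge0 ?addr_ge0 ?(le_trans ler01 k1).
have hN b : (b.+1 < s.+1)%N -> N b.+1 ^+ 2 <= N b * N b.+2 + E ^+ 2.
  rewrite ltnS => bs; rewrite /N.
  have -> : (s.+1 - b = (s - b.+1).+2)%N by lia.
  have -> : (s.+1 - b.+1 = (s - b.+1).+1)%N by lia.
  have -> : (s.+1 - b.+2 = s - b.+1)%N by lia.
  have h1 : (s - b.+1 + b.+1 = s)%N by lia.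
  have h2 : ((s - b.+1).+1 + b = s)%N by lia.
  have b1 : (b < s.+1)%N by lia.
  have b2 : (b.+1 < s.+1)%N by lia.
  have := interp_step wd wB w1 l0 l1 (hD _ b1) (hD _ b2) (h _ _ h1) (h _ _ h2).
  move/le_trans; apply; rewrite lerD2l /E [leRHS]exprMn ler_wpM2r ?sqr_ge0//.
  rewrite (@le_trans _ _ k)// ?ler_nat; first by lia.
  by rewrite expr2 ler_peMl// (le_trans ler01).
move=> a b ab.
have bs : (b <= s.+1)%N by rewrite -ab leq_addl.
have -> : a = (s.+1 - b)%N by rewrite -ab addnK.
have := interpolation_max E0 N0 hN bs.
rewrite {3}/N subnn expr0 mul1r P0 {2}/N subn0 -/X => /le_trans; apply.
rewrite mulrDl mul1r /E lerD ?lerD2l ?hK//.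
by rewrite [leRHS](_ : _ = k * (2 * C * (X + K)) * s.+1%:R ^+ 2)//; ring.
Qed.

End Interpolation.

Lemma Hb_chain {R : realType} {T : hilbertType R} (A : T -> T -> Prop) k x K : Hb A k x K ->
  exists v : nat -> T, [/\ v 0%N = x, forall b, (b < k)%N -> A (v b) (v b.+1) &
    forall b, (b <= k)%N -> nrm (v b) <= K].
Proof.
elim: k x => [|k IH] x [h1 h2]; first by exists (fun=> x); split => // b; rewrite leqn0.
have [x' xx' /IH[v [v0 v1 v2]]] := h2.
exists (fun b => if b is b'.+1 then v b' else x).
split => //; last by case.
by case => [_|b hb]; [rewrite v0|exact: v1].
Qed.

(** [Y] is inserted from its interpolation bound at scale d / tau. By the choice of [d] the
    quadratic part is at most half of X^2 / tau, and Young's inequality puts half of X^2 / tau under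
    the linear part, leaving a multiple of K^2 tau^(2n+1). *)
Lemma growth_rate {R : realType} (n : nat) (a C K X Y tau d : R) :
  0 <= a -> 0 <= C -> 0 <= X -> 0 < tau -> 0 < d -> a * C * d <= 2^-1 ->
  (d / tau) ^+ n * Y <= C * ((d / tau) ^+ n.+1 * X + K) ->
  a * (X * Y) <= X ^+ 2 / tau + (a * C) ^+ 2 / 2 * d^-1 ^+ (n + n) * K ^+ 2 * tau ^+ (n + n).+1.
Proof.
move=> a0 C0 X0 t0 d0 ad h.
have l0 : 0 < d / tau by rewrite divr_gt0.
have p0 : 0 < (d / tau) ^+ n by rewrite exprn_gt0.
pose m := a * C * K / (d / tau) ^+ n.
have hY : Y <= C * (d / tau * X) + C * K / (d / tau) ^+ n.
  rewrite -(ler_pM2l p0) (le_trans h)// exprSr.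
  rewrite [leRHS](_ : _ = C * ((d / tau) ^+ n * (d / tau) * X + K))//.
  by field; rewrite !gt_eqF// expf_neq0// gt_eqF.
have -> : (a * C) ^+ 2 / 2 * d^-1 ^+ (n + n) * K ^+ 2 * tau ^+ (n + n).+1 = tau * m ^+ 2 / 2.
  have e1 : d^-1 ^+ (n + n) = (d ^+ n)^-1 * (d ^+ n)^-1 by rewrite exprD exprVn.
  have e2 : tau ^+ (n + n).+1 = tau * (tau ^+ n * tau ^+ n) by rewrite exprS exprD.
  rewrite e1 e2 /m [(d / tau) ^+ n]expr_div_n.
  have : d ^+ n != 0 by rewrite expf_neq0// gt_eqF.
  have : tau ^+ n != 0 by rewrite expf_neq0// gt_eqF.
  by move: (d ^+ n) (tau ^+ n) => y z y0 z0; field; rewrite y0 z0.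
have h1 : m * X <= X ^+ 2 / tau / 2 + tau * m ^+ 2 / 2.
  rewrite -(ler_pM2l t0) [leRHS](_ : _ = (X ^+ 2 + (tau * m) ^+ 2) / 2); last by field; rewrite gt_eqF.
  by have := sqr_ge0 (X - tau * m); nra.
have h2 : a * C * (d / tau) * X ^+ 2 <= X ^+ 2 / tau / 2.
  rewrite [leLHS](_ : _ = a * C * d * (X ^+ 2 / tau)); last by ring.
  by rewrite [leRHS]mulrC ler_wpM2r// divr_ge0 ?sqr_ge0 ?ltW.
have h3 : a * (X * Y) <= a * (X * (C * (d / tau * X) + C * K / (d / tau) ^+ n)).
  by rewrite ler_wpM2l// ler_wpM2l.
have h4 : a * (X * (C * (d / tau * X) + C * K / (d / tau) ^+ n)) = a * C * (d / tau) * X ^+ 2 + m * X.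
  by rewrite /m; ring.
by lra.
Qed.

(** * Energy estimates for weighted norms along the flow *)

Section WeightGrowth.
Context {R : realType} {S : calculus R} (U : evolution S) (V : R -> R) (c : R).
Hypothesis bV : bounded_by c V.
Hypothesis genE : forall f g : S, gen U f g <-> exists f1 f2, [/\ D f f1, D f1 f2 & g = f2 + M V f].
Local Notation H := (Hb (@D _ S)).
Implicit Types (f g v : S) (K L t : R).

Section fixed_weight.
Variables (w w' : R -> R) (B : R).
Hypothesis wd : forall x : R, is_derive x 1 w (w' x).
Hypothesis wB : forall x : R, `|w x| <= B.
Hypothesis w1 : forall x : R, `|w' x| <= 1.
Local Notation P n := (@M R S (pw w n)).

Lemma weight_sder n f g t : gen U f g ->
  is_derive t 1 (fun t => nrm (P n (U t f)) ^+ 2) (2 * ip (P (n + n) (U t f)) (J (U t g))).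
Proof.
move=> h; have b := pw_bounded wd wB; have hs := flow_sder t h.
have dmP k v := dM_bounded v (b k).
have hs' : sder ((fun v => P (n + n) v) \o (fun t => U t f)) t (P (n + n) (J (U t g))).
  apply: (@sder_lip _ _ _ (B ^+ (n + n))) hs => [x y|a x|x].
  - by rewrite MB//; exact: (b _).1.
  - by rewrite MZ//; exact: (b _).1.
  - exact: M_bounded.
apply: (is_derive_conv (sder_ip hs' hs)) => [u|]; first by rewrite /= (ip_PD wd wB) ipff.
rewrite /= M_sym//; last exact: (b _).1.
by rewrite [ip (J _) _]ipC mulr_natl mulr2n.
Qed.

(** The potential contributes nothing by [M_J_ip0]. In the Laplacian term one integration by parts
    leaves a vanishing form of v1 with J v1 and the commutator, whose coefficient 2n + 2, doubled,
    gives 4 (n + 1). *)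
Lemma weight_derivative_bound n f v : (exists g, gen U f g) -> D f v ->
  forall g, gen U f g ->
  `|2 * ip (P (n.+1 + n.+1) f) (J g)| <= (4 * n.+1%:R) * (nrm (P n.+1 f) * nrm (P n v)).
Proof.
move=> _ dv g /genE[v1 [v2 [d1 d2 ->]]]; rewrite (D_unique dv d1) {v dv}.
have b := pw_bounded wd wB; have dmP k v := dM_bounded v (b k).
rewrite JD ipDr.
have -> : ip (P (n.+1 + n.+1) f) (J (M V f)) = 0.
  rewrite -M_J; [|exact: bV.1|exact: dM_bounded bV].
  rewrite -M_sym; [|exact: bV.1|exact: dM_bounded bV|exact: dM_bounded bV].
  have bb : bounded_by (c * B ^+ (n.+1 + n.+1)) (fun x => V x * pw w (n.+1 + n.+1) x).
    split; first by apply: measurable_funM; [exact: bV.1|exact: (b _).1].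
    by move=> x; rewrite normrM ler_pM// ?bV.2// (b _).2.
  rewrite M_comp; [|exact: bV.1|exact: dmP|exact: dM_bounded bb].
  by rewrite M_J_ip0//; [exact: bb.1|exact: dM_bounded bb].
have e : ip (P (n.+1 + n.+1) f) (J v2) = - ((n.+1 + n.+1)%:R * ip (M (qw w w' n) (J v1)) (P n.+1 f)).
  have d := D_skew (D_P wd wB w1 (n + n.+1) d1) (D_J d2).
  have b1 := qw_bounded wd wB w1 (n + n.+1).
  have e1 : ip (M (pw w (n + n.+1).+1) v1) (J v1) = 0 by rewrite M_J_ip0//; exact: (b _).1.
  rewrite ipDl ipZl e1 addr0 in d; rewrite addSn -[LHS]opprK -d; congr (- (_ * _)).
  rewrite M_sym; [|exact: b1.1|exact: dM_bounded b1|exact: dM_bounded b1].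
  by rewrite ipC (ip_QD wd wB w1).
rewrite e add0r addr0 || rewrite e addr0.
rewrite mulrN normrN 2!normrM !(ger0_norm (ler0n _ _)) natrD mulrA.
have h := Q_le wd wB w1 n (J v1).
have e2 : nrm (P n (J v1)) = nrm (P n v1).
  by rewrite M_J ?J_nrm//; exact: (b n).1.
rewrite e2 in h.
have h2 := cauchy_schwarz (M (qw w w' n) (J v1)) (P n.+1 f).
rewrite (_ : 2 * (n.+1%:R + n.+1%:R) = 4 * n.+1%:R); last by ring.
rewrite ler_wpM2l ?mulr_ge0// (le_trans h2)// mulrC.
by apply: ler_wpM2l => //; exact: nrm_ge0.
Qed.

End fixed_weight.

(** The squared norm with weight w^(n+1) is differentiated; the factor w^n D U t f that appears is
    interpolated between weight and derivatives, which leads to the differential inequality of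
    [growth]. All constants are independent of the bounded weight, so Fatou reaches the true power
    of x. *)
Lemma weighted_growth n : exists2 C : R, 0 <= C & forall f K,
  (forall t, H n.+1 (U t f) K) -> (exists L, H 2 f L) -> dM (powx n.+1) f ->
  forall t, dM (powx n.+1) (U t f) /\
    nrm (M (powx n.+1) (U t f)) <= C * (nrm (M (powx n.+1) f) + K) * (1 + `|t|) ^+ n.+1.
Proof.
have [C0 C00 hC0] := @interpolation R S n.+1.
(* Small enough that 4 s C0 d <= 1/2, as [growth_rate] requires, and at most 1 so that the
   interpolation scale does not exceed 1. *)
pose s := n.+1; pose d : R := (8 * s%:R * C0 + 1)^-1.
have k0 : 0 <= 8 * s%:R * C0 by rewrite !mulr_ge0.
have d0 : 0 < d by rewrite invr_gt0 ltr_wpDl.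
have d1 : d <= 1 by rewrite invf_le1 ?ltr_wpDl// lerDr.
pose B0 := (4 * s%:R * C0) ^+ 2 / 2 * (d^-1) ^+ (n + n).
have B00 : 0 <= B0 by rewrite mulr_ge0// ?divr_ge0 ?sqr_ge0// exprn_ge0// invr_ge0 ltW.
have key (w w' : R -> R) B f K : (forall x : R, is_derive x 1 w (w' x)) ->
    (forall x : R, `|w x| <= B) -> (forall x : R, `|w' x| <= 1) ->
    (forall t, H n.+1 (U t f) K) -> (exists g, gen U f g) -> forall t,
    nrm (M (pw w s) (U t f)) ^+ 2 <=
    (1 + `|t|) ^+ (n + n).+2 * (nrm (M (pw w s) f) ^+ 2 + B0 * K ^+ 2).
  move=> wd wB w1 hK [g fg] t; have K0 := Hb_ge0 (hK 0).
  have := @growth R (fun t => nrm (M (pw w s) (U t f)) ^+ 2)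
    (fun t => 2 * ip (M (pw w (s + s)) (U t f)) (J (U t g))) (n + n).+1 (B0 * K ^+ 2) t.
  rewrite flow_0; apply.
  - by rewrite mulr_ge0 ?sqr_ge0.
  - by rewrite sqr_ge0.
  - by move=> u; exact: (weight_sder wd wB s u fg).
  move=> u; have [_ [v1 dv hv]] := hK u.
  have ex : exists g, gen U (U u f) g by exists (U u g); exact: gen_flow.
  have := @weight_derivative_bound w w' B wd wB w1 n (U u f) v1 ex dv _ (gen_flow u fg).
  move=> /le_trans; apply.
  pose tau := 1 + `|u|; have t0 : 0 < tau by rewrite ltr_wpDr.
  have t1 : 1 <= tau by rewrite lerDl.
  have l0 : 0 <= d / tau by rewrite divr_ge0// ltW.
  have l1 : d / tau <= 1 by rewrite ler_pdivrMr// mul1r (le_trans d1).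
  have [v [v0 vD vK]] := Hb_chain (hK u).
  have v1E : v 1%N = v1 by have := vD 0%N isT; rewrite v0 => /D_unique; apply.
  (* Interpolation at the scale of the expected size of x at time u, with exactly one derivative. *)
  have hI := hC0 w w' B v K (d / tau) wd wB w1 l0 l1 vD vK n 1%N (addn1 n).
  rewrite v0 v1E in hI.
  have ad : 4 * n.+1%:R * C0 * d <= 2^-1.
    rewrite /d ler_pdivrMr ?ltr_wpDl// /s.
    by rewrite mulrDr mulr1 [leRHS](_ : _ = 4 * n.+1%:R * C0 + 2^-1) ?lerDl//; field.
  have := growth_rate (mulr_ge0 (ler0n _ 4) (ler0n _ n.+1)) C00 (nrm_ge0 _) t0 d0 ad hI.
  (* The coefficient 1 of y / (1 + |u|) is enlarged to 2n + 1 so that it matches the power in the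
     forcing term of [growth]. *)
  move=> /le_trans; apply; rewrite -/tau lerD2r ler_peMl ?ler1n//.
  by rewrite divr_ge0 ?sqr_ge0// ltW.
have w0 := wcst_ge0 S.
exists (wcst S * (1 + B0)); first by rewrite mulr_ge0// addr_ge0.
move=> f K hK [L hL] wf t; have K0 := Hb_ge0 (hK 0).
have [_ [f1 d1' [_ [f2 d2 _]]]] := hL.
have gf : exists g, gen U f g by exists (f2 + M V f); apply/genE; exists f1, f2.
pose e (j : nat) : R := j.+1%:R^-1.
have e0 j : 0 < e j by rewrite invr_gt0.
have xb j (x : R) : `|xi (e j) x| <= (e j)^-1 by exact: xi_bounded.
pose b := (1 + `|t|) ^+ n.+1 * (nrm (M (powx n.+1) f) + (1 + B0) * K).
have b0 : 0 <= b by rewrite mulr_ge0 ?exprn_ge0 ?addr_ge0 ?mulr_ge0 ?addr_ge0.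
have hb j : nrm (M (pw (xi (e j)) n.+1) (U t f)) <= b.
  rewrite -(@ler_pXn2r _ 2)// ?nnegrE//.
  rewrite (le_trans (key _ _ _ _ _ (xi_is_derive (e j)) (xb j) (xi'_le1 (e j)) hK gf t))//.
  have -> : b ^+ 2 = (1 + `|t|) ^+ (n + n).+2 * (nrm (M (powx n.+1) f) + (1 + B0) * K) ^+ 2.
    by rewrite /b exprMn -exprM; congr (_ ^+ _ * _); lia.
  rewrite ler_wpM2l ?exprn_ge0 ?addr_ge0//.
  have : nrm (M (pw (xi (e j)) s) f) <= nrm (M (powx n.+1) f).
    rewrite -[leRHS]mul1r; apply: (M_le ler01 (pw_bounded (xi_is_derive (e j)) (xb j) s).1 _ wf) => x.
    by rewrite mul1r /pw /powx !normrX lerXn2r ?nnegrE// xi_le.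
  move: (nrm_ge0 (M (pw (xi (e j)) s) f)) (nrm_ge0 (M (powx n.+1) f)).
  move: (nrm (M (pw _ _) f)) (nrm (M (powx _) f)) => y z y0 z0 yz.
  have h1 : y ^+ 2 <= z ^+ 2 by rewrite ler_pXn2r ?nnegrE.
  have h2 := mulr_ge0 z0 (mulr_ge0 B00 K0).
  have h3 := mulr_ge0 z0 K0.
  have h4 := sqr_ge0 K; have h5 := mulr_ge0 B00 h4; have h6 := mulr_ge0 B00 h5.
  rewrite [leRHS](_ : _ = z ^+ 2 + B0 * K ^+ 2 + (2 * (z * K) + 2 * (z * (B0 * K)) + K ^+ 2 + B0 * K ^+ 2 + B0 * (B0 * K ^+ 2))).
    by lra.
  by ring.
have hx (x : R) : (fun j => pw (xi (e j)) n.+1 x) @ \oo --> powx n.+1 x.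
  exact: xi_cvgX.
have [h1 h2] := @M_fatou R S (fun j => pw (xi (e j)) n.+1) (powx n.+1) (U t f) b b0
  (fun j => (pw_bounded (xi_is_derive (e j)) (xb j) n.+1).1)
  hx (fun j => dM_bounded _ (pw_bounded (xi_is_derive (e j)) (xb j) n.+1)) hb.
split => //; rewrite (le_trans h2)// [leRHS](_ : _ = wcst S *
  ((1 + `|t|) ^+ n.+1 * ((1 + B0) * (nrm (M (powx n.+1) f) + K)))); last by ring.
by rewrite ler_wpM2l// /b ler_wpM2l ?exprn_ge0 ?addr_ge0// mulrDr lerD2r ler_peMl// lerDl.
Qed.

End WeightGrowth.

(** * Asymptotic velocity *)

Lemma powx0 {R : realType} : powx 0 = (fun=> 1) :> (R -> R).
Proof. by apply/funext => y; rewrite /powx expr0. Qed.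

Section Nice.
Context {R : realType} {S : calculus R}.
Local Notation H := (Hb (@D _ S)).
Implicit Types (x y f g h : S) (e K L : R).

Lemma measurable_powx n : measurable_fun (setT : set R) (powx n).
Proof. exact: measurable_funX. Qed.

Lemma dM_powx_le j r x : (j <= r)%N -> dM (powx r) x ->
  dM (powx j) x /\ nrm (M (powx j) x) <= nrm x + nrm (M (powx r) x).
Proof.
move=> jr xr; have d1 : dM (fun=> 1) x by apply: (@dM_bounded _ _ 1); split => // y; rewrite normr1.
have dn : dM (fun y : R => `|powx r y|) x.
  apply: (@dM_le _ _ 1 _ _ _ ler01 _ _ xr) => [|y]; last by rewrite normr_id mul1r.
  by apply: measurableT_comp => //; exact: measurable_powx.
have le (y : R) : `|powx j y| <= 1 * `|1 + `|powx r y| |.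
  rewrite mul1r [leRHS]ger0_norm ?addr_ge0// /powx !normrX.
  case: (lerP `|y| 1) => y1; first by rewrite (le_trans (exprn_ile1 j _ y1))// lerDl exprn_ge0.
  by rewrite (le_trans (ler_weXn2l (ltW y1) jr))// lerDr.
have da := dM_add d1 dn.
split; first exact: dM_le ler01 (measurable_powx j) le da.
have := M_le ler01 (measurable_powx j) le da; rewrite mul1r => /le_trans; apply.
rewrite M_add// M_1 (le_trans (nrmD_le _ _))// lerD2l -[leRHS]mul1r.
apply: M_le xr => //; first by apply: measurableT_comp => //; exact: measurable_powx.
by move=> y; rewrite normr_id mul1r.
Qed.

Definition nice r x := (exists L, H r x L) /\ dM (powx r) x.

Lemma nice_le j r x : (j <= r)%N -> nice r x -> nice j x.
Proof.
move=> jr [[L hL] w]; split; first by exists L; exact: Hb_le jr hL.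
by have [] := dM_powx_le jr w.
Qed.

Lemma nice_dense r x e : 0 < e -> exists2 y, nice r y & nrm (x - y) <= e.
Proof.
move=> e0; have h0 : H 0 x (nrm x) by split.
have w0 : dM (powx 0) x.
  by rewrite powx0; apply: (@dM_bounded _ _ 1); split => // y; rewrite normr1.
have [y [L [h1 h2 h3 _]]] := sigma_dense (leq0n r) e0 h0 w0.
by exists y; [split => //; exists L|exact: Hb_nrm h3].
Qed.

Lemma nice_ext r x y : (forall z, nice r z -> ip x z = ip y z) -> x = y.
Proof.
move=> h; apply: nrm_small_eq => e e0; have [z nz hz] := nice_dense r (x - y) e0.
have q : nrm (x - y) ^+ 2 <= nrm (x - y) * e.
  rewrite -ipff; have -> : ip (x - y) (x - y) = ip (x - y) (x - y - z).
    by rewrite [RHS]ipBr [ip (x - y) z]ipBl (h z nz) subrr subr0.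
  by rewrite (le_trans (ip_le _ _))// ler_wpM2l.
have := nrm_ge0 (x - y); rewrite le_eqVlt => /orP[/eqP <-|p]; first exact: ltW.
by move: q; rewrite expr2 ler_pM2l.
Qed.

(** The regularized weight is the true one times a factor bounded by 1 that tends to 1; dominated
    convergence is applied to the class of x times [x], which lies in L^2 by hypothesis. *)
Lemma xi_strong x : dM (powx 1) x -> hcvg \oo (fun n => M (xi n.+1%:R^-1) x) (M (powx 1) x).
Proof.
move=> w; pose th n (r : R) := (1 + n.+1%:R^-1 ^+ 2 * r ^+ 2)^-1.
have mth n : measurable_fun (setT : set R) (th n).
  have e : th n = (fun r => 1 - n.+1%:R^-1 ^+ 2 * (r * xi n.+1%:R^-1 r)).
    apply/funext => r; rewrite /th /xi; have := gt_eqF (xi_den n.+1%:R^-1 r).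
    by move: (n.+1%:R^-1 ^+ 2) => a /negbT h; field.
  rewrite e; apply: measurable_funB => //; apply: measurable_funM => //; apply: measurable_funM => //.
  by apply: derivable_measurable => r; have [] := xi_is_derive n.+1%:R^-1 r.
have bth n : bounded_by 1 (th n).
  split => // r; rewrite /th normfV gtr0_norm ?xi_den// invf_le1 ?xi_den//.
  by rewrite lerDl -exprMn sqr_ge0.
have e n : M (xi n.+1%:R^-1) x = M (th n) (M (powx 1) x).
  have ee : xi n.+1%:R^-1 = fun r => th n r * powx 1 r.
    by apply/funext => r; rewrite /xi /th /powx expr1 mulrC.
  rewrite M_comp//; first by rewrite ee.
  rewrite -ee; apply: (@dM_le _ _ 1 _ _ _ ler01 _ _ w) => [|r].
    by apply: derivable_measurable => r; have [] := xi_is_derive n.+1%:R^-1 r.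
  by rewrite mul1r /powx expr1 xi_le.
have : hcvg \oo (fun n => M (th n) (M (powx 1) x)) (M (fun=> 1) (M (powx 1) x)).
  apply: (@M_dct _ _ _ _ _ 1) => // r.
  rewrite -[X in _ --> X]invr1; apply: cvgV; first exact: oner_neq0.
  rewrite -[X in _ --> X]addr0; apply: cvgD; first exact: cvg_cst.
  rewrite -(mul0r (r ^+ 2)); apply: cvgM; last exact: cvg_cst.
  rewrite (_ : (fun n => _) = (fun n : nat => n.+1%:R^-1 * n.+1%:R^-1 : R)); last exact/funext.
  by rewrite -(mulr0 0); apply: cvgM; exact: cvg_harmonic.
by rewrite M_1; apply: hcvg_eq => n; rewrite e.
Qed.

Lemma Wk0 k : Wk k (0 : R) (fun=> 0).
Proof.
have b : bounded_by (0 : R) (fun=> 0) by split => // r; rewrite normr0.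
elim: k => [|k IH]; split => //; split => [r|]; first exact: derivable_cst.
by rewrite (_ : derive1 _ = fun=> 0)//; apply/funext => r; rewrite derive1_cst.
Qed.

End Nice.

Lemma constant_of_derive {R : realType} (f : R -> R) a b :
  (forall x : R, is_derive x 1 f 0) -> f a = f b.
Proof.
move=> df; have [c _ e] := @mean_value R f a b (fun x => @ex_derive _ _ _ _ _ _ _ (df x)).
by move: e; rewrite (is_derive1E (df c)) mul0r => /eqP; rewrite subr_eq0 => /eqP.
Qed.

Lemma xi'_bounded {R : realType} (e : R) : bounded_by 1 (xi' e).
Proof.
split; last exact: xi'_le1.
by apply: (measurable_w' (xi_is_derive e)).
Qed.

Lemma xi'_sub {R : realType} {S : calculus R} (e : R) (v : S) : 0 <= e -> dM (powx 1) v ->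
  nrm (M (xi' e) v - v) <= 3 * e * nrm (M (powx 1) v).
Proof.
move=> e0 w; have d1 : dM (fun=> 1) v by apply: (@dM_bounded _ _ 1); split => // y; rewrite normr1.
have dx := dM_bounded v (xi'_bounded e).
have -> : M (xi' e) v - v = M (fun r => xi' e r + (-1) * 1) v.
  by rewrite M_add//; [rewrite M_scale// M_1 scaleN1r|exact: dM_scale].
apply: M_le w; first by rewrite mulr_ge0.
  by apply: measurable_funD => //; exact: (xi'_bounded e).1.
by move=> x; rewrite mulN1r /powx expr1 xi'_sub1.
Qed.

(** * The free flow and its action on the position *)

Section FreeFlow.
Context {R : realType} {S : calculus R} (U0 : evolution S).
Hypothesis genE : forall f g : S, gen U0 f g <-> exists2 f1, D f f1 & D f1 g.
Local Notation H := (Hb (@D _ S)).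
Implicit Types (k l h : S) (t K L : R).

Lemma free_genE (f g : S) : gen U0 f g <-> exists f1 f2, [/\ D f f1, D f1 f2 & g = f2 + M (fun=> 0) f].
Proof.
rewrite genE M_zero; split => [[f1 h1 h2]|[f1 [f2 [h1 h2 ->]]]].
  by exists f1, g; rewrite addr0.
by rewrite addr0; exists f1.
Qed.

Lemma nice_gen k r : nice r.+2 k -> exists2 g, gen U0 k g & exists L, H r g L.
Proof.
move=> [[L [_ [k1 h1 [_ [k2 h2 hh]]]]] _]; exists k2; last by exists L.
by apply/genE; exists k1.
Qed.

(** The derivative u of [U0 t k] solves the free equation with initial value [k']: its pairing with
    any other free solution is constant in time. Differentiability of u in time has to be shown
    first, and four derivatives put both [k] and its image under the generator in the domain. *)
Lemma D_flow t k k' : nice 4 k -> D k k' -> D (U0 t k) (U0 t k').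
Proof.
move=> nk kk'; have [g kg [L hg]] := nice_gen nk.
have [g2 gg2] : exists g2, gen U0 g g2.
  by have [_ [k1 h1 [_ [k2 h2 _]]]] := hg; exists k2; apply/genE; exists k1.
have hu s : exists u, D (U0 s k) u /\ D u (U0 s g).
  by have /genE[u h1 h2] := gen_flow s kg; exists u.
have hv s : exists v, D (U0 s g) v /\ D v (U0 s g2).
  by have /genE[u h1 h2] := gen_flow s gg2; exists u.
pose u s := sval (cid (hu s)); pose v s := sval (cid (hv s)).
have [u1 u2] : (forall s, D (U0 s k) (u s)) /\ (forall s, D (u s) (U0 s g)).
  by split => s; rewrite /u; case: cid => ? [].
have v1 s : D (U0 s g) (v s) by rewrite /v; case: cid => ? [].
have uv s : gen U0 (u s) (v s) by apply/genE; exists (U0 s g).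
have su s : sder u s (J (v s)).
  pose q (a : R) := a^-1 *: (U0 (s + a) k - U0 s k) - J (U0 s g).
  pose q1 (a : R) := a^-1 *: (u (s + a) - u s) - J (v s).
  pose q2 (a : R) := a^-1 *: (U0 (s + a) g - U0 s g) - J (U0 s g2).
  have qq1 a : D (q a) (q1 a).
    by apply: D_B; [apply: D_Z; apply: D_B|exact: D_J].
  have qq2 a : D (q1 a) (q2 a).
    have /genE[w h1 h2] := gen_flow s gg2; apply: D_B; first by apply: D_Z; exact: D_B.
    by apply: D_J; rewrite -(D_unique h1 (v1 s)) in h2 *.
  have hq0 := flow_sder s kg; have hq2 := flow_sder s gg2.
  (* The errors of the difference quotients of [U0 t k], of its first and of its second derivative
     are successive derivatives of each other, so the middle one is interpolated between two that
     tend to 0. *)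
  have hb a : nrm (q1 a) <= nrm (q a) + nrm (q2 a).
    rewrite nrm_le2 ?addr_ge0// (D_skew (qq1 a) (qq2 a)) (le_trans (ler_norm _))// normrN.
    rewrite (le_trans (cauchy_schwarz _ _))//.
    by have := nrm_ge0 (q a); have := nrm_ge0 (q2 a); nra.
  apply: (@hcvg_squeeze _ _ _ _ _ _ _ (fun a => nrm (q a) + nrm (q2 a))); first exact: nearW hb.
  by rewrite -[X in _ --> X]addr0; exact: cvgD.
suff -> : U0 t k' = u t by [].
apply: (@nice_ext _ _ 2) => h nh; have [h2 hh2 _] := nice_gen nh.
have {}hh2 := gen_flow (- t) hh2.
have dz (s : R) : is_derive s 1 (fun s => ip (u s) (U0 s (U0 (- t) h))) 0.
  apply: (is_derive_conv (sder_ip (su s) (flow_sder s hh2))) => //.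
  have /gen_J hj := gen_flow s hh2.
  by rewrite J_skew (gen_sym (uv s) hj) addNr.
have := constant_of_derive 0 t dz; rewrite flowVK => <-.
have := u1 0; rewrite !flow_0 => /(D_unique kk') <-.
by rewrite flow_adj.
Qed.

Lemma free_bounded k K : nice 2 k -> H 1 k K -> exists C, forall t, H 1 (U0 t k) C.
Proof.
move=> [[L hL] _] hK; have [C _ hC] := @Hb_flow R S U0 (fun=> 0) 0 0 (Wk0 _) free_genE 1 isT.
by exists (C * K) => t; apply: hC => //; exists L.
Qed.

Lemma free_weight k : nice 2 k -> exists2 C, 0 <= C & forall t,
  dM (powx 1) (U0 t k) /\ nrm (M (powx 1) (U0 t k)) <= C * (1 + `|t|).
Proof.
move=> nk; have [[L hL] w2] := nk; have [K hK] := free_bounded nk (HbS hL).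
have [w1 _] := dM_powx_le (isT : (1 <= 2)%N) w2.
have [C C0 hC] := @weighted_growth R S U0 _ 0 (Wk_bounded (Wk0 0)) free_genE 0.
exists (C * (nrm (M (powx 1) k) + K)).
  by rewrite mulr_ge0// addr_ge0// (Hb_ge0 (hK 0)).
move=> t; have [h1 h2] := hC k K hK (ex_intro _ L hL) w1 t; by split => //; rewrite expr1 in h2.
Qed.

(** The Heisenberg equation for a function of the position: commuting with the Laplacian leaves the
    derivative of the weight times the momentum, symmetrized. The terms with both momenta cancel
    because [J] is skew. *)
Lemma xi_weight_derivative (e t : R) k l k' l' : 0 < e -> nice 4 k -> nice 4 l -> D k k' -> D l l' ->
  is_derive t 1 (fun t => ip (M (xi e) (U0 t k)) (U0 t l))
    (- ip (J (U0 t k')) (M (xi' e) (U0 t l)) - ip (M (xi' e) (U0 t k)) (J (U0 t l'))).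
Proof.
move=> e0 nk nl kk' ll'; have xb (x : R) : `|xi e x| <= e^-1 by exact: xi_bounded.
have b : bounded_by e^-1 (xi e) by split => //; exact: (measurable_w (xi_is_derive e)).
have [g kg _] := nice_gen (nice_le (isT : (2 <= 4)%N) nk).
have [h lh _] := nice_gen (nice_le (isT : (2 <= 4)%N) nl).
have hs : sder ((fun v => M (xi e) v) \o (fun t => U0 t k)) t (M (xi e) (J (U0 t g))).
  apply: (@sder_lip _ _ _ e^-1) (flow_sder t kg) => [x y|a x|x].
  - by rewrite MB//; [exact: b.1|exact: dM_bounded b|exact: dM_bounded b].
  - by rewrite MZ//; [exact: b.1|exact: dM_bounded b].
  - exact: M_bounded.
apply: (is_derive_conv (sder_ip hs (flow_sder t lh))) => //.
have hD := D_flow t nk kk'; have hD' := D_flow t nl ll'.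
have /genE[u h1 h2] := gen_flow t kg; have /genE[m h3 h4] := gen_flow t lh.
have ue := D_unique h1 hD; have me := D_unique h3 hD'; rewrite -ue -me.
have prod (v v' : S) : D v v' -> D (M (xi e) v) (M (xi' e) v + M (xi e) v').
  move=> vv'; have xd : derive1 (xi e) = xi' e.
    by apply/funext => x; rewrite (is_derive1E (xi_is_derive e x)).
  rewrite -xd; apply: (@D_M _ _ _ e^-1 1) => // x; last by rewrite xd xi'_le1.
  by have [] := xi_is_derive e x.
have bs (x y : S) : ip (M (xi e) x) y = ip x (M (xi e) y).
  by apply: M_sym; [exact: b.1|exact: dM_bounded b|exact: dM_bounded b].
have q1 : ip (M (xi e) (J (U0 t g))) (U0 t l) = - ip (J u) (M (xi' e) (U0 t l) + M (xi e) m).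
  by rewrite bs (D_skew (D_J h2) (prod _ _ h3)).
have q2 : ip (M (xi e) (U0 t k)) (J (U0 t h)) = - ip (M (xi' e) (U0 t k) + M (xi e) u) (J m).
  by rewrite (D_skew (prod _ _ h1) (D_J h4)) opprK.
rewrite /= q1 q2 ipDr ipDl.
have q3 : ip (J u) (M (xi e) m) + ip (M (xi e) u) (J m) = 0.
  rewrite bs M_J; [|exact: b.1|exact: dM_bounded b]; exact: J_eq0.
lra.
Qed.

(** If the slope of the weight were 1, the derivative would be the constant -2 [ip (J k') l]. The
    actual slope causes an error of order e, since first moments of the free solutions are bounded
    on compact time intervals; then e tends to 0. *)
Lemma flow_position_form t k l k' l' : nice 4 k -> nice 4 l -> D k k' -> D l l' ->
  ip (M (powx 1) (U0 t k)) (U0 t l) = ip (M (powx 1) k) l - 2 * t * ip (J k') l.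
Proof.
move=> nk nl kk' ll'.
have [A A0 hA] := free_weight (nice_le (isT : (2 <= 4)%N) nk).
have [B B0 hB] := free_weight (nice_le (isT : (2 <= 4)%N) nl).
pose C := 3 * (nrm k' * B + A * nrm l') * (1 + `|t|) * `|t|.
pose phi (e s : R) := ip (M (xi e) (U0 s k)) (U0 s l).
have est (e : R) : 0 < e -> `|phi e t - phi e 0 + 2 * t * ip (J k') l| <= e * C.
  move=> e0.
  pose dphi (s : R) := - ip (J (U0 s k')) (M (xi' e) (U0 s l)) - ip (M (xi' e) (U0 s k)) (J (U0 s l')).
  have d1 (s : R) : is_derive s 1 (fun s => phi e s + 2 * ip (J k') l * s) (dphi s + 2 * ip (J k') l).
    have d2 := is_deriveZ (2 * ip (J k') l) (is_derive_id s (1 : R)).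
    apply: (is_derive_conv (is_deriveD (xi_weight_derivative s e0 nk nl kk' ll') d2)) => //.
    by rewrite /GRing.scale/= mulr1.
  have [c ct ec] := @mean_value R _ 0 t (fun s => @ex_derive _ _ _ _ _ _ _ (d1 s)).
  rewrite (is_derive1E (d1 c)) mulr0 addr0 !subr0 in ct ec.
  have -> : phi e t - phi e 0 + 2 * t * ip (J k') l = phi e t + 2 * ip (J k') l * t - phi e 0 by ring.
  rewrite ec normrM /C mulrA ler_wpM2r//.
  have a1 : ip (J (U0 c k')) (U0 c l) = ip (J k') l by rewrite -flow_J flow_ip.
  have a2 : ip (U0 c k) (J (U0 c l')) = ip (J k') l.
    by rewrite -flow_J flow_ip (D_skew (D_J kk') ll') J_skew opprK.
  have -> : dphi c + 2 * ip (J k') l = - ip (J (U0 c k')) (M (xi' e) (U0 c l) - U0 c l) -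
      ip (M (xi' e) (U0 c k) - U0 c k) (J (U0 c l')).
    by rewrite ipBr ipBl a1 a2 /dphi; ring.
  have [wk bk] := hA c; have [wl bl] := hB c.
  rewrite (le_trans (ler_normB _ _))// normrN.
  have e3 : 0 <= 3 * e by rewrite mulr_ge0// ltW.
  have tc : 1 + `|c| <= 1 + `|t| by rewrite lerD2l.
  have b1 : `|ip (J (U0 c k')) (M (xi' e) (U0 c l) - U0 c l)| <= nrm k' * (3 * e * (B * (1 + `|t|))).
    rewrite (le_trans (cauchy_schwarz _ _))// J_nrm flow_nrm ler_wpM2l//.
    rewrite (le_trans (xi'_sub (ltW e0) wl))// ler_wpM2l// (le_trans bl)// ler_wpM2l//.
  have b2 : `|ip (M (xi' e) (U0 c k) - U0 c k) (J (U0 c l'))| <= 3 * e * (A * (1 + `|t|)) * nrm l'.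
    rewrite (le_trans (cauchy_schwarz _ _))// J_nrm flow_nrm ler_wpM2r//.
    rewrite (le_trans (xi'_sub (ltW e0) wk))// ler_wpM2l// (le_trans bk)// ler_wpM2l//.
  rewrite (le_trans (lerD b1 b2))// [leLHS](_ : _ = e * (3 * (nrm k' * B + A * nrm l') * (1 + `|t|)))//.
  by ring.
have cx s : (fun n : nat => phi n.+1%:R^-1 s) @ \oo --> ip (M (powx 1) (U0 s k)) (U0 s l).
  exact: (hcvg_ipr (xi_strong (hA s).1)).
have c1 : (fun n : nat => phi n.+1%:R^-1 t - phi n.+1%:R^-1 0 + 2 * t * ip (J k') l) @ \oo -->
    ip (M (powx 1) (U0 t k)) (U0 t l) - ip (M (powx 1) (U0 0 k)) (U0 0 l) + 2 * t * ip (J k') l.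
  by apply: cvgD; [apply: cvgB; exact: cx|exact: cvg_cst].
have c2 : (fun n : nat => phi n.+1%:R^-1 t - phi n.+1%:R^-1 0 + 2 * t * ip (J k') l) @ \oo --> (0 : R).
  apply: (@cvg_dist_squeeze _ _ _ _ _ (fun n : nat => n.+1%:R^-1 * C)).
    by apply: nearW => n; rewrite subr0; apply: est; rewrite invr_gt0.
  by rewrite -(mul0r C); apply: cvgM; [exact: cvg_harmonic|exact: cvg_cst].
have e : ip (M (powx 1) (U0 t k)) (U0 t l) - ip (M (powx 1) (U0 0 k)) (U0 0 l) +
    2 * t * ip (J k') l = 0 by exact: (cvg_unique _ c1 c2).
by rewrite !flow_0 in e; lra.
Qed.

Lemma flow_position t k k' : nice 4 k -> D k k' ->
  M (powx 1) (U0 t k) = U0 t (M (powx 1) k) - (2 * t) *: U0 t (J k').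
Proof.
move=> nk kk'; suff -> : M (powx 1) k = U0 (- t) (M (powx 1) (U0 t k)) + (2 * t) *: J k'.
  by rewrite flowD flowVK flowZ addrK.
apply: (@nice_ext _ _ 4) => l nl; have [[L [_ [l' ll' _]]] _] := nl.
have := flow_position_form t nk nl kk' ll'.
rewrite ipDl ipZl.
have -> : ip (U0 (- t) (M (powx 1) (U0 t k))) l = ip (M (powx 1) (U0 t k)) (U0 t l).
  by rewrite flow_adj opprK.
by move=> ->; rewrite subrK.
Qed.

End FreeFlow.

(** * Wave operators along a translation-invariant filter of times *)

Section WaveOperator.
Context {R : realType} {S : calculus R} (U U0 : evolution S).
Variables (F : set_system R) (FF : ProperFilter F).
Hypothesis Fshift : forall a : R, t + a @[t --> F] --> F.
Implicit Types (f g h : S).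

(** The graph of the map from [f] to its scattering state. The filter is a parameter so that both
    infinite times are treated by one argument. *)
Definition wave f g := hcvg F (fun t => U t f - U0 t g) 0.

Hypothesis waveE : forall f, exists g, wave f g.

Lemma wave_lin a f g f' g' : wave f g -> wave f' g' -> wave (a *: f + f') (a *: g + g').
Proof.
move=> h h'; have h2 : hcvg F (fun t => a *: (U t f - U0 t g) + (U t f' - U0 t g')) (a *: 0 + 0).
  exact: hcvgD (hcvgZr a h) h'.
rewrite scaler0 addr0 in h2; apply: hcvg_eq h2 => t; rewrite !flow_lin.
by rewrite scalerBr opprD addrACA.
Qed.

Lemma wave0 : wave 0 0.
Proof. by apply: hcvg_eq (hcvg_cst (0 : S)) => t; rewrite !flow0 subrr. Qed.

Lemma waveZ a f g : wave f g -> wave (a *: f) (a *: g).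
Proof. by move=> h; have := wave_lin a h wave0; rewrite !addr0. Qed.

Lemma waveB f g f' g' : wave f g -> wave f' g' -> wave (f - f') (g - g').
Proof.
by move=> h h'; have := wave_lin (-1) h' h; rewrite !scaleN1r ![- _ + _]addrC.
Qed.

Lemma wave_J f g : wave f g -> wave (J f) (J g).
Proof.
by move=> /hcvg_J; rewrite J0; apply: hcvg_eq => t; rewrite JB !flow_J.
Qed.

Lemma wave_nrm f g : wave f g -> nrm g = nrm f.
Proof.
move=> h; apply/eqP; rewrite -subr_eq0 -normr_eq0; apply/eqP.
have c1 : (fun t => `|nrm g - nrm f|) @ F --> `|nrm g - nrm f| by exact: cvg_cst.
have c2 : (fun t : R => `|nrm g - nrm f|) @ F --> (0 : R).
  apply: (@cvg_dist_squeeze _ _ _ _ _ (fun t => nrm (U t f - U0 t g - 0))) h.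
  apply: nearW => t; rewrite subr0 normr_id subr0 -(flow_nrm U0 t g) -(flow_nrm U t f) nrmBC.
  exact: nrm_dist.
exact: (cvg_unique _ c1 c2).
Qed.

Lemma wave_ip f g f' g' : wave f g -> wave f' g' -> ip g g' = ip f f'.
Proof.
move=> h h'; have e (u v : S) : ip u v = (nrm (u + v) ^+ 2 - nrm u ^+ 2 - nrm v ^+ 2) / 2 :> R.
  by rewrite -!ipff ipDl !ipDr (ipC v u); field.
have hs : wave (f + f') (g + g') by have := wave_lin 1 h h'; rewrite !scale1r.
by rewrite e [RHS]e (wave_nrm h) (wave_nrm h') (wave_nrm hs).
Qed.

Lemma wave_flow a f g : wave f g -> wave (U a f) (U0 a g).
Proof.
move=> h; have := cvg_comp _ _ (Fshift a) h.
by apply: hcvg_eq => t; rewrite /comp -!flow_add.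
Qed.

(** The map to scattering states is linear, isometric and intertwines the two flows, so the
    difference quotient error for [g] has the same norm as that for [f]. *)
Lemma wave_gen f g f1 : wave f g -> gen U f f1 -> exists2 g1, gen U0 g g1 & wave f1 g1.
Proof.
move=> h hf; have [g1 h1] := waveE f1; exists g1 => //.
apply: hcvg_squeeze hf; apply: nearW => t.
have h2 := waveB (waveZ t^-1 (waveB (wave_flow t h) h)) (wave_J h1).
by rewrite (wave_nrm h2).
Qed.

Lemma wave_genn n f g fn : wave f g -> genn U n f fn -> exists2 gn, genn U0 n g gn & wave fn gn.
Proof.
elim: n f g => [|n IH] f g h /=; first by move=> <-; exists g.
move=> [f1 hf hn]; have [g1 hg h1] := wave_gen h hf.
by have [gn hgn hw] := IH _ _ h1 hn; exists gn => //; exists g1.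
Qed.

End WaveOperator.

(** * Strong limits of the powers of x / 2t *)

Section Scattering.
Context {R : realType} {S : calculus R} (U U0 : evolution S) (V : R -> R) (s : nat) (c : R).
Hypothesis wV : Wk s c V.
Hypothesis genE : forall f g : S, gen U f g <-> exists f1 f2, [/\ D f f1, D f1 f2 & g = f2 + M V f].
Hypothesis gen0E : forall f g : S, gen U0 f g <-> exists2 f1, D f f1 & D f1 g.
Local Notation H := (Hb (@D _ S)).
Implicit Types (f g h k : S) (K L C : R).

Lemma genn_of_Hb m f L : (m.*2 <= s.+2)%N -> H m.*2 f L -> exists g, genn U m f g.
Proof.
elim: m f L => [|m IH] f L ms hf; first by exists f.
have [g fg hg] := gen_of_Hb wV genE (ms : (m.*2 <= s)%N) hf.
have [g' hg'] := IH _ _ (ltnW (ltnW ms)) hg.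
by exists g'; exists g.
Qed.

(** With [wave_genn] this carries regularity from a datum to its scattering state: the datum lies in
    the domain of a power of the generator, the state in that of the free one, and elliptic
    regularity reads this as a number of derivatives. *)
Lemma free_Hb_of_genn m f g : genn U0 m f g -> exists L, H m.*2 f L.
Proof.
elim: m f => [|m IH] f /=; first by move=> _; exists (nrm f); split.
move=> [f1 h1 /IH[L hL]].
have [C C0 hC] := @Hb_of_gen R S U0 (fun=> 0) m.*2 0 (Wk0 _) (free_genE gen0E) m.*2 (leqnn _).
exists (C * Num.max L (nrm f)); apply: (hC _ _ _ h1); last by rewrite le_max lexx orbT.
by apply: HbW hL; rewrite le_max lexx.
Qed.

(* [gam j] is [p^j g] for the momentum [p = - J D], written so that [D (gam j) = J (gam j.+1)]. *)
Lemma momentum_chain r g L : H r g L -> exists gam : nat -> S, gam 0%N = g /\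
  forall j, (j < r)%N -> D (gam j) (J (gam j.+1)).
Proof.
move=> /Hb_chain[v [v0 hv _]]; exists (fun j => iter j (fun x => - J x) (v j)); split => // j jr.
have JNJ (x : S) : J (- J x) = x by rewrite JN JJ opprK.
have e : J (iter j.+1 (fun x => - J x) (v j.+1)) = iter j (fun x => - J x) (v j.+1) by rewrite iterS JNJ.
rewrite e; have := hv j jr; move: (v j) (v j.+1) => x y.
elim: j {jr e} => //= j IH h; by apply: D_N; apply: D_J; exact: IH.
Qed.

(** Symmetry of the momentum p: if y = p x and z = p y, the pairing of z with x is the squared norm
    of y. *)
Lemma momentum_ip (x y z : S) : D x (J y) -> D y (J z) -> ip z x = nrm y ^+ 2.
Proof. by move=> xy yz; have := D_skew (D_J yz) xy; rewrite JJ ipNl J_ip ipff => /oppr_inj. Qed.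

(** The free generator is D^2 = -p^2, which explains the sign. *)
Lemma free_genn_momentum (gam : nat -> S) m :
  (forall j, (j < m.*2)%N -> D (gam j) (J (gam j.+1))) ->
  genn U0 m (gam 0%N) ((-1) ^+ m *: gam m.*2).
Proof.
elim: m => [|m IH] h; first by rewrite expr0 scale1r.
rewrite -addn1; apply: (genn_add (IH _)) => [j hj|]; first by apply: h; rewrite doubleS; lia.
suff ge : gen U0 ((-1) ^+ m *: gam m.*2) ((-1) ^+ (m + 1) *: gam (m + 1).*2).
  by exists ((-1) ^+ (m + 1) *: gam (m + 1).*2).
apply/gen0E; rewrite addn1 exprSr; exists ((-1) ^+ m *: J (gam m.*2.+1)); first by apply: D_Z; apply: h; rewrite doubleS; lia.
rewrite mulrN1 scaleNr -scalerN -JJ; apply: D_Z; apply: D_J.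
by rewrite doubleS; apply: h; rewrite doubleS; lia.
Qed.

Lemma Hb_flow_weighted : exists2 C, 0 <= C & forall f K, H s.+1 f K ->
  (exists L, H (uphalf s.+1).*2 f L) -> dM (powx s.+1) f -> forall t,
  dM (powx s.+1) (U t f) /\
  nrm (M (powx s.+1) (U t f)) <= C * (nrm (M (powx s.+1) f) + K) * (1 + `|t|) ^+ s.+1.
Proof.
have [A A0 hA] := Hb_flow wV genE (leqnn s.+1).
have [B B0 hB] := weighted_growth (Wk_bounded wV) genE s.
exists (B * (1 + A)); first by rewrite mulr_ge0// addr_ge0.
move=> f K hK [L hL] wf t; have K0 := Hb_ge0 hK.
have h2 : exists L, H 2 f L.
  by exists L; apply: Hb_le hL; rewrite /= doubleS.
have [h3 h4] := hB f (A * K) (hA f K hK (ex_intro _ L hL)) h2 wf t.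
split => //; rewrite (le_trans h4)// ler_wpM2r ?exprn_ge0 ?addr_ge0// -mulrA ler_wpM2l//.
rewrite mulrDl mul1r mulrDr; have := mulr_ge0 A0 (nrm_ge0 (M (powx s.+1) f)); lra.
Qed.

Section limits.
Variables (F : set_system R) (FF : ProperFilter F).
Hypothesis Fshift : forall a : R, t + a @[t --> F] --> F.
Hypothesis Finf : forall A : R, \forall t \near F, A <= `|t|.
Hypothesis waveE : forall f, exists g, wave U U0 F f g.

Lemma Finv : t^-1 @[t --> F] --> (0 : R).
Proof.
apply/cvgrPdist_lt => e e0; near=> t; rewrite sub0r normrN normfV.
have h : e^-1 + 1 <= `|t| by near: t; exact: Finf.
have t0 : 0 < `|t| by rewrite (lt_le_trans _ h)// ltr_wpDl// invr_ge0 ltW.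
by rewrite invf_plt ?posrE// (lt_le_trans _ h)// ltrDl.
Unshelve. all: by end_near. Qed.

Section nice_data.
Variables (f g : S) (gam : nat -> S).
Hypothesis fg : wave U U0 F f g.
Hypothesis nf : nice (uphalf s.+1).*2 f.
Hypothesis gam0 : gam 0%N = g.
Hypothesis gamD : forall j, (j <= s)%N -> D (gam j) (J (gam j.+1)).

(** A free particle of momentum p has velocity 2p; dividing by 2t makes p^j g the limit profile, and
    the factor is restored at the end as 2^(2s). *)
Definition velocity j t : S := (2 * t)^-1 ^+ j *: M (powx j) (U t f).

Lemma weighted_flow j t : (j <= s.+1)%N -> dM (powx j) (U t f).
Proof.
move=> js; have [[L hL] w] := nf.
have rs : (s.+1 <= (uphalf s.+1).*2)%N by rewrite uphalf_half -{1}(odd_double_half s.+1) doubleD; lia.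
have [C C0 hC] := Hb_flow_weighted.
have [h _] := hC f L (Hb_le rs hL) (ex_intro _ L hL) (dM_powx_le rs w).1 t.
by have [] := dM_powx_le js h.
Qed.

(** The top order comes from the weighted growth, as 1 + |t| <= 2 |t| once |t| >= 1. Lower orders
    follow pointwise from z^j <= 1 + z^(s+1) with z = |x / 2t|. *)
Lemma velocity_bounded : exists C, \forall t \near F, forall j, (j <= s.+1)%N -> nrm (velocity j t) <= C.
Proof.
have [[L hL] w] := nf.
have rs : (s.+1 <= (uphalf s.+1).*2)%N by rewrite uphalf_half -{1}(odd_double_half s.+1) doubleD; lia.
have [C C0 hC] := Hb_flow_weighted.
exists (nrm f + C * (nrm (M (powx s.+1) f) + L)); near=> t => j js.
have t1 : 1 <= `|t| by near: t; exact: Finf.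
have [h hb] := hC f L (Hb_le rs hL) (ex_intro _ L hL) (dM_powx_le rs w).1 t.
have t0 : 0 < `|t| by rewrite (lt_le_trans ltr01).
pose a := (2 * t)^-1; have an : `|a| = (2 * `|t|)^-1 by rewrite normfV normrM ger0_norm.
have e (k : nat) : (k <= s.+1)%N -> nrm (velocity k t) = nrm (M (fun x => a ^+ k * powx k x) (U t f)).
  by move=> ks; rewrite /velocity M_scale//; exact: weighted_flow.
have ds (k : nat) : (k <= s.+1)%N -> dM (fun x => a ^+ k * powx k x) (U t f).
  by move=> ks; apply: dM_scale; exact: weighted_flow.
have hs : nrm (velocity s.+1 t) <= C * (nrm (M (powx s.+1) f) + L).
  rewrite /velocity nrmZ normrX -/a an exprVn -ler_pdivlMl ?invr_gt0 ?exprn_gt0 ?mulr_gt0// invrK.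
  rewrite (le_trans hb)// mulrC ler_wpM2r//; last by rewrite lerXn2r ?nnegrE ?mulr_ge0 ?addr_ge0//; lra.
  by rewrite mulr_ge0// addr_ge0// (Hb_ge0 hL).
rewrite e//; have d1 : dM (fun=> 1) (U t f) by apply: (@dM_bounded _ _ 1); split => // y; rewrite normr1.
have mp (k : nat) : measurable_fun (setT : set R) (fun x => a ^+ k * powx k x).
  by apply: measurable_funM => //; exact: measurable_powx.
pose m (x : R) := `|a ^+ s.+1 * powx s.+1 x|.
have mm : measurable_fun (setT : set R) m by apply: measurableT_comp => //; exact: mp.
have dm : dM m (U t f).
  by apply: (dM_le ler01 mm _ (ds s.+1 (leqnn _))) => x; rewrite /m normr_id mul1r.
have le (x : R) : `|a ^+ j * powx j x| <= 1 * `|1 + m x|.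
  have m0 : 0 <= m x by exact: normr_ge0.
  rewrite mul1r [leRHS]ger0_norm ?addr_ge0// /m /powx -!exprMn !normrX.
  case: (lerP `|a * x| 1) => y1.
    by apply: (le_trans (exprn_ile1 j (normr_ge0 _) y1)); rewrite lerDl; exact: exprn_ge0.
  by rewrite (le_trans (ler_weXn2l (ltW y1) js))// lerDr.
have := M_le ler01 (mp j) le (dM_add d1 dm); rewrite mul1r => /le_trans; apply.
rewrite M_add// M_1 (le_trans (nrmD_le _ _))// flow_nrm lerD2l (le_trans _ hs)// e//.
rewrite -[leRHS]mul1r; apply: (M_le ler01 mm _ (ds s.+1 (leqnn _))) => x.
by rewrite /m normr_id mul1r.
Unshelve. all: by end_near. Qed.

Lemma velocity_step j t k k' : (j <= s)%N -> nice 4 k -> D k k' ->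
  t != 0 ->
  ip (velocity j.+1 t) (U0 t k) =
  (2 * t)^-1 * ip (velocity j t) (U0 t (M (powx 1) k)) - ip (velocity j t) (U0 t (J k')).
Proof.
move=> js nk kk' t0; have nk2 := free_weight gen0E (nice_le (isT : (2 <= 4)%N) nk).
have [C _ /(_ t)[wk _]] := nk2.
have wj := weighted_flow t (leqW js : (j <= s.+1)%N).
have wj1 := weighted_flow t (js : (j.+1 <= s.+1)%N).
have px : powx j.+1 = (fun x : R => powx 1 x * powx j x).
  by apply/funext => x; rewrite /powx expr1 exprS.
have e : M (powx j.+1) (U t f) = M (powx 1) (M (powx j) (U t f)).
  by rewrite M_comp -?px//; exact: measurable_powx.
have dm1 : dM (powx 1) (M (powx j) (U t f)).
  by apply: dM_comp => //; [exact: measurable_powx|rewrite -px].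
rewrite /velocity e exprSr !ipZl -mulrA; rewrite M_sym//; last exact: measurable_powx.
rewrite (flow_position gen0E t nk kk') ipBr ipZr.
by field.
Qed.

Lemma velocity_weak j : (j <= s.+1)%N -> forall h,
  ip (velocity j t) (U0 t h) @[t --> F] --> ip (gam j) h.
Proof.
elim: j => [|j IH] js h.
  have -> : (fun t => ip (velocity 0 t) (U0 t h)) = (fun t => ip (U t f - U0 t g) (U0 t h) + ip g h).
    by apply/funext => t; rewrite /velocity expr0 scale1r powx0 M_1 ipBl flow_ip subrK.
  rewrite gam0 -[X in _ --> X]add0r; apply: cvgD; last exact: cvg_cst.
  apply: (@cvg_dist_squeeze _ _ _ _ _ (fun t => nrm (U t f - U0 t g - 0) * nrm h)).
    by apply: nearW => t; rewrite !subr0 (le_trans (cauchy_schwarz _ _))// flow_nrm.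
  by rewrite -(mul0r (nrm h)); apply: cvgM; [exact: fg|exact: cvg_cst].
have {IH} := IH (ltnW js) => IH.
(* Against smooth decaying [k] the commutation formula applies, and the term with x k is killed by 1
   / 2t. General [h] is reached by density and the uniform bound. *)
have nicek k : nice 4 k -> ip (velocity j.+1 t) (U0 t k) @[t --> F] --> ip (gam j.+1) k.
  move=> nk; have [[L [_ [k' kk' _]]] _] := nk.
  have lim : (2 * t)^-1 * ip (velocity j t) (U0 t (M (powx 1) k)) - ip (velocity j t) (U0 t (J k')) @[t --> F]
     --> 0 * ip (gam j) (M (powx 1) k) - ip (gam j) (J k').
    apply: cvgB; last exact: IH.
    apply: cvgM; last exact: IH.
    have -> : (fun t : R => (2 * t)^-1) = (fun t => 2^-1 * t^-1) by apply/funext => t; rewrite invfM.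
    by rewrite -(mulr0 2^-1); apply: cvgM; [exact: cvg_cst|exact: Finv].
  have e : 0 * ip (gam j) (M (powx 1) k) - ip (gam j) (J k') = ip (gam j.+1) k.
    rewrite mul0r sub0r -J_skew; have := D_skew (D_J (gamD js)) kk'.
    by rewrite JJ ipNl => /oppr_inj ->.
  rewrite e in lim; apply: cvg_trans lim; apply: near_eq_cvg; near=> t.
  have t1 : 1 <= `|t| by near: t; exact: Finf.
  rewrite -velocity_step// -normr_gt0 (lt_le_trans ltr01)//.
have [C hC] := velocity_bounded.
apply/cvgrPdist_lt => e e0.
have C0 : 0 <= `|C| + nrm (gam j.+1) by rewrite addr_ge0.
pose d := e / 2 / (1 + (`|C| + nrm (gam j.+1))).
have d0 : 0 < d by rewrite !divr_gt0// ltr_wpDr.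
have [k nk hk] := nice_dense 4 h d0.
near=> t.
have h1 : `|ip (gam j.+1) k - ip (velocity j.+1 t) (U0 t k)| < e / 2.
  by near: t; have /cvgrPdist_lt/(_ (e / 2)) := nicek k nk; apply; rewrite divr_gt0.
have h2 : nrm (velocity j.+1 t) <= `|C|.
  by rewrite (le_trans _ (ler_norm C))//; near: t; apply: filterS hC => t; apply.
have -> : ip (gam j.+1) h - ip (velocity j.+1 t) (U0 t h) =
   (ip (gam j.+1) k - ip (velocity j.+1 t) (U0 t k)) +
   (ip (gam j.+1) (h - k) - ip (velocity j.+1 t) (U0 t (h - k))).
  by rewrite flowB !ipBr; ring.
rewrite (le_lt_trans (ler_normD _ _))// [ltRHS]splitr ltr_leD//.
rewrite (le_trans (ler_normB _ _))//.
have q1 : `|ip (gam j.+1) (h - k)| <= nrm (gam j.+1) * d.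
  by rewrite (le_trans (cauchy_schwarz _ _))// ler_wpM2l.
have q2 : `|ip (velocity j.+1 t) (U0 t (h - k))| <= `|C| * d.
  by rewrite (le_trans (cauchy_schwarz _ _))// flow_nrm ler_pM.
rewrite (le_trans (lerD q1 q2))// -mulrDl /d mulrCA ler_piMr ?divr_ge0 ?(ltW e0)//.
by rewrite ler_pdivrMr ?ltr_wpDr// mul1r addrC lerDr.
Unshelve. all: by end_near. Qed.

Lemma velocity_strong j : (j <= s)%N -> hcvg F (fun t => velocity j t - U0 t (gam j)) 0.
Proof.
elim: j => [|j IH] js.
  by apply: hcvg_eq fg => t; rewrite gam0 /velocity expr0 scale1r powx0 M_1.
have {IH} IH := IH (ltnW js).
have e0 t : nrm (velocity j.+1 t) ^+ 2 = ip (velocity j.+2 t) (velocity j t - U0 t (gam j)) +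
    ip (velocity j.+2 t) (U0 t (gam j)).
  rewrite -ipDr subrK -ipff /velocity !ipZl !ipZr !mulrA -!exprD addnS addSn; congr (_ * _).
  have wj := weighted_flow t (leqW (ltnW js) : (j <= s.+1)%N).
  have wj1 := weighted_flow t (leqW js : (j.+1 <= s.+1)%N).
  have wj2 := weighted_flow t (js : (j.+2 <= s.+1)%N).
  have px i : powx i.+1 = (fun x : R => powx 1 x * powx i x).
    by apply/funext => x; rewrite /powx expr1 exprS.
  have mx := measurable_powx 1.
  have q1 : M (powx j.+2) (U t f) = M (powx 1) (M (powx j.+1) (U t f)).
    by rewrite M_comp -?px.
  have q2 : M (powx j.+1) (U t f) = M (powx 1) (M (powx j) (U t f)).
    by rewrite M_comp -?px.
  have d1 : dM (powx 1) (M (powx j.+1) (U t f)) by apply: dM_comp => //; rewrite -px.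
  have d0 : dM (powx 1) (M (powx j) (U t f)) by apply: dM_comp => //; rewrite -px.
  by rewrite q1 (M_sym (mx R) d1 d0) -q2.
have ge := momentum_ip (gamD (ltnW js)) (gamD js).
have [C hC] := velocity_bounded.
have c1 : nrm (velocity j.+1 t) ^+ 2 @[t --> F] --> nrm (gam j.+1) ^+ 2.
  rewrite (_ : (fun t => _) = (fun t => ip (velocity j.+2 t) (velocity j t - U0 t (gam j)) +
     ip (velocity j.+2 t) (U0 t (gam j)))); last exact/funext.
  rewrite -ge -[X in _ --> X]add0r; apply: cvgD; last exact: velocity_weak.
  (* Order j + 2 is only bounded here, paired with the strong convergence known at order j; the
     other term is a weak limit. The limit is a squared norm by momentum symmetry. *)
  apply: (@cvg_dist_squeeze _ _ _ _ _ (fun t => `|C| * nrm (velocity j t - U0 t (gam j) - 0))).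
    near=> t; rewrite !subr0 (le_trans (cauchy_schwarz _ _))// ler_wpM2r//.
    rewrite (le_trans _ (ler_norm C))//; near: t; apply: filterS hC => t; exact.
  by rewrite -(mulr0 `|C|); apply: cvgM; [exact: cvg_cst|exact: IH].
have c2 : nrm (velocity j.+1 t - U0 t (gam j.+1)) ^+ 2 @[t --> F] --> (0 : R).
  have -> : (fun t => nrm (velocity j.+1 t - U0 t (gam j.+1)) ^+ 2) =
     (fun t => nrm (velocity j.+1 t) ^+ 2 + nrm (gam j.+1) ^+ 2 - 2 * ip (velocity j.+1 t) (U0 t (gam j.+1))).
    apply/funext => t; rewrite -!ipff !ipBl !ipBr flow_ip (ipC (U0 t _)); ring.
  have -> : (0 : R) = nrm (gam j.+1) ^+ 2 + nrm (gam j.+1) ^+ 2 - 2 * ip (gam j.+1) (gam j.+1).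
    by rewrite ipff; ring.
  apply: cvgB; first by apply: cvgD => //; exact: cvg_cst.
  by apply: cvgM; [exact: cvg_cst|apply: velocity_weak; exact: leqW].
apply/hcvgP => e ep; have /cvgrPdist_lt/(_ (e ^+ 2)) := c2; rewrite exprn_gt0// => /(_ isT).
apply: filterS => t; rewrite sub0r normrN ger0_norm ?exprn_ge0// subr0.
by rewrite ltr_pXn2r ?nnegrE// ltW.
Unshelve. all: by end_near. Qed.

Lemma velocity_nrm j : (j <= s)%N -> nrm (velocity j t) ^+ 2 @[t --> F] --> nrm (gam j) ^+ 2.
Proof.
move=> js; suff h : nrm (velocity j t) @[t --> F] --> nrm (gam j) by rewrite !expr2; exact: cvgM.
have h := velocity_strong js.
apply: (@cvg_dist_squeeze _ _ _ _ _ (fun t => nrm (velocity j t - U0 t (gam j) - 0)) _ _ h); apply: nearW => t.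
by rewrite subr0 -(flow_nrm U0 t (gam j)) nrm_dist.
Qed.

End nice_data.

(** The scattering map is isometric and intertwines powers of the generators, so the free expression
    for the squared norm of p^s g can be read on [f]. The sign (-1)^s compensates for the generator
    being -H, applied s times in all. *)
Lemma nice_limit f : nice (uphalf s.+1).*2 f -> exists fa fb,
  [/\ genn U (uphalf s) f fa, genn U (half s) f fb &
      nrm (velocity f s t) ^+ 2 @[t --> F] --> (-1) ^+ s * ip fa fb].
Proof.
move=> nf; have [[L hL] _] := nf; have [g fg] := waveE f.
(* The even order is at most s + 2, within reach of [V], and exceeds s, so the momentum chain of g
   extends up to order s + 1. *)
have M2 : ((uphalf s.+1).*2 <= s.+2)%N.
  by rewrite uphalf_half doubleD; have := odd_double_half s.+1; case: (odd s.+1); lia.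
have s2 : (s < (uphalf s.+1).*2)%N.
  by rewrite uphalf_half doubleD; have := odd_double_half s.+1; case: (odd s.+1); lia.
have a2 : ((uphalf s).*2 <= s.+1)%N.
  by rewrite uphalf_half doubleD; have := odd_double_half s; case: (odd s); lia.
have b2 : ((half s).*2 <= s.+1)%N by have := odd_double_half s; lia.
have [fM hfM] := genn_of_Hb M2 hL.
have [gM hgM _] := wave_genn FF Fshift waveE fg hfM.
have [L' hL'] := free_Hb_of_genn hgM.
have [gam [gam0 gamD]] := momentum_chain hL'.
have gamD' j : (j <= s)%N -> D (gam j) (J (gam j.+1)) by move=> js; apply: gamD; exact: leq_ltn_trans s2.
have [fa hfa] := genn_of_Hb (leqW a2) (Hb_le (leq_trans a2 s2) hL).
have [fb hfb] := genn_of_Hb (leqW b2) (Hb_le (leq_trans b2 s2) hL).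
exists fa, fb; split => //.
have [ga hga wa] := wave_genn FF Fshift waveE fg hfa.
have [gb hgb wb] := wave_genn FF Fshift waveE fg hfb.
have ea := free_genn_momentum (fun j (hj : (j < (uphalf s).*2)%N) => gamD' j (leq_trans hj a2)).
have eb := free_genn_momentum (fun j (hj : (j < (half s).*2)%N) => gamD' j (leq_trans hj b2)).
rewrite gam0 in ea eb.
have -> : (-1) ^+ s * ip fa fb = nrm (gam s) ^+ 2.
  rewrite -(wave_ip FF wa wb) (genn_unique hga ea) (genn_unique hgb eb) ipZl ipZr !mulrA -!exprD.
  have -> : (s + uphalf s + half s = s.*2)%N.
    by rewrite uphalf_half; have := odd_double_half s; case: (odd s); lia.
  rewrite -muln2 exprM sqrr_sign mul1r.
  have := odd_double_half s; rewrite uphalf_half; case: (odd s) => /=; last first.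
    by rewrite add0n => ->; rewrite ipff.
  (* For odd [s] the two factors are the momenta of orders s + 1 and s - 1; symmetry of the momentum
     brings both to order [s]. *)
  move=> e; have -> : (1 + s./2).*2 = s.+1 by lia.
  have -> : s./2.*2 = s.-1 by lia.
  have sp : s.-1.+1 = s by lia.
  apply: momentum_ip; last exact: gamD'.
  by rewrite -{2}sp; apply: gamD'; lia.
exact: (velocity_nrm fg nf gam0 gamD').
Qed.

End limits.

(** The growth estimate extends from smoother data by density and closedness of the weight. The
    constant must not see the smoother norm, which is why [Hb_flow] bounds order [s] by order [s]
    alone. *)
Lemma sigma_growth : (0 < s)%N -> exists2 C, 0 <= C & forall f K, H s f K -> dM (powx s) f ->
  forall t, dM (powx s) (U t f) /\
    nrm (M (powx s) (U t f)) <= C * (nrm (M (powx s) f) + K) * (1 + `|t|) ^+ s.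
Proof.
move=> s0; have w0 := wcst_ge0 S.
have [A A0 hA] := Hb_flow wV genE (leqnSn s).
have [B B0] := weighted_growth (Wk_bounded wV) genE s.-1.
rewrite prednK// => hB; pose r := maxn 2 (uphalf s).*2.
have sr : (s <= r)%N by rewrite leq_max uphalf_half; have := odd_double_half s; case: (odd s); lia.
have nf f K : H s f K -> (exists L, H r f L) -> dM (powx s) f -> forall t,
    dM (powx s) (U t f) /\
    nrm (M (powx s) (U t f)) <= (B * (1 + A)) * (nrm (M (powx s) f) + K) * (1 + `|t|) ^+ s.
  move=> hK [L hL] wf t; have K0 := Hb_ge0 hK.
  have h2 : exists L, H (uphalf s).*2 f L by exists L; apply: Hb_le hL; rewrite leq_maxr.
  have h3 : exists L, H 2 f L by exists L; apply: Hb_le hL; rewrite leq_maxl.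
  have [h4 h5] := hB f (A * K) (hA f K hK h2) h3 wf t.
  split => //; rewrite (le_trans h5)// ler_wpM2r ?exprn_ge0 ?addr_ge0// -mulrA ler_wpM2l//.
  rewrite mulrDl mul1r mulrDr; have := mulr_ge0 A0 (nrm_ge0 (M (powx s) f)); lra.
pose B' := B * (1 + A); have B'0 : 0 <= B' by rewrite mulr_ge0// addr_ge0.
(* Each approximant adds at most X to both the weighted norm and the Sobolev bound, which together
   start from X. *)
exists (wcst S * (B' * 3)); first by rewrite mulr_ge0// mulr_ge0.
move=> f K hK wf t; have K0 := Hb_ge0 hK; have tau0 : 0 <= (1 + `|t|) ^+ s by rewrite exprn_ge0 ?addr_ge0.
pose X := nrm (M (powx s) f) + K; have X0 : 0 <= X by rewrite addr_ge0.
(* The approximation error is taken proportional to X, so X = 0, which forces f = 0, is set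
   apart. *)
have [X00|Xn] := eqVneq X 0.
  have f0 : f = 0.
    apply: nrm0_eq0; apply/eqP; rewrite eq_le nrm_ge0 (le_trans (Hb_nrm hK))//.
    by move: X00 (nrm_ge0 (M (powx s) f)); rewrite /X; lra.
  have := M0 (measurable_powx s); have := dM0 (measurable_powx s).
  rewrite f0 flow0 => h1 h2; split; first exact: h1.
  by rewrite h2 nrm0 !mulr_ge0// addr_ge0.
have Xp : 0 < X by rewrite lt_def Xn.
have hu (n : nat) : exists y, [/\ exists L, H r y L, dM (powx s) y, H s (f - y) (X / n.+1%:R) &
    nrm (M (powx s) (f - y)) <= X / n.+1%:R].
  have en : 0 < X / n.+1%:R by rewrite divr_gt0.
  have [y [L [h1 h2 h3 h4]]] := sigma_dense sr en hK wf.
  by exists y; split => //; [exists L|exact: (dM_powx_le sr h2).1].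
have [u {}hu] := choice hu.
have eX (n : nat) : X / n.+1%:R <= X by rewrite ler_pdivrMr// ler_peMr ?ler1n.
have Uu : hcvg \oo (fun n => U t (u n)) (U t f).
  apply: flow_hcvg; apply: (@hcvg_squeeze _ _ _ _ _ _ _ (fun n => X * n.+1%:R^-1)).
    by apply: nearW => n; rewrite nrmBC; have [_ _ h _] := hu n; exact: Hb_nrm h.
  by rewrite -(mulr0 X); apply: cvgM; [exact: cvg_cst|exact: cvg_harmonic].
have z (W : zmodType) (x y : W) : y - (y - x) = x by rewrite opprB addrCA subrr addr0.
have est n : dM (powx s) (U t (u n)) /\ nrm (M (powx s) (U t (u n))) <= B' * 3 * X * (1 + `|t|) ^+ s.
  have [h1 h2 h3 h4] := hu n.
  have hn : H s (u n) (K + X / n.+1%:R).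
    by rewrite -[u n](z _ _ f); exact: (HbB (@D_lin _ S) hK h3).
  have [h5 h6] := nf _ _ hn h1 h2 t; split => //.
  rewrite (le_trans h6)// ler_wpM2r// -/B' -mulrA ler_wpM2l//.
  have h7 : nrm (M (powx s) (u n)) <= nrm (M (powx s) f) + X / n.+1%:R.
    have mp := @measurable_powx R s.
    rewrite -[u n](z _ _ f) (MB mp wf (dMB mp wf h2)) (le_trans (nrmB_le _ _))//.
    by rewrite lerD2l.
  have XE : X = nrm (M (powx s) f) + K by [].
  move: h7 (eX n) XE Xp; clearbody X; move: (X / _) => a; lra.
have b0 : 0 <= B' * 3 * X * (1 + `|t|) ^+ s by rewrite mulr_ge0// mulr_ge0// mulr_ge0.
have [h1 h2] := M_closed (measurable_powx s) b0 Uu (fun n => (est n).1) (fun n => (est n).2).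
by split => //; rewrite (le_trans h2)// -/X !mulrA.
Qed.

End Scattering.

(** * Spectral measures *)

Record pvm (R : realType) (S : calculus R) := Pvm {
  pm :> set R -> S -> S ;
  pm_lin : forall B a x y, measurable B -> pm B (a *: x + y) = a *: pm B x + pm B y ;
  pm_J : forall B x, measurable B -> pm B (J x) = J (pm B x) ;
  pm_sym : forall B x y, measurable B -> ip (pm B x) y = ip x (pm B y) ;
  pm_T : forall x, pm setT x = x ;
  pm_I : forall B B' x, measurable B -> measurable B' -> pm (B `&` B') x = pm B (pm B' x) ;
  pm_sigma : forall x, semi_sigma_additive (fun B : set R => (ip (pm B x) x)%:E)
}.

Section SpectralMeasure.
Context {R : realType} {S : calculus R} (P : pvm S).
Implicit Types (x y k : S) (B : set R).

Lemma pm_ip B x : measurable B -> ip (P B x) x = nrm (P B x) ^+ 2.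
Proof. by move=> mB; rewrite -ipff -pm_sym// -pm_I// setIid. Qed.

Lemma pm_nrm B x : measurable B -> nrm (P B x) <= nrm x.
Proof.
move=> mB; have := nrm_ge0 (P B x); rewrite le_eqVlt => /orP[/eqP <-//|p].
by rewrite -(ler_pM2l p) -expr2 -pm_ip// ip_le.
Qed.

(* Non-measurable sets get mass [0], so that the measure is nonnegative everywhere. *)
Definition spm x B : \bar R := if `[< measurable B >] then (ip (P B x) x)%:E else 0%E.

Lemma spmE x B : measurable B -> spm x B = (ip (P B x) x)%:E.
Proof. by move=> mB; rewrite /spm; case: asboolP. Qed.

Lemma spm_ge0 x B : (0 <= spm x B)%E.
Proof. by rewrite /spm; case: asboolP => // mB; rewrite lee_fin pm_ip// exprn_ge0. Qed.

Lemma spm_sigma x : semi_sigma_additive (spm x).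
Proof.
move=> F mF tF mU; rewrite spmE//; have := @pm_sigma _ _ P x F mF tF mU.
rewrite (_ : (fun n => _) = (fun n => \sum_(0 <= i < n) spm x (F i))%E)//.
by apply/funext => n; apply: eq_bigr => i _; rewrite spmE.
Qed.

(** Additivity on the constant sequence of empty sets says that n a tends to a, where a is the mass
    of the empty set; consecutive differences then give a = 0. *)
Lemma spm0 x : spm x set0 = 0%E.
Proof.
have h := @pm_sigma _ _ P x (fun=> set0) (fun _ : nat => measurable0).
have t0 : trivIset setT (fun _ : nat => set0 : set R) by move=> i j _ _ [? []].
have mU : measurable (\bigcup_(n : nat) (set0 : set R)) by rewrite bigcup0.
have {h} := h t0 mU; rewrite bigcup0// spmE//; set a := ip _ _ => h; congr EFin.
have h2 : (fun n : nat => (n%:R * a)%:E) @ \oo --> a%:E.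
  rewrite (_ : (fun n => _) = (fun n : nat => \sum_(0 <= i < n) a%:E)%E)//.
  by apply/funext => n; rewrite sumEFin big_const_nat subn0 iter_addr_0 mulr_natl.
have h3 : (fun n : nat => n%:R * a) @ \oo --> a by exact: fine_cvg h2.
have h4 : (fun n : nat => n.+1%:R * a) @ \oo --> a.
  by have := cvg_comp _ _ (cvg_addnr 1) h3; rewrite /comp; under eq_fun do rewrite addn1.
have h5 : (fun n : nat => n.+1%:R * a - n%:R * a) @ \oo --> a - a by exact: cvgB.
rewrite subrr (_ : (fun n => _) = (fun=> a)) in h5; last first.
  by apply/funext => n; rewrite -mulrBl -natrB// subSnn mul1r.
by have -> : a = 0 by exact: (cvg_unique _ (cvg_cst a) h5).
Qed.

HB.instance Definition _ x := isMeasure.Build _ R R (spm x) (spm0 x) (spm_ge0 x) (@spm_sigma x).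

Lemma spm_T x : spm x setT = (nrm x ^+ 2)%:E.
Proof. by rewrite spmE// pm_T ipff. Qed.

(** Formal simple functions, whose sets may overlap. Sums are concatenations and products are lists
    of intersections, so [op] is visibly an algebra morphism; [op_ext] shows that it depends on the
    function only. *)
Definition simple := seq (R * set R).
Implicit Types (l : simple).

Definition ev l (t : R) : R := \sum_(p <- l) p.1 * \1_p.2 t.
Definition op l x : S := \sum_(p <- l) p.1 *: P p.2 x.
Definition valid l := forall p, p \in l -> measurable p.2.

Lemma ev_cons p l t : ev (p :: l) t = p.1 * \1_p.2 t + ev l t.
Proof. by rewrite /ev big_cons. Qed.

Lemma op_cons p l x : op (p :: l) x = p.1 *: P p.2 x + op l x.
Proof. by rewrite /op big_cons. Qed.

Lemma ev_nil : ev [::] = fun=> 0. Proof. by apply/funext => t; rewrite /ev big_nil. Qed.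
Lemma op_nil x : op [::] x = 0. Proof. by rewrite /op big_nil. Qed.

Lemma validW p l : valid (p :: l) -> measurable p.2 /\ valid l.
Proof.
move=> h; split; first by apply: h; rewrite mem_head.
by move=> q ql; apply: h; rewrite in_cons ql orbT.
Qed.

Lemma measurable_ev l : valid l -> measurable_fun setT (ev l).
Proof.
elim: l => [_|p l IH /validW[mp /IH h]]; first by rewrite ev_nil.
rewrite (_ : ev _ = (fun t => p.1 * \1_p.2 t + ev l t)); last by apply/funext => t; rewrite ev_cons.
by apply: measurable_funD => //; apply: measurable_funM => //; exact: measurable_indic.
Qed.

Definition cb l : R := \sum_(p <- l) `|p.1|.

Lemma cb_ge0 l : 0 <= cb l. Proof. exact: sumr_ge0. Qed.

Lemma ev_bound l t : `|ev l t| <= cb l.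
Proof.
rewrite (le_trans (ler_norm_sum _ _ _))//; apply: ler_sum => p _.
by rewrite normrM ler_piMr// indicE normr_nat lern1; case: (_ \in _).
Qed.

Lemma op_bound l x : valid l -> nrm (op l x) <= cb l * nrm x.
Proof.
elim: l => [_|p l IH /validW[mp /IH h]]; first by rewrite op_nil nrm0 mulr_ge0// cb_ge0.
rewrite op_cons (le_trans (nrmD_le _ _))// /cb big_cons mulrDl lerD// nrmZ ler_wpM2l//.
exact: pm_nrm.
Qed.

Lemma op_lin l a x y : valid l -> op l (a *: x + y) = a *: op l x + op l y.
Proof.
elim: l => [_|p l IH /validW[mp /IH h]]; first by rewrite !op_nil scaler0 addr0.
rewrite !op_cons h pm_lin// !scalerDr !scalerA (mulrC a) -!addrA; congr (_ + _).
by rewrite addrCA.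
Qed.

Lemma opB l x y : valid l -> op l (x - y) = op l x - op l y.
Proof. by move=> vl; rewrite addrC -scaleN1r op_lin// scaleN1r addrC. Qed.

Lemma op_sym l x y : valid l -> ip (op l x) y = ip x (op l y).
Proof.
elim: l => [_|p l IH /validW[mp /IH h]]; first by rewrite !op_nil ip0l ip0r.
by rewrite !op_cons ipDl ipDr h !ipZl !ipZr pm_sym.
Qed.

Definition sneg l : simple := [seq (- p.1, p.2) | p <- l].

Lemma ev_sub l l' t : ev (l ++ sneg l') t = ev l t - ev l' t.
Proof.
rewrite /ev big_cat big_map/= -sumrN; congr (_ + _).
by apply: eq_bigr => p _; rewrite mulNr.
Qed.

Lemma op_sub l l' x : op (l ++ sneg l') x = op l x - op l' x.
Proof.
rewrite /op big_cat big_map/= -sumrN; congr (_ + _).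
by apply: eq_bigr => p _; rewrite scaleNr.
Qed.

Lemma valid_sub l l' : valid l -> valid l' -> valid (l ++ sneg l').
Proof.
move=> vl vl' p; rewrite mem_cat => /orP[/vl//|/mapP[q ql ->]]; exact: vl' ql.
Qed.

Definition sprod l l' : simple := [seq (p.1 * q.1, p.2 `&` q.2) | p <- l, q <- l'].

Lemma ev_prod l l' t : ev (sprod l l') t = ev l t * ev l' t.
Proof.
rewrite /ev big_allpairs_dep/= mulr_suml; apply: eq_bigr => p _.
rewrite mulr_sumr; apply: eq_bigr => q _.
by rewrite indicI mulrACA.
Qed.

Lemma valid_prod l l' : valid l -> valid l' -> valid (sprod l l').
Proof.
by move=> vl vl' p /allpairsP[[q q'] /= [h h' ->]]; apply: measurableI; [exact: vl h|exact: vl' h'].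
Qed.

Lemma op_prod l l' x : valid l -> valid l' -> op (sprod l l') x = op l (op l' x).
Proof.
move=> vl vl'; rewrite /op big_allpairs_dep/= big_seq [RHS]big_seq; apply: eq_bigr => p pl.
have mp := vl p pl.
elim: l' vl' => [_|q l' IH /validW[mq /IH h]].
  rewrite !big_nil; have := pm_lin P (-1) x x mp.
  by rewrite !scaleN1r !addNr => ->; rewrite scaler0.
by rewrite !big_cons h pm_lin// scalerDr scalerA pm_I.
Qed.

Definition int1 x (g : R -> R) := (spm x).-integrable setT (EFin \o g).

Lemma int1_bounded x (g : R -> R) (c : R) : measurable_fun setT g -> (forall t, `|g t| <= c) -> int1 x g.
Proof.
move=> mg gc; apply/integrableP; split; first exact/measurable_EFinP.
have c0 : 0 <= c by rewrite (le_trans _ (gc 0)).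
apply: (@le_lt_trans _ _ (\int[spm x]_(t in setT) c%:E)%E).
  apply: ge0_le_integral => //=; last by move=> t _; rewrite lee_fin.
  by apply/measurable_EFinP; exact: measurableT_comp.
by rewrite integral_cst// [X in (_ * X)%E](spm_T x) -EFinM ltry.
Qed.

Lemma int1_le x (g b : R -> R) : measurable_fun setT g -> (forall t, `|g t| <= b t) -> int1 x b -> int1 x g.
Proof.
move=> mg gb; apply: le_integrable => //; first exact/measurable_EFinP.
by move=> t _; rewrite lee_fin (le_trans (gb t))// ler_norm.
Qed.

Lemma int1_D x g g' : int1 x g -> int1 x g' -> int1 x (fun t => g t + g' t).
Proof.
by move=> h h'; have := @integrableD _ _ _ (spm x) _ measurableT _ _ h h'; apply: eq_integrable.
Qed.

Lemma int1_Z x a g : int1 x g -> int1 x (fun t => a * g t).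
Proof.
by move=> h; have := integrableZl measurableT a h; apply: eq_integrable.
Qed.

Local Notation I x g := (\int[spm x]_t g t).

Lemma int1_ev x l : valid l -> int1 x (ev l).
Proof. by move=> vl; apply: (@int1_bounded x _ (cb l)); [exact: measurable_ev|exact: ev_bound]. Qed.

Lemma I_ev x l : valid l -> I x (ev l) = ip (op l x) x.
Proof.
elim: l => [_|p l IH /validW[mp vl]].
  by rewrite op_nil ip0l /Rintegral integral0_eq// => t _; rewrite ev_nil.
rewrite op_cons ipDl ipZl -IH// (_ : ev _ = (fun t => p.1 * \1_p.2 t + ev l t)); last first.
  by apply/funext => t; rewrite ev_cons.
have h1 : int1 x (\1_p.2 : R -> R).
  by apply: (@int1_bounded x _ 1) => [|t]; [exact: measurable_indic|rewrite indicE normr_nat lern1; case: (_ \in _)].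
rewrite RintegralD//; [|exact: int1_Z|exact: int1_ev].
rewrite RintegralZl//; congr (_ * _ + _).
by rewrite /Rintegral integral_indic// setIT [X in fine X](spmE x mp).
Qed.

Lemma ip_op x l l' : valid l -> valid l' -> ip (op l x) (op l' x) = I x (fun t => ev l t * ev l' t).
Proof.
move=> vl vl'; rewrite -op_sym// -op_prod// -I_ev; last exact: valid_prod.
by congr fine; apply: eq_integral => t _; rewrite ev_prod mulrC.
Qed.

Lemma I_dct x (gn : nat -> R -> R) (g b : R -> R) : (forall n, measurable_fun setT (gn n)) ->
  (forall t, gn ^~ t @ \oo --> g t) -> (forall n t, `|gn n t| <= b t) -> int1 x b ->
  int1 x g /\ (fun n => I x (gn n)) @ \oo --> I x g.
Proof.
move=> mgn cg gb ib.
have cE t : (fun n => (gn n t)%:E) @ \oo --> (g t)%:E by apply: cvg_EFin; [exact: nearW|exact: cg].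
have mg : measurable_fun setT g by exact: (measurable_fun_cvg mgn (fun t _ => cg t)).
have [h1 _ h2] := @dominated_convergence _ _ _ (spm x) setT measurableT (fun n => EFin \o gn n)
  (EFin \o g) (EFin \o b) (fun n => (measurable_EFinP _ _).2 (mgn n)) ((measurable_EFinP _ _).2 mg)
  (aeW _ (fun t _ => cE t)) ib (aeW _ (fun t n _ => gb n t)).
split => //; apply: fine_cvg.
by rewrite /Rintegral fineK//; exact: integrable_fin_num.
Qed.

Import HBNNSimple.

Definition approximates (phi : R -> R) (lst : nat -> simple) :=
  [/\ forall n, valid (lst n), forall n t, 0 <= ev (lst n) t <= phi t,
      forall t, {homo (fun n => ev (lst n) t) : m n / (m <= n)%N >-> m <= n} &
      forall t, (fun n => ev (lst n) t) @ \oo --> phi t].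

Lemma approximation (phi : R -> R) : measurable_fun setT phi -> (forall t, 0 <= phi t) ->
  exists lst, approximates phi lst.
Proof.
move=> mphi phi0; have mE : measurable_fun setT (EFin \o phi) by exact/measurable_EFinP.
pose ap := nnsfun_approx measurableT mE.
pose a n : R -> R := ap n.
pose lst n : simple := [seq (z, a n @^-1` [set z]) | z <- finmap.enum_fset (fset_set (range (a n)))].
have e n t : ev (lst n) t = ap n t.
  by rewrite fimfunE fsbig_finite//= /ev big_map.
have cv t : (fun n => ev (lst n) t) @ \oo --> phi t.
  have h := @cvg_nnsfun_approx _ _ _ _ measurableT _ mE (fun z _ => phi0 z) t Logic.I.
  rewrite (_ : (fun n => _) = (fun n => ap n t)); first exact: (fine_cvg h).
  exact/funext.
have nd t : {homo (fun n => ev (lst n) t) : m n / (m <= n)%N >-> m <= n}.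
  by move=> m n mn; rewrite !e; have /lefP := nd_nnsfun_approx measurableT mE mn; apply.
exists lst; split => //.
- move=> n p /mapP[i _ ->]; exact: measurable_sfunP.
- move=> n t; rewrite {1}e fun_ge0/=.
  by have := nondecreasing_cvgn_le (nd t) (cvgP _ (cv t)) n; rewrite (cvg_lim (@norm_hausdorff _ _) (cv t)).
Qed.

Local Notation EI x g := (\int[spm x]_t (g t)%:E)%E.

Lemma EI_I x g : int1 x g -> EI x g = (I x g)%:E.
Proof. by move=> h; rewrite /Rintegral fineK//; exact: integrable_fin_num. Qed.

Lemma EI_ev2 x l : valid l -> EI x (fun t => ev l t ^+ 2) = (nrm (op l x) ^+ 2)%:E.
Proof.
move=> vl; have vp := valid_prod vl vl; rewrite -ipff ip_op// -EI_I.
  by apply: eq_integral => t _; rewrite expr2.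
by have := int1_ev x vp; congr (_.-integrable _ _); apply/funext => t /=; rewrite ev_prod.
Qed.

Section approximates.
Variables (phi : R -> R) (lst : nat -> simple).
Hypothesis al : approximates phi lst.

Lemma valid_approx n : valid (lst n). Proof. by case: al. Qed.

Lemma ev_approx n t : 0 <= ev (lst n) t <= phi t. Proof. by case: al. Qed.

Lemma measurable_approx : measurable_fun setT phi.
Proof.
have [h1 _ _ h4] := al.
exact: (measurable_fun_cvg (fun n => measurable_ev (h1 n)) (fun t _ => h4 t)).
Qed.

Lemma approx_ge0 t : 0 <= phi t.
Proof. by have /andP[h1 h2] := ev_approx 0 t; rewrite (le_trans h1). Qed.

(** Monotone convergence. The extra factor [g] allows a product of two approximated functions to be
    passed to the limit one factor at a time. *)
Lemma cvg_EI x (g : R -> R) : measurable_fun setT g -> (forall t, 0 <= g t) ->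
  EI x (fun t => g t * ev (lst n) t ^+ 2) @[n --> \oo] --> EI x (fun t => g t * phi t ^+ 2).
Proof.
move=> mg g0; have [h1 h2 h3 h4] := al.
pose G n t := (g t * ev (lst n) t ^+ 2)%:E.
have h := @cvg_monotone_convergence _ _ _ (spm x) setT measurableT G.
rewrite [X in _ --> X](_ : _ = (\int[spm x]_t limn (G ^~ t))%E); last first.
  apply: eq_integral => t _; apply/esym/cvg_lim => //.
  apply: cvg_EFin; first exact: nearW.
  by apply: cvgMr; exact: (cvgM (h4 t) (h4 t)).
apply: h => [n|n t _|t _ m n mn].
- apply/measurable_EFinP; apply: measurable_funM => //; apply: measurable_funX.
  exact: measurable_ev.
- by rewrite lee_fin mulr_ge0// exprn_ge0//; case/andP: (h2 n t).
- rewrite lee_fin ler_wpM2l// ler_sqr ?nnegrE ?h3//; first by case/andP: (h2 m t).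
  by case/andP: (h2 n t).
Qed.

Lemma op_le_EI x n : ((nrm (op (lst n) x) ^+ 2)%:E <= EI x (fun t => phi t ^+ 2))%E.
Proof.
rewrite -EI_ev2; last exact: valid_approx.
apply: ge0_le_integral => //=.
- by move=> t _; rewrite lee_fin sqr_ge0.
- apply/measurable_EFinP; apply: measurable_funX; apply: measurable_ev; exact: valid_approx.
- apply/measurable_EFinP; apply: measurable_funX; exact: measurable_approx.
- move=> t _; rewrite lee_fin ler_sqr ?nnegrE; first by case/andP: (ev_approx n t).
    by case/andP: (ev_approx n t).
  exact: approx_ge0.
Qed.

(** The later simple function exceeds the earlier one, so the increment has nonnegative pairing with
    [op (lst m) x]. Convergence is thereby reduced to that of a monotone real sequence. *)
Lemma op_dist x m n : (m <= n)%N ->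
  nrm (op (lst n) x - op (lst m) x) ^+ 2 <= nrm (op (lst n) x) ^+ 2 - nrm (op (lst m) x) ^+ 2.
Proof.
move=> mn; have [h1 h2 h3 _] := al.
have h : 0 <= ip (op (lst m) x) (op (lst n) x - op (lst m) x).
  rewrite -op_sub ip_op//; last exact: valid_sub.
  apply: Rintegral_ge0 => t _; rewrite ev_sub mulr_ge0//; first by case/andP: (h2 m t).
  by rewrite subr_ge0 h3.
rewrite -!ipff; move: h; rewrite !ipBr !ipBl.
by rewrite (ipC (op (lst n) x) (op (lst m) x)); lra.
Qed.

Lemma op_cvg x K : (forall n, nrm (op (lst n) x) <= K) ->
  exists h, hcvg \oo (fun n => op (lst n) x) h.
Proof.
move=> hK; pose a n := nrm (op (lst n) x) ^+ 2.
have nd : {homo a : m n / (m <= n)%N >-> m <= n}.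
  by move=> m n mn; rewrite -subr_ge0 (le_trans _ (op_dist x mn))// sqr_ge0.
have ca : cvgn a.
  apply: nondecreasing_is_cvgn => //; exists (K ^+ 2) => _ [n _ <-].
  by rewrite ler_sqr ?nnegrE ?nrm_ge0// (le_trans (nrm_ge0 _) (hK n)).
have al_lim n := nondecreasing_cvgn_le nd ca n.
apply: hcomplete => e e0.
have e2 : 0 < (e / 2) ^+ 2 by rewrite exprn_gt0// divr_gt0.
have /cvgrPdist_lt/(_ _ e2)[N _ hN] := ca.
have d n : (N <= n)%N -> nrm (op (lst n) x - op (lst N) x) <= e / 2.
  move=> Nn; rewrite -ler_sqr ?nnegrE ?nrm_ge0// ?divr_ge0 1?ltW//.
  rewrite (le_lt_trans (op_dist x Nn))// (le_lt_trans _ (hN N (leqnn N)))//.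
  by rewrite (le_trans _ (ler_norm _))// lerD2r; exact: al_lim.
exists N => m n Nm Nn; rewrite (le_trans (nrm_triangle (op (lst N) x) _ _))//.
by rewrite [e]splitr lerD ?d// nrmBC d.
Qed.

Lemma op_lim x h : hcvg \oo (fun n => op (lst n) x) h ->
  EI x (fun t => phi t ^+ 2) = (nrm h ^+ 2)%:E.
Proof.
move=> /hcvg_nrm ch; have := @cvg_EI x (fun=> 1) (measurable_cst _) (fun=> ler01).
rewrite (_ : (fun n => _) = (fun n => (nrm (op (lst n) x) ^+ 2)%:E)); last first.
  apply/funext => n; rewrite -EI_ev2; last exact: valid_approx.
  by apply: eq_integral => t _; rewrite mul1r.
under eq_integral do rewrite mul1r.
have {}ch : (fun n => (nrm (op (lst n) x) ^+ 2)%:E) @ \oo --> (nrm h ^+ 2)%:E.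
  apply: cvg_EFin; first exact: nearW.
  exact: (cvgM ch ch).
by move=> /cvg_unique; apply.
Qed.

Lemma spectral_cvg x : (EI x (fun t => phi t ^+ 2)%R < +oo)%E ->
  exists h, hcvg \oo (fun n => op (lst n) x) h.
Proof.
move=> fin; have fi : EI x (fun t => phi t ^+ 2) \is a fin_num.
  by rewrite ge0_fin_numE//; apply: integral_ge0 => t _; rewrite lee_fin sqr_ge0.
apply: (@op_cvg x (Num.sqrt (fine (EI x (fun t => phi t ^+ 2))))) => n.
rewrite -(ger0_norm (nrm_ge0 _)) -sqrtr_sqr ler_wsqrtr// -lee_fin fineK//.
exact: op_le_EI.
Qed.

Lemma int1_approx x : (EI x (fun t => phi t ^+ 2)%R < +oo)%E -> int1 x phi.
Proof.
move=> fin; have mphi := measurable_approx.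
have i2 : int1 x (fun t => phi t ^+ 2).
  apply/integrableP; split; first by apply/measurable_EFinP; exact: measurable_funX.
  by under eq_integral do rewrite /= ger0_norm ?sqr_ge0//.
apply: (@int1_le x phi (fun t => 1 + phi t ^+ 2)) => [//|t|].
  by rewrite ger0_norm ?approx_ge0//; nra.
by apply: int1_D => //; apply: (@int1_bounded x _ 1) => [|t]; [exact: measurable_cst|rewrite normr1].
Qed.

Lemma I_approx x h : hcvg \oo (fun n => op (lst n) x) h -> I x phi = ip h x.
Proof.
move=> ch; have fin : (EI x (fun t => phi t ^+ 2)%R < +oo)%E by rewrite (op_lim ch) ltry.
have [h1 h2 h3 h4] := al.
have le n t : `|ev (lst n) t| <= phi t.
  by have /andP[a b] := h2 n t; rewrite ger0_norm.
have [_ c1] := I_dct (fun n => measurable_ev (h1 n)) h4 le (int1_approx fin).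
have c2 : ip (op (lst n) x) x @[n --> \oo] --> ip h x by exact: (hcvg_ipr ch).
have c3 : ip (op (lst n) x) x @[n --> \oo] --> I x phi.
  by rewrite (_ : (fun n => _) = (fun n => I x (ev (lst n))))//; apply/funext => n; rewrite I_ev.
by have e : I x phi = ip h x by exact: (cvg_unique _ c3 c2).
Qed.

(** Real polarization; symmetry of [op] makes the two cross terms equal. It links limits of simple
    operators to the quadratic description of spectral integrals. *)
Lemma form_approx x k h h' : hcvg \oo (fun n => op (lst n) x) h ->
  hcvg \oo (fun n => op (lst n) k) h' -> ip h k = 4^-1 * (I (x + k) phi - I (x - k) phi).
Proof.
move=> cx ck; have [h1 _ _ _] := al.
have cD : hcvg \oo (fun n => op (lst n) (x + k)) (h + h').
  have c : hcvg \oo (fun n => op (lst n) x + op (lst n) k) (h + h') by exact: hcvgD.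
  apply: hcvg_eq c => n.
  by have := op_lin 1 x k (h1 n); rewrite !scale1r.
have cB : hcvg \oo (fun n => op (lst n) (x - k)) (h - h').
  have c : hcvg \oo (fun n => op (lst n) x - op (lst n) k) (h - h') by exact: hcvgB.
  by apply: hcvg_eq c => n; rewrite opB.
rewrite (I_approx cD) (I_approx cB) !ipDl !ipDr !ipNl !ipNr.
have e : ip h' x = ip h k.
  have c1 : ip (op (lst n) k) x @[n --> \oo] --> ip h' x by exact: (hcvg_ipr ck).
  have c2 : ip (op (lst n) x) k @[n --> \oo] --> ip h k by exact: (hcvg_ipr cx).
  rewrite (_ : (fun n => _) = (fun n => ip (op (lst n) x) k)) in c1; last first.
    by apply/funext => n; rewrite op_sym// ipC.
  by have e : ip h' x = ip h k by exact: (cvg_unique _ c1 c2).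
by rewrite e; lra.
Qed.

(** Finiteness of the integral is equivalent to convergence of the simple operators, and that is a
    linear condition. *)
Lemma EI_lin a x k : (EI x (fun t => phi t ^+ 2)%R < +oo)%E -> (EI k (fun t => phi t ^+ 2)%R < +oo)%E ->
  (EI ((a *: x + k)%R) (fun t => phi t ^+ 2)%R < +oo)%E.
Proof.
move=> /spectral_cvg[h ch] /spectral_cvg[h' ch'].
have c : hcvg \oo (fun n => op (lst n) (a *: x + k)) (a *: h + h').
  have c : hcvg \oo (fun n => a *: op (lst n) x + op (lst n) k) (a *: h + h').
    have c : hcvg \oo (fun n => a *: op (lst n) x) (a *: h) by exact: hcvgZr.
    by exact: hcvgD.
  apply: hcvg_eq c => n.
  by rewrite op_lin//; exact: valid_approx.
by rewrite (op_lim c) ltry.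
Qed.

End approximates.

Lemma EI_le x (g g' : R -> R) : measurable_fun setT g -> measurable_fun setT g' ->
  (forall t, `|g t| <= `|g' t|) -> (EI x (fun t => g t ^+ 2)%R <= EI x (fun t => g' t ^+ 2)%R)%E.
Proof.
move=> mg mg' h; apply: ge0_le_integral => //=.
- by move=> t _; rewrite lee_fin sqr_ge0.
- by apply/measurable_EFinP; exact: measurable_funX.
- by apply/measurable_EFinP; exact: measurable_funX.
- by move=> t _; rewrite lee_fin -[g t ^+ 2]real_normK ?num_real// -[g' t ^+ 2]real_normK ?num_real// ler_sqr ?nnegrE.
Qed.

Lemma op_ev0 l x : valid l -> (forall t, ev l t = 0) -> op l x = 0.
Proof.
move=> vl l0; apply/nrm0_eq0/eqP; rewrite -sqrf_eq0; apply/eqP.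
have [] : (nrm (op l x) ^+ 2)%:E = 0%:E :> \bar R; last by [].
rewrite -EI_ev2//; apply: integral0_eq => t _.
by rewrite l0 expr0n.
Qed.

Lemma op_ext l l' x : valid l -> valid l' -> (forall t, ev l t = ev l' t) -> op l x = op l' x.
Proof.
move=> vl vl' e; apply/eqP; rewrite -subr_eq0 -op_sub; apply/eqP/op_ev0; first exact: valid_sub.
by move=> t; rewrite ev_sub e subrr.
Qed.

Section restriction.
Variable B : set R.
Hypothesis mB : measurable B.

Lemma valid1 : valid [:: (1, B)].
Proof. by move=> p; rewrite inE => /eqP ->. Qed.

Lemma op1 x : op [:: (1, B)] x = P B x.
Proof. by rewrite op_cons op_nil scale1r addr0. Qed.

Lemma ev1 t : ev [:: (1, B)] t = \1_B t.
Proof. by rewrite ev_cons ev_nil mul1r addr0. Qed.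

Lemma op_pm l x : valid l -> op l (P B x) = P B (op l x).
Proof.
move=> vl; rewrite -!op1 -(op_prod x vl valid1) -(op_prod x valid1 vl).
apply: op_ext => [||t]; [exact: (valid_prod vl valid1)|exact: (valid_prod valid1 vl)|].
by rewrite !ev_prod mulrC.
Qed.

Lemma hcvg_pm (u : nat -> S) x : hcvg \oo u x -> hcvg \oo (fun n => P B (u n)) (P B x).
Proof.
move=> ux; apply: (@hcvg_squeeze _ _ _ _ _ _ _ (fun n => nrm (u n - x))) => //.
by apply: nearW => n; rewrite -!op1 -opB ?op1 ?pm_nrm//; exact: valid1.
Qed.

Lemma op_restrict l x : valid l -> (forall t, ~ B t -> ev l t = 0) -> op l x = op l (P B x).
Proof.
move=> vl l0; rewrite -op1 -(op_prod x vl valid1).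
apply: (op_ext x vl (valid_prod vl valid1)) => t.
rewrite ev_prod ev1 indicE; have [/set_mem Bt|/negP Bt] := boolP (t \in B); first by rewrite mulr1.
by rewrite l0 ?mul0r// => Bt'; apply: Bt; rewrite inE.
Qed.

Lemma op_restrict0 l x : valid l -> (forall t, B t -> ev l t = 0) -> op l (P B x) = 0.
Proof.
move=> vl l0; rewrite -op1 -(op_prod x vl valid1).
apply: (op_ev0 x (valid_prod vl valid1)) => t.
rewrite ev_prod ev1 indicE; have [/set_mem Bt|_] := boolP (t \in B); first by rewrite l0// mul0r.
by rewrite mulr0.
Qed.

End restriction.

End SpectralMeasure.

Arguments valid {R}.

(** * Powers of the generator and its spectral measure *)

Section Generator.
Context {R : realType} {S : calculus R} (P : pvm S) (U : evolution S).
Implicit Types (f g h k x y : S).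
Local Notation I x g := (\int[spm P x]_t g t).
Local Notation EI x g := (\int[spm P x]_t (g t)%:E)%E.

Definition dom (phi : R -> R) x := (EI x (fun t => phi t ^+ 2)%R < +oo)%E.

Hypothesis Hspec : forall f g, gen U f g <->
  dom id f /\ forall k, dom id k -> ip g k = - (4^-1 * (I (f + k) id - I (f - k) id)).
Hypothesis Hpos : forall f g, gen U f g -> ip g f <= 0.
Hypothesis gen_dense : forall x y, (forall k g, gen U k g -> ip x k = ip y k) -> x = y.

(** Monotone approximation needs nonnegative functions, so the identity is split as [pp - np], and
    positivity is used to discard the second half. *)
Definition pp (t : R) : R := Num.max t 0.
Definition np (t : R) : R := Num.max (- t) 0.

Lemma measurable_pp : measurable_fun (setT : set R) pp.
Proof. by apply: measurable_maxr => //; exact: measurable_cst. Qed.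

Lemma measurable_np : measurable_fun (setT : set R) np.
Proof. by apply: measurable_maxr => //; exact: measurableT_comp. Qed.

Lemma pp_ge0 t : 0 <= pp t. Proof. by rewrite le_max lexx orbT. Qed.
Lemma np_ge0 t : 0 <= np t. Proof. by rewrite le_max lexx orbT. Qed.

Lemma pp_np t : t = pp t - np t.
Proof. by rewrite /pp /np /Num.max; do 2 case: ifP; lra. Qed.

Lemma dom_le (phi psi : R -> R) x : measurable_fun setT phi -> measurable_fun setT psi ->
  (forall t, `|phi t| <= `|psi t|) -> dom psi x -> dom phi x.
Proof. by move=> mphi mpsi h; apply: le_lt_trans; exact: EI_le. Qed.

Lemma dom_pp x : dom id x -> dom pp x.
Proof.
apply: dom_le; [exact: measurable_pp|exact: measurable_id|move=> t].
by rewrite ger0_norm ?pp_ge0// /pp ge_max ler_norm normr_ge0.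
Qed.

Lemma dom_np x : dom id x -> dom np x.
Proof.
apply: dom_le; [exact: measurable_np|exact: measurable_id|move=> t].
by rewrite ger0_norm ?np_ge0// /np ge_max -normrN ler_norm normr_ge0.
Qed.

Lemma measurable_norm : measurable_fun (setT : set R) (fun t : R => `|t|).
Proof. exact: measurableT_comp. Qed.

Lemma dom_lin a x y : dom id x -> dom id y -> dom id (a *: x + y).
Proof.
have [lst al] := approximation measurable_norm (@normr_ge0 R R).
have e z : dom Num.norm z = dom id z.
  by congr (_ < _)%E; apply: eq_integral => t _; rewrite real_normK// num_real.
by rewrite -!e; exact: EI_lin al _ _ _.
Qed.

Lemma dom_pm (B : set R) x : measurable B -> dom id x -> dom id (P B x).
Proof.
move=> mB; have [lst al] := approximation measurable_norm (@normr_ge0 R R).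
have e z : dom Num.norm z = dom id z.
  by congr (_ < _)%E; apply: eq_integral => t _; rewrite real_normK// num_real.
rewrite -!e => /(spectral_cvg al)[h ch].
have c : hcvg \oo (fun n => op P (lst n) (P B x)) (P B h).
  have c : hcvg \oo (fun n => P B (op P (lst n) x)) (P B h) by exact: hcvg_pm.
  by apply: hcvg_eq c => n; rewrite op_pm//; exact: (valid_approx al).
by rewrite /dom (op_lim al c) ltry.
Qed.

Section halves.
Variables (lp ln : nat -> @simple R).
Hypotheses (ap : approximates pp lp) (an : approximates np ln).

Lemma I_id x : dom id x -> I x id = I x pp - I x np.
Proof.
move=> dx; rewrite -RintegralB//; last 2 first.
- exact: (int1_approx ap (dom_pp dx)).
- exact: (int1_approx an (dom_np dx)).
by apply: eq_Rintegral => t _; exact: pp_np.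
Qed.

Lemma form_halves x k hp hn : dom id x -> dom id k -> hcvg \oo (fun n => op P (lp n) x) hp ->
  hcvg \oo (fun n => op P (ln n) x) hn ->
  ip (hp - hn) k = 4^-1 * (I (x + k) id - I (x - k) id).
Proof.
move=> dx dk cp cn.
have [kp ckp] := spectral_cvg ap (dom_pp dk); have [kn ckn] := spectral_cvg an (dom_np dk).
have dD : dom id (x + k) by have := dom_lin 1 dx dk; rewrite scale1r.
have dB : dom id (x - k) by have := dom_lin (-1) dk dx; rewrite scaleN1r addrC.
rewrite ipBl (form_approx ap cp ckp) (form_approx an cn ckn) !I_id//; lra.
Qed.

Let N : set R := [set t | t < 0].

Let mN : measurable N.
Proof. by have := measurable_itv (R := R) `]-oo, 0[; congr measurable. Qed.

Let lp0 n t : N t -> ev (lp n) t = 0.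
Proof.
move=> Nt; have /andP[h1 h2] := ev_approx ap n t; apply/le_anti; rewrite h1 andbT.
by rewrite (le_trans h2)// /pp ge_max lexx andbT ltW.
Qed.

Let ln0 n t : ~ N t -> ev (ln n) t = 0.
Proof.
move=> /negP; rewrite -leNgt => Nt; have /andP[h1 h2] := ev_approx an n t; apply/le_anti.
by rewrite h1 andbT (le_trans h2)// /np ge_max lexx andbT oppr_le0.
Qed.

(* The negative spectral part [x] of [f] satisfies [<- H x, x> = <np(H) x, x> >= 0]. *)
Lemma pm_negative f g : gen U f g -> P N f = 0.
Proof.
move=> /Hspec[df _]; set x := P N f.
have dx : dom id x by exact: dom_pm.
have [hn cn] := spectral_cvg an (dom_np dx).
have cp : hcvg \oo (fun n => op P (lp n) x) 0.
  have c : hcvg \oo (fun _ : nat => 0 : S) 0 by exact: hcvg_cst.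
  apply: hcvg_eq c => n; have vn : valid (lp n) by exact: (valid_approx ap).
  by rewrite (op_restrict0 P mN f vn (lp0 n)).
have gx : gen U x hn.
  apply/Hspec; split => // k dk.
  by rewrite -(form_halves dx dk cp cn) sub0r ipNl opprK.
have i0 : I x np = 0.
  apply/le_anti; rewrite (I_approx an cn) Hpos//= -(I_approx an cn).
  by apply: Rintegral_ge0 => t _; exact: np_ge0.
have ei0 : (\int[spm P x]_t `|(np t)%:E| = 0)%E.
  under eq_integral do rewrite abse_EFin ger0_norm ?np_ge0//.
  by rewrite EI_I ?i0//; exact: (int1_approx an (dom_np dx)).
have mE : measurable_fun setT (EFin \o np) by apply/measurable_EFinP; exact: measurable_np.
have [A [mA A0 hA]] := (ae_eq_integral_abs (spm P x) measurableT mE).1 ei0.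
have : (spm P x N <= spm P x A)%E.
  apply: le_measure; rewrite ?inE// => t Nt; apply: hA => /(_ Logic.I) /= [].
  by rewrite /np max_l ?oppr_ge0 ?ltW// => h; move: Nt; rewrite /N/= -oppr_gt0 h ltxx.
rewrite [X in (_ <= X)%E]A0 [X in (X <= _)%E]spmE// lee_fin pm_ip// /x -pm_I// setIid => h.
by apply/nrm0_eq0/eqP; rewrite -sqrf_eq0 eq_le h sqr_ge0.
Qed.

(** Only the positive part of the identity contributes, because the spectral part of [f] on the
    negative half-line vanishes. The limit is H f = - g. *)
Lemma gen_spectral f g : gen U f g -> hcvg \oo (fun n => op P (lp n) f) (- g).
Proof.
move=> fg; have [df hg] := (Hspec f g).1 fg.
have [hp cp] := spectral_cvg ap (dom_pp df).
have cn : hcvg \oo (fun n => op P (ln n) f) 0.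
  have c : hcvg \oo (fun _ : nat => 0 : S) 0 by exact: hcvg_cst.
  apply: hcvg_eq c => n; have vn : valid (ln n) by exact: (valid_approx an).
  rewrite (op_restrict P mN f vn (ln0 n)) (pm_negative fg).
  by have := opB P 0 0 vn; rewrite !subr0 => ->; rewrite subrr.
suff -> : g = - hp by rewrite opprK.
apply: gen_dense => k g' /Hspec[dk _].
by rewrite hg// ipNl -(form_halves df dk cp cn) subr0.
Qed.

End halves.

(** The square root is 0 at negative arguments, so for positive [n] this vanishes on the negative
    half-line, whereas [root 0] is 1 everywhere. *)
Definition root n (t : R) : R := Num.sqrt t ^+ n.

Lemma measurable_root n : measurable_fun (setT : set R) (root n).
Proof.
apply: measurable_funX; apply: continuous_measurable_fun; exact: sqrt_continuous.
Qed.

Lemma root_ge0 n t : 0 <= root n t. Proof. by rewrite exprn_ge0// sqrtr_ge0. Qed.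

Lemma sqr_sqrt_pp t : Num.sqrt t ^+ 2 = pp t.
Proof.
rewrite /pp /Num.max; case: ltP => t0; last by rewrite sqr_sqrtr.
by rewrite ler0_sqrtr ?ltW// expr0n.
Qed.

Lemma root_step n t : root n.+2 t ^+ 2 = root n t ^+ 2 * pp t ^+ 2.
Proof. by rewrite -sqr_sqrt_pp /root -exprMn -exprD addn2. Qed.

Lemma op_hcvg l (u : nat -> S) x : valid l -> hcvg \oo u x -> hcvg \oo (fun n => op P l (u n)) (op P l x).
Proof.
move=> vl ux; apply: (@hcvg_squeeze _ _ _ _ _ _ _ (fun n => cb l * nrm (u n - x))).
  by apply: nearW => n; rewrite -opB// op_bound.
by rewrite -[X in _ --> X](mulr0 (cb l)); exact: (cvgMr ux).
Qed.

(** The spectral measure of H f is that of [f] with density l^2. This is checked on squares of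
    simple functions, where the simple operators compose, and then the simple functions increase to
    [root n]. *)
Lemma EI_root_gen n f g : gen U f g ->
  EI f (fun t => root n.+2 t ^+ 2) = EI g (fun t => root n t ^+ 2).
Proof.
move=> fg; have [lp ap] := approximation measurable_pp pp_ge0.
have [ln an] := approximation measurable_np np_ge0.
have [lk ak] := approximation (measurable_root n) (root_ge0 n).
have cg := gen_spectral ap an fg.
have e m : EI f (fun t => ev (lk m) t ^+ 2 * pp t ^+ 2) = EI g (fun t => ev (lk m) t ^+ 2).
  have vm : valid (lk m) by exact: (valid_approx ak).
  have me : measurable_fun setT (fun t => ev (lk m) t ^+ 2).
    by apply: measurable_funX; exact: measurable_ev.
  have c1 := @cvg_EI _ _ P _ _ ap f _ me (fun t => sqr_ge0 (ev (lk m) t)).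
  have c2 : (nrm (op P (lk m) (op P (lp i) f)) ^+ 2)%:E @[i --> \oo] --> (nrm (op P (lk m) g) ^+ 2)%:E.
    apply: cvg_EFin; first exact: nearW.
    have c3 : nrm (op P (lk m) (op P (lp i) f)) @[i --> \oo] --> nrm (op P (lk m) g).
      have -> : nrm (op P (lk m) g) = nrm (op P (lk m) (- g)).
        have h := opB P 0 g vm; have h0 := opB P 0 0 vm.
        rewrite !subrr in h0; rewrite sub0r h0 sub0r in h; by rewrite h nrmN.
      exact: (hcvg_nrm (op_hcvg vm cg)).
    exact: (cvgM c3 c3).
  rewrite (_ : (fun i => _) = (fun i => (nrm (op P (lk m) (op P (lp i) f)) ^+ 2)%:E)) in c1; last first.
    apply/funext => i; have vi : valid (lp i) by exact: (valid_approx ap).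
    have vp := valid_prod vm vi; rewrite -op_prod// -EI_ev2//.
    by apply: eq_integral => t _; rewrite ev_prod exprMn.
  by rewrite EI_ev2//; exact: (cvg_unique _ c1 c2).
have c1 := @cvg_EI _ _ P _ _ ak f _ (measurable_funX 2 measurable_pp) (fun t => sqr_ge0 (pp t)).
have c2 := @cvg_EI _ _ P _ _ ak g _ (measurable_cst (1 : R)) (fun=> ler01).
rewrite (_ : (fun i => _) = (fun m => EI g (fun t => 1 * ev (lk m) t ^+ 2))) in c1; last first.
  apply/funext => m; under [RHS]eq_integral do rewrite mul1r.
  by rewrite -e; apply: eq_integral => t _; rewrite mulrC.
have e2 : EI f (fun t => pp t ^+ 2 * root n t ^+ 2) = EI g (fun t => 1 * root n t ^+ 2).
  by exact: (cvg_unique _ c1 c2).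
under [RHS]eq_integral do rewrite -[_ ^+ 2]mul1r.
by rewrite -e2; apply: eq_integral => t _; rewrite root_step mulrC.
Qed.

Lemma EI_root_genn m n f g : genn U m f g ->
  EI f (fun t => root (n + m.*2) t ^+ 2) = EI g (fun t => root n t ^+ 2).
Proof.
elim: m f => [|m IH] f /=; first by move=> ->; rewrite addn0.
by move=> [f' h /IH <-]; rewrite doubleS !addnS; exact: EI_root_gen.
Qed.

(** Two powers of the square root are exchanged for one application of H, until [root 0] or [root 1]
    is left according to parity: the total mass in the first case, the quadratic form of H in the
    second. *)
Lemma EI_root s f fa fb : genn U (uphalf s) f fa -> genn U (half s) f fb ->
  EI f (fun t => root s t ^+ 2) = ((-1) ^+ s * ip fa fb)%:E.
Proof.
move=> ha hb; have := @EI_root_genn _ (odd s) _ _ hb; rewrite odd_double_half => ->.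
rewrite -signr_odd; move: ha; rewrite uphalf_half; case: (odd s) => ha.
- have [lp ap] := approximation measurable_pp pp_ge0.
  have [ln an] := approximation measurable_np np_ge0.
  have fg : gen U fb fa.
    have [f' h1 h2] : exists2 f', genn U (half s) f f' & gen U f' fa.
      move: ha; rewrite addnC; elim: (half s) (f) => [|m IH] x /=.
        by move=> [y h <-]; exists x.
      by move=> [y h /IH[f' h1 h2]]; exists f' => //; exists y.
    by rewrite -(genn_unique h1 hb).
  have cg := gen_spectral ap an fg.
  have [df _] := (Hspec _ _).1 fg.
  under eq_integral do rewrite /root/= expr1 sqr_sqrt_pp.
  rewrite EI_I; last exact: (int1_approx ap (dom_pp df)).
  by rewrite (I_approx ap cg) ipNl expr1 mulN1r.
- rewrite (genn_unique ha hb) expr0 mul1r ipff.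
  under eq_integral do rewrite /root/= expr0 expr1n.
  by rewrite integral_cst// mul1e [LHS](spm_T P).
Qed.

End Generator.

(** * Extension of the limit to all of Sigma_s *)

Section Velocity.
Context {R : realType} {S : calculus R} (P : pvm S) (U U0 : evolution S) (V : R -> R) (s : nat) (c : R).
Hypothesis wV : Wk s c V.
Hypothesis genE : forall f g : S, gen U f g <-> exists f1 f2, [/\ D f f1, D f1 f2 & g = f2 + M V f].
Hypothesis gen0E : forall f g : S, gen U0 f g <-> exists2 f1, D f f1 & D f1 g.
Hypothesis s0 : (0 < s)%N.
Local Notation H := (Hb (@D _ S)).
Implicit Types (f g h k y : S) (K L C : R).
Local Notation I x g := (\int[spm P x]_t g t).
Local Notation EI x g := (\int[spm P x]_t (g t)%:E)%E.
Hypothesis Hspec : forall f g, gen U f g <->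
  dom P id f /\ forall k, dom P id k -> ip g k = - (4^-1 * (I (f + k) id - I (f - k) id)).
Hypothesis Hpos : forall f g, gen U f g -> ip g f <= 0.

Lemma gen_ext x y : (forall k g, gen U k g -> ip x k = ip y k) -> x = y.
Proof.
move=> h; apply: (@nice_ext _ _ 2) => z [[L hz] _].
have [g zg _] := gen_of_Hb wV genE (leq0n s) hz; exact: h zg.
Qed.

Lemma velocity_bound : exists2 C, 0 <= C & forall f K, H s f K -> dM (powx s) f ->
  forall t, 1 <= `|t| -> nrm (velocity U f s t) <= C * (nrm (M (powx s) f) + K).
Proof.
have [C C0 hC] := sigma_growth wV genE s0; exists C => // f K hf w t t1.
have [_ h] := hC f K hf w t; have t2 : 0 < 2 * `|t| by lra.
rewrite /velocity nrmZ normrX normfV normrM (ger0_norm (ler0n _ 2)) exprVn.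
rewrite mulrC ler_pdivrMr ?exprn_gt0// (le_trans h)// ler_wpM2l//.
  by rewrite mulr_ge0// addr_ge0 ?nrm_ge0// (Hb_ge0 hf).
by rewrite lerXn2r ?nnegrE//; lra.
Qed.

Section along.
Variables (F : set_system R) (FF : ProperFilter F).
Hypothesis Fshift : forall a : R, t + a @[t --> F] --> F.
Hypothesis Finf : forall A : R, \forall t \near F, A <= `|t|.
Hypothesis waveE : forall f, exists g, wave U U0 F f g.
Variables (C : R).
Hypothesis C0 : 0 <= C.
Hypothesis hC : forall f K, H s f K -> dM (powx s) f ->
  forall t, 1 <= `|t| -> nrm (velocity U f s t) <= C * (nrm (M (powx s) f) + K).
Variable (lst : nat -> @simple R).
Hypothesis al : approximates (root s) lst.
Local Notation rr := ((uphalf s.+1).*2).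

Let sr : (s <= rr)%N.
Proof. by rewrite uphalf_half -{1}(odd_double_half s.+1) doubleD; lia. Qed.

Lemma nice_velocity y : nice rr y -> exists2 v, nrm (velocity U y s t) @[t --> F] --> v &
  0 <= v /\ EI y (fun t => root s t ^+ 2) = (v ^+ 2)%:E.
Proof.
move=> ny; have [fa [fb [ha hb ch]]] := nice_limit wV genE gen0E FF Fshift Finf waveE ny.
have e := EI_root Hspec Hpos gen_ext ha hb.
have p : 0 <= (-1) ^+ s * ip fa fb.
  by rewrite -lee_fin -e; apply: integral_ge0 => t _; rewrite lee_fin sqr_ge0.
exists (Num.sqrt ((-1) ^+ s * ip fa fb)); last by rewrite sqrtr_ge0 sqr_sqrtr.
have := cvg_comp _ _ ch (@sqrt_continuous R _); apply: cvg_trans; apply: near_eq_cvg.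
by apply: nearW => t /=; rewrite sqrtr_sqr ger0_norm ?nrm_ge0.
Qed.

(** The simple operator is dominated by the limit of the velocity norms, and those satisfy the
    dynamical bound; this gives a spectral estimate in terms of the Sigma_s norm. *)
Lemma op_nice y K n : nice rr y -> H s y K -> nrm (op P (lst n) y) <= C * (nrm (M (powx s) y) + K).
Proof.
move=> ny hy; have [_ w] := nice_le sr ny.
have [v cv [v0 e]] := nice_velocity ny.
have h1 : nrm (op P (lst n) y) <= v.
  rewrite -ler_sqr ?nnegrE ?nrm_ge0// -lee_fin -e.
  exact: op_le_EI.
rewrite (le_trans h1)// -(cvg_lim (@norm_hausdorff _ _) cv).
apply: limr_le; first by apply/cvg_ex; exists v.
by near=> t; apply: hC => //; near: t; exact: Finf.
Unshelve. all: by end_near. Qed.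

(* The bound is independent of [n], although [op P (lst n)] is only bounded by [cb (lst n)]:
   the latter is multiplied by an error that is as small as one likes. *)
Lemma op_sigma f K n : H s f K -> dM (powx s) f ->
  nrm (op P (lst n) f) <= C * (nrm (M (powx s) f) + K).
Proof.
move=> hf w; apply/ler_addgt0Pr => e e0; have vn : valid (lst n) by exact: (valid_approx al).
have c0 := cb_ge0 (lst n).
have [d d0 dE] : exists2 d, 0 < d & (2 * C + cb (lst n)) * d <= e.
  have den : 0 < 2 * C + cb (lst n) + 1 by rewrite ltr_wpDl// addr_ge0// mulr_ge0.
  exists (e / (2 * C + cb (lst n) + 1)); first exact: divr_gt0.
  by rewrite mulrCA ler_piMr ?(ltW e0)// ler_pdivrMr// mul1r lerDl.
have [y [L [h1 h2 h3 h4]]] := sigma_dense sr d0 hf w.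
have ny : nice rr y by split => //; exists L.
have [_ wy] := nice_le sr ny.
have wz : dM (powx s) (f - y) by exact: (dMB (@measurable_powx R s) w wy).
have hy : H s y (K + d) by have := HbB (@D_lin _ S) hf h3; rewrite opprB addrC subrK.
have m : nrm (M (powx s) y) <= nrm (M (powx s) f) + d.
  have -> : M (powx s) y = M (powx s) f - M (powx s) (f - y).
    by rewrite (MB (@measurable_powx R s))// opprB addrC subrK.
  by rewrite (le_trans (nrmB_le _ _))// lerD2l.
have q : nrm (op P (lst n) f) <= nrm (op P (lst n) y) + cb (lst n) * d.
  have -> : op P (lst n) f = op P (lst n) y + op P (lst n) (f - y) by rewrite opB// addrC subrK.
  rewrite (le_trans (nrmD_le _ _))// lerD2l (le_trans (op_bound _ _ vn))// ler_wpM2l//.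
  exact: Hb_nrm h3.
rewrite (le_trans q)//.
have m' := ler_wpM2l C0 m; have := op_nice n ny hy.
rewrite (mulrDl (2 * C)) in dE; rewrite !mulrDr in m' *; move: m' dE => {q}.
move: (nrm _) (C * nrm _) (C * nrm _) (C * K) (cb _ * d) => a a1 a2 a3 a4.
by rewrite -mulrA; move: (C * d) => a5; lra.
Qed.

(** Both the velocity at time t and the spectral limit depend on the datum through bounds uniform in
    t and in the approximation index, so a smooth decaying [y] close to [f] suffices. *)
Lemma sigma_velocity f K h : H s f K -> dM (powx s) f ->
  hcvg \oo (fun n => op P (lst n) f) h -> nrm (velocity U f s t) @[t --> F] --> nrm h.
Proof.
move=> hf w ch; apply/cvgrPdist_le => e e0.
(* Replacing [f] by [y] costs 2 C d on the dynamical side and 2 C d on the spectral side; the other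
   e/2 is the convergence for [y]. *)
have [d d0 dE] : exists2 d, 0 < d & (4 * C) * d <= e / 2.
  have den : 0 < 4 * C + 1 by rewrite ltr_wpDl// mulr_ge0.
  exists (e / 2 / (4 * C + 1)); first by rewrite !divr_gt0.
  by rewrite mulrCA ler_piMr ?divr_ge0 ?(ltW e0)// ler_pdivrMr// mul1r lerDl.
have [y [L [h1 h2 h3 h4]]] := sigma_dense sr d0 hf w.
have ny : nice rr y by split => //; exists L.
have [[Ky hy] wy] := nice_le sr ny.
have wz : dM (powx s) (f - y) by exact: (dMB (@measurable_powx R s) w wy).
have [v cv [v0 ve]] := nice_velocity ny.
have [h' ch'] : exists h', hcvg \oo (fun n => op P (lst n) y) h'.
  by apply: (spectral_cvg al); rewrite ve ltry.
have vh : nrm h' = v.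
  have := ve; rewrite (op_lim al ch') => -[] /eqP.
  by rewrite eqrXn2 ?nrm_ge0// => /eqP.
have hh : nrm (h - h') <= C * (d + d).
  have cz : hcvg \oo (fun n => op P (lst n) f - op P (lst n) y) (h - h') by exact: hcvgB.
  apply: hcvg_nrm_le cz; apply: nearW => n; rewrite -opB; last exact: (valid_approx al).
  by rewrite (le_trans (op_sigma n h3 wz))// ler_wpM2l// lerD2r.
have [C' _ hC'] := sigma_growth wV genE s0.
near=> t.
have t1 : 1 <= `|t| by near: t; exact: Finf.
have vy : `|v - nrm (velocity U y s t)| <= e / 2.
  by near: t; have /cvgrPdist_le := cv; apply; rewrite divr_gt0.
have vz : nrm (velocity U f s t - velocity U y s t) <= C * (d + d).
  have -> : velocity U f s t - velocity U y s t = velocity U (f - y) s t.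
    have [wf _] := hC' _ _ hf w t; have [wyt _] := hC' _ _ hy wy t.
    by rewrite /velocity flowB (MB (@measurable_powx R s))// scalerBr.
  by rewrite (le_trans (hC h3 wz t1))// ler_wpM2l// lerD2r.
have := nrm_dist h h'; have := nrm_dist (velocity U f s t) (velocity U y s t).
rewrite -vh in vy; move: (nrm h) (nrm h') (nrm (velocity _ _ _ _)) (nrm (velocity _ _ _ _)) vy => a b a' b'.
move: hh vz; move: (nrm _) (nrm _) => p q; rewrite !ler_norml.
move=> ? ? /andP[? ?] /andP[? ?] /andP[? ?]; apply/andP; split; lra.
Unshelve. all: by end_near. Qed.

End along.

Theorem velocity_limit f K :
  (forall x, exists y, wave U U0 +oo%R x y) -> (forall x, exists y, wave U U0 -oo%R x y) ->
  H s f K -> dM (powx s) f ->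
  exists h, [/\ dom P (root s) f,
    forall k, dom P (root s) k -> ip h k = 4^-1 * (I (f + k) (root s) - I (f - k) (root s)),
    nrm (velocity U f s t) @[t --> +oo] --> nrm h &
    nrm (velocity U f s t) @[t --> -oo] --> nrm h].
Proof.
move=> wp wm hf w; have [C C0 hC] := velocity_bound.
have [lst al] := approximation (@measurable_root R s) (@root_ge0 R s).
have sp (a : R) : t + a @[t --> +oo] --> +oo%R by exact: cvg_addrr.
have sm (a : R) : t + a @[t --> -oo] --> -oo%R by exact: cvg_addrr_Ny.
have ip (A : R) : \forall t \near +oo, A <= `|t|.
  by near=> t; rewrite (le_trans _ (ler_norm t))//; near: t; exact: nbhs_pinfty_ge.
have im (A : R) : \forall t \near -oo, A <= `|t|.
  near=> t; rewrite -normrN (le_trans _ (ler_norm _))// lerNr; near: t.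
  by apply: nbhs_ninfty_le; exact: num_real.
(* The dynamical bound at positive times already produces [h], hence membership in the spectral
   domain. As [h] is the spectral limit, it serves at negative times as well. *)
have [h ch] := op_cvg al (fun n => op_sigma _ sp ip wp C0 hC al n hf w).
exists h; split.
- by rewrite /dom (op_lim al ch) ltry.
- by move=> k /(spectral_cvg al)[k' ck]; rewrite (form_approx al ch ck).
- exact: (sigma_velocity _ sp ip wp C0 hC al hf w ch).
- exact: (sigma_velocity _ sm im wm C0 hC al hf w ch).
Unshelve. all: by end_near. Qed.

End Velocity.

(** * Complex functions as pairs of classes *)

Opaque cl ltwo_add ltwo_scale ltwo_ip mul nrm.

Section ComplexParts.
Context {R : realType}.
Implicit Types (z w : R[i]) (a : R).

Lemma ReD z w : complex.Re (z + w) = complex.Re z + complex.Re w. Proof. by case: z; case: w. Qed.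
Lemma ImD z w : complex.Im (z + w) = complex.Im z + complex.Im w. Proof. by case: z; case: w. Qed.
Lemma ReN z : complex.Re (- z) = - complex.Re z. Proof. by case: z. Qed.
Lemma ImN z : complex.Im (- z) = - complex.Im z. Proof. by case: z. Qed.

Lemma ReM z w : complex.Re (z * w) = complex.Re z * complex.Re w - complex.Im z * complex.Im w.
Proof. by case: z; case: w. Qed.

Lemma ImM z w : complex.Im (z * w) = complex.Re z * complex.Im w + complex.Im z * complex.Re w.
Proof. by case: z => a b; case: w. Qed.

Lemma Re_conj z : complex.Re (conjc z) = complex.Re z. Proof. by case: z. Qed.
Lemma Im_conj z : complex.Im (conjc z) = - complex.Im z. Proof. by case: z. Qed.

Lemma complex_ext z w : complex.Re z = complex.Re w -> complex.Im z = complex.Im w -> z = w.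
Proof. by case: z => a b; case: w => c d /= -> ->. Qed.

Lemma normc_sqr z : ComplexField.Normc.normc z ^+ 2 = complex.Re z ^+ 2 + complex.Im z ^+ 2.
Proof. by case: z => a b /=; rewrite sqr_sqrtr// addr_ge0// sqr_ge0. Qed.

Lemma normc_ge0 z : 0 <= ComplexField.Normc.normc z.
Proof. by case: z => a b; exact: sqrtr_ge0. Qed.

Lemma sign_complex n : (-1) ^+ n = Complex ((-1) ^+ n) 0 :> R[i].
Proof.
rewrite -signr_odd -[in RHS]signr_odd; case: (odd n); rewrite ?expr1 ?expr0//.
by apply: complex_ext => //=; rewrite oppr0.
Qed.

End ComplexParts.

Section Classes.
Context {R : realType}.
Local Notation mu := (@lebesgue_measure R).
Local Notation C := R[i].
Local Notation S := (ltwo_pairs R).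
Implicit Types (f g h : R -> C) (x y : S) (phi : R -> R).

Definition re f : R -> R := fun t => complex.Re (f t).
Definition im f : R -> R := fun t => complex.Im (f t).

Definition cls f : S := (cl (re f), cl (im f)).
Definition fun_of x : R -> C := fun t => Complex (x.1 t) (x.2 t).

Lemma integral_normc f (m : R -> R) : cmeasurable f -> measurable_fun setT m -> (forall t, 0 <= m t) ->
  (\int[mu]_t (m t * ComplexField.Normc.normc (f t) ^+ 2)%:E =
   \int[mu]_t (m t * re f t ^+ 2)%:E + \int[mu]_t (m t * im f t ^+ 2)%:E)%E.
Proof.
move=> [mr mi] mm m0; rewrite -ge0_integralD//.
- by apply: eq_integral => t _; rewrite normc_sqr mulrDr.
- by move=> t _; rewrite lee_fin mulr_ge0 ?sqr_ge0.
- by apply/measurable_EFinP; apply: measurable_funM => //; exact: measurable_funX.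
- by move=> t _; rewrite lee_fin mulr_ge0 ?sqr_ge0.
- by apply/measurable_EFinP; apply: measurable_funM => //; exact: measurable_funX.
Qed.

Lemma l2norm_sqr f : (l2norm f = (\int[mu]_t (ComplexField.Normc.normc (f t) ^+ 2)%:E) `^ (2^-1))%E.
Proof.
rewrite /l2norm unlock; congr (_ `^ _)%E; apply: eq_integral => t _.
by rewrite /= ger0_norm ?normc_ge0// powR_mulrn ?normc_ge0.
Qed.

Lemma integral_normc1 f : cmeasurable f ->
  (\int[mu]_t (ComplexField.Normc.normc (f t) ^+ 2)%:E =
   \int[mu]_t (re f t ^+ 2)%:E + \int[mu]_t (im f t ^+ 2)%:E)%E.
Proof.
move=> mf; have := integral_normc mf (measurable_cst (1 : R)) (fun=> ler01).
have e (u : R -> R) : (\int[mu]_t (cst 1 t * u t)%:E = \int[mu]_t (u t)%:E)%E.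
  by apply: eq_integral => t _; rewrite mul1r.
by rewrite !e.
Qed.

Lemma L2P f : L2 f <-> sqi (re f) /\ sqi (im f).
Proof.
have e (a : \bar R) : (0 <= a)%E -> (a `^ 2^-1 < +oo)%E = (a < +oo)%E.
  case: a => [a|//|//] _; first by rewrite poweR_EFin !ltry.
  by rewrite /poweR invr_eq0 pnatr_eq0.
have p (u : R -> R) : (0 <= \int[mu]_t (u t ^+ 2)%:E)%E.
  by apply: integral_ge0 => t _; rewrite lee_fin sqr_ge0.
split => [[mf]|[/sqiP[mr hr] /sqiP[mi hi]]].
  rewrite l2norm_sqr e ?p// integral_normc1// => h; have [mr mi] := mf.
  by split; apply/sqiP; split => //; apply: le_lt_trans h; rewrite ?leeDl ?leeDr// p.
split; first by [].
by rewrite l2norm_sqr e ?p// integral_normc1//; exact: lte_add_pinfty.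
Qed.

Lemma l2normE f : L2 f -> l2norm f = (nrm (cls f))%:E.
Proof.
move=> hf; have [hr hi] := (L2P f).1 hf; rewrite l2norm_sqr integral_normc1; last by case: hf.
rewrite (integral_sq_nrm hr) (integral_sq_nrm hi) -EFinD poweR_EFin.
have -> : nrm (cl (re f)) ^+ 2 + nrm (cl (im f)) ^+ 2 = nrm (cls f) ^+ 2 by rewrite nrm_pair.
by rewrite -powR_mulrn ?nrm_ge0// -powRrM mulfV ?pnatr_eq0// powRr1 ?nrm_ge0.
Qed.

Lemma L2_fun_of x : L2 (fun_of x).
Proof. by apply/L2P; split; exact: sqi_fn. Qed.

Lemma cls_fun_of x : cls (fun_of x) = x.
Proof. by case: x => p q; rewrite /cls/= (fnK p) (fnK q). Qed.

Lemma cls_ae f g : L2 f -> L2 g -> f = g %[ae mu] -> cls f = cls g.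
Proof.
move=> /L2P[f1 f2] /L2P[g1 g2] fg; congr (_, _); apply: eq_cl => //.
  by apply: filterS fg => t h /h; rewrite /re => ->.
by apply: filterS fg => t h /h; rewrite /im => ->.
Qed.

Lemma ae_cls f g : L2 f -> L2 g -> cls f = cls g -> f = g %[ae mu].
Proof.
move=> /L2P[f1 f2] /L2P[g1 g2] e.
have e1 : cl (re f) = cl (re g) := congr1 fst e; have e2 : cl (im f) = cl (im g) := congr1 snd e.
have h1 : re f = re g %[ae mu].
  by apply: ae_eq_trans (clE g1); rewrite -e1; exact: ae_eq_sym (clE f1).
have h2 : im f = im g %[ae mu].
  by apply: ae_eq_trans (clE g2); rewrite -e2; exact: ae_eq_sym (clE f2).
by apply: filterS2 h1 h2 => t a b tt; apply: complex_ext; [exact: a|exact: b].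
Qed.

Lemma fun_of_cls f : L2 f -> fun_of (cls f) = f %[ae mu].
Proof. by move=> hf; apply: ae_cls => //; [exact: L2_fun_of|exact: cls_fun_of]. Qed.

Lemma L2_lin (a : C) f g : L2 f -> L2 g -> L2 (fun t => a * f t + g t).
Proof.
move=> /L2P[f1 f2] /L2P[g1 g2]; apply/L2P; split.
  rewrite (_ : re _ = (fun t => (complex.Re a * re f t + (- complex.Im a) * im f t) + re g t)).
    by apply: sqiD g1; apply: sqiD; exact: sqiZ.
  by apply/funext => t; rewrite /re ReD ReM mulNr.
rewrite (_ : im _ = (fun t => (complex.Re a * im f t + complex.Im a * re f t) + im g t)).
  by apply: sqiD g2; apply: sqiD; exact: sqiZ.
by apply/funext => t; rewrite /im ImD ImM.
Qed.

Lemma cls_lin (a : C) f g : L2 f -> L2 g ->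
  cls (fun t => a * f t + g t) = complex.Re a *: cls f + complex.Im a *: J (cls f) + cls g.
Proof.
move=> /L2P[f1 f2] /L2P[g1 g2].
have lin (b d : R) (p q r : R -> R) : sqi p -> sqi q -> sqi r ->
    cl (fun t => (b * p t + d * q t) + r t) = b *: cl p + d *: cl q + cl r.
  move=> hp hq hr; have hb := sqiZ b hp; have hd := sqiZ d hq.
  by rewrite (clD (sqiD hb hd) hr) (clD hb hd) (clZ b hp) (clZ d hq).
have e1 : cl (re (fun t => a * f t + g t)) =
    complex.Re a *: cl (re f) + complex.Im a *: (- cl (im f)) + cl (re g).
  rewrite scalerN -scaleNr -(lin _ _ _ _ _ f1 f2 g1); congr cl.
  by apply/funext => t; rewrite /re ReD ReM mulNr.
have e2 : cl (im (fun t => a * f t + g t)) =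
    complex.Re a *: cl (im f) + complex.Im a *: cl (re f) + cl (im g).
  rewrite -(lin _ _ _ _ _ f2 f1 g2); congr cl.
  by apply/funext => t; rewrite /im ImD ImM.
by rewrite /cls e1 e2.
Qed.

Lemma cls0 : cls (fun=> 0) = 0.
Proof. by []. Qed.

Lemma innerE f g : L2 f -> L2 g -> inner f g = Complex (ip (cls f) (cls g)) (ip (cls f) (J (cls g))).
Proof.
move=> /L2P[f1 f2] /L2P[g1 g2]; rewrite /inner /cintegral; congr Complex.
  rewrite [RHS]ip_pair/= (ip_cl f1 g1) (ip_cl f2 g2) /sip -RintegralD//; last 2 first.
  - exact: sqiM_integrable.
  - exact: sqiM_integrable.
  by apply: eq_Rintegral => t _; rewrite ReM Re_conj Im_conj mulrN opprK.
rewrite [RHS]ip_pair/= ipNr (ip_cl f1 g2) (ip_cl f2 g1) /sip addrC -RintegralB//; last 2 first.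
- exact: sqiM_integrable.
- exact: sqiM_integrable.
by apply: eq_Rintegral => t _; rewrite ImM Re_conj Im_conj mulrN addrC.
Qed.

Lemma cintegral_test f phi : L2 f -> sqi phi ->
  cintegral (fun t => f t * (phi t)%:C%C) = Complex (ip (cl (re f)) (cl phi)) (ip (cl (im f)) (cl phi)).
Proof.
move=> /L2P[f1 f2] hp; rewrite (ip_cl f1 hp) (ip_cl f2 hp) /cintegral; congr Complex.
  by apply: eq_Rintegral => t _; rewrite ReM/= mulr0 subr0.
by apply: eq_Rintegral => t _; rewrite ImM/= mulr0 add0r.
Qed.

Lemma weakP k f g : L2 f -> L2 g -> weak_derivative k f g <->
  forall phi, test_fun phi ->
    ip (cl (re f)) (cl (derive1n k phi)) = (-1) ^+ k * ip (cl (re g)) (cl phi) /\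
    ip (cl (im f)) (cl (derive1n k phi)) = (-1) ^+ k * ip (cl (im g)) (cl phi).
Proof.
move=> hf hg; split => h phi tp.
  have := h phi tp; rewrite (cintegral_test hf (sqi_test (test_fun_derive1n k tp))).
  rewrite (cintegral_test hg (sqi_test tp)) sign_complex => e.
  split; first by have := congr1 (@complex.Re R) e; rewrite ReM/= mul0r subr0.
  by have := congr1 (@complex.Im R) e; rewrite ImM/= mul0r addr0.
have {}tp : test_fun phi by [].
have [h1 h2] := h phi tp; rewrite (cintegral_test hf (sqi_test (test_fun_derive1n k tp))).
rewrite (cintegral_test hg (sqi_test tp)) sign_complex h1 h2.
by apply: complex_ext; rewrite ?ReM ?ImM/= mul0r ?subr0 ?addr0.
Qed.

Lemma weak0 f : weak_derivative 0 f f.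
Proof. by move=> phi _; rewrite expr0 mul1r. Qed.

(** Testing order [k] against the derivative of a test function, and order k + 1 against the
    function itself, makes [g'] the weak derivative of [g], hence the strong one. *)
Lemma D_of_weak k f g g' : L2 f -> L2 g -> L2 g' ->
  weak_derivative k f g -> weak_derivative k.+1 f g' -> D (cls g) (cls g').
Proof.
move=> hf hg hg' /(weakP _ hf hg) w /(weakP _ hf hg') w'.
have s (a b c : R) : a = (-1) ^+ k * b -> a = (-1) ^+ k.+1 * c -> b = - c.
  move=> -> /eqP; rewrite exprS mulN1r mulNr -mulrN => /eqP; apply: mulfI.
  by rewrite signr_eq0.
have key phi : test_fun phi -> ip (cl (re g)) (cl (derive1 phi)) = - ip (cl (re g')) (cl phi) /\
    ip (cl (im g)) (cl (derive1 phi)) = - ip (cl (im g')) (cl phi).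
  move=> tp; have [a b] := w _ (test_fun_derive tp); have [a' b'] := w' _ tp.
  by rewrite derive1Sn in a' b'; split; [exact: s a a'|exact: s b b'].
by split; apply: weak_SD_SD => phi tp; [exact: (key phi tp).1|exact: (key phi tp).2].
Qed.

Lemma weak_of_D k f g g' : L2 f -> L2 g -> L2 g' ->
  weak_derivative k f g -> D (cls g) (cls g') -> weak_derivative k.+1 f g'.
Proof.
move=> hf hg hg' /(weakP _ hf hg) w [/SD_weak d1 /SD_weak d2]; apply/(weakP _ hf hg') => phi tp.
have [a b] := w _ (test_fun_derive tp); rewrite derive1Sn a b (d1 _ tp) (d2 _ tp).
by rewrite exprS mulN1r !mulNr !mulrN.
Qed.

Lemma Hb_of_weak s f k j g : Hsobolev s f -> (k + j <= s)%N -> L2 g -> weak_derivative k f g ->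
  exists K, Hb (@D _ S) j (cls g) K.
Proof.
move=> [hf hs]; elim: j k g => [|j IH] k g ks hg w; first by exists (nrm (cls g)); split.
have ks' : (k.+1 + j <= s)%N by rewrite addSnnS.
have [g' hg' w'] := hs k.+1 (leq_trans (leq_addr _ _) ks').
have [K hK] := IH k.+1 g' ks' hg' w'.
have K0 := Hb_ge0 hK; exists (nrm (cls g) + K); apply: (HbI _ (D_of_weak hf hg hg' w w')).
  by rewrite lerDl.
by apply: HbW hK; rewrite lerDr nrm_ge0.
Qed.

Lemma cls_mul c V f : bounded_by c V -> L2 f ->
  L2 (fun t => (V t)%:C%C * f t) /\ cls (fun t => (V t)%:C%C * f t) = M V (cls f).
Proof.
move=> bV /L2P[f1 f2].
have e1 : re (fun t => (V t)%:C%C * f t) = (fun t => V t * re f t).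
  by apply/funext => t; rewrite /re ReM/= mul0r subr0.
have e2 : im (fun t => (V t)%:C%C * f t) = (fun t => V t * im f t).
  by apply/funext => t; rewrite /im ImM/= mul0r addr0.
have s1 : sqi (fun t => V t * re f t) by exact: sqi_bounded_mul bV.1 bV.2 f1.
have s2 : sqi (fun t => V t * im f t) by exact: sqi_bounded_mul bV.1 bV.2 f2.
split; first by apply/L2P; rewrite e1 e2.
have aux (u : R -> R) : sqi u -> sqi (fun t => V t * u t) -> cl (fun t => V t * u t) = mul V (cl u).
  move=> h1 h2; apply: eq_cl => //; first exact: (bounded_dm _ bV).
  by apply: filterS (clE h1) => t h /h ->.
by rewrite /cls e1 e2; congr (_, _); exact: aux.
Qed.

Lemma dm_cl n (u : R -> R) : sqi u -> dm (powx n) (cl u) <-> sqi (fun t => powx n t * u t).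
Proof.
move=> hu; have e := clE hu; have mp := @measurable_powx R n.
have e' : (fun t => powx n t * cl u t) = (fun t => powx n t * u t) %[ae mu].
  by apply: filterS e => t h /h ->.
have m1 := measurable_funM mp (measurable_fn (cl u)); have m2 := measurable_funM mp hu.1.
by split; [exact: (ae_sqi m2 e')|exact: (ae_sqi m1 (ae_eq_sym e'))].
Qed.

Lemma nrm_mul_cl n (u : R -> R) : sqi u -> dm (powx n) (cl u) ->
  (\int[mu]_t (t ^+ (2 * n) * u t ^+ 2)%:E = (nrm (mul (powx n) (cl u)) ^+ 2)%:E)%E.
Proof.
move=> hu hd; have hs := (dm_cl n hu).1 hd.
have -> : mul (powx n) (cl u) = cl (fun t => powx n t * u t).
  by apply: eq_cl => //; apply: filterS (clE hu) => t h /h ->.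
rewrite -(integral_sq_nrm hs); apply: eq_integral => t _.
by rewrite exprMn /powx -exprM mulnC.
Qed.

Lemma powx2_ge0 n (t : R) : 0 <= t ^+ (2 * n).
Proof. by rewrite exprM exprn_ge0// sqr_ge0. Qed.

Lemma dM_cls n f : L2 f ->
  (\int[mu]_t (t ^+ (2 * n) * ComplexField.Normc.normc (f t) ^+ 2)%:E < +oo)%E -> dM (powx n) (cls f).
Proof.
move=> hf; have [f1 f2] := (L2P f).1 hf.
rewrite integral_normc; [|by case: hf|exact: measurable_powx|exact: powx2_ge0].
have p (u : R -> R) : (0 <= \int[mu]_t (t ^+ (2 * n) * u t ^+ 2)%:E)%E.
  by apply: integral_ge0 => t _; rewrite lee_fin mulr_ge0 ?sqr_ge0 ?powx2_ge0.
have key (u : R -> R) : sqi u -> (\int[mu]_t (t ^+ (2 * n) * u t ^+ 2)%:E < +oo)%E -> dm (powx n) (cl u).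
  move=> hu fin; apply/(dm_cl n hu)/sqiP; split.
    exact: (measurable_funM (@measurable_powx R n) hu.1).
  apply: le_lt_trans fin; rewrite le_eqVlt; apply/orP; left; apply/eqP.
  by apply: eq_integral => t _; rewrite exprMn /powx -exprM mulnC.
move=> h; split; apply: key => //; apply: le_lt_trans h; [exact: leeDl (p _)|exact: leeDr (p _)].
Qed.

Lemma integral_powx n f : L2 f -> dM (powx n) (cls f) ->
  (\int[mu]_t (t ^+ (2 * n) * ComplexField.Normc.normc (f t) ^+ 2)%:E = (nrm (M (powx n) (cls f)) ^+ 2)%:E)%E.
Proof.
move=> hf; have [f1 f2] := (L2P f).1 hf; move=> [d1 d2].
rewrite integral_normc; [|by case: hf|exact: measurable_powx|exact: powx2_ge0].
rewrite (nrm_mul_cl f1 d1) (nrm_mul_cl f2 d2) -EFinD; congr EFin.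
by rewrite [RHS]nrm_pair.
Qed.

End Classes.

(** * Lifting operators to classes *)

Opaque cls fun_of ltwo_pairs.

Lemma nrm_iscale {R : realType} {S : calculus R} (a : R) (x y : S) :
  nrm (0 *: x + (- a) *: J x - y) = nrm (a *: x - J y).
Proof.
by rewrite -J_nrm JB scale0r add0r JZ JJ scalerN scaleNr opprK.
Qed.

Lemma scale_units {R : realType} {S : calculus R} (x : S) :
  [/\ 1 *: x + 0 *: J x = x, -1 *: x + 0 *: J x = - x,
      0 *: x + 1 *: J x = J x & 0 *: x + -1 *: J x = - J x].
Proof. by split; rewrite scale0r ?add0r ?addr0 ?scale1r ?scaleN1r. Qed.

(** The even terms of the complex sum form the real polarization against the vector, the odd ones
    that against [J] of it. *)
Lemma polarization {R : realType} (r : R[i] -> R) :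
  4^-1 * \sum_(k < 4) (Complex 0 1) ^+ k * (r ((Complex 0 1) ^+ k))%:C%C =
  Complex (4^-1 * (r 1 - r (-1))) (4^-1 * (r (Complex 0 1) - r (Complex 0 (-1)))).
Proof.
have i2 : (Complex 0 1 : R[i]) ^+ 2 = -1.
  by apply: complex_ext; rewrite expr2 ?ReM ?ImM/= ?ReN ?ImN/=; ring.
have i3 : (Complex 0 1 : R[i]) ^+ 3 = Complex 0 (-1).
  by rewrite exprS i2; apply: complex_ext; rewrite ?ReM ?ImM ?ReN ?ImN/=; ring.
have q : (4^-1 : R[i]) = Complex 4^-1 0.
  have e4 : (4 : R[i]) = Complex 4 0.
    by rewrite (_ : 4 = 4%:R%:C%C :> R[i])// rmorph_nat.
  have n4 : (4 : R[i]) != 0 by rewrite pnatr_eq0.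
  apply: (mulfI n4); rewrite mulfV// e4.
  by apply: complex_ext; rewrite ?ReM ?ImM/= ?mulr0 ?mul0r ?subr0 ?addr0// mulfV ?pnatr_eq0.
rewrite !big_ord_recl big_ord0 /= /bump /= expr0 expr1 i2 i3 q.
move: (r 1) (r (-1)) (r (Complex 0 1)) (r (Complex 0 (-1))) => a b d e.
by apply: complex_ext; rewrite ?(ReM, ImM, ReD, ImD, ReN, ImN)/=; ring.
Qed.

Section Lifting.
Context {R : realType}.
Local Notation mu := (@lebesgue_measure R).
Local Notation C := R[i].
Local Notation S := (ltwo_pairs R).
Implicit Types (f g h : R -> C) (x y : S).

Lemma L2_0 : L2 (fun=> 0 : C).
Proof. by apply/L2P; split; exact: sqi0. Qed.

Lemma L2Z (a : C) f : L2 f -> L2 (fun t => a * f t).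
Proof. by move=> /(L2_lin a)/(_ L2_0); under eq_fun do rewrite addr0. Qed.

Lemma cls_scale (a : C) f : L2 f -> cls (fun t => a * f t) = complex.Re a *: cls f + complex.Im a *: J (cls f).
Proof. by move=> hf; have := cls_lin a hf L2_0; under eq_fun do rewrite addr0; rewrite cls0 addr0. Qed.

Lemma L2N f : L2 f -> L2 (fun t => - f t).
Proof. by move=> /(L2Z (-1)); under eq_fun do rewrite mulN1r. Qed.

Lemma cls_opp f : L2 f -> cls (fun t => - f t) = - cls f.
Proof.
move=> /(cls_scale (-1)); under eq_fun do rewrite mulN1r.
by rewrite ReN ImN/= oppr0 scale0r addr0 scaleN1r.
Qed.

Lemma L2B f g : L2 f -> L2 g -> L2 (fun t => f t - g t).
Proof. by move=> hf hg; have := L2_lin (-1) hg hf; under eq_fun do rewrite mulN1r addrC. Qed.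

Lemma cls_sub f g : L2 f -> L2 g -> cls (fun t => f t - g t) = cls f - cls g.
Proof.
move=> hf hg; have := cls_lin (-1) hg hf; under eq_fun do rewrite mulN1r addrC.
by rewrite ReN ImN/= oppr0 scale0r addr0 scaleN1r addrC.
Qed.

Lemma cls_add f g : L2 f -> L2 g -> cls (fun t => f t + g t) = cls f + cls g.
Proof.
move=> hf hg; have := cls_lin 1 hf hg; under eq_fun do rewrite mul1r.
by rewrite /= scale0r addr0 scale1r.
Qed.

Lemma L2D f g : L2 f -> L2 g -> L2 (fun t => f t + g t).
Proof. by move=> hf hg; have := L2_lin 1 hf hg; under eq_fun do rewrite mul1r. Qed.

Lemma cls_eq0 f : L2 f -> cls f = 0 -> f = (fun=> 0) %[ae mu].
Proof. by move=> hf f0; apply: ae_cls => //; exact: L2_0. Qed.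

(** Linearity up to null sets does not by itself imply that functions equal almost everywhere have
    equal images; the clause on null functions supplies exactly this, so that [T] descends to
    classes. *)
Definition liftable (T : (R -> C) -> R -> C) :=
  linear_on_L2 T /\ forall h, L2 h -> h = (fun=> 0) %[ae mu] -> T h = (fun=> 0) %[ae mu].

Definition lift (T : (R -> C) -> R -> C) x : S := cls (T (fun_of x)).

Section lift.
Variables (T : (R -> C) -> R -> C) (hT : liftable T).

Let TL f : L2 f -> L2 (T f). Proof. exact: hT.1.1. Qed.

Lemma cls_T_lin (a : C) f g : L2 f -> L2 g ->
  cls (T (fun t => a * f t + g t)) = complex.Re a *: cls (T f) + complex.Im a *: J (cls (T f)) + cls (T g).
Proof.
move=> hf hg; rewrite -cls_lin; [|exact: TL|exact: TL].
by apply: cls_ae; [apply/TL/L2_lin|apply: L2_lin; exact: TL|exact: hT.1.2].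
Qed.

Lemma lift_cls f : L2 f -> lift T (cls f) = cls (T f).
Proof.
move=> hf; have hf' := L2_fun_of (cls f).
have hd := L2_lin (-1) hf' hf.
have d0 : cls (T (fun t => -1 * fun_of (cls f) t + f t)) = 0.
  rewrite -cls0; apply: cls_ae; [exact: TL|exact: L2_0|apply: hT.2 => //].
  by apply: filterS (fun_of_cls hf) => t h /h ->; rewrite mulN1r addNr.
move: d0; rewrite cls_T_lin// ReN ImN/= oppr0 scale0r addr0 scaleN1r => /eqP.
by rewrite addrC subr_eq0 => /eqP.
Qed.

Lemma lift_scale (a : C) x y :
  lift T (complex.Re a *: x + complex.Im a *: J x + y) =
  complex.Re a *: lift T x + complex.Im a *: J (lift T x) + lift T y.
Proof.
rewrite -{1 2}[x]cls_fun_of -{1}[y]cls_fun_of -cls_lin; try exact: L2_fun_of.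
by rewrite lift_cls ?cls_T_lin//; try apply: L2_lin; exact: L2_fun_of.
Qed.

Lemma lift_lin (a : R) x y : lift T (a *: x + y) = a *: lift T x + lift T y.
Proof. by have := lift_scale (Complex a 0) x y; rewrite /= !scale0r !addr0. Qed.

Lemma lift0 : lift T 0 = 0.
Proof. by have := lift_lin (-1) 0 0; rewrite !scaleN1r !addNr. Qed.

Lemma lift_J x : lift T (J x) = J (lift T x).
Proof. by have := lift_scale (Complex 0 1) x 0; rewrite /= !scale0r !scale1r !add0r lift0 !addr0. Qed.

End lift.

Section Unitary.
Variables (A : operator) (U : R -> (R -> C) -> R -> C) (hU : unitary_group A U).

Lemma unitary_liftable t : liftable (U t).
Proof.
split; first exact: ug_linear hU t.
move=> h hh h0; have hL : L2 (U t h) by exact: (ug_linear hU t).1.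
apply: cls_eq0 => //; apply: nrm0_eq0; have := ug_isometry hU t hh.
rewrite (l2normE hL) (l2normE hh) (cls_ae hh L2_0 h0) cls0 nrm0.
by case.
Qed.

Definition evolution_of : evolution S.
Proof.
apply: (@Evolution R S (fun t => lift (U t))).
- by move=> t a x y; exact: lift_lin (unitary_liftable t) a x y.
- by move=> t x; exact: lift_J (unitary_liftable t) x.
- move=> t x; have hx := L2_fun_of x; have := ug_isometry hU t hx.
  by rewrite (l2normE hx) (l2normE ((ug_linear hU t).1 _ hx)) cls_fun_of => -[].
- move=> x; have hx := L2_fun_of x; rewrite -[RHS]cls_fun_of.
  apply: cls_ae => //; [exact: (ug_linear hU 0).1|exact: ug_zero hU _ hx].
- move=> t u x; have hx := L2_fun_of x; have hu := (ug_linear hU u).1 _ hx.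
  rewrite [lift (U u) x]/lift (lift_cls (unitary_liftable t) hu).
  by apply: cls_ae; [exact: (ug_linear hU (t + u)).1|exact: (ug_linear hU t).1|exact: ug_add hU t u _ hx].
Defined.

Lemma flow_cls t f : L2 f -> evolution_of t (cls f) = cls (U t f).
Proof. by move=> hf; exact: lift_cls (unitary_liftable t) _ hf. Qed.

Opaque evolution_of.

Lemma l2norm_cvg {I : Type} (F : set_system I) {FF : ProperFilter F} (u : I -> R -> C) (v : I -> S) :
  (forall i, L2 (u i)) -> (forall i, nrm (cls (u i)) = nrm (v i)) ->
  (l2norm (u i) @[i --> F] --> 0%E) <-> (nrm (v i) @[i --> F] --> (0 : R)).
Proof.
move=> hu e; rewrite (_ : (fun i => l2norm (u i)) = (fun i => (nrm (v i))%:E)); last first.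
  by apply/funext => i; rewrite l2normE// e.
split => [h|h]; first exact: (fine_cvg h).
by apply: cvg_EFin => //; exact: nearW.
Qed.

Lemma gen_of_unitary f g : L2 f -> L2 g -> gen evolution_of (cls f) (cls g) <-> A f g.
Proof.
move=> hf hg; rewrite (ug_generator hU hf hg).
have hUf t : L2 (U t f) by exact: (ug_linear hU t).1.
have e t : (fun z : R => (U t f z - f z) / (Complex 0 t) - g z) =
    (fun z : R => (Complex 0 t)^-1 * (U t f z - f z) + - g z).
  by apply/funext => z; rewrite mulrC.
have i t : (Complex 0 t : C)^-1 = Complex 0 (- t^-1).
  have [->|t0] := eqVneq t 0; first by rewrite [X in Complex 0 (- X)]invr0 oppr0; exact: invr0.
  apply: (mulfI (_ : (Complex 0 t : C) != 0)).
    by apply/eqP => -[/eqP]; rewrite (negbTE t0).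
  rewrite mulfV; last by apply/eqP => -[/eqP]; rewrite (negbTE t0).
  apply: complex_ext; rewrite ?ReM ?ImM/= !mul0r ?add0r ?mulr0 ?addr0//.
  by rewrite mulrN opprK mulfV.
have := l2norm_cvg (F := (0 : R)^') (u := fun t (z : R) => (U t f z - f z) / (Complex 0 t) - g z)
  (v := fun t => t^-1 *: (evolution_of t (cls f) - cls f) - J (cls g)).
move=> h; rewrite h; first by [].
- by move=> t; rewrite e; apply: L2_lin; [exact: L2B|exact: L2N].
- move=> t; rewrite e cls_lin; [|exact: L2B|exact: L2N].
  rewrite (i t) (cls_sub (hUf t) hf) (cls_opp hg) -(flow_cls t hf).
  exact: nrm_iscale.
Qed.

End Unitary.

Section Schroedinger.
Variables (V : R -> R) (c : R).
Hypothesis bV : bounded_by c V.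

Lemma laplacian_cls f g : L2 f -> L2 g -> laplacian_plus V f g <->
  exists f1 f2 : S, [/\ D (cls f) f1, D f1 f2 & cls g = f2 + M V (cls f)].
Proof.
move=> hf hg; have [hV eV] := cls_mul bV hf; split.
  move=> [[_ hs] _ [f2 [h2 w2 e]]]; have [f1 h1 w1] := hs 1%N isT.
  exists (cls f1), (cls f2); split.
  - exact: (D_of_weak hf hf h1 (@weak0 _ f) w1).
  - exact: (D_of_weak hf h1 h2 w1 w2).
  - by rewrite -eV -cls_add//; apply: cls_ae => //; exact: L2D.
move=> [f1 [f2 [d1 d2 e]]]; rewrite -[f1]cls_fun_of in d1 d2; rewrite -[f2]cls_fun_of in d2 e.
have h1 := L2_fun_of f1; have h2 := L2_fun_of f2.
have w1 := weak_of_D hf hf h1 (@weak0 _ f) d1; have w2 := weak_of_D hf h1 h2 w1 d2.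
split => //.
  split => // -[|[|[|//]]] _; [by exists f => //; exact: weak0|by exists (fun_of f1)|by exists (fun_of f2)].
exists (fun_of f2); split => //; apply: ae_cls => //; first exact: L2D.
by rewrite cls_add// eV.
Qed.

Lemma gen_schroedinger U (hU : unitary_group (laplacian_plus V) U) x y :
  gen (evolution_of hU) x y <-> exists f1 f2 : S, [/\ D x f1, D f1 f2 & y = f2 + M V x].
Proof.
have hx := L2_fun_of x; have hy := L2_fun_of y.
have := laplacian_cls hx hy; rewrite !cls_fun_of => <-.
by have := gen_of_unitary hU hx hy; rewrite !cls_fun_of.
Qed.

End Schroedinger.

Lemma gen_free U (hU : unitary_group (laplacian_plus (fun=> 0)) U) x y :
  gen (evolution_of hU) x y <-> exists2 f1 : S, D x f1 & D f1 y.
Proof.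
have b0 : bounded_by (0 : R) (fun=> 0 : R) by split => [|t]; rewrite ?normr0.
rewrite (gen_schroedinger b0 hU) M_zero; split => [[f1 [f2 [d1 d2 ->]]]|[f1 d1 d2]].
  by rewrite addr0; exists f1.
by exists f1, y; rewrite addr0.
Qed.

Import HBNNSimple.

(** [scalar_measure] is a bare set function, so the argument goes to the definition of the integral:
    a supremum over simple functions, which evaluates it on measurable sets only. *)
Lemma eq_measure_raw_integral (m1 m2 : set R -> \bar R) (g : R -> \bar R) :
  (forall B, measurable B -> m1 B = m2 B) -> (\int[m1]_t g t = \int[m2]_t g t)%E.
Proof.
move=> h; have e (u : R -> \bar R) :
    ereal_sup [set sintegral m1 k | k in [set k : {nnsfun R >-> R} | forall t, ((k t)%:E <= u t)%E]] =
    ereal_sup [set sintegral m2 k | k in [set k : {nnsfun R >-> R} | forall t, ((k t)%:E <= u t)%E]].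
  congr ereal_sup; apply/seteqP.
  have s (k : {nnsfun R >-> R}) : sintegral m1 k = sintegral m2 k.
    by apply: eq_fsbigr => z _; rewrite h.
  by split => z [k hk <-]; exists k; rewrite ?s.
by rewrite /integral !e.
Qed.

Section Spectral.
Variables (E : set R -> (R -> C) -> R -> C) (hE : projection_valued_measure E).

(** For a null [h], symmetry gives that the squared norm of E(B) h is the pairing of [h] with E(B)
    E(B) h, which is 0. *)
Lemma pvm_liftable B : measurable B -> liftable (E B).
Proof.
move=> mB; split; first exact: pvm_linear hE B mB.
move=> h hh h0; have hL : L2 (E B h) by exact: (pvm_linear hE mB).1.
have hLL : L2 (E B (E B h)) by exact: (pvm_linear hE mB).1.
apply: cls_eq0 => //; apply: nrm0_eq0; have := pvm_symmetric hE mB hh hL.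
rewrite (innerE hL hL) (innerE hh hLL) (cls_ae hh L2_0 h0) cls0 !ip0l => -[/eqP].
by rewrite ipff sqrf_eq0 => /eqP.
Qed.

Lemma scalar_measure_cls f B : measurable B -> L2 f ->
  scalar_measure E f B = (ip (lift (E B) (cls f)) (cls f))%:E.
Proof.
move=> mB hf; have hL : L2 (E B f) by exact: (pvm_linear hE mB).1.
by rewrite /scalar_measure (innerE hL hf) (lift_cls (pvm_liftable mB) hf).
Qed.

Definition pvm_of : pvm S.
Proof.
apply: (@Pvm R S (fun B => lift (E B))).
- by move=> B a x y mB; exact: lift_lin (pvm_liftable mB) a x y.
- by move=> B x mB; exact: lift_J (pvm_liftable mB) x.
- move=> B x y mB; have hx := L2_fun_of x; have hy := L2_fun_of y.
  have := pvm_symmetric hE mB hx hy.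
  rewrite (innerE ((pvm_linear hE mB).1 _ hx) hy) (innerE hx ((pvm_linear hE mB).1 _ hy)).
  by rewrite !cls_fun_of => -[].
- move=> x; have hx := L2_fun_of x; rewrite -[RHS]cls_fun_of.
  by apply: cls_ae => //; [exact: (pvm_linear hE measurableT).1|exact: pvm_setT hE _ hx].
- move=> B B' x mB mB'; have hx := L2_fun_of x; have hu := (pvm_linear hE mB').1 _ hx.
  rewrite [lift (E B') x]/lift (lift_cls (pvm_liftable mB) hu).
  apply: cls_ae; [exact: (pvm_linear hE (measurableI _ _ mB mB')).1|exact: (pvm_linear hE mB).1|].
  exact: pvm_setI hE _ _ _ mB mB' hx.
- move=> x F mF tF mU; have hx := L2_fun_of x.
  have := pvm_sigma_additive hE hx mF tF mU.
  rewrite (scalar_measure_cls mU hx) cls_fun_of.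
  rewrite [X in X @ _ --> _ -> _](_ : _ = (fun n => \sum_(0 <= i < n) (ip (lift (E (F i)) x) x)%:E)%E)//.
  apply/funext => n; apply: eq_bigr => i _.
  by rewrite (scalar_measure_cls (mF i) hx) cls_fun_of.
Defined.

Lemma spm_ofE x B : measurable B -> spm pvm_of x B = (ip (lift (E B) x) x)%:E.
Proof. exact: spmE. Qed.

Opaque pvm_of.

Lemma integral_scalar_measure f (g : R -> \bar R) : L2 f ->
  (\int[scalar_measure E f]_t g t = \int[spm pvm_of (cls f)]_t g t)%E.
Proof.
move=> hf; apply: eq_measure_raw_integral => B mB.
by rewrite [RHS](spm_ofE _ mB) (scalar_measure_cls mB hf).
Qed.

Lemma spectral_domainE (phi : R -> R) f : spectral_domain E phi f <-> L2 f /\ dom pvm_of phi (cls f).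
Proof.
split => -[hf h]; split => //; first by rewrite /dom -(integral_scalar_measure _ hf).
by rewrite (integral_scalar_measure _ hf).
Qed.

Lemma spm_J x B : measurable B -> spm pvm_of (J x) B = spm pvm_of x B.
Proof. by move=> mB; rewrite !spmE// pm_J// J_ip. Qed.

Lemma dom_J (phi : R -> R) x : dom pvm_of phi (J x) = dom pvm_of phi x.
Proof. rewrite /dom; have h := @eq_measure_raw_integral _ _ (fun t => (phi t ^+ 2)%:E) (@spm_J x).
by rewrite h. Qed.

Local Notation I x g := (\int[spm pvm_of x]_t g t).

Lemma spectral_formE (phi : R -> R) f h : L2 f -> L2 h ->
  spectral_form E phi f h =
  Complex (4^-1 * (I (cls f + cls h) phi - I (cls f - cls h) phi))
          (4^-1 * (I (cls f + J (cls h)) phi - I (cls f - J (cls h)) phi)).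
Proof.
move=> hf hh; have key (a : C) : fine (\int[scalar_measure E (fun t => f t + a * h t)%R]_l (phi l)%:E) =
    I (cls f + (complex.Re a *: cls h + complex.Im a *: J (cls h))) phi.
  have hah := L2Z a hh; congr fine.
  by rewrite (integral_scalar_measure (fun l => (phi l)%:E) (L2D hf hah)) (cls_add hf hah) (cls_scale a hh).
pose r (a : C) := fine (\int[scalar_measure E (fun t => f t + a * h t)%R]_l (phi l)%:E).
have key2 a u v z : complex.Re a = u -> complex.Im a = v -> u *: cls h + v *: J (cls h) = z ->
  r a = I (cls f + z) phi by move=> <- <- <-; exact: (key a).
have [z1 z2 z3 z4] := scale_units (cls h).
have k1 : r 1 = I (cls f + cls h) phi by exact: (key2 _ 1 0).
have k2 : r (-1) = I (cls f - cls h) phi.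
  by exact: (key2 _ (-1) 0 _ (ReN 1) (etrans (ImN 1) (oppr0 _)) z2).
have k3 : r (Complex 0 1) = I (cls f + J (cls h)) phi by exact: (key2 _ 0 1).
have k4 : r (Complex 0 (-1)) = I (cls f - J (cls h)) phi by exact: (key2 _ 0 (-1)).
apply: (etrans (polarization r)).
exact: (f_equal2 (fun a b => Complex (4^-1 * a) (4^-1 * b))
  (f_equal2 (fun a b => a - b) k1 k2) (f_equal2 (fun a b => a - b) k3 k4)).
Qed.

End Spectral.

End Lifting.

(** * The potential and the theorem *)

Opaque cls fun_of ltwo_pairs evolution_of pvm_of.

Section Potential.
Context {R : realType}.
Implicit Types (f m : R -> R).

Lemma vanishing_bounded f : continuous f -> f x @[x --> +oo] --> 0 -> f x @[x --> -oo] --> 0 ->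
  exists c, forall x, `|f x| <= c.
Proof.
move=> cf /cvgrPdist_le/(_ 1 ltr01)[A [_ hA]] /cvgrPdist_le/(_ 1 ltr01)[B [_ hB]].
pose N := Num.max `|A| `|B|; have N0 : 0 <= N by rewrite le_max normr_ge0.
have cn : {within `[- N, N], continuous (fun x => `|f x|)}.
  by apply: continuous_subspaceT => x; apply: cvg_norm; exact: cf.
have NN : - N <= N by lra.
have [c _ hc] := EVT_max NN cn; exists (Num.max `|f c| 1) => x.
have [xN|xN] := leP `|x| N; first by rewrite le_max hc// in_itv/= -ler_norml.
rewrite le_max; apply/orP; right; move: xN; rewrite gt_max => /andP[xA xB].
have [x0|x0] := leP 0 x.
  rewrite -normrN -sub0r; apply: hA; rewrite (ger0_norm x0) in xA.
  by rewrite (le_lt_trans (ler_norm A)).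
rewrite -normrN -sub0r; apply: hB; rewrite (ltr0_norm x0) in xB.
by rewrite ltrNr in xB; rewrite (lt_le_trans xB)// lerNl -normrN ler_norm.
Qed.

Lemma Wk_of_derive k c m : (forall j, (j <= k)%N -> bounded_by c (derive1n j m)) ->
  (forall j, (j < k)%N -> forall x, derivable (derive1n j m) x 1) -> Wk k c m.
Proof.
elim: k m => [|k IH] m h1 h2; first by split => //; exact: (h1 0%N).
split; first exact: (h1 0%N).
split; first exact: (h2 0%N).
by apply: IH => j jk; rewrite -derive1Sn; [exact: h1|exact: h2].
Qed.

(** [V] is bounded as a continuous function with limits at both ends, its derivatives through the
    constants C_j; finitely many orders allow a common bound. *)
Lemma potential_Wk s (V : R -> R) : (0 < s)%N -> V x @[x --> +oo] --> 0 -> V x @[x --> -oo] --> 0 ->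
  (forall j : nat, (1 <= j <= s)%N ->
     (forall x : R, derivable (derive1n j.-1 V) x 1) /\
     exists2 Cj : R, 0 < Cj &
       forall x : R, `|derive1n j V x| <= Cj * (1 + `|x|)^-1) ->
  exists c, Wk s c V.
Proof.
move=> s0 Vp Vm Vd.
have dV j : (j < s)%N -> forall x, derivable (derive1n j V) x 1.
  by move=> js; have [] := Vd j.+1 js.
have [c hc] : exists c, forall j, (j <= s)%N -> bounded_by c (derive1n j V).
  have bj j : (j <= s)%N -> exists c, bounded_by c (derive1n j V).
    case: j => [_|j js].
      have [c hc] := vanishing_bounded (derivable_continuous (dV 0%N s0)) Vp Vm.
      by exists c; split => //; exact: (derivable_measurable (dV 0%N s0)).
    have [_ [C C0 hC]] := Vd j.+1 js; exists C; split.
      exact: (derive1_measurable (dV j js)).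
    by move=> x; rewrite (le_trans (hC x))// ler_piMr ?(ltW C0)// invf_le1 ?lerDl// ltr_wpDr.
  have : forall n, (n <= s)%N -> exists c, forall j, (j <= n)%N -> bounded_by c (derive1n j V).
    elim=> [|n IH] ns; first by have [c hc] := bj 0%N (leq0n s); exists c => -[].
    have [c hc] := IH (ltnW ns); have [c' hc'] := bj _ ns; exists (Num.max c c') => j.
    rewrite leq_eqVlt => /orP[/eqP ->|jn].
      by split; [exact: hc'.1|move=> x; rewrite le_max hc'.2 orbT].
    by have [a b] := hc j jn; split => // x; rewrite le_max b.
  by apply.
by exists c; apply: Wk_of_derive.
Qed.

End Potential.

Section Operators.
Context {R : realType}.
Local Notation mu := (@lebesgue_measure R).
Local Notation C := R[i].
Local Notation S := (ltwo_pairs R).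
Implicit Types (f g h : R -> C) (x y k : S).

(** The real part of the defining identity suffices: tested on [J k], whose spectral measure is that
    of [k], it returns the imaginary part. *)
Lemma spectral_integralE E (hE : projection_valued_measure E) (phi : R -> R) f g : L2 f -> L2 g ->
  spectral_integral E phi f g <-> dom (pvm_of hE) phi (cls f) /\
  forall k, dom (pvm_of hE) phi k -> ip (cls g) k =
    4^-1 * (\int[spm (pvm_of hE) (cls f + k)]_t phi t - \int[spm (pvm_of hE) (cls f - k)]_t phi t).
Proof.
move=> hf hg; split => [[/(spectral_domainE hE)[_ df] _ H]|[df H]].
  split => // k dk; have ck := cls_fun_of k; set h := fun_of k in ck; have hk : L2 h := L2_fun_of k.
  have : spectral_domain E phi h by apply/(spectral_domainE hE); rewrite ck.
  move=> /H; rewrite (innerE hg hk) (spectral_formE hE phi hf hk) ck => e.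
  exact: (congr1 (@complex.Re R) e).
split => //; first exact/(spectral_domainE hE).
move=> h /(spectral_domainE hE)[hh dh]; rewrite (innerE hg hh) (spectral_formE hE phi hf hh).
have dJ : dom (pvm_of hE) phi (J (cls h)) by rewrite dom_J.
by rewrite (H _ dh) (H _ dJ).
Qed.

Lemma wave_of_l2 (U U0 : R -> (R -> C) -> R -> C) A A0 (hU : unitary_group A U)
    (hU0 : unitary_group A0 U0) (F : set_system R) (FF : ProperFilter F) f g : L2 f -> L2 g ->
  l2norm (fun z : R => U t f z - U0 t g z) @[t --> F] --> 0%E ->
  wave (evolution_of hU) (evolution_of hU0) F (cls f) (cls g).
Proof.
move=> hf hg; have hUf t : L2 (U t f) by exact: (ug_linear hU t).1.
have hUg t : L2 (U0 t g) by exact: (ug_linear hU0 t).1.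
have e t : nrm (cls (fun z : R => U t f z - U0 t g z)) =
    nrm (evolution_of hU t (cls f) - evolution_of hU0 t (cls g) - 0).
  by rewrite subr0 (cls_sub (hUf t) (hUg t)) (flow_cls hU t hf) (flow_cls hU0 t hg).
exact: (@l2norm_cvg _ _ F FF _ _ (fun t => L2B (hUf t) (hUg t)) e).1.
Qed.

Lemma velocity_integral (U : R -> (R -> C) -> R -> C) A (hU : unitary_group A U) s t f : L2 f ->
  dM (powx s) (evolution_of hU t (cls f)) ->
  (\int[mu]_x ((x / t) ^+ (2 * s) * ComplexField.Normc.normc (U t f x) ^+ 2)%R%:E =
   (2 ^+ (2 * s) * nrm (velocity (evolution_of hU) (cls f) s t) ^+ 2)%:E)%E.
Proof.
move=> hf; have hUf : L2 (U t f) by exact: (ug_linear hU t).1.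
rewrite (flow_cls hU t hf) => w; have e := integral_powx hUf w.
rewrite /velocity (flow_cls hU t hf) nrmZ exprMn normrX -exprM (mulnC s 2).
rewrite mulrA -normrX.
have -> : 2 ^+ (2 * s) * `|(2 * t)^-1 ^+ (2 * s)| = t^-1 ^+ (2 * s) :> R.
  rewrite ger0_norm ?powx2_ge0// -exprMn; congr (_ ^+ _).
  by rewrite invfM mulrA mulfV ?mul1r// pnatr_eq0.
rewrite EFinM -e -ge0_integralZl//.
- apply: eq_integral => x _; rewrite -EFinM; congr EFin.
  by rewrite exprMn; move: (x ^+ _) (t^-1 ^+ _) (_ ^+ 2) => a b d; rewrite (mulrC a b) mulrA.
- have [mr mi] : cmeasurable (U t f) by case: hUf.
  apply/measurable_EFinP; apply: measurable_funM; first exact: measurable_funX.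
  rewrite (_ : (fun z : R => _) = (fun z : R => complex.Re (U t f z) ^+ 2 + complex.Im (U t f z) ^+ 2)).
    by apply: measurable_funD; exact: measurable_funX.
  by apply/funext => x; rewrite normc_sqr.
- by move=> x _; rewrite lee_fin mulr_ge0 ?sqr_ge0 ?powx2_ge0.
- by rewrite lee_fin powx2_ge0.
Qed.

End Operators.

Theorem theorem1p3 (R : realType) (s : nat) (V : R -> R)
    (U U0 : R -> (R -> R[i]) -> R -> R[i])
    (E : set R -> (R -> R[i]) -> R -> R[i]) :
  (1 <= s)%N ->
  V \in Lfun (@lebesgue_measure R) +oo%E ->
  V x @[x --> +oo] --> 0 ->
  V x @[x --> -oo] --> 0 ->
  (forall j : nat, (1 <= j <= s)%N ->
     (forall x : R, derivable (derive1n j.-1 V) x 1) /\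
     exists2 Cj : R, 0 < Cj &
       forall x : R, `|derive1n j V x| <= Cj * (1 + `|x|)^-1) ->
  nonneg_operator (oppop (laplacian_plus V)) ->
  unitary_group (laplacian_plus V) U ->
  unitary_group (laplacian_plus (fun=> 0)) U0 ->
  spectral_measure (oppop (laplacian_plus V)) E ->
  (forall g, L2 g ->
     exists gp gm, [/\ L2 gp, L2 gm,
       l2norm (fun x => U t g x - U0 t gp x) @[t --> +oo] --> 0%E &
       l2norm (fun x => U t g x - U0 t gm x) @[t --> -oo] --> 0%E]) ->
  forall f, Sigma_space s f ->
    exists h, [/\ spectral_integral E (fun l => Num.sqrt l ^+ s) f h,
      (\int[@lebesgue_measure R]_x
         ((x / t) ^+ (2 * s) *
          ComplexField.Normc.normc (U t f x) ^+ 2)%R%:E)%E @[t --> +oo]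
        --> ((2 ^+ (2 * s))%:E * l2norm h ^+ 2)%E &
      (\int[@lebesgue_measure R]_x
         ((x / t) ^+ (2 * s) *
          ComplexField.Normc.normc (U t f x) ^+ 2)%R%:E)%E @[t --> -oo]
        --> ((2 ^+ (2 * s))%:E * l2norm h ^+ 2)%E].
Proof.
move=> s0 _ Vp Vm Vd pos hU hU0 [hE hspec] ac f [hs hx].
have [c wV] := potential_Wk s0 Vp Vm Vd.
have genE := gen_schroedinger (Wk_bounded wV) hU.
have gen0E := gen_free hU0.
(* The flow is generated by the Laplacian plus [V], while positivity and the spectral measure
   concern its opposite; the sign is moved onto the image vector. *)
have genA (x y : ltwo_pairs R) : gen (evolution_of hU) x y <->
    oppop (laplacian_plus V) (fun_of x) (fun t => - fun_of y t).
  have := gen_of_unitary hU (L2_fun_of x) (L2_fun_of y); rewrite !cls_fun_of => ->.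
  by rewrite /oppop; under [X in _ <-> laplacian_plus V _ X]eq_fun do rewrite opprK.
have Hspec (x y : ltwo_pairs R) : gen (evolution_of hU) x y <-> dom (pvm_of hE) id x /\
    forall k, dom (pvm_of hE) id k -> ip y k =
      - (4^-1 * (\int[spm (pvm_of hE) (x + k)]_t id t - \int[spm (pvm_of hE) (x - k)]_t id t)).
  rewrite genA hspec (spectral_integralE hE _ (L2_fun_of x) (L2N (L2_fun_of y))).
  rewrite (cls_opp (L2_fun_of y)) !cls_fun_of.
  split => -[h1 h2]; split => // k dk; have := h2 k dk; rewrite ipNl.
    by move=> <-; rewrite opprK.
  by move=> ->; rewrite opprK.
have Hpos (x y : ltwo_pairs R) : gen (evolution_of hU) x y -> ip y x <= 0.
  move=> /genA/pos; rewrite (innerE (L2N (L2_fun_of y)) (L2_fun_of x)) (cls_opp (L2_fun_of y)).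
  by rewrite !cls_fun_of lecE/= => /andP[_]; rewrite ipNl oppr_ge0.
have wp (x : ltwo_pairs R) : exists y, wave (evolution_of hU) (evolution_of hU0) +oo%R x y.
  have [gp [_ [hp _ cp _]]] := ac _ (L2_fun_of x); exists (cls gp).
  by have := wave_of_l2 hU hU0 _ (L2_fun_of x) hp cp; rewrite cls_fun_of; apply.
have wm (x : ltwo_pairs R) : exists y, wave (evolution_of hU) (evolution_of hU0) -oo%R x y.
  have [_ [gm [_ hm _ cm]]] := ac _ (L2_fun_of x); exists (cls gm).
  by have := wave_of_l2 hU hU0 _ (L2_fun_of x) hm cm; rewrite cls_fun_of; apply.
have hf : L2 f by case: hs.
have [K hK] := Hb_of_weak hs (leqnn s : (0 + s <= s)%N) hf (@weak0 _ f).
have w := dM_cls hf hx.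
have [h [h1 h2 h3 h4]] := velocity_limit wV genE gen0E s0 Hspec Hpos wp wm hK w.
have [B _ hB] := sigma_growth wV genE s0.
have lim (F : set_system R) (FF : ProperFilter F) :
    nrm (velocity (evolution_of hU) (cls f) s t) @[t --> F] --> nrm h ->
    (\int[@lebesgue_measure R]_x
       ((x / t) ^+ (2 * s) * ComplexField.Normc.normc (U t f x) ^+ 2)%R%:E)%E @[t --> F]
      --> ((2 ^+ (2 * s))%:E * l2norm (fun_of h) ^+ 2)%E.
  move=> ch; rewrite (l2normE (L2_fun_of h)) cls_fun_of -EFin_expe -EFinM.
  rewrite (_ : (fun t => _) = (fun t => (2 ^+ (2 * s) * nrm (velocity (evolution_of hU) (cls f) s t) ^+ 2)%:E)).
    apply: cvg_EFin; first exact: nearW.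
    by apply: cvgMr; exact: (cvgM ch ch).
  by apply/funext => t; apply: velocity_integral => //; have [] := hB _ _ hK w t.
exists (fun_of h); split; [|exact: lim|exact: lim].
apply/(spectral_integralE hE _ hf (L2_fun_of h)); rewrite cls_fun_of; split; first exact: h1.
exact: h2.
Qed.
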